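(* Let $\mu$ be a probability measure on $\mathbb R^d$ with density proportional to $e^{-U}$ satisfying the standing assumptions in the context (Poincaré inequality with constant $\frac1m$, discrete spectrum, $\nabla^2U\ge-Km\cdot I_d$ with $K\ge0$). Assume that there exists $L\ge0$ such that $\partial_{kk}U(x)\le L$ for all $k\in\{1,\dots,d\}$ and $x\in\mathbb R^d$. (i) Let $\kappa=\mathcal N(0,I_d)$ or $\kappa=\mathrm{Unif}(\{-1,+1\}^d)$. Then, choosing $T=m^{-1/2}$, the transition semigroup $(\hat P_t)$ of the Zig-Zag process with velocity distribution $\kappa$ and refreshment rate $\gamma>0$ is exponentially contractive in $T$-average with rate $$\nu=\Omega\left(\frac{\gamma m}{\gamma^2+m(1+K)+L}\right).$$ If $\gamma=\Theta\left(\sqrt{m(1+K)+L}\right)$, then $\nu=\Omega\left(\sqrt m\big/\sqrt{(1+K)+L/m}\right)$. (ii) Let $\kappa=\mathrm{Unif}(\{\pm\sqrt d\,e_i:i=1,\dots,d\})$. Then, choosing $T=m^{-1/2}$, the transition semigroup $(\hat P_t)$ of the Zig-Zag process with velocity distribution $\kappa$ and refreshment rate $\gamma>0$ is exponentially contractive in $T$-average with rate $$\nu=\Omega\left(\frac{\gamma m}{\gamma^2+md(1+K)+Ld}\right).$$ If $\gamma=\Theta\left(\sqrt{(m(1+K)+L)d}\right)$, then $\nu=\Omega\left(\sqrt m\big/\sqrt{((1+K)+L/m)d}\right)$.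
   Context: Standing assumptions: $U:\mathbb R^d\to\mathbb R$ is $C^2$ with $\int e^{-U(x)}dx<\infty$, $\mu(dx)\propto e^{-U(x)}dx$; $\mu$ satisfies a Poincaré inequality with constant $\frac1m$, $m>0$, i.e. $\mathrm{Var}_\mu(f)\le\frac1m\int|\nabla f|^2d\mu$; the generator of the overdamped Langevin diffusion, i.e. the closure in $L^2(\mu)$ of $\mathcal Lf=-\frac12\nabla U\cdot\nabla f+\frac12\Delta f$ on $C_c^\infty(\mathbb R^d)$, has discrete spectrum; and $\nabla^2U(x)\ge-Km\cdot I_d$ for all $x$, for some $K\ge0$. Zig-Zag process: let $\mathcal V$ be $\mathbb R^d$, $\{-1,+1\}^d$ or $\{\pm\sqrt d\,e_i:i=1,\dots,d\}$ ($e_i$ the canonical basis), with $\kappa=\mathcal N(0,I_d)$ in the first case and $\kappa=\mathrm{Unif}(\mathcal V)$ in the other two. The Zig-Zag process is the piecewise deterministic Markov process $(X_t,V_t)$ on $\mathbb R^d\times\mathcal V$ that moves with $\dot X=V$ and constant velocity between events; for each $k$, the component $v_k$ is flipped to $-v_k$ with rate $(v_k\partial_kU(x))_+$, where $y_+=\max(y,0)$; and with rate $\gamma>0$ the whole velocity is resampled from $\kappa$. Its invariant probability measure is $\hat\mu=\mu\otimes\kappa$, and its generator is $$\hat{\mathcal L}f(x,v)=v\cdot\nabla_xf(x,v)+\sum_{i=1}^d(v_i\partial_iU(x))_+\big(f(x,v-2e_iv_i)-f(x,v)\big)+\gamma\Big(\int f(x,w)\kappa(dw)-f(x,v)\Big)$$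 for compactly supported $C^1$ functions $f$. $(\hat P_t)$ is its transition semigroup on $L^2(\hat\mu)$. Exponentially contractive in $T$-average with rate $\nu$ means: $\int_t^{t+T}\|\hat P_sf\|^2_{L^2(\hat\mu)}ds\le e^{-2\nu t}\int_0^T\|\hat P_sf\|^2_{L^2(\hat\mu)}ds$ for all $t\ge0$ and all $f\in L^2(\hat\mu)$ with $\int f\,d\hat\mu=0$. $\nu=\Omega(A)$ means that the statement holds with $\nu=cA$ for a universal constant $c>0$ (independent of $d$, $U$ and all parameters). $\gamma=\Theta(A)$ means $c_1A\le\gamma\le c_2A$ with universal constants $c_1,c_2>0$ (on which the constant in the subsequent $\Omega$ may depend). *)

(* Defs.v *)
From HB Require Import structures.
From mathcomp Require Import all_boot all_order all_algebra.
From mathcomp Require Import all_classical all_reals all_analysis.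

Set Implicit Arguments.
Unset Strict Implicit.
Unset Printing Implicit Defensive.

Import Order.TTheory GRing.Theory Num.Theory.
Import numFieldNormedType.Exports.

Local Open Scope classical_set_scope.
Local Open Scope ring_scope.

Definition measure_rV_display : measure_display.
Proof. exact. Qed.

(* R^n = 'rV[R]_n carries the product sigma-algebra, which is its Borel one. *)
Section measurable_rV.
Context {R : realType} (n : nat).

Let coord (i : 'I_n) (x : 'rV[R]_n) : R := x ord0 i.

Let rV_set0 : g_sigma_preimage coord set0.
Proof. exact: sigma_algebra0. Qed.

Let rV_setC A : g_sigma_preimage coord A -> g_sigma_preimage coord (~` A).
Proof. exact: sigma_algebraC. Qed.

Let rV_bigcup (F : _^nat) : (forall i, g_sigma_preimage coord (F i)) ->
  g_sigma_preimage coord (\bigcup_i (F i)).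
Proof. exact: sigma_algebra_bigcup. Qed.

HB.instance Definition _ := @isMeasurable.Build measure_rV_display
  'rV[R]_n (g_sigma_preimage coord) rV_set0 rV_setC rV_bigcup.

End measurable_rV.

Section measurable_rV_theory.
Context {R : realType}.

Lemma measurable_coord n (i : 'I_n) :
  measurable_fun [set: 'rV[R]_n] (fun x => x ord0 i).
Proof.
move=> _ Y mY; rewrite setTI; apply: sub_sigma_algebra => /=.
rewrite -bigcup_seq/=; exists i => /=; first by rewrite mem_index_enum.
by exists Y => //; rewrite setTI.
Qed.

Lemma measurable_fun_rV d (T : measurableType d) n (f : T -> 'rV[R]_n) :
  (forall i, measurable_fun [set: T] (fun x => f x ord0 i)) ->
  measurable_fun [set: T] f.
Proof.
move=> mf _ A mA; rewrite setTI.
suff: measurable `<=` [set A | measurable (f @^-1` A)] by exact.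
apply: smallest_sub.
  split => /=; first by rewrite preimage_set0.
  - by move=> B mB; rewrite setTD preimage_setC; exact: measurableC.
  - by move=> F mF; rewrite preimage_bigcup; exact: bigcup_measurable.
rewrite -bigcup_seq => B [i _ [C mC <-]] /=.
by rewrite setTI -comp_preimage -[X in measurable X]setTI; exact: mf.
Qed.

Definition rV_cons n (p : R * 'rV[R]_n) : 'rV[R]_n.+1 :=
  row_mx (const_mx p.1 : 'rV[R]_1) p.2.

Definition rV_uncons n (x : 'rV[R]_n.+1) : R * 'rV[R]_n :=
  (x ord0 ord0, \row_i x ord0 (lift ord0 i)).

Lemma rV_cons0 n (p : R * 'rV[R]_n) : rV_cons p ord0 ord0 = p.1.
Proof. by rewrite mxE; case: splitP => // j _; rewrite mxE. Qed.

Lemma rV_consS n (p : R * 'rV[R]_n) (i : 'I_n) :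
  rV_cons p ord0 (lift ord0 i) = p.2 ord0 i.
Proof.
rewrite mxE; case: splitP => [j|j]; first by rewrite ord1.
by move=> /= [ij]; congr (p.2 _ _); exact/val_inj.
Qed.

Lemma rV_uncons_cons n : cancel (@rV_cons n) (@rV_uncons n).
Proof.
move=> p; rewrite /rV_uncons rV_cons0 [RHS]surjective_pairing; congr pair.
by apply/rowP => i; rewrite mxE rV_consS.
Qed.

Lemma measurable_rV_cons n : measurable_fun setT (@rV_cons n).
Proof.
apply: measurable_fun_rV => i; case: (unliftP ord0 i) => [j|] ->; last first.
  by under eq_fun do rewrite rV_cons0; exact: measurable_fst.
under eq_fun do rewrite rV_consS.
exact: (measurableT_comp (measurable_coord j) measurable_snd).
Qed.

Lemma measurable_rV_uncons n : measurable_fun setT (@rV_uncons n).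
Proof.
apply/measurable_fun_pairP; split; first exact: measurable_coord.
apply: measurable_fun_rV => i; rewrite /comp/=.
by under eq_fun do rewrite mxE; exact: measurable_coord.
Qed.

End measurable_rV_theory.

Section lebesgue_rV.
Context {R : realType}.

Section cons.
Context n (mu : {sigma_finite_measure set 'rV[R]_n -> \bar R}).

Definition lebesgue_cons : set 'rV[R]_n.+1 -> \bar R :=
  pushforward (@lebesgue_measure R \x mu)%E (@rV_cons R n).

HB.instance Definition _ := Measure.copy lebesgue_cons
  (@measure_function_pushforward__canonical__measure_function_Measure
     _ _ _ _ R (@lebesgue_measure R \x mu)%E _ (@measurable_rV_cons R n)).

Let lebesgue_cons_sigma_finite : sigma_finite [set: 'rV[R]_n.+1] lebesgue_cons.
Proof.
have /sigma_finiteP[F [TF ndF Foo]] := sigma_finiteT (@lebesgue_measure R).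
have /sigma_finiteP[G [TG ndG Goo]] := sigma_finiteT mu.
exists (fun k => @rV_uncons R n @^-1` (F k `*` G k)).
  apply/seteqP; split => // x _.
  have [i _ Fi] : (\bigcup_i F i) (rV_uncons x).1 by rewrite -TF.
  have [j _ Gj] : (\bigcup_i G i) (rV_uncons x).2 by rewrite -TG.
  exists (maxn i j) => //; split.
  - by move: Fi; exact/subsetPset/ndF/leq_maxl.
  - by move: Gj; exact/subsetPset/ndG/leq_maxr.
move=> k; have [mF Fk] := Foo k; have [mG Gk] := Goo k; split.
  rewrite -[X in measurable X]setTI; apply: measurable_rV_uncons => //.
  exact: measurableX.
rewrite /lebesgue_cons /pushforward -comp_preimage.
rewrite (_ : _ \o _ = id) ?preimage_id; last first.
  by apply/funext => p /=; rewrite rV_uncons_cons.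
by rewrite product_measure1E// lte_mul_pinfty// ge0_fin_numE.
Qed.

HB.instance Definition _ := Measure_isSigmaFinite.Build _ _ _
  lebesgue_cons lebesgue_cons_sigma_finite.

End cons.

Fixpoint lebesgue_rV n : {sigma_finite_measure set 'rV[R]_n -> \bar R} :=
  match n with
  | 0 => \d_(0 : 'rV[R]_0)
  | n'.+1 => lebesgue_cons (lebesgue_rV n')
  end.

Lemma lebesgue_rV_box n (A : 'I_n -> set R) : (forall i, measurable (A i)) ->
  lebesgue_rV n [set x | forall i, A i (x ord0 i)] =
  (\prod_(i < n) lebesgue_measure (A i))%E.
Proof.
elim: n A => [|n IH] A mA /=.
  by rewrite big_ord0 diracE mem_set// => -[].
pose B := [set x : 'rV[R]_n | forall i, A (lift ord0 i) (x ord0 i)].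
have mB : measurable B.
  rewrite (_ : B = \bigcap_(i in [set` predT])
      ((fun x : 'rV[R]_n => x ord0 i) @^-1` A (lift ord0 i))).
    apply: fin_bigcap_measurable => [|i _]; first exact: finite_finset.
    by rewrite -[X in measurable X]setTI; exact: measurable_coord.
  by apply/seteqP; split => x Ax i => [_|]; exact: Ax.
rewrite big_ord_recl -IH// -product_measure1E// /lebesgue_cons /pushforward.
congr product_measure1; apply/seteqP; split => -[a x] /=.
  move=> Ax; split=> [|i]; first by have := Ax ord0; rewrite rV_cons0.
  by have := Ax (lift ord0 i); rewrite rV_consS.
move=> [Aa Ax] i; case: (unliftP ord0 i) => [k|] ->; last by rewrite rV_cons0.
- by rewrite rV_consS; exact: Ax.
- exact: mA.
Qed.

End lebesgue_rV.

Section calculus.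
Context {R : realType} {d : nat}.
Implicit Types (U f : 'rV[R]_d -> R) (x v : 'rV[R]_d).

Definition partial (i : 'I_d) f : 'rV[R]_d -> R :=
  fun x => 'D_(delta_mx ord0 i) f x.

Definition gradient_sq f x : R := \sum_i partial i f x ^+ 2.

Fixpoint Cn (n : nat) f : Prop :=
  continuous f /\
  if n is n'.+1 then
    forall i, (forall x, derivable f x (delta_mx ord0 i)) /\ Cn n' (partial i f)
  else True.

Definition Cc_infty f : Prop :=
  (forall n, Cn n f) /\
  exists K : set 'rV[R]_d, compact K /\ forall x, ~ K x -> f x = 0.

(* The generator of the overdamped Langevin diffusion. *)
Definition langevin U f : 'rV[R]_d -> R := fun x =>
  - (2^-1) * (\sum_i partial i U x * partial i f x)
  + 2^-1 * (\sum_i partial i (partial i f) x).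

Definition hessian_ge U (c : R) : Prop := forall x v,
  c * (\sum_i v ord0 i ^+ 2) <=
  \sum_i \sum_j v ord0 i * partial i (partial j U) x * v ord0 j.

End calculus.

(* Elements of L^2(mu) are represented by square integrable functions, and
   unbounded operators by their graphs, which are stable under a.e. equality. *)
Section L2_operators.
Context d (T : measurableType d) (R : realType).
Variable mu : {measure set T -> \bar R}.
Implicit Types (f g h : T -> R) (G : (T -> R) -> (T -> R) -> Prop).

Definition L2 f : Prop := f \in Lfun mu 2%:E.

Definition L2norm f : \bar R := 'N[mu]_2%:E[EFin \o f].

Definition ae_equal f g : Prop := {ae mu, forall x, f x = g x}.

Definition closure_graph (D : set (T -> R)) (A : (T -> R) -> (T -> R)) f g :=
  L2 f /\ L2 g /\
  exists phi : nat -> T -> R,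
    [/\ forall n, D (phi n),
        (fun n => L2norm (phi n \- f)) @ \oo --> 0%E &
        (fun n => L2norm (A (phi n) \- g)) @ \oo --> 0%E].

Definition resolvent_set G : set R := [set lambda |
  (forall h, L2 h ->
     exists f g, G f g /\ ae_equal (g \- lambda \*o f) h) /\
  (exists C : R, forall f g, G f g ->
     (L2norm f <= C%:E * L2norm (g \- lambda \*o f)%R)%E)].

Definition spectrum G : set R := ~` resolvent_set G.

Definition eigenfunction G (lambda : R) f : Prop :=
  exists g, G f g /\ ae_equal g (lambda \*o f).

(* Every spectral value is isolated and is an eigenvalue of finite
   multiplicity.  For the self-adjoint operators considered here the complex
   spectrum is real, so that real spectral parameters suffice. *)
Definition discrete_spectrum G : Prop := forall lambda, spectrum G lambda ->
  [/\ exists2 eps : R, 0 < eps & forall lambda', spectrum G lambda' ->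
        `|lambda' - lambda| < eps -> lambda' = lambda,
      exists f, eigenfunction G lambda f /\ ~ ae_equal f (cst 0) &
      exists n (e : 'I_n -> T -> R), forall f, eigenfunction G lambda f ->
        exists a : 'I_n -> R, ae_equal f (fun x => \sum_i a i * e i x)].

End L2_operators.

Section target.
Context {R : realType} {d : nat}.
Variables (U : 'rV[R]_d -> R) (mu : probability 'rV[R]_d R).

(* mu(dx) is proportional to exp(- U(x)) dx *)
Definition gibbs_measure : Prop :=
  (\int[lebesgue_rV d]_x (expR (- U x))%:E < +oo)%E /\
  exists c : R, forall A, measurable A ->
    mu A = (c%:E * \int[lebesgue_rV d]_(x in A) (expR (- U x))%:E)%E.

(* C_c^infty is dense in the domain of the Dirichlet form, so that testing the
   inequality on it is enough. *)
Definition poincare (C : R) : Prop := forall f, Cc_infty f ->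
  ('V_mu[f] <= C%:E * \int[mu]_x (gradient_sq f x)%:E)%E.

Definition standing_assumptions (m K : R) : Prop :=
  [/\ Cn 2 U /\ gibbs_measure,
      0 < m /\ poincare m^-1,
      discrete_spectrum mu (closure_graph mu Cc_infty (langevin U)) &
      0 <= K /\ hessian_ge U (- (K * m))].

End target.

(* The velocity distributions, as laws on R^d. *)
Section velocities.
Context {R : realType} {d : nat}.
Implicit Type kappa : probability 'rV[R]_d R.

Definition standard_gaussian kappa : Prop := forall A, measurable A ->
  kappa A =
  (\int[lebesgue_rV d]_(v in A) (\prod_i normal_pdf 0 1 (v ord0 i))%:E)%E.

Definition uniform_on (I : finType) (p : I -> 'rV[R]_d) kappa : Prop :=
  forall A, measurable A ->
    kappa A = ((#|I|%:R^-1)%:E * \sum_(i : I) \d_(p i) A)%E.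

Definition uniform_hypercube : probability 'rV[R]_d R -> Prop :=
  uniform_on (fun s : {ffun 'I_d -> bool} => \row_k (-1) ^+ s k).

Definition uniform_axes : probability 'rV[R]_d R -> Prop :=
  uniform_on (fun s : 'I_d * bool =>
    ((-1) ^+ s.2 * Num.sqrt d%:R) *: delta_mx ord0 s.1).

End velocities.

(* The Zig-Zag process, constructed from independent Exp(1) clocks.  A state is
   z = (x, v).  The event [Some k] flips the k-th velocity, [None] resamples the
   whole velocity.  After the n-th event, the event o would occur as soon as its
   rate, integrated along the flow, exceeds the clock [e n o]; the first of these
   events does occur, and then all the clocks are renewed.  [w n] is the velocity
   taken if the event is a refreshment. *)
Section zigzag.
Context {R : realType} {d : nat}.
Variables (U : 'rV[R]_d -> R) (gamma : R).
Local Notation state := ('rV[R]_d * 'rV[R]_d)%type.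
Implicit Types (z : state) (o : option 'I_d) (w : 'rV[R]_d).

Definition flip (k : 'I_d) (v : 'rV[R]_d) : 'rV[R]_d :=
  \row_i (if i == k then - v ord0 i else v ord0 i).

Definition zz_flow z (s : R) : state := (z.1 + s *: z.2, z.2).

Definition zz_rate z o : R :=
  if o is Some k then Num.max (z.2 ord0 k * partial k U z.1) 0 else gamma.

Definition zz_jump z o w : state :=
  if o is Some k then (z.1, flip k z.2) else (z.1, w).

Definition zz_time z o (e : R) : \bar R :=
  ereal_inf [set t%:E | t in [set t : R | 0 <= t /\
    (e%:E <= \int[lebesgue_measure]_(s in `[0%R, t]) (zz_rate (zz_flow z s) o)%:E)%E]].

Definition zz_first z (e : option 'I_d -> R) : option 'I_d :=
  [arg min_(o < None) zz_time z o (e o)]%O.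

(* (T_n, Z_n): the time of the n-th event and the state just after it.  The
   waiting time is finite, being at most that of the refreshment, e / gamma. *)
Fixpoint zz_skeleton (e : nat -> option 'I_d -> R) (w : nat -> 'rV[R]_d) z
    (n : nat) : R * state :=
  if n is n'.+1 then
    let: (t, y) := zz_skeleton e w z n' in
    let o := zz_first y (e n') in
    let tau := fine (zz_time y o (e n' o)) in
    (t + tau, zz_jump (zz_flow y tau) o (w n'))
  else (0, z).

(* Explosion has probability 0; the default value 0 of n is only used then. *)
Definition zz_path (e : nat -> option 'I_d -> R) (w : nat -> 'rV[R]_d) z
    (t : R) : state :=
  let n := xget 0%N [set n | (zz_skeleton e w z n).1 <= t <
                             (zz_skeleton e w z n.+1).1] in
  zz_flow (zz_skeleton e w z n).2 (t - (zz_skeleton e w z n).1).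

Section semigroup.
Context {dO : measure_display} {O : measurableType dO} {P : probability O R}.
Variables (E : nat -> option 'I_d -> {RV P >-> R})
          (W : nat -> {RV P >-> 'rV[R]_d}).

(* The E n o are Exp(1), the W n have law kappa, all of them independent. *)
Definition zz_noise (kappa : probability 'rV[R]_d R) : Prop :=
  forall (N : nat) (A : nat -> option 'I_d -> set R) (B : nat -> set 'rV[R]_d),
    (forall n o, measurable (A n o)) -> (forall n, measurable (B n)) ->
    P [set om | forall n, (n < N)%N ->
                  (forall o, A n o (E n o om)) /\ B n (W n om)] =
    (\prod_(n < N)
       ((\prod_(o : option 'I_d) exponential_prob 1 (A n o)) * kappa (B n)))%E.

Definition zz_semigroup (t : R) (f : state -> R) : state -> R := fun z =>
  \int[P]_om f (zz_path (fun n o => E n o om) (fun n => W n om) z t).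

End semigroup.
End zigzag.

Definition contractive_in_average d (T : measurableType d) (R : realType)
    (mu : {measure set T -> \bar R}) (S : R -> (T -> R) -> (T -> R))
    (T0 nu : R) : Prop :=
  forall (t : R) (f : T -> R), 0 <= t -> L2 mu f -> (\int[mu]_z (f z)%:E = 0)%E ->
    (\int[lebesgue_measure]_(s in `[t, (t + T0)%R]) (L2norm mu (S s f) ^+ 2) <=
     (expR (- (2 * nu * t))%R)%:E *
     \int[lebesgue_measure]_(s in `[0%R, T0]) (L2norm mu (S s f) ^+ 2))%E.

(* The semigroup does not depend on the realization of the random inputs. *)
Definition zigzag_contractive (R : realType) (d : nat) (U : 'rV[R]_d -> R)
    (mu kappa : probability 'rV[R]_d R) (gamma T nu : R) : Prop :=
  forall (dO : measure_display) (O : measurableType dO) (P : probability O R)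
    (E : nat -> option 'I_d -> {RV P >-> R}) (W : nat -> {RV P >-> 'rV[R]_d}),
    zz_noise E W kappa ->
    contractive_in_average (mu \x kappa)%E (zz_semigroup U gamma E W) T nu.

(* Main.v *)
(* For bounded data the semigroup solves the Duhamel formula along the flow.
   Let Pi average over velocities, and n, D be the L^2 norms of Pi u, u - Pi u.
   Refreshment gives (n^2 + D^2)' <= - 2 gamma D^2.  If (m + grad^* grad) phi =
   Pi u, then <u, v . grad phi>' controls n^2 up to multiples of n D and D^2, by
   Bochner's formula and the moments of kappa; so D^2 controls n^2 on average
   over the time m^{-1/2}.  The spectral assumption only serves to solve for phi
   up to small errors in C_c^infty.  Averaging in time makes bounded solutions
   Lipschitz in time; L^2 data follow by density. *)

Require Import Defs.
From HB Require Import structures.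
From mathcomp Require Import all_boot all_order all_algebra.
From mathcomp Require Import all_classical all_reals all_analysis.
From mathcomp Require Import measurable_realfun measurable_fun_approximation.
From mathcomp Require Import ring lra.

Set Implicit Arguments.
Unset Strict Implicit.
Unset Printing Implicit Defensive.

Import Order.TTheory GRing.Theory Num.Theory.
Import numFieldNormedType.Exports.

Local Open Scope classical_set_scope.
Local Open Scope ring_scope.

Implicit Types R : realType.

(** Nothing is known beforehand about the domain of the generator or about the smoothness of
    solutions. Smooth test functions are therefore paired with the solution along flow lines: on
    each line the Duhamel formula is an explicit primitive, and the resulting identity is integrated
    over the invariant measure, on which the flow acts with the weight exp(U(x) - U(x + r v)).
    Non-explosion is proved the same way: the series over the number of events solves the formula
    with data 1, so does the constant 1, and the energy inequality forces them to agree almost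
    everywhere. Integrability of the jump rates rests on partial_k U being in L^2(mu), which the
    upper bound L on partial_kk U yields by integration by parts against cutoffs. Finally phi is
    available only up to an error and at each time separately, with no regularity in time. The
    derivative of the pairing is thus replaced by increments over a grid of step h with tolerance
    h^2; the errors are O(h^2) per step and vanish in the sum as h tends to 0. *)

Notation mfunT := (measurable_fun setT).
Notation phase R d := ('rV[R]_d * 'rV[R]_d)%type.
Notation rVlaw R d := (probability 'rV[R]_d R).
Notation msT := measurableT.
Notation mcomp := measurableT_comp.
Notation mEFinP := measurable_EFinP.
Notation mfunM := measurable_funM.
Notation mfunX := measurable_funX.
Notation mfunB := measurable_funB.
Notation mfunD := measurable_funD.
Notation m_fst := measurable_fst.
Notation m_cst := measurable_cst.
Notation m_snd := measurable_snd.
Notation m_pair := measurable_fun_pair.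
Notation m_pair1 := measurable_pair1.
Notation intble m f := (m.-integrable setT (EFin \o f)).
Notation intble_on m D f := (m.-integrable D (EFin \o f)).

(** * Measure theory on R^n *)

Section measurability.
Context {R}.

(** The boxes with rational centre and radius 1 / (k + 1) are countably many and measurable for the
    product structure, and an open set is the union of those that it contains. *)
Lemma open_measurable_rV n (A : set 'rV[R]_n) : open A -> measurable A.
Proof.
move=> oA.
pose B (p : 'rV[rat]_n * nat) : set 'rV[R]_n :=
 [set x | forall i, `|x ord0 i - ratr (p.1 ord0 i)| < p.2.+1%:R^-1].
have mB p : measurable (B p).
 rewrite (_ : B p = \bigcap_(i in [set` predT])
   ((fun x : 'rV[R]_n => x ord0 i) @^-1`
    ball (ratr (p.1 ord0 i) : R) p.2.+1%:R^-1)); last first.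
  apply/seteqP; split => x Bx i; first by move=> _; rewrite /= /ball /= distrC; exact: Bx.
  by have := Bx i isT; rewrite /= /ball /= distrC.
 apply: fin_bigcap_measurable => [|i _]; first exact: finite_finset.
 rewrite -[X in measurable X]setTI; apply: measurable_coord => //.
 by apply: open_measurable; apply: ball_open; rewrite invr_gt0.
rewrite (_ : A = \bigcup_(p in [set p | B p `<=` A]) B p).
 rewrite bigcup_mkcond; apply: countable_bigcupT_measurable => // p.
 by case: ifP.
apply/seteqP; split => [x Ax|x [p pA]]; last exact: pA.
have /nbhs_ballP[e /= e0 xeA] : nbhs x A by exact: open_nbhs_nbhs.
(* Half of [e], because both [x] and the points of the box are compared with the rational centre. *)
have [k ke] : exists k : nat, k.+1%:R^-1 < e / 2.
 have e20 : 0 < e / 2 by rewrite divr_gt0.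
 exists (Num.trunc (e / 2)^-1).
 by rewrite invf_plt ?posrE// truncnS_gt.
have k0 : (0 : R) < k.+1%:R^-1 by rewrite invr_gt0.
pose q i : rat := xget 0 [set q : rat | ratr q \in `](x ord0 i), (x ord0 i + k.+1%:R^-1)[%R].
have qP i : `|x ord0 i - ratr (q i)| < k.+1%:R^-1.
 have : [set q : rat | ratr q \in `](x ord0 i), (x ord0 i + k.+1%:R^-1)[%R] (q i).
  apply: xgetPex; apply: rat_in_itvoo; by rewrite ltrDl.
 rewrite /= in_itv/= => /andP[a b]; rewrite distrC gtr0_norm ?subr_gt0//.
 by rewrite ltrBlDl.
exists (\row_i q i, k) => /=; last by move=> i /=; rewrite mxE; exact: qP.
move=> y By; apply: xeA; split => // i j; rewrite (ord1 i) -ball_normE /=.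
rewrite (_ : x ord0 j - _ = (x ord0 j - ratr (q j)) - (y ord0 j - ratr (q j))); last by ring.
rewrite (le_lt_trans (ler_normB _ _))// (splitr e) ltrD// (lt_trans _ ke)//.
by have := By j; rewrite /= mxE.
Qed.

Lemma cont_meas_rV n (f : 'rV[R]_n -> R) :
 continuous f -> mfunT f.
Proof.
move=> cf; apply: (measurability _ (RGenOpens.measurableE R)).
move=> _ [_ [a [b ->] <-]].
rewrite setTI; apply: open_measurable_rV.
by move/continuousP: cf; apply; exact: interval_open.
Qed.

Lemma lebesgue_measure_translate (a : R) (A : set R) : measurable A ->
 pushforward lebesgue_measure (fun x : R => x + a : measurableTypeR R) A = lebesgue_measure A.
Proof.
have mtr : mfunT (fun x : measurableTypeR R => x + a : measurableTypeR R) by exact: mfunD.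
move=> mA; apply/esym. 
apply: (@lebesgue_measure_unique R (measure_function_pushforward__canonical__measure_function_Measure lebesgue_measure mtr)) => //= _ [[b c]] _ <-.
rewrite /pushforward (_ : _ @^-1` _ = `]b - a, c - a]%classic); last first.
 by apply/seteqP; split => x /=; rewrite !in_itv/= ltrBlDr lerBrDr.
rewrite !lebesgue_measure_itv/= !lte_fin ltrD2r !EFinN -EFinB.
by rewrite -EFinB opprB addrA subrK.
Qed.

Lemma lebesgue_measure_translate_integral (a : R) (f : R -> \bar R) :
 mfunT f -> (forall x, (0 <= f x)%E) ->
 (\int[lebesgue_measure]_x f (x + a)%R = \int[lebesgue_measure]_x f x)%E.
Proof.
move=> mf f0.
have mtr : mfunT (fun x : measurableTypeR R => x + a : measurableTypeR R) by exact: mfunD.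
rewrite -[RHS](@eq_measure_integral _ _ _ _ _ (pushforward lebesgue_measure (fun x : measurableTypeR R => x + a : measurableTypeR R))).
 by rewrite (ge0_integral_pushforward mtr).
by move=> A mA _; exact: lebesgue_measure_translate.
Qed.

(** One induction by Fubini serves two purposes: the translations, which give the invariance of the
    Gibbs measure under the flow, and the reflection of a single coordinate, which gives the flip
    symmetry of the Gaussian. *)
Lemma lebesgue_rV_coordwise n (phi : 'I_n -> R -> R) (f : 'rV[R]_n -> \bar R) :
 (forall i, mfunT (phi i)) ->
 (forall i (g : R -> \bar R), mfunT g -> (forall a, (0 <= g a)%E) ->
  (\int[lebesgue_measure]_a g (phi i a) = \int[lebesgue_measure]_a g a)%E) ->
 mfunT f -> (forall x, (0 <= f x)%E) ->
 (\int[lebesgue_rV n]_x f (\row_i phi i (x ord0 i)) = \int[lebesgue_rV n]_x f x)%E.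
Proof.
elim: n phi f => [|n IH] phi f mphi phiE mf f0.
 by apply: eq_integral => x _; congr f; apply/rowP => -[].
have mtr k (p : 'I_k -> R -> R) : (forall i, mfunT (p i)) ->
  mfunT (fun x : 'rV[R]_k => \row_i p i (x ord0 i)).
 move=> mp; apply: measurable_fun_rV => i; under eq_fun do rewrite mxE.
 exact: (mcomp (mp i) (measurable_coord i)).
have pf (g : 'rV[R]_n.+1 -> \bar R) : mfunT g -> (forall x, (0 <= g x)%E) ->
  (\int[lebesgue_rV n.+1]_x g x =
   \int[lebesgue_measure]_a \int[lebesgue_rV n]_y g (rV_cons (a, y)))%E.
 move=> mg g0.
 have := @ge0_integral_pushforward _ _ (measurableTypeR R * 'rV[R]_n)%type 'rV[R]_n.+1 R
  (@rV_cons R n) (@measurable_rV_cons R n)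
  (@lebesgue_measure R \x lebesgue_rV n)%E setT g msT mg (fun y _ => g0 y).
 rewrite preimage_setT fubini_tonelli1//=; last first.
  exact: (mcomp mg (@measurable_rV_cons R n)).
rewrite (pf _ mf f0) (pf (fun x => f (\row_i phi i (x ord0 i))))//; last first.
 exact: (mcomp mf (mtr _ _ _)).
pose p' (i : 'I_n) := phi (lift ord0 i).
have cE (a : R) (y : 'rV[R]_n) : \row_i phi i (rV_cons (a, y) ord0 i) =
  rV_cons (phi ord0 a, \row_i p' i (y ord0 i)).
 apply/rowP => i; rewrite [LHS]mxE; case: (unliftP ord0 i) => [j|] ->.
  by rewrite !rV_consS /= mxE.
 by rewrite !rV_cons0.
under eq_integral do under eq_integral do rewrite cE.
have mg a : mfunT (fun y => f (rV_cons (a, y))).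
 apply: (mcomp mf); apply: (mcomp (@measurable_rV_cons R n)).
 exact: m_pair1.
have E a : (\int[lebesgue_rV n]_y f (rV_cons (phi ord0 a, \row_i p' i (y ord0 i))) =
  \int[lebesgue_rV n]_y f (rV_cons (phi ord0 a, y)))%E.
 apply: (IH p' (fun y => f (rV_cons (phi ord0 a, y)))) => // [i|i g]; first exact: mphi.
 exact: phiE.
under eq_integral => a _ do rewrite E.
pose F a := (\int[lebesgue_rV n]_y f (rV_cons (a, y)))%E.
have mF : mfunT F.
 apply: (@measurable_fun_fubini_tonelli_F _ _ _ _ _ _ (fun p => f (rV_cons p))) => //.
 exact: (mcomp mf (@measurable_rV_cons R n)).
exact: (phiE ord0 F mF (fun a => integral_ge0 _ (fun _ _ => f0 _))).
Qed.

Lemma lebesgue_rV_translate n (v : 'rV[R]_n) (f : 'rV[R]_n -> \bar R) :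
 mfunT f -> (forall x, (0 <= f x)%E) ->
 (\int[lebesgue_rV n]_x f (x + v)%R = \int[lebesgue_rV n]_x f x)%E.
Proof.
move=> mf f0; rewrite -[RHS](@lebesgue_rV_coordwise n (fun i a => a + v ord0 i)%R)//.
- by apply: eq_integral => x _; congr f; apply/rowP => i; rewrite !mxE.
- by move=> i; exact: mfunD.
- by move=> i g mg g0; exact: lebesgue_measure_translate_integral.
Qed.

End measurability.

Import HBNNSimple.
Section density.
Context d (T : measurableType d) R.
Variables (la nu : {measure set T -> \bar R}) (w : T -> R).
Hypotheses (mw : mfunT w) (w0 : forall x, 0 <= w x).
Hypothesis nuE : forall A, measurable A -> nu A = (\int[la]_(x in A) (w x)%:E)%E.
Let density_nnsfun (f : {nnsfun T >-> R}) :
 (\int[nu]_x (f x)%:E = \int[la]_x ((f x)%:E * (w x)%:E))%E.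
Proof.
under [LHS]eq_integral do rewrite fimfunE -fsumEFin//.
rewrite [LHS]ge0_integral_fsum//; last 2 first.
 - by move=> r; exact/mEFinP/mcomp.
 - by move=> n x _; rewrite EFinM nnfun_muleindic_ge0.
under [RHS]eq_integral.
 move=> x xD; rewrite fimfunE -fsumEFin// ge0_mule_fsuml; last first.
  by move=> r; rewrite EFinM nnfun_muleindic_ge0.
 over.
rewrite [RHS]ge0_integral_fsum//; last 2 first.
 - move=> r; apply: emeasurable_funM; last exact/mEFinP.
  by apply/mEFinP; do 2 apply/mcomp => //.
 - by move=> n x _; rewrite mule_ge0 ?lee_fin//; rewrite -lee_fin EFinM nnfun_muleindic_ge0.
apply: eq_fsbigr => r _.
have [r0|r0] := ltP r 0.
 rewrite (_ : f @^-1` [set r] = set0) ?preimage_nnfun0//.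
 by rewrite !integral0_eq// => x _; rewrite indic0 /cst mulr0// mul0e.
rewrite (integralZl_indic_nnsfun nu) // integral_indic//= setIT nuE//.
under [RHS]eq_integral do rewrite EFinM -muleA.
rewrite ge0_integralZl//; last 2 first.
- by apply: emeasurable_funM => //; exact/mEFinP.
- by move=> x _; rewrite mule_ge0// lee_fin.
congr (_ * _)%E; rewrite integral_mkcond; apply: eq_integral => x _.
rewrite patchE indicE; case: ifPn => _; by rewrite ?mul1e ?mul0e.
Qed.

(** From indicators to simple functions, then monotone convergence. It is applied to Gibbs weights,
    to the Gaussian and to the law of the waiting time of an event. *)
Lemma ge0_integral_density (f : T -> \bar R) :
 mfunT f -> (forall x, (0 <= f x)%E) ->
 (\int[nu]_x f x = \int[la]_x (f x * (w x)%:E))%E.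
Proof.
move=> mf f0; pose f_ := nnsfun_approx msT mf.
transitivity (lim (\int[nu]_x (f_ n x)%:E @[n --> \oo])%E).
 rewrite -monotone_convergence//=.
 - apply: eq_integral => ? /[!inE] xD; apply/esym/cvg_lim => //=.
  exact: cvg_nnsfun_approx.
 - by move=> n; exact/mEFinP/measurable_funTS.
 - by move=> n ? _; rewrite lee_fin.
 - by move=> ? _ ? ? mn; rewrite lee_fin; exact/lefP/nd_nnsfun_approx.
rewrite [RHS](_ : _ = lim (\int[la]_x ((f_ n x)%:E * (w x)%:E) @[n --> \oo])%E); last first.
 rewrite -monotone_convergence//=.
 - apply: eq_integral => x /[!inE] xD; apply/esym/cvg_lim => //.
  by apply: cvgeZr => //; exact: cvg_nnsfun_approx.
 - by move=> n; apply: emeasurable_funM; apply/mEFinP => //; exact/measurable_funTS.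
 - by move=> n ? _; rewrite mule_ge0// lee_fin.
 - by move=> ? _ ? ? ?; rewrite lee_wpmul2r ?lee_fin//; exact/lefP/nd_nnsfun_approx.
by apply: congr_lim; apply/funext => n /=; exact: density_nnsfun.
Qed.
End density.

(** * Directional derivatives and symmetry of second derivatives *)

Section lines.
Context {R} {d : nat}.
Implicit Types (f : 'rV[R]_d -> R) (x y v : 'rV[R]_d).

Lemma is_derive_line f y v (s : R) : derivable f (y + s *: v) v ->
 is_derive s 1 (fun s => f (y + s *: v)) ('D_v f (y + s *: v)).
Proof.
have E : (fun h : R => h^-1 *: (f (y + (h *: (1 : R) + s) *: v) - f (y + s *: v))) =
     (fun h : R => h^-1 *: (f (h *: v + (y + s *: v)) - f (y + s *: v))).
 by apply/funext => h; rewrite /= [h *: (1:R)]mulr1 scalerDl addrCA.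
by move=> df; apply: DeriveDef; rewrite /derivable /derive /= E.
Qed.
Let translateE f y w v : (fun h : R => h^-1 *: (f (h *: v + y + w) - f (y + w))) =
 (fun h : R => h^-1 *: (f (h *: v + (y + w)) - f (y + w))).
Proof. by apply/funext => h; rewrite addrA. Qed.

Lemma derivable_translate f y w v :
 derivable (fun y => f (y + w)) y v <-> derivable f (y + w) v.
Proof. by rewrite /derivable /= translateE. Qed.

Lemma derive_translate f y w v : 'D_v (fun y => f (y + w)) y = 'D_v f (y + w).
Proof. by rewrite /derive /= translateE. Qed.

Lemma continuous_line y v : continuous (fun s : R => y + s *: v).
Proof.
move=> s; apply: cvgD; first exact: cvg_cst.
exact: (cvgZr_tmp cvg_id).
Qed.

Lemma MVT_line f v y (t : R) : (forall x, derivable f x v) ->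
 exists2 th : R, `|th| <= `|t| & f (y + t *: v) - f y = t * 'D_v f (y + th *: v).
Proof.
move=> df.
have d1 (s : R) : is_derive s 1 (fun s => f (y + s *: v)) ('D_v f (y + s *: v)).
 exact: is_derive_line.
have c1 (A : set R) : {within A, continuous (fun s => f (y + s *: v))}.
 apply: continuous_subspaceT => s; apply: differentiable_continuous.
 by apply/derivable1_diffP; case: (d1 s).
have [t0|t0] := leP 0 t.
 have [|c cI E] := @MVT_segment _ (fun s => f (y + s *: v)) (fun s => 'D_v f (y + s *: v)) 0 t t0.
  exact: c1.
 exists c; first by move: cI; rewrite in_itv/= => /andP[c0 ct]; rewrite !ger0_norm.
 by move: E; rewrite scale0r addr0 subr0 mulrC.
have [|c cI E] := @MVT_segment _ (fun s => f (y + s *: v)) (fun s => 'D_v f (y + s *: v)) t 0 (ltW t0).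
 exact: c1.
exists c.
 by move: cI; rewrite in_itv/= => /andP[c0 ct]; rewrite !ler0_norm ?lerN2// ltW.
by move: E; rewrite scale0r addr0 => E; rewrite -opprB E; ring.
Qed.

(** The axes are added one at a time. The mean value theorem along the new axis turns its increment
    into a partial derivative at a point that tends to [x], and the continuity of the partial
    derivative gives the limit. *)
Lemma derivable_dir_sum f (r : seq 'I_d) (a : 'I_d -> R) x :
 (forall k y, derivable f y (delta_mx ord0 k)) ->
 (forall k, continuous (partial k f)) ->
 let v := \sum_(k <- r) a k *: delta_mx ord0 k in
 is_derive x v f (\sum_(k <- r) a k * partial k f x).
Proof.
move=> df cf; elim: r => [|k r IH] v.
 by rewrite /v !big_nil; apply: DeriveDef; [exact: derivable0|exact: derive0].
set w := \sum_(k <- r) a k *: delta_mx ord0 k : 'rV[R]_d in IH.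
have vE : v = a k *: delta_mx ord0 k + w by rewrite /v big_cons.
have key : (fun h : R => h^-1 *: (f (h *: v + x) - f x)) h @[h --> 0^'] -->
  (\sum_(k0 <- k :: r) a k0 * partial k0 f x : R).
 rewrite big_cons.
 rewrite (_ : (fun h : R => _) = (fun h : R => h^-1 *: (f (h *: v + x) - f (h *: w + x)) +
   h^-1 *: (f (h *: w + x) - f x))); last first.
  by apply/funext => h; rewrite -scalerDr subrKA.
 apply: cvgD; last first.
  by case: IH => + E; rewrite -E; exact.
 (* [th h] locates the mean value on the segment of length |h a_k| along axis k, so it tends to 0
    with h. *)
 have /choice[th thP] : forall h : R, exists t : R, `|t| <= `|h * a k| /\
   f (h *: w + x + (h * a k) *: delta_mx ord0 k) - f (h *: w + x) =
   h * a k * partial k f (h *: w + x + t *: delta_mx ord0 k).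
  by move=> h; have [t ? ?] := MVT_line (h *: w + x) (h * a k) (df k); exists t.
 have th2 h : `|th h| <= `|h * a k| by case: (thP h).
 have th0 : th h @[h --> 0^'] --> (0 : R).
  have ha0 : (h * a k) @[h --> 0^'] --> (0 : R).
   rewrite -[X in _ --> X](mul0r (a k)); apply: cvgM; last exact: cvg_cst.
   exact: nbhs_dnbhs.
  apply/cvgr0Pnorm_le => e e0; move/cvgr0Pnorm_le: ha0 => /(_ _ e0).
  by apply: filterS => h; exact/le_trans.
 have xi0 : (h *: w + x + th h *: delta_mx ord0 k) @[h --> 0^'] --> x.
  suff : (h *: w + x + th h *: delta_mx ord0 k) @[h --> 0^'] --> (0 : R) *: w + x + (0 : R) *: delta_mx ord0 k.
   by rewrite !scale0r add0r addr0.
  apply: cvgD; first (apply: cvgD; last exact: cvg_cst).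
   by apply: cvgZr_tmp; exact: nbhs_dnbhs.
  by apply: cvgZr_tmp.
 have := cvg_comp _ _ xi0 (cf k x) => cc.
 apply: (@cvg_trans _ ((fun h : R => a k * partial k f (h *: w + x + th h *: delta_mx ord0 k)) @ 0^')); last first.
  by apply: cvgM cc; exact: cvg_cst.
 apply: near_eq_cvg; near=> h.
 have h0 : h != 0 by near: h; exact: nbhs_dnbhs_neq.
 have -> : h *: v + x = h *: w + x + (h * a k) *: delta_mx ord0 k.
  by rewrite vE scalerDr scalerA -addrA addrC.
 by case: (thP h) => _ ->; rewrite -mulrA; apply/esym/(mulKf h0).
apply: DeriveDef; rewrite /derivable /derive.
 by apply/cvg_ex; eexists; exact: key.
exact/cvg_lim.
Unshelve. all: by end_near. Qed.

Lemma is_derive_Cn1_line f y v (s : R) : Cn 1 f ->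
 is_derive s 1 (fun s => f (y + s *: v)) (\sum_k v ord0 k * partial k f (y + s *: v)).
Proof.
move=> [_ Cf].
have vE : v = \sum_(k <- index_enum 'I_d) v ord0 k *: delta_mx ord0 k by exact: row_sum_delta.
have := @derivable_dir_sum f (index_enum 'I_d) (fun k => v ord0 k) (y + s *: v)
 (fun k x => (Cf k).1 x) (fun k => (Cf k).2.1).
rewrite /= -vE => -[dv <-]; exact: is_derive_line.
Qed.

(* The mixed difference quotient over a small square is, by the mean value theorem
  applied in either order, a value of either mixed partial derivative. *)
Lemma partial_comm f i j x : Cn 2 f -> partial i (partial j f) x = partial j (partial i f) x.
Proof.
move=> C2.
have mixed k l (h : R) : exists p : R * R, [/\ `|p.1| <= `|h|, `|p.2| <= `|h| &
  (f (x + h *: delta_mx ord0 k + h *: delta_mx ord0 l) - f (x + h *: delta_mx ord0 k))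
  - (f (x + h *: delta_mx ord0 l) - f x) =
  h * (h * partial l (partial k f) (x + p.1 *: delta_mx ord0 k + p.2 *: delta_mx ord0 l))].
 have [_ C2f] := C2; have [dk [_ C1k]] := C2f k.
 have dl := (C2f l).1.
 pose g y := f (y + h *: delta_mx ord0 l) - f y.
 have dg y : derivable g y (delta_mx ord0 k).
  apply: derivableB; last exact: dk.
  by apply/derivable_translate; exact: dk.
 have Dg y : partial k g y = partial k f (y + h *: delta_mx ord0 l) - partial k f y.
  rewrite /partial /g deriveB; first by rewrite derive_translate.
   by apply/derivable_translate; exact: dk.
  exact: dk.
 have [t t1 E] := MVT_line x h dg.
 have [t' t'1 E'] := MVT_line (x + t *: delta_mx ord0 k) h (C1k l).1.
 exists (t, t'); split => //=.
 by rewrite /g in E; rewrite E -/(partial k g _) Dg E'.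
suff quot k l (u : nat -> R) : (forall n, u n != 0) -> u n @[n --> \oo] --> (0 : R) ->
  ((f (x + u n *: delta_mx ord0 k + u n *: delta_mx ord0 l) - f (x + u n *: delta_mx ord0 k))
  - (f (x + u n *: delta_mx ord0 l) - f x)) / u n ^+ 2 @[n --> \oo] --> partial l (partial k f) x.
 pose u n : R := n.+1%:R^-1.
 have u0 n : u n != 0 by rewrite invr_eq0 pnatr_eq0.
 have cu : u n @[n --> \oo] --> (0 : R) by exact: cvg_harmonic.
 rewrite -(cvg_lim _ (quot i j u u0 cu))// -(cvg_lim _ (quot j i u u0 cu))//.
 congr (limn _); apply/funext => n; congr (_ / _).
 by rewrite [x + _ + u n *: delta_mx ord0 j]addrAC; ring.
move=> u0 cu; have /choice[p pP] n := mixed k l (u n).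
rewrite (_ : (fun n => _) = fun n => partial l (partial k f)
  (x + (p n).1 *: delta_mx ord0 k + (p n).2 *: delta_mx ord0 l)); last first.
 apply/funext => n; case: (pP n) => _ _ ->; field; exact: u0.
have c0 (q : nat -> R) : (forall n, `|q n| <= `|u n|) -> q n @[n --> \oo] --> (0 : R).
 move=> qu; apply/cvgr0Pnorm_le => e e0; move/cvgr0Pnorm_le: cu => /(_ _ e0).
 by apply: filterS => h; exact/le_trans.
have cP : (x + (p n).1 *: delta_mx ord0 k + (p n).2 *: delta_mx ord0 l) @[n --> \oo] --> x.
 suff : (x + (p n).1 *: delta_mx ord0 k + (p n).2 *: delta_mx ord0 l) @[n --> \oo] -->
   x + (0 : R) *: delta_mx ord0 k + (0 : R) *: delta_mx ord0 l.
  by rewrite !scale0r !addr0.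
 apply: cvgD; first (apply: cvgD; first exact: cvg_cst).
  by apply: cvgZr_tmp; apply: c0 => n; case: (pP n).
 by apply: cvgZr_tmp; apply: c0 => n; case: (pP n).
have [_ C2f] := C2; have [_ [_ C1k]] := C2f k.
exact: (cvg_comp _ _ cP ((C1k l).2.1 x)).
Qed.
End lines.

(** * Fubini's theorem for real-valued integrals *)

Section Rfubini.
Context d1 d2 (T1 : measurableType d1) (T2 : measurableType d2) R.
Variables (m1 : {sigma_finite_measure set T1 -> \bar R})
 (m2 : {sigma_finite_measure set T2 -> \bar R}).
Variable K : T1 * T2 -> R.
Hypothesis iK : intble (m1 \x m2)%E K.
Let fubFE : {ae m1, forall x, setT x ->
  (\int[m2]_y K (x, y))%:E = (\int[m2]_y (K (x, y))%:E)%E}.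
Proof.
have := ae_integrable1 iK; apply: filterS => x /= ix _.
by rewrite /Rintegral fineK//; exact: integrable_fin_num ix.
Qed.

(** The extended inner integral can fail to be finite on a null set, where its real version is a
    default value. The two agree almost everywhere, which is enough to transfer integrability and
    then the identity of Fubini. *)
Lemma intble_Rintegral1 : m1.-integrable setT (fun x => (\int[m2]_y K (x, y))%:E).
Proof.
have := integrable_fubini_F iK; move=> iF.
have mF : mfunT (fun x => (\int[m2]_y K (x, y))%:E).
 apply/mEFinP; apply: mcomp => //; exact: measurable_int iF.
apply/integrableP; split => //.
rewrite (ae_eq_integral (fun x => `|fubini_F m2 (EFin \o K) x|)%E)//.
- by case/integrableP: iF.
- by apply: mcomp => //.
- by apply: mcomp => //; exact: measurable_int iF.
- by apply: filterS fubFE => x h _; congr abse; exact: h.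
Qed.

Lemma RFubini1 : \int[m1]_x \int[m2]_y K (x, y) = \int[(m1 \x m2)%E]_z K z.
Proof.
rewrite /Rintegral -(integral12_prod_meas1 iK); congr fine.
apply: ae_eq_integral => //.
- exact: measurable_int intble_Rintegral1.
- exact: measurable_int (integrable_fubini_F iK).
Qed.
End Rfubini.

Section Rfubini2.
Context d1 d2 (T1 : measurableType d1) (T2 : measurableType d2) R.
Variables (m1 : {sigma_finite_measure set T1 -> \bar R})
 (m2 : {sigma_finite_measure set T2 -> \bar R}).
Variable K : T1 * T2 -> R.
Hypothesis iK : intble (m1 \x m2)%E K.
Let fubGE : {ae m2, forall y, setT y ->
  (\int[m1]_x K (x, y))%:E = (\int[m1]_x (K (x, y))%:E)%E}.
Proof.
have := ae_integrable2 iK; apply: filterS => x /= ix _.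
by rewrite /Rintegral fineK//; exact: integrable_fin_num ix.
Qed.
Let intble_G : m2.-integrable setT (fubini_G m1 (EFin \o K)).
Proof.
have mG := measurable_fubini_G iK; apply/integrableP; split => //.
have mK := measurable_int _ iK.
apply: le_lt_trans ((integrable21ltyP m1 m2 mK).1 iK).
apply: ge0_le_integral => //.
- exact: mcomp.
- apply: (@measurable_fun_fubini_tonelli_G _ _ _ _ _ m1 (fun z => `|(EFin \o K) z|)%E) => //.
 exact: mcomp.
- by move=> y _; apply: le_abse_integral => //; exact: mcomp mK _.
Qed.

Lemma intble_Rintegral2 : m2.-integrable setT (fun y => (\int[m1]_x K (x, y))%:E).
Proof.
have iF := intble_G.
have mF : mfunT (fun x => (\int[m1]_y K (y, x))%:E).
 apply/mEFinP; apply: mcomp => //; exact: measurable_int iF.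
apply/integrableP; split => //.
rewrite (ae_eq_integral (fun x => `|fubini_G m1 (EFin \o K) x|)%E)//.
- by case/integrableP: iF.
- by apply: mcomp => //.
- by apply: mcomp => //; exact: measurable_int iF.
- by apply: filterS fubGE => x h _; congr abse; exact: h.
Qed.

Lemma RFubini2 : \int[m2]_y \int[m1]_x K (x, y) = \int[(m1 \x m2)%E]_z K z.
Proof.
rewrite /Rintegral -(integral21_prod_meas1 iK); congr fine.
apply: ae_eq_integral => //.
- exact: measurable_int intble_Rintegral2.
- exact: measurable_int intble_G.
Qed.

Lemma RFubini : \int[m1]_x \int[m2]_y K (x, y) = \int[m2]_y \int[m1]_x K (x, y).
Proof. by rewrite RFubini1// RFubini2. Qed.
End Rfubini2.

(** * Integrals over intervals of the line *)

Section onedim.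
Context {R}.
Notation mu := (@lebesgue_measure R).
Implicit Types (f F : R -> R) (a b c s x : R).
Let continuous_itv f a b : (forall x, a <= x <= b -> {for x, continuous f}) ->
 {within `[a, b], continuous f}.
Proof.
move=> cf; apply: continuous_in_subspaceT => x; rewrite inE/= in_itv/= => xab.
exact: cf.
Qed.

Lemma continuous_itv_integrable f a b : (forall x, a <= x <= b -> {for x, continuous f}) ->
 intble_on mu `[a, b] f.
Proof.
move=> cf; apply: continuous_compact_integrable; first exact: segment_compact.
exact: continuous_itv.
Qed.

Lemma Rintegral_FTC f F a b : a <= b -> (forall x, a <= x <= b -> {for x, continuous f}) ->
 (forall x, a <= x <= b -> is_derive x 1 F (f x)) ->
 \int[mu]_(x in `[a, b]) f x = F b - F a.
Proof.
rewrite le_eqVlt => /predU1P[->|ab] cf dF.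
 by rewrite set_itv1 Rintegral_set1 subrr.
rewrite /Rintegral (@continuous_FTC2 _ f F)//.
- exact: continuous_itv.
- have cF x : a <= x <= b -> F t @[t --> x] --> F x.
  move=> /dF [dx _]; exact/differentiable_continuous/derivable1_diffP.
 split.
 + by move=> x; rewrite in_itv/= => /andP[/ltW ax /ltW xb]; case: (dF x); rewrite ?ax.
 + by apply: cvg_at_right_filter; apply: cF; rewrite lexx ltW.
 + by apply: cvg_at_left_filter; apply: cF; rewrite lexx ltW.
- move=> x; rewrite in_itv/= => /andP[/ltW ax /ltW xb].
 by rewrite derive1E; case: (dF x) => //; rewrite ax.
Qed.

Lemma is_derive_prim f a x : continuous f -> a < x ->
 is_derive x 1 (fun y => \int[mu]_(t in `[a, y]) f t) (f x).
Proof.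
move=> cf ax.
have [||||d1 d2] := @continuous_FTC1 R f (BLeft a) x (x + 1).
- by rewrite ltrDl.
- by apply: continuous_itv_integrable => y _; exact: cf.
- by first [exact: (ltW ax) | by rewrite lteBSide ltW | by rewrite lte_fin].
- exact: cf.
by apply: DeriveDef; [exact: d1|rewrite -derive1E; exact: d2].
Qed.

Lemma Rintegral_itv_chasles f a b c : a <= b -> b <= c ->
 intble_on mu `[a, c] f ->
 \int[mu]_(t in `[a, c]) f t = \int[mu]_(t in `[a, b]) f t + \int[mu]_(t in `[b, c]) f t.
Proof.
move=> ab bc ii.
rewrite -(@Rintegral_itv_obnd_cbnd _ b (BRight c)); last first.
 by apply: integrableS ii => //; apply: subset_itv; rewrite ?bnd_simp.
rewrite -(@Rintegral_itvB _ f (BLeft a) (BRight c) b)//; first by rewrite addrC subrK.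
Qed.
(** Shared by translations and reflections: positive and negative parts reduce the claim to the
    invariance of integrals of nonnegative functions over the whole line. *)
Let integral_affine (phi : R -> R) (f : R -> R) a b c e :
 mfunT phi ->
 (forall h : R -> \bar R, mfunT h -> (forall x, (0 <= h x)%E) ->
  (\int[mu]_x h (phi x) = \int[mu]_x h x)%E) ->
 (forall x, (x \in `[a, b]) = (phi x \in `[c, e])) ->
 mfunT f ->
 \int[mu]_(t in `[a, b]) f (phi t) = \int[mu]_(t in `[c, e]) f t.
Proof.
move=> mphi phiE phiI mf; rewrite /Rintegral; congr fine.
have trE (h : R -> \bar R) : mfunT h -> (forall x, (0 <= h x)%E) ->
  (\int[mu]_(t in `[a, b]) h (phi t) = \int[mu]_(t in `[c, e]) h t)%E.
 move=> mh h0; rewrite integral_mkcond [RHS]integral_mkcond -[RHS]phiE.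
 - apply: eq_integral => x _; rewrite !patchE; congr (if _ then _ else _).
  by apply/idP/idP; rewrite !inE/= phiI.
 - exact/(measurable_restrictT _ _).1/measurable_funTS.
 - by move=> x; exact: erestrict_ge0.
rewrite integralE [RHS]integralE; congr (_ - _)%E.
- rewrite -(trE ((EFin \o f)^\+)%E)//; first by apply: eq_integral => x _; rewrite !funeposE.
 by apply: measurable_funepos; exact/mEFinP.
- rewrite -(trE ((EFin \o f)^\-)%E)//; first by apply: eq_integral => x _; rewrite !funenegE.
 by apply: measurable_funeneg; exact/mEFinP.
Qed.

Lemma Rintegral_itv_translate f a b s : mfunT f ->
 \int[mu]_(t in `[a, b]) f (t + s) = \int[mu]_(t in `[a + s, b + s]) f t.
Proof.
apply: (@integral_affine (fun t => t + s)).
- exact: mfunD.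
- by move=> h mh h0; exact: lebesgue_measure_translate_integral.
- by move=> x; rewrite !in_itv/= !lerD2r.
Qed.

Lemma lebesgue_measure_reflect_integral b (h : R -> \bar R) :
 mfunT h -> (forall x, (0 <= h x)%E) ->
 (\int[mu]_x h (b - x)%R = \int[mu]_x h x)%E.
Proof.
move=> mh h0; rewrite -[RHS](@lebesgue_measure_translate_integral _ b)//.
pose h' (x : measurableTypeR R) := h (x + b).
have mh' : mfunT h'.
 apply: (mcomp mh); exact: mfunD.
have := @ge0_integral_pushforward _ _ (measurableTypeR R) (measurableTypeR R) R
 (-%R : measurableTypeR R -> measurableTypeR R) (@oppr_measurable R setT) mu setT h' msT mh' (fun y _ => h0 _).
rewrite preimage_setT => E.
transitivity (\int[mu]_x (h' \o -%R) x)%E.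
 by apply: eq_integral => x _; rewrite /h'/= addrC.
rewrite -E; apply: eq_measure_integral => A mA _; exact: lebesgue_measureN.
Qed.

Lemma Rintegral_itv_reflect f b : mfunT f ->
 \int[mu]_(t in `[0, b]) f (b - t) = \int[mu]_(t in `[0, b]) f t.
Proof.
apply: (@integral_affine (fun t => b - t)).
- exact: mfunB.
- by move=> h mh h0; exact: lebesgue_measure_reflect_integral.
- by move=> x; rewrite !in_itv/= subr_ge0 gerBl andbC.
Qed.

Lemma intble_prod_triangle (be pi : R -> R) :
 intble mu be -> intble mu pi ->
 intble (mu \x mu)%E (fun z : measurableTypeR R * measurableTypeR R =>
   be z.1 * pi z.2 * (z.2 <= z.1)%R%:R).
Proof.
move=> ib ip.
have mb : mfunT be by move/measurable_int : ib => /mEFinP.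
have mp : mfunT pi by move/measurable_int : ip => /mEFinP.
have mbp : mfunT (fun z : measurableTypeR R * measurableTypeR R => be z.1 * pi z.2).
 apply: mfunM; first exact: (mcomp mb m_fst).
 exact: (mcomp mp m_snd).
have mK : mfunT (fun z : measurableTypeR R * measurableTypeR R =>
   be z.1 * pi z.2 * (z.2 <= z.1)%R%:R).
 apply: mfunM => //.
 rewrite (_ : (fun _ => _) = fun z : measurableTypeR R * measurableTypeR R =>
   if z.2 <= z.1 then 1 else 0 : R); last by apply/funext => z; case: ifP.
 by apply: measurable_fun_ifT => //; apply: measurable_fun_ler.
have ibp : (mu \x mu)%E.-integrable setT
  (EFin \o (fun z : measurableTypeR R * measurableTypeR R => be z.1 * pi z.2)).
 apply/integrable12ltyP; first exact/mEFinP.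
 rewrite (eq_integral (fun x : measurableTypeR R => `|be x|%:E * \int[mu]_y `|pi y|%:E)%E); last first.
  move=> x _; rewrite -ge0_integralZl//; last exact/mEFinP/mcomp.
  by apply: eq_integral => y _; rewrite /= normrM EFinM.
 rewrite ge0_integralZr//.
 - case/integrableP: ib => _ ib; case/integrableP: ip => _ ip.
  by apply: lte_mul_pinfty => //; [exact: integral_ge0|rewrite ge0_fin_numE//; exact: integral_ge0].
 - exact/mEFinP/mcomp.
 - exact: integral_ge0.
apply: le_integrable ibp => //; first exact/mEFinP.
move=> z _; rewrite /= lee_fin normrM; case: (z.2 <= z.1); rewrite ?normr1 ?mulr1//.
by rewrite normr0 mulr0.
Qed.

(** The two double integrals are both the integral of [be r * pi q] over the triangle q <= r, taken
    in the two orders, so they cancel. Integrability of [be] and [pi] suffices for this, and the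
    source of the Duhamel formula is no better than measurable in time. *)
Lemma Rintegral_by_parts (be pi : R -> R) tau (p0 c : R) : 
 intble_on mu `[0, tau] be -> intble_on mu `[0, tau] pi ->
 \int[mu]_(r in `[0, tau]) ((p0 + \int[mu]_(q in `[0, r]) pi q) * be r -
   pi r * (c + \int[mu]_(q in `[r, tau]) be q)) =
 p0 * \int[mu]_(r in `[0, tau]) be r - c * \int[mu]_(r in `[0, tau]) pi r.
Proof.
move=> ib ip; set D := `[0, tau]%classic.
pose b := be \_ D; pose p := pi \_ D.
have ib' : intble mu b by move: ib; rewrite integrable_mkcond//= restrict_EFin.
have ip' : intble mu p by move: ip; rewrite integrable_mkcond//= restrict_EFin.
have iK := intble_prod_triangle ib' ip'.
have iK1 := intble_Rintegral1 iK; have iK2 := intble_Rintegral2 iK.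
have FK := RFubini iK; rewrite /= in iK1 iK2 FK.
pose P r := \int[mu]_y (b r * p y * (y <= r)%R%:R).
pose B q := \int[mu]_x (b x * p q * (q <= x)%R%:R).
have PE r : P r = b r * \int[mu]_(q in `[0, r]) pi q.
 rewrite /P /b patchE; case: ifPn => rD; last first.
  rewrite mul0r; under eq_Rintegral do rewrite mul0r mul0r.
  by rewrite Rintegral_cst ?mul0r.
 rewrite -RintegralZl; [|exact: measurable_itv|]; last first.
  have /andP[_ rt] : 0 <= r <= tau by move: rD; rewrite inE /D /= in_itv.
  by apply: integrableS ip => //; apply: subset_itvl; rewrite bnd_simp.
 rewrite [RHS]Rintegral_mkcond; apply: eq_Rintegral => q _.
 rewrite /p !patchE; move: rD; rewrite inE /D /= in_itv/= => /andP[r0 rt].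
 case: ifPn; rewrite ?inE ?notin_setE/= in_itv/=.
  move=> /andP[q0 qt]; case: ifPn; rewrite ?inE ?notin_setE/= in_itv/= q0/=.
   by move=> ->; rewrite mulr1.
  by move=> /negP/negbTE ->; rewrite mulr0.
 move=> qn; rewrite mulr0 mul0r; case: ifPn => //; rewrite inE/= in_itv/=.
 by move=> /andP[q0 qr]; case: qn; rewrite q0 (le_trans qr).
have BE q : B q = p q * \int[mu]_(x in `[q, tau]) be x.
 rewrite /B /p patchE; case: ifPn => rD; last first.
  rewrite mul0r; under eq_Rintegral do rewrite mulr0 mul0r.
  by rewrite Rintegral_cst ?mul0r.
 rewrite -RintegralZl; [|exact: measurable_itv|]; last first.
  have /andP[q0 _] : 0 <= q <= tau by move: rD; rewrite inE /D /= in_itv.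
  by apply: integrableS ib => //; apply: subset_itvr; rewrite bnd_simp.
 rewrite [RHS]Rintegral_mkcond; apply: eq_Rintegral => x _.
 rewrite /b !patchE; move: rD; rewrite inE /D /= in_itv/= => /andP[r0 rt].
 case: ifPn; rewrite ?inE ?notin_setE/= in_itv/=.
  move=> /andP[q0 qt]; case: ifPn; rewrite ?inE ?notin_setE/= in_itv/= qt ?andbT.
   by move=> ->; rewrite mulr1 mulrC.
  by move=> /negP/negbTE ->; rewrite mulr0.
 move=> qn; rewrite !mul0r; case: ifPn => //; rewrite inE/= in_itv/=.
 by move=> /andP[q0 qr]; case: qn; rewrite qr (le_trans r0).
have iP : mu.-integrable setT (fun x => (P x)%:E) by exact: iK1.
have iB : mu.-integrable setT (fun x => (B x)%:E) by exact: iK2.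
rewrite Rintegral_mkcond [in RHS]Rintegral_mkcond [X in _ - _ * X]Rintegral_mkcond -/b -/p.
transitivity (\int[mu]_x ((p0 * b x + P x) - (c * p x + B x))).
 apply: eq_Rintegral => x _; rewrite PE BE /b /p !patchE; case: ifPn => _; first by ring.
 by rewrite !mul0r !mulr0 !addr0 subrr.
have i1 : intble mu (fun x => p0 * b x).
 by rewrite (_ : _ \o _ = fun x => p0%:E * (EFin \o b) x)%E//; exact: integrableZl.
have i2 : intble mu (fun x => c * p x).
 by rewrite (_ : _ \o _ = fun x => c%:E * (EFin \o p) x)%E//; exact: integrableZl.
rewrite RintegralB; [|exact: msT|exact: (integrableD msT i1 iP)
 |exact: (integrableD msT i2 iB)].
rewrite (RintegralD msT i1 iP) (RintegralD msT i2 iB).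
rewrite (RintegralZl _ msT ib') (RintegralZl _ msT ip').
have -> : \int[mu]_x P x = \int[mu]_x B x by exact: FK.
by ring.
Qed.
End onedim.

Lemma intble_EFin_le d (T : measurableType d) R (m : {measure set T -> \bar R})
  (f g : T -> R) : mfunT f -> intble m g ->
 (forall z, `|f z| <= `|g z|) -> intble m f.
Proof.
move=> mf ig fg; apply: (le_integrable _ _ _ ig) => //; first exact/mEFinP.
by move=> z _; rewrite /= lee_fin.
Qed.

Lemma m_uncurry dA dB dC dD (A : measurableType dA) (B : measurableType dB)
  (C : measurableType dC) (D : measurableType dD) (h : B -> C -> D) (f : A -> B) (g : A -> C) :
 mfunT (fun p : B * C => h p.1 p.2) ->
 mfunT f -> mfunT g ->
 mfunT (fun a => h (f a) (g a)).
Proof. by move=> mh mf mg; exact: (mcomp mh (m_pair mf mg)). Qed.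

Section integrable_real.
Context d (T : measurableType d) R (m : {measure set T -> \bar R}) (D : set T).
Hypothesis mD : measurable D.
Implicit Types f g : T -> R.

Lemma intble_cmul k f : intble_on m D f ->
 intble_on m D (fun x => k * f x).
Proof.
move=> h; have := integrableZl mD k h.
by apply: eq_integrable => // x _; rewrite /= EFinM.
Qed.

Lemma intble_add f g : intble_on m D f -> intble_on m D g ->
 intble_on m D (fun x => f x + g x).
Proof. by move=> h1 h2; exact: (integrableD mD h1 h2). Qed.

Lemma intble_sub f g : intble_on m D f -> intble_on m D g ->
 intble_on m D (fun x => f x - g x).
Proof. by move=> h1 h2; exact: (integrableB mD h1 h2). Qed.

Lemma intble_bigsum I (r : seq I) (P : pred I) (F : I -> T -> R) :
 (forall i, P i -> intble_on m D (F i)) ->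
 intble_on m D (fun x => \sum_(i <- r | P i) F i x).
Proof.
move=> iF; elim: r => [|i r IH].
 by have := @integrable0 _ _ _ m D; apply: eq_integrable => // x _; rewrite /= big_nil.
case Pi : (P i).
 by apply: eq_integrable (intble_add (iF _ Pi) IH) => // x _; rewrite /= big_cons Pi.
by apply: eq_integrable IH => // x _; rewrite /= big_cons Pi.
Qed.

Lemma Rintegral_bigsum I (r : seq I) (P : pred I) (F : I -> T -> R) :
 (forall i, P i -> intble_on m D (F i)) ->
 \int[m]_(x in D) (\sum_(i <- r | P i) F i x) = \sum_(i <- r | P i) \int[m]_(x in D) F i x.
Proof.
move=> iF; elim: r => [|i r IH].
 rewrite big_nil; under eq_Rintegral do rewrite big_nil; by rewrite Rintegral_cst// mul0r.
rewrite big_cons; case: ifP => Pi.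
 rewrite -IH -RintegralD//; last 2 first.
 - exact: iF.
 - exact: intble_bigsum.
 by apply: eq_Rintegral => x _; rewrite big_cons Pi.
by rewrite -IH; apply: eq_Rintegral => x _; rewrite big_cons Pi.
Qed.
End integrable_real.

(** * Balance laws along a quasi-invariant flow *)

Section flow.
Context d (T : measurableType d) R.
Variables (m : {sigma_finite_measure set T -> \bar R}) (phi : R -> T -> T) (V : T -> R).
Hypotheses (mphi : mfunT (fun p : R * T => phi p.1 p.2)) (mV : mfunT V).

(** The Jacobian of the flow for a measure of density exp(- V) with respect to a reference measure
    that the flow preserves. *)
Definition flow_weight (r : R) (z : T) : R := expR (V z - V (phi r z)).

Hypothesis quasi_inv : forall (r : R) (F : T -> \bar R), mfunT F ->
 (forall z, (0 <= F z)%E) ->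
 (\int[m]_z (F (phi r z) * (flow_weight r z)%:E) = \int[m]_z F z)%E.
Let mphir r : mfunT (phi r).
Proof. exact: (mcomp mphi (@m_pair1 _ _ _ _ r)). Qed.

Lemma m_flow_weight : mfunT (fun p : R * T => flow_weight p.1 p.2).
Proof.
apply: mcomp => //; apply: mfunB.
 exact: (mcomp mV m_snd).
exact: (mcomp mV mphi).
Qed.
Let mw r : mfunT (flow_weight r).
Proof. exact: (mcomp m_flow_weight (@m_pair1 _ _ _ _ r)). Qed.

Lemma intble_flow r (F : T -> R) : intble m F ->
 intble m (fun z => F (phi r z) * flow_weight r z).
Proof.
move=> iF; have mF : mfunT F by move/measurable_int : iF => /mEFinP.
have mK : mfunT (fun z => F (phi r z) * flow_weight r z).
 by apply: mfunM => //; exact: mcomp.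
apply/integrableP; split; first exact/mEFinP.
rewrite (eq_integral (fun z => (fun y => `|F y|%:E) (phi r z) * (flow_weight r z)%:E)%E); last first.
 by move=> z _; rewrite /= normrM EFinM [`|flow_weight _ _|]ger0_norm ?expR_ge0.
rewrite (quasi_inv r (F := fun y => `|F y|%:E))//; first by case/integrableP : iF.
exact/mEFinP/mcomp.
Qed.

Lemma Rintegral_flow r (F : T -> R) : intble m F ->
 \int[m]_z (F (phi r z) * flow_weight r z) = \int[m]_z F z.
Proof.
move=> iF; have mF : mfunT F by move/measurable_int : iF => /mEFinP.
rewrite /Rintegral; congr fine; rewrite integralE [RHS]integralE; congr (_ - _)%E.
- rewrite -(quasi_inv r (F := (EFin \o F)^\+)%E)//; last first.
  by apply: measurable_funepos; exact/mEFinP.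
 apply: eq_integral => z _; rewrite !funeposE /= -!EFin_max -EFinM; congr EFin.
 by rewrite maxr_pMl ?expR_ge0// mul0r.
- rewrite -(quasi_inv r (F := (EFin \o F)^\-)%E)//; last first.
  by apply: measurable_funeneg; exact/mEFinP.
 apply: eq_integral => z _; rewrite !funenegE /= -!EFin_max -EFinM; congr EFin.
 by rewrite maxr_pMl ?expR_ge0// mul0r mulNr.
Qed.

(** An identity known on each flow line is integrated over the starting point. After Fubini every
    time slice is moved back by quasi-invariance, so the weights disappear from the conclusion. The
    bound [g] is the same at all times, which makes the weighted kernel integrable on [0, tau] times
    the space. *)
Lemma flow_balance (F0 F1 g : T -> R) (G : R * T -> R) tau : 0 <= tau ->
 mfunT G -> intble m g ->
 intble m F0 -> intble m F1 ->
 (forall r z, 0 <= r <= tau -> `|G (r, z)| <= g z) ->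
 (forall z, F1 (phi tau z) * flow_weight tau z - F0 z =
   \int[lebesgue_measure]_(r in `[0, tau]) (G (r, phi r z) * flow_weight r z)) ->
 \int[m]_z F1 z - \int[m]_z F0 z =
  \int[lebesgue_measure]_(r in `[0, tau]) \int[m]_z G (r, z).
Proof.
move=> tau0 mG ig iF0 iF1 Gg line.
pose K (p : measurableTypeR R * T) : R :=
 \1_`[0, tau] p.1 * (G (p.1, phi p.1 p.2) * flow_weight p.1 p.2).
have mphi' : mfunT (fun p : measurableTypeR R * T => (p.1, phi p.1 p.2)).
 by apply/measurable_fun_pairP; split => //; exact: m_fst.
have mind : mfunT (fun p : measurableTypeR R * T => \1_`[0, tau] p.1 : R).
 by apply: mcomp m_fst; exact: measurable_indic.
have mK : mfunT K.
 apply: mfunM => //; apply: mfunM; last exact: m_flow_weight.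
 exact: (mcomp mG mphi').
have g0 z : 0 <= g z by apply: le_trans (Gg 0 z _) => //; rewrite lexx.
have mg : mfunT g by move/measurable_int : ig => /mEFinP.
have iK : intble (@lebesgue_measure R \x m)%E K.
 apply/integrable12ltyP; first exact/mEFinP.
 apply: (@le_lt_trans _ _ (\int[lebesgue_measure]_x ((\1_`[0, tau] x)%:E * \int[m]_z (g z)%:E))%E).
  apply: ge0_le_integral => //.
  - by move=> x _; exact: integral_ge0.
  - apply: (@measurable_fun_fubini_tonelli_F _ _ _ _ _ m (fun z => `|(EFin \o K) z|)%E) => //.
   by apply/mcomp => //; exact/mEFinP.
  - apply: emeasurable_funM => //; exact/mEFinP/measurable_indic.
  (* The slice of the weighted kernel at time x is compared with [g] moved by the flow, whose
     weighted integral is that of [g]. *)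
  - move=> x _; rewrite -(quasi_inv x (F := EFin \o g))//; last exact/mEFinP.
   rewrite -ge0_integralZl//; last 2 first.
   + apply: emeasurable_funM; last exact/mEFinP.
    exact/mEFinP/mcomp.
   + by move=> z _; rewrite mule_ge0// lee_fin ?expR_ge0.
   apply: ge0_le_integral => //.
   + by apply/mcomp => //; apply/mEFinP; exact: (mcomp mK (@m_pair1 _ _ _ _ x)).
   + apply: emeasurable_funM; first exact: m_cst.
    apply: emeasurable_funM; last exact/mEFinP.
    exact/mEFinP/mcomp.
   move=> z _; rewrite /K /= -!EFinM lee_fin !normrM [`|flow_weight _ _|]ger0_norm ?expR_ge0//.
   rewrite indicE; case: (boolP (x \in _)) => xI; last by rewrite normr0 !mul0r.
   rewrite normr1 !mul1r ler_wpM2r ?expR_ge0// Gg//.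
   by move: xI; rewrite inE/= in_itv.
 rewrite ge0_integralZr//; last 2 first.
 - exact/mEFinP/measurable_indic.
 - by apply: integral_ge0 => z _; rewrite lee_fin.
 rewrite integral_indic//= setIT lebesgue_measure_itv/= lte_fin.
 have ig2 : (\int[m]_z (g z)%:E < +oo)%E.
  case/integrableP : ig => _; apply: le_lt_trans.
  by rewrite le_eqVlt; apply/orP; left; apply/eqP; apply: eq_integral => z _; rewrite /= ger0_norm.
 case: ifP => _; last by rewrite mul0e.
 by apply: lte_mul_pinfty => //; rewrite ?lee_fin ?subr_ge0// -EFinB fin_numE.
have FK := RFubini iK; rewrite /= in FK.
transitivity (\int[m]_z (F1 (phi tau z) * flow_weight tau z - F0 z)).
 by rewrite RintegralB ?Rintegral_flow//; exact: intble_flow.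
transitivity (\int[m]_y \int[lebesgue_measure]_x K (x, y)).
 apply: eq_Rintegral => z _; rewrite line Rintegral_mkcond; apply: eq_Rintegral => x _.
 by rewrite /K patchE indicE; case: ifPn => xI; rewrite ?mul1r ?mul0r.
rewrite -FK [RHS]Rintegral_mkcond; apply: eq_Rintegral => r _.
rewrite patchE; case: ifPn => rI; last first.
 rewrite /K /= indicE (negbTE rI); under eq_Rintegral do rewrite mul0r.
 by rewrite Rintegral_cst// mul0r.
rewrite -(@Rintegral_flow r (fun z => G (r, z))).
 by apply: eq_Rintegral => z _; rewrite /K/= indicE rI mul1r.
apply: (intble_EFin_le _ ig); first exact: (mcomp mG (@m_pair1 _ _ _ _ r)).
move=> z; rewrite [leRHS]ger0_norm// Gg//; by move: rI; rewrite inE/= in_itv.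
Qed.
End flow.

(* The potential of the Gibbs weight exp(- U) is compensated by [flow_weight],
  so that only translation invariance of the Lebesgue measure is used. *)
Section gibbs.
Context {R} {d : nat}.
Variables (U : 'rV[R]_d -> R) (mu : rVlaw R d).
Hypotheses (cU : continuous U) (gU : gibbs_measure U mu).

Lemma gibbs_density : exists2 c : R, 0 <= c & forall A, measurable A ->
 mu A = (\int[lebesgue_rV d]_(x in A) (c * expR (- U x))%:E)%E.
Proof.
have mE : mfunT (fun x => expR (- U x)).
 apply: mcomp => //; apply: mcomp => //.
 exact: cont_meas_rV.
case: gU => Ioo [c muE]; have c0 : 0 <= c.
 rewrite leNgt; apply/negP => c0.
 have := muE setT msT; rewrite probability_setT => E.
 have : (1 <= 0 :> \bar R)%E.
  rewrite E mule_le0_ge0 ?lee_fin ?(ltW c0)//.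
  by apply: integral_ge0 => x _; rewrite lee_fin expR_ge0.
 by rewrite lee_fin ler10.
exists c => // A mA; rewrite muE// -ge0_integralZl//.
exact/mEFinP/measurable_funTS.
Qed.

Lemma gibbs_quasi_inv (v : 'rV[R]_d) (F : 'rV[R]_d -> \bar R) : mfunT F ->
 (forall x, (0 <= F x)%E) ->
 (\int[mu]_x (F (x + v)%R * (expR (U x - U (x + v)))%:E) = \int[mu]_x F x)%E.
Proof.
move=> mF F0; have [c c0 muE] := gibbs_density.
have mU : mfunT U by exact: cont_meas_rV.
have msT : mfunT (fun x : 'rV[R]_d => x + v).
 apply: measurable_fun_rV => i; under eq_fun do rewrite mxE.
 by apply: mfunD => //; exact: measurable_coord.
have mE : mfunT (fun x => c * expR (- U x)).
 by apply: mfunM => //; do 2 apply: mcomp => //.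
have w0 x : 0 <= c * expR (- U x) by rewrite mulr_ge0 ?expR_ge0.
rewrite (ge0_integral_density mE w0 muE); last 2 first.
- apply: emeasurable_funM; first exact: mcomp.
 apply/mEFinP; apply: mcomp => //; apply: mfunB => //.
 exact: mcomp.
- by move=> x; rewrite mule_ge0// lee_fin expR_ge0.
rewrite (ge0_integral_density mE w0 muE)//.
rewrite -(@lebesgue_rV_translate _ _ v (fun x => F x * (c * expR (- U x))%:E)%E); last 2 first.
- by apply: emeasurable_funM => //; exact/mEFinP.
- by move=> x; rewrite mule_ge0// lee_fin.
apply: eq_integral => x _; rewrite -muleA -EFinM; congr (_ * _%:E)%E.
by rewrite mulrCA -expRD; congr (_ * expR _); ring.
Qed.

Lemma m_rV_line (v : 'rV[R]_d) :
 mfunT (fun p : R * 'rV[R]_d => p.2 + p.1 *: v).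
Proof.
apply: measurable_fun_rV => i; under eq_fun do rewrite !mxE.
apply: mfunD; first exact: (mcomp (measurable_coord i) m_snd).
by apply: mfunM => //; exact: m_fst.
Qed.

Lemma m_zz_flow : mfunT (fun p : R * ('rV[R]_d * 'rV[R]_d) => zz_flow p.2 p.1).
Proof.
apply/measurable_fun_pairP; split; last exact: (mcomp m_snd m_snd).
apply: measurable_fun_rV => i; rewrite /comp/=; under eq_fun do rewrite !mxE.
apply: mfunD.
 by apply: (mcomp (measurable_coord i)); apply: (mcomp m_fst m_snd).
apply: mfunM; first exact: m_fst.
by apply: (mcomp (measurable_coord i)); apply: (mcomp m_snd m_snd).
Qed.

Variable kappa : rVlaw R d.

(** For a fixed velocity the flow is the translation by r v, so Fubini with the integral over x
    inside reduces this to [gibbs_quasi_inv]. *)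
Lemma zz_quasi_inv r (F : 'rV[R]_d * 'rV[R]_d -> \bar R) : mfunT F ->
 (forall z, (0 <= F z)%E) ->
 (\int[mu \x kappa]_z (F (zz_flow z r) * (flow_weight (fun r z => zz_flow z r) (U \o fst) r z)%:E) =
  \int[mu \x kappa]_z F z)%E.
Proof.
move=> mF F0.
have mU : mfunT U by exact: cont_meas_rV.
have mphi : mfunT (fun z : 'rV[R]_d * 'rV[R]_d => zz_flow z r).
 exact: (mcomp m_zz_flow (@m_pair1 _ _ _ _ r)).
rewrite fubini_tonelli2/=; last 2 first.
- apply: emeasurable_funM; first exact: mcomp.
 apply/mEFinP; apply: mcomp => //; apply: mfunB.
  exact: (mcomp mU m_fst).
 exact: (mcomp (mcomp mU m_fst) mphi).
- by move=> z; rewrite mule_ge0// lee_fin expR_ge0.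
rewrite fubini_tonelli2; [|by []|by []]; apply: eq_integral => v _.
rewrite /fubini_G -(@gibbs_quasi_inv (r *: v) (fun x => F (x, v)))//.
exact: (mcomp mF (@measurable_pair2 _ _ _ _ v)).
Qed.

End gibbs.

Section line1d.
Context {R}.
Notation mu := (@lebesgue_measure R).
Variables (p dp be : R -> R) (c tau : R).
Hypotheses (tau0 : 0 <= tau) (dpE : forall x, 0 <= x <= tau -> is_derive x 1 p (dp x))
 (cdp : forall x, 0 <= x <= tau -> {for x, continuous dp}) (ibe : intble_on mu `[0, tau] be).
Let C r := c + \int[mu]_(q in `[r, tau]) be q.
Let pE r : 0 <= r <= tau -> p r = p 0 + \int[mu]_(q in `[0, r]) dp q.
Proof.
move=> /andP[r0 rt]; have sub x : 0 <= x <= r -> 0 <= x <= tau.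
 by move=> /andP[-> /le_trans]; apply.
have -> := Rintegral_FTC r0 (fun x h => cdp (sub x h)) (fun x h => dpE (sub x h)).
by rewrite addrC subrK.
Qed.
Let idp : intble_on mu `[0, tau] dp.
Proof. exact: continuous_itv_integrable. Qed.

(** [C] is the absolutely continuous function with derivative - [be] and final value [c], and the
    integrand is the derivative of - p C. As [be] is merely integrable, this goes through
    [Rintegral_by_parts]. *)
Lemma line_linear :
 \int[mu]_(r in `[0, tau]) (p r * be r - dp r * C r) = p 0 * C 0 - p tau * c.
Proof.
have pt := Rintegral_FTC tau0 cdp dpE.
have := @Rintegral_by_parts R be dp tau (p 0) c ibe idp.
rewrite /C => E; transitivity (p 0 * \int[mu]_(r in `[0, tau]) be r - c * \int[mu]_(r in `[0, tau]) dp r); last by rewrite pt; ring.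
rewrite -E; apply: eq_Rintegral => r; rewrite inE/= in_itv/= => rt.
by rewrite -pE.
Qed.
End line1d.

Section line1d_square.
Context {R}.
Notation mu := (@lebesgue_measure R).
Variables (p dp be : R -> R) (c tau : R).
Hypotheses (tau0 : 0 <= tau) (dpE : forall x, 0 <= x <= tau -> is_derive x 1 p (dp x))
 (cdp : forall x, 0 <= x <= tau -> {for x, continuous dp}) (ibe : intble_on mu `[0, tau] be).
Let C r := c + \int[mu]_(q in `[r, tau]) be q.
Hypothesis iC : intble_on mu `[0, tau] (fun r => p r * be r - dp r * C r).

(** The same for - p C^2. The linear case on [r, tau] and its restriction to [0, r] show that p C is
    again a primitive, of dp C - p be, so the integration by parts applies a second time with p C in
    place of p. *)
Lemma line_square :
 \int[mu]_(r in `[0, tau]) (2 * p r * C r * be r - dp r * C r ^+ 2) =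
 p 0 * C 0 ^+ 2 - p tau * c ^+ 2.
Proof.
have P r : 0 <= r <= tau -> p r * C r = p 0 * C 0 +
  \int[mu]_(q in `[0, r]) (dp q * C q - p q * be q).
 move=> /andP[r0 rt].
 have ibr : intble_on mu `[0, r] be.
  by apply: integrableS ibe => //; apply: subset_itvl; rewrite bnd_simp.
 have := @line_linear R p dp be (C r) r r0.
 have sub x : 0 <= x <= r -> 0 <= x <= tau by move=> /andP[-> /le_trans]; apply.
 move=> /(_ (fun x h => dpE (sub x h)) (fun x h => cdp (sub x h)) ibr).
 have CE q : 0 <= q <= r -> C r + \int[mu]_(x in `[q, r]) be x = C q.
  move=> /andP[q0 qr]; rewrite /C (@Rintegral_itv_chasles _ be q r tau)//; first by ring.
  by apply: integrableS ibe => //; apply: subset_itvr; rewrite bnd_simp.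
 rewrite CE ?lexx// => E.
 rewrite (_ : p r * C r = p 0 * C 0 - (p 0 * C 0 - p r * C r)); last by ring.
 rewrite -E; congr (_ + _); rewrite -mulN1r -RintegralZl//.
  apply: eq_Rintegral => q; rewrite inE/= in_itv/= => qr; rewrite CE//; ring.
 have : intble_on mu `[0, r] (fun r => p r * be r - dp r * C r).
  by apply: integrableS iC => //; apply: subset_itvl; rewrite bnd_simp.
 apply: eq_integrable => // q; rewrite inE/= in_itv/= => qr; by rewrite /= CE.
have iC' : intble_on mu `[0, tau] (fun r => dp r * C r - p r * be r).
 apply: eq_integrable (integrableN iC) => // r _.
 by rewrite /= opprB.
have := @Rintegral_by_parts R be (fun r => dp r * C r - p r * be r) tau (p 0 * C 0) c ibe iC'.
have := P tau; rewrite tau0 lexx => /(_ isT) Pt.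
set I := \int[mu]_(r in `[0, tau]) (dp r * C r - p r * be r) in Pt *.
set J := \int[mu]_(r in `[0, tau]) be r.
have C0 : C 0 = c + J by [].
have Ct : C tau = c by rewrite /C set_itv1 Rintegral_set1 addr0.
move=> E; transitivity (p 0 * C 0 * J - c * I).
 rewrite -E; apply: eq_Rintegral => r; rewrite inE/= in_itv/= => rt.
 by rewrite -P// -/(C r); ring.
have -> : I = p tau * c - p 0 * C 0 by rewrite -[in p tau * c]Ct Pt; ring.
have -> : J = C 0 - c by rewrite C0; ring.
ring.
Qed.
End line1d_square.

Lemma continuous_bigsum (T : topologicalType) R (I : Type) (r : seq I) (P : pred I)
  (F : I -> T -> R) : (forall i, continuous (F i)) ->
 continuous (fun x => \sum_(i <- r | P i) F i x).
Proof.
move=> cF; elim: r => [|i r IH] x.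
 rewrite (_ : (fun _ => _) = fun=> 0); first exact: cvg_cst.
 by apply/funext => y; rewrite big_nil.
rewrite (_ : (fun _ => _) = fun x => (if P i then F i x else 0) + \sum_(j <- r | P j) F j x); last first.
 by apply/funext => y; rewrite big_cons; case: ifP; rewrite ?add0r.
case: (P i); last by apply: cvgD; [exact: cvg_cst|exact: IH].
by apply: cvgD; [exact: cF|exact: IH].
Qed.

(** * The Duhamel formula *)

Section rates.
Context {R} {d : nat}.
Variables (U : 'rV[R]_d -> R) (gamma : R).
Local Notation state := (phase R d).
Local Notation leb := (@lebesgue_measure R).
Implicit Types (z : state) (s t : R) (o : option 'I_d).
Hypotheses (CU : Cn 1 U) (gamma0 : 0 < gamma).

Definition zz_tot z : R := \sum_o zz_rate U gamma z o.
(** Velocities are reversed because the adjoint of the jumps, and the divergence of the flow under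
    the Gibbs weight, bring in the rates at (x, - v). *)
Definition zz_rev z : state := (z.1, - z.2).
Definition zz_cum z t : R := \int[leb]_(s in `[0, t]) zz_tot (zz_flow z s).

Lemma zz_flow0 z : zz_flow z 0 = z.
Proof. by case: z => x v; rewrite /zz_flow scale0r addr0. Qed.

Lemma zz_flowD z s t : zz_flow (zz_flow z s) t = zz_flow z (s + t).
Proof. by rewrite /zz_flow /= scalerDl addrA. Qed.

Lemma zz_rate_ge0 z o : 0 <= zz_rate U gamma z o.
Proof. by case: o => [k|]; rewrite /= ?le_max ?lexx ?orbT// ltW. Qed.

Lemma zz_tot_ge0 z : 0 <= zz_tot z.
Proof. by apply: sumr_ge0 => o _; exact: zz_rate_ge0. Qed.

Lemma zz_totE z : zz_tot z = gamma + \sum_k Num.max (z.2 ord0 k * partial k U z.1) 0.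
Proof. rewrite /zz_tot (bigD1 None)//=; congr (_ + _).
rewrite (reindex_omap Some id)/=; last by case.
by under eq_bigl do rewrite eqxx. Qed.

(** Each term is a_+ - (- a)_+ = a with a = v_k partial_k U. So the change of the weight exp(- U)
    along the flow exactly compensates the difference between the rates at v and at - v; this is the
    mechanism behind the invariance of the measure. *)
Lemma zz_tot_rev z : zz_tot z - zz_tot (zz_rev z) = \sum_k z.2 ord0 k * partial k U z.1.
Proof.
rewrite !zz_totE opprD addrACA subrr add0r -sumrB; apply: eq_bigr => k _.
rewrite /= mxE mulNr; set a := z.2 ord0 k * _.
by have [a0|a0] := leP 0 a; have [b0|b0] := leP 0 (- a); lra.
Qed.

Lemma continuous_partial k : continuous (partial k U).
Proof. by case: CU => _ /(_ k) [_ []]. Qed.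

Lemma m_zz_rate o : mfunT (fun z => zz_rate U gamma z o).
Proof.
case: o => [k|] /=; last exact: m_cst.
apply: measurable_maxr => //; apply: mfunM.
 exact: (mcomp (measurable_coord k) m_snd).
apply: (mcomp _ m_fst); apply: cont_meas_rV.
exact: continuous_partial.
Qed.

Lemma m_zz_tot : mfunT zz_tot.
Proof. by apply: measurable_sum => o; exact: m_zz_rate. Qed.

Lemma m_rev : mfunT zz_rev.
Proof.
apply/measurable_fun_pairP; split; first exact: m_fst.
apply: measurable_fun_rV => i; rewrite /comp/=; under eq_fun do rewrite mxE.
by apply: mcomp => //; exact: (mcomp (measurable_coord i) m_snd).
Qed.

Lemma continuous_zz_rate z o : continuous (fun s => zz_rate U gamma (zz_flow z s) o).
Proof.
case: o => [k|] s /=; last exact: cvg_cst.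
apply: (@continuous_max R R (fun s => z.2 ord0 k * partial k U (z.1 + s *: z.2)) (fun=> 0)); last exact: cvg_cst.
apply: cvgM; first exact: cvg_cst.
exact: (cvg_comp _ _ (@continuous_line _ _ _ _ s) (@continuous_partial k _)).
Qed.

Lemma continuous_zz_tot z : continuous (fun s => zz_tot (zz_flow z s)).
Proof. by apply: continuous_bigsum => o; exact: continuous_zz_rate. Qed.

Lemma m_flow_comp dA (A : measurableType dA) (y : A -> state) (t : A -> R) :
 mfunT y -> mfunT t ->
 mfunT (fun a => zz_flow (y a) (t a)).
Proof.
by move=> my mt; exact: (mcomp m_zz_flow (m_pair mt my)).
Qed.

Lemma m_cumulative (r : state -> R) : mfunT r -> (forall z, 0 <= r z) ->
 mfunT (fun p : state * R => \int[leb]_(s in `[0, p.2]) r (zz_flow p.1 s)).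
Proof.
move=> mr r0.
pose K (q : (state * R) * measurableTypeR R) : \bar R :=
  (r (zz_flow q.1.1 q.2) * (if (0 <= q.2) && (q.2 <= q.1.2) then 1 else 0))%:E.
have mI : mfunT K.
 apply/mEFinP; apply: mfunM.
  apply: (mcomp mr).
  apply: m_flow_comp; last exact: m_snd.
  exact: (mcomp m_fst m_fst).
 apply: measurable_fun_ifT => //; apply: measurable_and; apply: measurable_fun_ler => //.
  exact: (mcomp m_snd m_fst).
have H := @measurable_fun_fubini_tonelli_F _ _ _ _ _ leb K.
apply: (eq_measurable_fun (fun p => fine (fubini_F leb K p))).
 move=> p _; rewrite /fubini_F /K /Rintegral; congr fine; rewrite [RHS]integral_mkcond.
 apply: eq_integral => s _; rewrite patchE; case: (boolP (s \in _)); rewrite ?inE ?notin_setE/= in_itv/=.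
  by move=> ->; rewrite mulr1.
 by move=> /negP/negbTE ->; rewrite mulr0.
apply: mcomp => //; apply: H => // q; rewrite lee_fin mulr_ge0//.
by case: ifP.
Qed.

Lemma m_zz_cum : mfunT (fun p : state * R => zz_cum p.1 p.2).
Proof. by apply: m_cumulative; [exact: m_zz_tot|exact: zz_tot_ge0]. Qed.

Lemma zz_cum_ge0 z t : 0 <= zz_cum z t.
Proof. by apply: Rintegral_ge0 => s _; exact: zz_tot_ge0. Qed.

Lemma zz_cum_flow z r s : 0 <= r -> 0 <= s -> zz_cum (zz_flow z r) s = zz_cum z (r + s) - zz_cum z r.
Proof.
move=> r0 s0; rewrite /zz_cum.
have itg b : intble_on leb `[0, b] (fun s => zz_tot (zz_flow z s)).
 by apply: continuous_itv_integrable => x _; exact: continuous_zz_tot.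
rewrite (@Rintegral_itv_chasles _ (fun s => zz_tot (zz_flow z s)) 0 r (r + s))//; last by rewrite lerDl.
rewrite addrAC subrr add0r.
have := @Rintegral_itv_translate _ (fun s => zz_tot (zz_flow z s)) 0 s r.
rewrite add0r [s + r]addrC => <-.
 by apply: eq_Rintegral => q _; rewrite zz_flowD addrC.
apply: continuous_measurable_fun; exact: continuous_zz_tot.
Qed.
End rates.

Section mild.
Context {R} {d : nat}.
Variables (U : 'rV[R]_d -> R) (gamma : R).
Local Notation state := (phase R d).
Local Notation leb := (@lebesgue_measure R).
Local Notation tot := (zz_tot U gamma).
Local Notation cum := (zz_cum U gamma).
Local Notation rev := (@zz_rev R d).
Hypotheses (CU : Cn 1 U) (gamma0 : 0 < gamma).

(** The first term is the contribution of no event before t, and s is the time of the first event.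
    The source [b] is left abstract; it becomes the jump operator applied to [u]. No regularity in
    time is asked of [u]. *)
Definition mild_solution (f : state -> R) (b u : R -> state -> R) : Prop :=
 forall t z, 0 <= t -> u t z = expR (- cum z t) * f (zz_flow z t) +
  \int[leb]_(s in `[0, t]) (expR (- cum z s) * b (t - s) (zz_flow z s)).

Variables (f : state -> R) (b u : R -> state -> R) (M : R).
Hypotheses (mild : mild_solution f b u) (mu_ : mfunT (fun p : R * state => u p.1 p.2))
 (mb : mfunT (fun p : R * state => b p.1 p.2)) (M0 : 0 <= M) (uM : forall t z, 0 <= t -> `|u t z| <= M)
 (bM : forall t z, 0 <= t -> `|b t z| <= M * tot z).

Section line.
Variables (z : state) (tau : R).
Hypothesis tau0 : 0 <= tau.
Let w r := flow_weight (fun r z => zz_flow z r) (U \o fst) r z.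
Let c := expR (- cum z tau) * f (zz_flow z tau).
Let be q := expR (- cum z q) * b (tau - q) (zz_flow z q).
Let C r := c + \int[leb]_(q in `[r, tau]) be q.
(** The cumulated rate, continued to negative times by integrating from -1: the fundamental theorem
    of calculus is applied at interior points, and r = 0 has to be one. *)
Let Lm r := \int[leb]_(q in `[-1, r]) tot (zz_flow z q) - \int[leb]_(q in `[-1, 0]) tot (zz_flow z q).
Let cumE r : 0 <= r -> Lm r = cum z r.
Proof.
move=> r0; rewrite /Lm (@Rintegral_itv_chasles _ _ (-1) 0 r)//.
 by rewrite addrAC subrr add0r.
by apply: continuous_itv_integrable => x _; exact: continuous_zz_tot.
Qed.
Let mcum : mfunT (cum z).
Proof. exact: (mcomp (m_zz_cum CU gamma0) (@m_pair1 _ _ _ _ z)). Qed.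
Let mflow : mfunT (zz_flow z).
Proof. by apply: m_flow_comp. Qed.
Let mbe : mfunT be.
Proof.
apply: mfunM; first by apply: mcomp => //; exact: mcomp.
apply: (m_uncurry mb); last exact: mflow.
exact: mfunB.
Qed.
Let ltau q : 0 <= q <= tau -> 0 <= tau - q.
Proof. by move=> /andP[_ ?]; rewrite subr_ge0. Qed.
Let dominated (h k : R -> R) : mfunT h ->
 (forall q : R, 0 <= q <= tau -> {for q, continuous k}) ->
 (forall q, 0 <= q <= tau -> `|h q| <= k q) -> intble_on leb `[0, tau] h.
Proof.
move=> mh ck hk.
have ik : intble_on leb `[0, tau] k by exact: continuous_itv_integrable.
apply: (le_integrable _ _ _ ik) => //.
- exact/mEFinP/measurable_funTS.
- move=> q; rewrite /= in_itv/= => qt; rewrite lee_fin.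
 by rewrite (le_trans (hk _ qt))// ler_norm.
Qed.
Let expcum q : 0 <= expR (- cum z q) <= 1.
Proof. by rewrite expR_ge0 -expR0 ler_expR oppr_le0 zz_cum_ge0. Qed.
Let ibe : intble_on leb `[0, tau] be.
Proof.
apply: (dominated (k := fun q => M * tot (zz_flow z q)) mbe).
 by move=> q _; apply: cvgM; [exact: cvg_cst|exact: continuous_zz_tot].
move=> q qt; rewrite normrM -[leRHS]mul1r ler_pM//.
 by case/andP: (expcum q) => e0 e1; rewrite ger0_norm.
by apply: bM; exact: ltau.
Qed.

Lemma intble_mild :
 intble_on leb `[0, tau] (fun q => expR (- cum z q) * b (tau - q) (zz_flow z q)).
Proof. exact: ibe. Qed.

(** Started from a later point of the line with the remaining time, the Duhamel formula has the same
    integrand up to the factor exp(cum z r), because [zz_cum] is additive along the flow. This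
    explicit primitive replaces a transport equation for [u]. *)
Lemma mild_line r : 0 <= r <= tau -> u (tau - r) (zz_flow z r) = expR (cum z r) * C r.
Proof.
move=> /andP[r0 rt]; rewrite mild ?subr_ge0// zz_cum_flow// ?subr_ge0//.
rewrite zz_flowD (_ : r + (tau - r) = tau); last by ring.
rewrite mulrDr; congr (_ + _).
 by rewrite /c mulrA -expRD; congr (expR _ * _); ring.
have := @Rintegral_itv_translate _ (fun q => expR (- (cum z q - cum z r)) * b (tau - q) (zz_flow z q)) 0 (tau - r) r.
rewrite add0r subrK => E; transitivity (\int[leb]_(q in `[r, tau]) (expR (- (cum z q - cum z r)) * b (tau - q) (zz_flow z q))).
 rewrite -E; last first.
  apply: mfunM; last first.
   apply: (m_uncurry mb); last exact: mflow.
   exact: mfunB.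
  apply: mcomp => //; apply: mcomp => //; exact: mfunB.
 apply: eq_Rintegral => q; rewrite inE/= in_itv/= => /andP[q0 qt].
 by rewrite zz_cum_flow// zz_flowD [r + q]addrC; congr (_ * b _ _); ring.
rewrite -RintegralZl//; last by apply: integrableS ibe => //; apply: subset_itvr; rewrite bnd_simp.
apply: eq_Rintegral => q _; rewrite /be mulrA -expRD; congr (expR _ * _); ring.
Qed.
Let sumUv r := \sum_k z.2 ord0 k * partial k U (z.1 + r *: z.2).
Let is_derive_U (r : R) : is_derive r 1 (fun r => U (zz_flow z r).1) (sumUv r).
Proof. exact: is_derive_Cn1_line. Qed.
Let is_derive_Lm (r : R) : 0 <= r -> is_derive r 1 Lm (tot (zz_flow z r)).
Proof.
move=> r0; have := @is_derive_prim R (fun q => tot (zz_flow z q)) (-1) r (@continuous_zz_tot _ _ _ gamma CU z).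
move=> /(_ (lt_le_trans (ltrN10 _) r0)) h.
have := is_deriveB h (is_derive_cst _ r 1 : is_derive r 1 (fun=> \int[leb]_(q in `[-1, 0]) tot (zz_flow z q)) 0).
by rewrite subr0.
Qed.
(** The logarithm of exp(k cum) times the flow weight. k = 1 serves the pairing with a test function
    and k = 2 the square of the solution. *)
Let E (k r : R) := k * Lm r + (U z.1 - U (zz_flow z r).1).
Let is_derive_E (k r : R) : 0 <= r -> is_derive r 1 (E k) (k * tot (zz_flow z r) - sumUv r).
Proof.
move=> r0; have h1 := is_derive_Lm r0; have h2 := is_derive_U r.
have h3 := is_deriveB (is_derive_cst (U z.1) r 1 : is_derive r 1 (fun=> U z.1) 0) h2.
have := is_deriveD (is_deriveZ k h1) h3.
by rewrite sub0r.
Qed.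
Let is_derive_expE (k r : R) : 0 <= r ->
 is_derive r 1 (expR \o E k) (expR (E k r) * (k * tot (zz_flow z r) - sumUv r)).
Proof. by move=> r0; apply: is_derive1_comp; exact: is_derive_E. Qed.
Let EE (k r : R) : 0 <= r -> expR (E k r) = expR (k * cum z r) * w r.
Proof. by move=> r0; rewrite /E cumE// expRD. Qed.

Variables (g Dg : state -> R).
Hypotheses (dg : forall r : R, is_derive r 1 (fun r => g (zz_flow z r)) (Dg (zz_flow z r)))
 (cDg : continuous (fun r => Dg (zz_flow z r))).
Let totrev r : tot (zz_flow z r) - sumUv r = tot (rev (zz_flow z r)).
Proof.
have := zz_tot_rev U gamma (zz_flow z r); rewrite /= -/(sumUv r) => <-.
by rewrite opprB addrC subrK.
Qed.
Let is_derive_cont (F : R -> R) (a r : R) : is_derive r 1 F a -> {for r, continuous F}.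
Proof. by case=> dF1 _; exact/differentiable_continuous/derivable1_diffP. Qed.
Let csumUv : continuous sumUv.
Proof.
apply: continuous_bigsum => k r; apply: cvgM; first exact: cvg_cst.
apply: (@continuous_comp _ _ _ (fun r : R => z.1 + r *: z.2) (partial k U)).
 exact: continuous_line.
by have := continuous_partial CU (k := k); apply.
Qed.
Let cexpE (k r : R) : 0 <= r -> {for r, continuous (expR \o E k)}.
Proof. by move=> r0; exact: (is_derive_cont (is_derive_expE k r0)). Qed.
Let E0 (k : R) : expR (E k 0) = 1.
Proof. by rewrite EE// /w /flow_weight/= scale0r addr0 subrr /zz_cum set_itv1 Rintegral_set1 mulr0 expR0 mulr1. Qed.
Let C0 : C 0 = u tau z.
Proof.
have := @mild_line 0; rewrite lexx tau0 subr0 zz_flow0 => -> //.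
by rewrite /zz_cum set_itv1 Rintegral_set1 expR0 mul1r.
Qed.

(** [line_linear] with p = exp(E 1) g. The factor exp(E 1) has logarithmic derivative tot - v . grad
    U, which is the total rate at the reversed velocity. *)
Lemma mild_line_linear :
 f (zz_flow z tau) * g (zz_flow z tau) * w tau - u tau z * g z =
 - \int[leb]_(r in `[0, tau]) ((b (tau - r) (zz_flow z r) * g (zz_flow z r) -
  u (tau - r) (zz_flow z r) * (Dg (zz_flow z r) + tot (rev (zz_flow z r)) * g (zz_flow z r))) * w r).
Proof.
pose p r := expR (E 1 r) * g (zz_flow z r).
pose dp r := expR (E 1 r) * (Dg (zz_flow z r) + tot (rev (zz_flow z r)) * g (zz_flow z r)).
have dpE (r : R) : 0 <= r <= tau -> is_derive r 1 p (dp r).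
 move=> /andP[r0 _].
 have h : is_derive r 1 p _ := is_deriveM (is_derive_expE 1 r0) (dg r).
 rewrite (_ : dp r = expR (E 1 r) * Dg (zz_flow z r) +
  g (zz_flow z r) * (expR (E 1 r) * (1 * tot (zz_flow z r) - sumUv r))); first exact: h.
 by rewrite /dp mul1r totrev; ring.
have cdp (r : R) : 0 <= r <= tau -> {for r, continuous dp}.
 move=> /andP[r0 _]; apply: cvgM; first exact: cexpE.
 apply: cvgD; first exact: cDg.
 apply: cvgM; last exact: (is_derive_cont (dg r)).
 rewrite -totrev; under eq_fun do rewrite -totrev.
 by apply: cvgB; [exact: continuous_zz_tot|exact: csumUv].
have H0 : \int[leb]_(r in `[0, tau]) (p r * be r - dp r * C r) = p 0 * C 0 - p tau * c.
 exact: line_linear.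
have p0 : p 0 = g z by rewrite /p E0 mul1r zz_flow0.
have pt : p tau = expR (cum z tau) * w tau * g (zz_flow z tau) by rewrite /p EE// mul1r.
move: H0; rewrite C0 p0 pt /c => H.
transitivity (- (g z * u tau z - expR (cum z tau) * w tau * g (zz_flow z tau) * (expR (- cum z tau) * f (zz_flow z tau)))).
 have : expR (cum z tau) * expR (- cum z tau) = 1 by rewrite -expRD subrr expR0.
 by move=> e1; rewrite (_ : expR _ * w tau * _ * _ = (expR (cum z tau) * expR (- cum z tau)) * (w tau * g (zz_flow z tau) * f (zz_flow z tau))); [rewrite e1; ring|ring].
rewrite -H; congr (- _); apply: eq_Rintegral => r; rewrite inE/= in_itv/= => rt.
have r0 : 0 <= r by case/andP: rt.
rewrite /p /dp EE// mul1r mild_line// /be.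
have e1 : expR (cum z r) * expR (- cum z r) = 1 by rewrite -expRD subrr expR0.
transitivity ((expR (cum z r) * expR (- cum z r)) * (w r * g (zz_flow z r) * b (tau - r) (zz_flow z r)) -
 expR (cum z r) * w r * (Dg (zz_flow z r) + tot (rev (zz_flow z r)) * g (zz_flow z r)) * C r); first by ring.
by rewrite e1; ring.
Qed.

(** [line_square] with p = exp(E 2), whose logarithmic derivative 2 tot - v . grad U is the sum of
    the total rates at v and at - v. *)
Lemma mild_line_square :
 f (zz_flow z tau) ^+ 2 * w tau - u tau z ^+ 2 =
 - \int[leb]_(r in `[0, tau]) ((2 * u (tau - r) (zz_flow z r) * b (tau - r) (zz_flow z r) -
  (tot (zz_flow z r) + tot (rev (zz_flow z r))) * u (tau - r) (zz_flow z r) ^+ 2) * w r).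
Proof.
pose p r := expR (E 2 r).
pose dp r := expR (E 2 r) * (tot (zz_flow z r) + tot (rev (zz_flow z r))).
have dpE (r : R) : 0 <= r <= tau -> is_derive r 1 p (dp r).
 move=> /andP[r0 _]; have h : is_derive r 1 p _ := is_derive_expE 2 r0.
 rewrite (_ : dp r = expR (E 2 r) * (2 * tot (zz_flow z r) - sumUv r)); first exact: h.
 by rewrite /dp -totrev; congr (_ * _); ring.
have ctr : continuous (fun r => tot (zz_flow z r) + tot (rev (zz_flow z r))).
 move=> r; apply: cvgD; first exact: continuous_zz_tot.
 rewrite -totrev; under eq_fun do rewrite -totrev.
 by apply: cvgB; [exact: continuous_zz_tot|exact: csumUv].
have cdp (r : R) : 0 <= r <= tau -> {for r, continuous dp}.
 by move=> /andP[r0 _]; apply: cvgM; [exact: cexpE|exact: ctr].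
have e1 (r : R) : expR (cum z r) * expR (- cum z r) = 1 by rewrite -expRD subrr expR0.
have E2 (r : R) : expR (2 * cum z r) = expR (cum z r) * expR (cum z r).
 by rewrite -expRD; congr expR; ring.
(* The integrand that [line_square] asks to be integrable, with [C] expressed by [u]. In this form
   the bounds on [u] and [b] dominate it by a continuous function. *)
pose h r := expR (cum z r) * w r * (b (tau - r) (zz_flow z r) -
 (tot (zz_flow z r) + tot (rev (zz_flow z r))) * u (tau - r) (zz_flow z r)).
have hE (r : R) : 0 <= r <= tau -> h r = p r * be r - dp r * C r.
 move=> rt; have r0 : 0 <= r by case/andP: rt.
 rewrite /h /dp /p EE// mild_line// /be E2.
 transitivity (expR (cum z r) * w r * (expR (cum z r) * expR (- cum z r)) * b (tau - r) (zz_flow z r) -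
  expR (cum z r) * w r * (tot (zz_flow z r) + tot (rev (zz_flow z r))) * (expR (cum z r) * C r)); last by ring.
 by rewrite e1; ring.
have iC : intble_on leb `[0, tau] (fun r => p r * be r - dp r * C r).
 have ih : intble_on leb `[0, tau] h.
  apply: (dominated (k := fun r => expR (E 1 r) * (M * tot (zz_flow z r) +
    (tot (zz_flow z r) + tot (rev (zz_flow z r))) * M))).
  - have mr : mfunT (fun r : R => tau - r) by exact: mfunB.
   have mw : mfunT w.
    apply: mcomp => //; apply: mfunB => //.
    apply: (mcomp (cont_meas_rV _)); first by case: CU.
    exact: (mcomp m_fst mflow).
   apply: mfunM.
    by apply: mfunM => //; exact: mcomp.
   apply: mfunB; first exact: (m_uncurry mb mr mflow).
   apply: mfunM; last exact: (m_uncurry mu_ mr mflow).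
   apply: continuous_measurable_fun; exact: ctr.
  - move=> q /andP[q0 _]; apply: cvgM; first exact: cexpE.
   apply: cvgD; first by apply: cvgM; [exact: cvg_cst|exact: continuous_zz_tot].
   by apply: cvgM; [exact: ctr|exact: cvg_cst].
  - move=> q qt; have q0 : 0 <= q by case/andP: qt.
   rewrite /h EE// mul1r normrM [`|expR _ * _|]ger0_norm ?mulr_ge0 ?expR_ge0//.
   rewrite ler_wpM2l ?mulr_ge0 ?expR_ge0// (le_trans (ler_normB _ _))//.
   rewrite lerD ?bM ?ltau// normrM ger0_norm ?addr_ge0 ?zz_tot_ge0//.
   by rewrite ler_wpM2l ?addr_ge0 ?zz_tot_ge0 ?uM ?ltau.
 by apply: eq_integrable ih => // r; rewrite inE/= in_itv/= => rt; rewrite /= hE.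
have H0 : \int[leb]_(r in `[0, tau]) (2 * p r * C r * be r - dp r * C r ^+ 2) =
  p 0 * C 0 ^+ 2 - p tau * c ^+ 2.
 exact: line_square.
have p0 : p 0 = 1 by rewrite /p E0.
have pt : p tau = expR (cum z tau) * expR (cum z tau) * w tau by rewrite /p EE// E2.
move: H0; rewrite C0 p0 mul1r pt /c => H.
transitivity (- (u tau z ^+ 2 - expR (cum z tau) * expR (cum z tau) * w tau * (expR (- cum z tau) * f (zz_flow z tau)) ^+ 2)).
 rewrite (_ : _ * w tau * _ = (expR (cum z tau) * expR (- cum z tau)) ^+ 2 * (w tau * f (zz_flow z tau) ^+ 2)); last by ring.
 by rewrite e1; ring.
rewrite -H; congr (- _); apply: eq_Rintegral => r; rewrite inE/= in_itv/= => rt.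
have r0 : 0 <= r by case/andP: rt.
rewrite /p /dp EE// E2 mild_line// /be.
transitivity (2 * (expR (cum z r) * expR (- cum z r)) * (w r * (expR (cum z r) * C r) * b (tau - r) (zz_flow z r)) -
  w r * (tot (zz_flow z r) + tot (rev (zz_flow z r))) * (expR (cum z r) * C r) ^+ 2); first by ring.
by rewrite e1; ring.
Qed.
End line.
End mild.

Section mild_semigroup.
Context {R} {d : nat}.
Variables (U : 'rV[R]_d -> R) (gamma : R).
Local Notation state := (phase R d).
Local Notation leb := (@lebesgue_measure R).
Local Notation tot := (zz_tot U gamma).
Hypotheses (CU : Cn 1 U) (gamma0 : 0 < gamma).
Variables (f : state -> R) (b u : R -> state -> R) (M : R).
Hypotheses (mild : mild_solution U gamma f b u) (mb : mfunT (fun p : R * state => b p.1 p.2))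
 (bM : forall t z, 0 <= t -> `|b t z| <= M * tot z).

(** The formula up to time s + t, split at t: by [mild_line] the part after t is the value of u(s)
    at the end of the line, discounted by exp(- cum z t). *)
Lemma mild_shift s : 0 <= s -> mild_solution U gamma (u s) (fun q => b (s + q)) (fun q => u (s + q)).
Proof.
move=> s0 t z t0; have st0 : 0 <= s + t by rewrite addr_ge0.
have := @mild_line _ _ _ _ CU gamma0 f b u M mild mb bM z (s + t) t.
rewrite addrK t0 lerDr s0 => /(_ isT) ->.
have expK (x y : R) : expR (- x) * (expR x * y) = y by rewrite mulrA -expRD addNr expR0 mul1r.
rewrite expK (mild z st0).
rewrite (@Rintegral_itv_chasles _ _ 0 t (s + t))// ?lerDr//; last first.
 exact: (intble_mild CU gamma0 mb bM).
rewrite [RHS]addrAC -[RHS]addrA; congr (_ + (_ + _)).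
by apply: eq_Rintegral => q _; rewrite addrA.
Qed.

Variables (f' : state -> R) (b' u' : R -> state -> R) (M' : R).
Hypotheses (mild' : mild_solution U gamma f' b' u') (mb' : mfunT (fun p : R * state => b' p.1 p.2))
 (bM' : forall t z, 0 <= t -> `|b' t z| <= M' * tot z).

Lemma mild_sub : mild_solution U gamma (fun z => f z - f' z)
 (fun t z => b t z - b' t z) (fun t z => u t z - u' t z).
Proof.
move=> t z t0; have i1 := intble_mild CU gamma0 mb bM z t.
have i2 := intble_mild CU gamma0 mb' bM' z t.
rewrite (_ : \int[leb]_(s in `[0, t]) _ =
 \int[leb]_(s in `[0, t]) (expR (- zz_cum U gamma z s) * b (t - s) (zz_flow z s)) -
 \int[leb]_(s in `[0, t]) (expR (- zz_cum U gamma z s) * b' (t - s) (zz_flow z s))).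
 by rewrite (mild z t0) (mild' z t0); ring.
rewrite -(RintegralB _ i1 i2); last exact: measurable_itv.
by apply: eq_Rintegral => q _; rewrite mulrBr.
Qed.
End mild_semigroup.

Section invariance.
Context {R} {d : nat}.
Local Notation state := (phase R d).

Definition flip_invariant (kappa : rVlaw R d) := forall (k : 'I_d) (F : 'rV[R]_d -> \bar R),
 mfunT F -> (forall v, (0 <= F v)%E) -> (\int[kappa]_v F (flip k v) = \int[kappa]_v F v)%E.

Definition flow_quasi_invariant (U : 'rV[R]_d -> R) (mu kappa : rVlaw R d) :=
 forall (r : R) (F : state -> \bar R), mfunT F -> (forall z, (0 <= F z)%E) ->
 (\int[mu \x kappa]_z (F (zz_flow z r) * (flow_weight (fun r z => zz_flow z r) (U \o fst) r z)%:E) =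
  \int[mu \x kappa]_z F z)%E.

End invariance.

Lemma Rintegral_opp d (T : measurableType d) R (m : {measure set T -> \bar R})
  (D : set T) (f : T -> R) : \int[m]_(x in D) (- f x) = - \int[m]_(x in D) f x.
Proof.
rewrite /Rintegral integralE [in RHS]integralE.
rewrite (_ : (fun x => (- f x)%:E) = \- (EFin \o f))%E; last by apply/funext => x.
rewrite funeposN funenegN.
rewrite (_ : (fun x => (f x)%:E) = EFin \o f) //.
by case: (\int[m]_(x in D) _)%E => [a||]; case: (\int[m]_(x in D) _)%E => [b||]//=; rewrite ?opprB ?oppr0.
Qed.

Lemma m_Rintegral dA dT (A : measurableType dA) (T : measurableType dT) R
  (m : {sigma_finite_measure set T -> \bar R}) (K : A -> T -> R) :
 mfunT (fun p : A * T => K p.1 p.2) ->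
 mfunT (fun a => \int[m]_z K a z).
Proof.
move=> mK; have mE : mfunT (fun p : A * T => (K p.1 p.2)%:E) by exact/mEFinP.
apply: mcomp => //; under eq_fun do rewrite integralE.
apply: emeasurable_funB.
- rewrite (_ : (fun _ => _) = fubini_F m ((fun p : A * T => (K p.1 p.2)%:E)^\+)%E).
  by apply: measurable_fun_fubini_tonelli_F => //; exact: measurable_funepos.
 by apply/funext => a; apply: eq_integral => z _; rewrite !funeposE.
- rewrite (_ : (fun _ => _) = fubini_F m ((fun p : A * T => (K p.1 p.2)%:E)^\-)%E).
  by apply: measurable_fun_fubini_tonelli_F => //; exact: measurable_funeneg.
 by apply/funext => a; apply: eq_integral => z _; rewrite !funenegE.
Qed.

Lemma intble_bounded d (T : measurableType d) R (m : probability T R)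
  (f : T -> R) (M : R) : mfunT f ->
 (forall z, `|f z| <= M) -> intble m f.
Proof.
move=> mf fM; apply: measurable_bounded_integrable => //.
 by rewrite (le_lt_trans (probability_le1 m msT))// ltry.
by exists M; split; rewrite ?num_real// => y My z _ /=; rewrite (le_trans (fM z))// ltW.
Qed.

Notation intble_by m M := (@intble_bounded _ _ _ m _ M).

Section mild_integrated.
Context {R} {d : nat}.
Variables (U : 'rV[R]_d -> R) (gamma : R).
Local Notation state := (phase R d).
Local Notation leb := (@lebesgue_measure R).
Local Notation tot := (zz_tot U gamma).
Local Notation rev := (@zz_rev R d).
Variable m : probability state R.
Hypothesis CU : Cn 1 U.
Hypothesis quasi_inv : forall (r : R) (F : state -> \bar R), mfunT F ->
 (forall z, (0 <= F z)%E) ->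
 (\int[m]_z (F (zz_flow z r) * (flow_weight (fun r z => zz_flow z r) (U \o fst) r z)%:E) =
  \int[m]_z F z)%E.
Hypothesis gamma0 : 0 < gamma.
Variables (f : state -> R) (b u : R -> state -> R) (M : R).
Hypotheses (mild : mild_solution U gamma f b u) (mu_ : mfunT (fun p : R * state => u p.1 p.2))
 (mb : mfunT (fun p : R * state => b p.1 p.2)) (M0 : 0 <= M) (uM : forall t z, 0 <= t -> `|u t z| <= M)
 (bM : forall t z, 0 <= t -> `|b t z| <= M * tot z).
Let cU : continuous U. Proof. by case: CU. Qed.

Lemma mild0 z : u 0 z = f z.
Proof.
by rewrite mild// zz_flow0 set_itv1 Rintegral_set1 addr0 /zz_cum set_itv1 Rintegral_set1 oppr0 expR0 mul1r.
Qed.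

Lemma m_mild t : mfunT (u t).
Proof. exact: (mcomp mu_ (@m_pair1 _ _ _ _ t)). Qed.
Let mf : mfunT f.
Proof. by rewrite (_ : f = u 0); [exact: m_mild|apply/funext => z; rewrite mild0]. Qed.
Let fM z : `|f z| <= M.
Proof. by rewrite -mild0 uM. Qed.
Let mtau (tau : R) : mfunT (fun p : R * state => tau - p.1).
Proof. by apply: mfunB => //; exact: m_fst. Qed.
Let mrev : mfunT (fun z => tot (rev z)).
Proof. by apply: (mcomp (f := tot)); [exact: m_zz_tot|exact: m_rev]. Qed.
Let msnd (h : state -> R) : mfunT h -> mfunT (fun p : R * state => h p.2).
Proof. by move=> mh; exact: (mcomp mh m_snd). Qed.
Let balance := @flow_balance _ state R m (fun r z => zz_flow z r) (U \o fst)
 m_zz_flow (mcomp (cont_meas_rV cU) m_fst) quasi_inv.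

Section weak.
Variables (g Dg : state -> R).
Hypotheses (dg : forall z (r : R), is_derive r 1 (fun r => g (zz_flow z r)) (Dg (zz_flow z r)))
 (cDg : forall z, continuous (fun r => Dg (zz_flow z r))) (mg : mfunT g) (mDg : mfunT Dg) (ig : intble m g)
 (iDg : intble m Dg) (itg : intble m (fun z => tot z * g z)) (itrg : intble m (fun z => tot (rev z) * g z)).

(** [mild_line_linear] integrated by [flow_balance]. All derivatives fall on the test function,
    through its derivative [Dg] along flow lines. The final reflection of the interval turns the
    time r spent on the line into the time q = tau - r of the solution. *)
Lemma mild_weak tau : 0 <= tau ->
 \int[m]_z (u tau z * g z) - \int[m]_z (f z * g z) =
 \int[leb]_(q in `[0, tau]) \int[m]_z (b q z * g z - u q z * (Dg z + tot (rev z) * g z)).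
Proof.
move=> tau0.
pose K q z := b q z * g z - u q z * (Dg z + tot (rev z) * g z).
have mK : mfunT (fun p : R * state => K p.1 p.2).
 apply: mfunB; first by apply: mfunM => //; exact: msnd.
 apply: mfunM => //; apply: (msnd (h := fun z => Dg z + tot (rev z) * g z)).
 by apply: mfunD => //; exact: mfunM.
have mK' : mfunT (fun p : R * state => - K (tau - p.1) p.2).
 by apply: mcomp => //; exact: (m_uncurry mK (mtau tau) m_snd).
pose k z := M * `|tot z * g z| + M * (`|Dg z| + `|tot (rev z) * g z|).
have ik : intble m k.
 apply: intble_add => //; apply: intble_cmul => //; first exact: integrable_norm.
 by apply: intble_add => //; exact: integrable_norm.
have ibd (h : state -> R) : mfunT h -> (forall z, `|h z| <= M) ->
  intble m (fun z => h z * g z).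
 move=> mh hM; apply: (@intble_EFin_le _ _ _ _ _ (fun z => M * g z)).
 - exact: mfunM.
 - exact: intble_cmul.
 - by move=> z; rewrite !normrM ler_wpM2r// (ger0_norm M0).
have := balance tau0 mK' ik (ibd _ (m_mild tau) (fun z => uM z tau0)) (ibd _ mf fM).
have dom (r : R) z : 0 <= r <= tau -> `|- K (tau - r) z| <= k z.
 move=> /andP[r0 rt]; rewrite normrN /K /k.
 have tr : 0 <= tau - r by rewrite subr_ge0.
 rewrite (le_trans (ler_normB _ _))// lerD// normrM.
  rewrite normrM mulrA ler_wpM2r// (le_trans (bM _ tr))// ler_wpM2l//.
  by rewrite ger0_norm// zz_tot_ge0.
 by rewrite ler_pM// ?uM// ler_normD.
move=> /(_ (fun r z => dom r z)) E.
have {}E := E (fun z => _); rewrite -opprB E; last first.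
 move=> z; rewrite (mild_line_linear CU gamma0 mild mb bM tau0 (dg z) (@cDg z)).
 rewrite -Rintegral_opp; apply: eq_Rintegral => r _.
 by rewrite /K/= mulNr.
rewrite -(@Rintegral_itv_reflect R (fun q => \int[m]_z K q z) tau); last first.
 exact: m_Rintegral.
rewrite -Rintegral_opp; apply: eq_Rintegral => r _.
by rewrite -Rintegral_opp; under eq_Rintegral do rewrite opprK.
Qed.
End weak.

Hypotheses (itot : intble m tot) (itrev : intble m (fun z => tot (rev z))).

(** [mild_line_square] integrated in the same way. This is the energy identity for bounded
    solutions, although u^2 is not known to be differentiable along any line. *)
Lemma mild_energy tau : 0 <= tau ->
 \int[m]_z (u tau z ^+ 2) - \int[m]_z (f z ^+ 2) =
 \int[leb]_(q in `[0, tau]) \int[m]_z (2 * u q z * b q z - (tot z + tot (rev z)) * u q z ^+ 2).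
Proof.
move=> tau0.
pose K q z := 2 * u q z * b q z - (tot z + tot (rev z)) * u q z ^+ 2.
have mK : mfunT (fun p : R * state => K p.1 p.2).
 apply: mfunB; first by apply: mfunM => //; exact: mfunM.
 apply: mfunM; last exact: mfunX.
 apply: (msnd (h := fun z => tot z + tot (rev z))).
 by apply: mfunD => //; exact: m_zz_tot.
have mK' : mfunT (fun p : R * state => - K (tau - p.1) p.2).
 by apply: mcomp => //; exact: (m_uncurry mK (mtau tau) m_snd).
pose k z := (3 * M ^+ 2) * tot z + M ^+ 2 * tot (rev z).
have ik : intble m k.
 by apply: intble_add => //; exact: intble_cmul.
have ibd (h : state -> R) : mfunT h -> (forall z, `|h z| <= M) ->
  intble m (fun z => h z ^+ 2).
 move=> mh hM; apply: (intble_by _ (M ^+ 2)).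
 - exact: mfunX.
 - by move=> z; rewrite normrX lerXn2r ?nnegrE.
have := balance tau0 mK' ik (ibd _ (m_mild tau) (fun z => uM z tau0)) (ibd _ mf fM).
have dom (r : R) z : 0 <= r <= tau -> `|- K (tau - r) z| <= k z.
 move=> /andP[r0 rt]; rewrite normrN /K /k.
 have tr : 0 <= tau - r by rewrite subr_ge0.
 have u2 : u (tau - r) z ^+ 2 <= M ^+ 2.
  by rewrite -[u _ _ ^+ 2]ger0_norm ?sqr_ge0// normrX lerXn2r ?nnegrE// uM.
 have h1 : `|2 * u (tau - r) z * b (tau - r) z| <= 2 * (M * (M * tot z)).
  by rewrite -mulrA !normrM ger0_norm// ler_wpM2l// ler_pM// ?uM// bM.
 have h2 : `|(tot z + tot (rev z)) * u (tau - r) z ^+ 2| <= (tot z + tot (rev z)) * M ^+ 2.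
  rewrite normrM ger0_norm ?addr_ge0 ?zz_tot_ge0// ler_wpM2l ?addr_ge0 ?zz_tot_ge0//.
  by rewrite ger0_norm ?sqr_ge0.
 by apply: (le_trans (ler_normB _ _)); move: h1 h2; lra.
move=> /(_ (fun r z => dom r z)) E.
have {}E := E (fun z => _); rewrite -opprB E; last first.
 move=> z; rewrite (mild_line_square CU gamma0 mild mu_ mb uM bM z tau0).
 rewrite -Rintegral_opp; apply: eq_Rintegral => r _.
 by rewrite /K/= mulNr.
rewrite -(@Rintegral_itv_reflect R (fun q => \int[m]_z K q z) tau); last first.
 exact: m_Rintegral.
rewrite -Rintegral_opp; apply: eq_Rintegral => r _.
by rewrite -Rintegral_opp; under eq_Rintegral do rewrite opprK.
Qed.
End mild_integrated.

Lemma Rintegral_cst_prob d (T : measurableType d) R (P : probability T R) (c : R) :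
 \int[P]_x c = c.
Proof.
rewrite Rintegral_cst//= [X in fine X](_ : _ = 1%E) ?mulr1//; exact: probability_setT.
Qed.

Section fst_snd.
Context d1 d2 (T1 : measurableType d1) (T2 : measurableType d2) R.
Variables (m1 : probability T1 R) (m2 : probability T2 R).
Local Notation m := (m1 \x m2)%E.

Lemma intble_fst (h : T1 -> R) : intble m1 h ->
 intble m (fun z => h z.1).
Proof.
move=> ih; have mh : mfunT h by move/measurable_int : ih => /mEFinP.
apply/integrable12ltyP; first by apply/mEFinP; exact: (mcomp mh m_fst).
case/integrableP : ih => _; apply: le_lt_trans.
rewrite le_eqVlt; apply/orP; left; apply/eqP; apply: eq_integral => x _ /=.
rewrite integral_cst// [X in (_ * X)%E](_ : _ = 1%E) ?mule1//; exact: probability_setT.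
Qed.

Lemma Rintegral_fst (h : T1 -> R) : intble m1 h ->
 \int[m]_z h z.1 = \int[m1]_x h x.
Proof.
move=> ih; rewrite -RFubini1; last exact: intble_fst.
by apply: eq_Rintegral => x _ /=; rewrite Rintegral_cst_prob.
Qed.

Lemma Rintegral_fst_mul (h : T1 -> R) (g : T1 * T2 -> R) :
 (forall x, intble m2 (fun y => g (x, y))) ->
 intble m (fun z => h z.1 * g z) ->
 \int[m]_z (h z.1 * g z) = \int[m1]_x (h x * \int[m2]_y g (x, y)).
Proof.
move=> ig ihg; rewrite -RFubini1//; apply: eq_Rintegral => x _ /=.
by rewrite RintegralZl.
Qed.
End fst_snd.

(** * The jump operator, its adjoint and its dissipation *)

Section jumps.
Context {R} {d : nat}.
Variables (U : 'rV[R]_d -> R) (gamma : R) (mu kappa : rVlaw R d).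
Local Notation state := (phase R d).
Local Notation leb := (@lebesgue_measure R).
Local Notation tot := (zz_tot U gamma).
Local Notation rev := (@zz_rev R d).
Local Notation m := (mu \x kappa)%E.
Hypotheses (CU : Cn 1 U) (gamma0 : 0 < gamma).
Hypothesis flip_inv : flip_invariant kappa.

Definition refresh (h : state -> R) (x : 'rV[R]_d) : R := \int[kappa]_w h (x, w).

Definition flip_rate (k : 'I_d) (z : state) : R := Num.max (z.2 ord0 k * partial k U z.1) 0.

Definition zz_flip (k : 'I_d) (z : state) : state := (z.1, flip k z.2).

Definition zz_jumps (h : state -> R) (z : state) : R :=
 \sum_k flip_rate k z * h (zz_flip k z) + gamma * refresh h z.1.

Lemma totE z : tot z = \sum_k flip_rate k z + gamma.
Proof. by rewrite zz_totE addrC. Qed.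

Lemma flip_rate_ge0 k z : 0 <= flip_rate k z.
Proof. by rewrite le_max lexx orbT. Qed.

Lemma flipK k : involutive (@flip R d k).
Proof.
by move=> v; apply/rowP => i; rewrite !mxE; case: (i == k); rewrite ?opprK.
Qed.

Lemma zz_flipK k : involutive (zz_flip k).
Proof. by case=> x v; rewrite /zz_flip /= flipK. Qed.

Lemma flip_rate_flip k z : flip_rate k (zz_flip k z) = flip_rate k (rev z).
Proof. by rewrite /flip_rate/= !mxE eqxx. Qed.

Lemma m_flip k : mfunT (@flip R d k).
Proof.
apply: measurable_fun_rV => i; under eq_fun do rewrite mxE.
case: (i == k); last exact: measurable_coord.
by apply: mcomp => //; exact: measurable_coord.
Qed.

Lemma m_zz_flip k : mfunT (zz_flip k).
Proof.
apply/measurable_fun_pairP; split; first exact: m_fst.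
exact: (mcomp (m_flip k) m_snd).
Qed.

Lemma m_flip_rate k : mfunT (flip_rate k).
Proof. exact: (m_zz_rate gamma CU (Some k)). Qed.

Lemma m_refresh (h : state -> R) : mfunT h ->
 mfunT (refresh h).
Proof.
move=> mh; apply: (@m_Rintegral _ _ _ _ R kappa (fun x w => h (x, w))).
by rewrite (_ : (fun _ => _) = h)//; apply/funext => -[].
Qed.

Lemma m_zz_jumps (u : R -> state -> R) :
 mfunT (fun p : R * state => u p.1 p.2) ->
 mfunT (fun p : R * state => zz_jumps (u p.1) p.2).
Proof.
move=> mu_; apply: mfunD.
 apply: measurable_sum => k; apply: mfunM.
  exact: (mcomp (m_flip_rate k) m_snd).
 apply: (m_uncurry mu_); first exact: m_fst.
 exact: (mcomp (m_zz_flip k) m_snd).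
apply: mfunM => //.
apply: (@m_Rintegral _ _ _ _ R kappa (fun (p : R * state) w => u p.1 (p.2.1, w))).
apply: (m_uncurry mu_); first exact: (mcomp m_fst m_fst).
apply: m_pair; last exact: m_snd.
by apply: (mcomp m_fst); exact: (mcomp m_snd m_fst).
Qed.

Section bounded.
Variables (h : state -> R) (M : R).
Hypotheses (mh : mfunT h) (hM : forall z, `|h z| <= M).
Let M0 : 0 <= M. Proof. exact: le_trans (hM (0, 0)). Qed.

Lemma intble_section x : intble kappa (fun w => h (x, w)).
Proof.
apply: (intble_by kappa M) => //.
exact: (mcomp mh (@m_pair1 _ _ _ _ x)).
Qed.

Lemma refresh_le x : `|refresh h x| <= M.
Proof.
rewrite /refresh (le_trans (le_normr_Rintegral _ (intble_section x)))//.
apply: (@le_trans _ _ (\int[kappa]_w M)).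
 apply: le_Rintegral => //.
 - exact: integrable_norm (intble_section x).
 - by apply: (intble_by kappa `|M|) => //; exact: m_cst.
by rewrite Rintegral_cst_prob.
Qed.

Lemma zz_jumps_le z : `|zz_jumps h z| <= M * tot z.
Proof.
rewrite totE mulrDr mulr_sumr /zz_jumps (le_trans (ler_normD _ _))// lerD//; last first.
 by rewrite normrM gtr0_norm// mulrC ler_wpM2r ?refresh_le// ltW.
rewrite (le_trans (ler_norm_sum _ _ _))// ler_sum// => k _.
by rewrite normrM ger0_norm ?flip_rate_ge0// mulrC ler_wpM2r ?flip_rate_ge0.
Qed.
End bounded.

Lemma ge0_integral_flip k (F : state -> \bar R) : mfunT F -> (forall z, (0 <= F z)%E) ->
 (\int[m]_z F (zz_flip k z) = \int[m]_z F z)%E.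
Proof.
move=> mF F0; rewrite fubini_tonelli1//; last first.
 exact: (mcomp mF (m_zz_flip k)).
rewrite fubini_tonelli1//; apply: eq_integral => x _; rewrite /fubini_F/=.
rewrite -(flip_inv k (F := fun v => F (x, v)))//.
exact: (mcomp mF (@m_pair1 _ _ _ _ x)).
Qed.

Lemma intble_flip k (F : state -> R) : intble m F ->
 intble m (fun z => F (zz_flip k z)).
Proof.
move=> iF; have mF : mfunT F by move/measurable_int : iF => /mEFinP.
apply/integrableP; split.
 by apply/mEFinP; exact: (mcomp mF (m_zz_flip k)).
rewrite (ge0_integral_flip k (F := fun z => `|F z|%:E))//; first by case/integrableP : iF.
exact/mEFinP/mcomp.
Qed.

Lemma Rintegral_flip k (F : state -> R) : mfunT F ->
 \int[m]_z F (zz_flip k z) = \int[m]_z F z.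
Proof.
move=> mF; rewrite /Rintegral; congr fine; rewrite integralE [RHS]integralE; congr (_ - _)%E.
- rewrite -(ge0_integral_flip k (F := ((EFin \o F)^\+)%E))//; last first.
  by apply: measurable_funepos; exact/mEFinP.
 by apply: eq_integral => z _; rewrite !funeposE.
- rewrite -(ge0_integral_flip k (F := ((EFin \o F)^\-)%E))//; last first.
  by apply: measurable_funeneg; exact/mEFinP.
 by apply: eq_integral => z _; rewrite !funenegE.
Qed.

Section adjoint.
Variables (h g : state -> R) (M : R).
Hypotheses (mh : mfunT h) (hM : forall z, `|h z| <= M) (mg : mfunT g) (ig : intble m g)
 (igx : forall x, intble kappa (fun w => g (x, w)))
 (irg : forall k, intble m (fun z => flip_rate k z * g z)).

(** The adjoint of the jumps in L^2(mu x kappa). The change of variables by a flip moves the k-th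
    rate to the flipped velocity; as this rate depends on v through v_k alone, it equals the rate at
    - v. Refreshment is an orthogonal projection, hence self-adjoint. *)
Definition zz_jumps_adj z : R :=
 \sum_k flip_rate k (rev z) * g (zz_flip k z) + gamma * refresh g z.1.
Let bint (F : state -> R) : intble m F ->
 intble m (fun z => h z * F z).
Proof.
move=> iF; have mF : mfunT F by move/measurable_int : iF => /mEFinP.
apply: (intble_EFin_le _ (intble_cmul msT M iF)).
 exact: mfunM.
move=> z; rewrite !normrM ler_wpM2r//; apply: le_trans (hM z) _; exact: ler_norm.
Qed.
Let irg' k : intble m (fun z => flip_rate k (rev z) * g (zz_flip k z)).
Proof.
apply: eq_integrable (intble_flip k (irg k)) => // z _.
by rewrite /= flip_rate_flip.
Qed.
Let ihflip k : intble m (fun z => flip_rate k z * h (zz_flip k z) * g z).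
Proof.
have := intble_flip k (bint (irg' k)).
by apply: eq_integrable => // z _; rewrite /= -flip_rate_flip !zz_flipK; congr EFin; ring.
Qed.
Let irefg : intble mu (refresh g).
Proof. exact: intble_Rintegral1 ig. Qed.
Let irefh : intble m (fun z => refresh h z.1 * g z).
Proof.
apply: (intble_EFin_le _ (intble_cmul msT M ig)).
 by apply: mfunM => //; exact: (mcomp (m_refresh mh) m_fst).
move=> z; rewrite !normrM ler_wpM2r//; apply: le_trans (refresh_le mh hM z.1) _; exact: ler_norm.
Qed.

Lemma refresh_adj : \int[m]_z (refresh h z.1 * g z) = \int[m]_z (h z * refresh g z.1).
Proof.
rewrite Rintegral_fst_mul//; under [RHS]eq_Rintegral do rewrite mulrC.
rewrite (Rintegral_fst_mul (h := refresh g)).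
- by apply: eq_Rintegral => x _; rewrite mulrC.
- by move=> x; exact: intble_section mh hM x.
- have := bint (intble_fst kappa irefg).
 by apply: eq_integrable => // z _; rewrite /= mulrC.
Qed.

Lemma zz_jumps_adjoint : \int[m]_z (zz_jumps h z * g z) = \int[m]_z (h z * zz_jumps_adj z).
Proof.
transitivity (\sum_k \int[m]_z (flip_rate k z * h (zz_flip k z) * g z) +
  gamma * \int[m]_z (refresh h z.1 * g z)).
 rewrite -RintegralZl// -Rintegral_bigsum// -RintegralD//; last 2 first.
 - exact: intble_bigsum.
 - exact: intble_cmul.
 by apply: eq_Rintegral => z _; rewrite /zz_jumps mulrDl mulr_suml mulrA.
transitivity (\sum_k \int[m]_z (h z * (flip_rate k (rev z) * g (zz_flip k z))) +
  gamma * \int[m]_z (h z * refresh g z.1)).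
 rewrite refresh_adj; congr (_ + _); apply: eq_bigr => k _.
 rewrite -(@Rintegral_flip k (fun z => h z * (flip_rate k (rev z) * g (zz_flip k z)))).
  by apply: eq_Rintegral => z _; rewrite -flip_rate_flip !zz_flipK; ring.
 by have := bint (irg' k) => /measurable_int/mEFinP.
have i2 : intble m (fun z => h z * refresh g z.1).
 exact: bint (intble_fst kappa irefg).
rewrite -RintegralZl// -Rintegral_bigsum//; last by move=> k _; exact: bint.
rewrite -RintegralD//; last 2 first.
- by apply: intble_bigsum => // k _; exact: bint.
- exact: intble_cmul.
by apply: eq_Rintegral => z _; rewrite /zz_jumps_adj mulrDr mulr_sumr mulrCA.
Qed.
End adjoint.
End jumps.

Lemma intble_itv_bounded R (F : R -> R) (C a c : R) :
 mfunT F -> (forall x, `|F x| <= C) ->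
 intble_on (@lebesgue_measure R) `[a, c] F.
Proof.
move=> mF FC; apply: measurable_bounded_integrable => //.
- change (lebesgue_measure `[a, c]%classic < +oo)%E.
 by rewrite lebesgue_measure_itv/=; case: ifP => // _; rewrite -EFinB ltry.
- exact: measurable_funTS.
- by exists C; split; [exact: num_real|move=> x /ltW Cx q _; apply: le_trans Cx].
Qed.

Lemma subr_chasles (V : zmodType) (a b c x y z : V) :
 a - c = x -> b - c = y -> x = y + z -> a - b = z.
Proof.
move=> ac bc xyz; have -> : a - b = (a - c) - (b - c) by rewrite opprB addrA subrK.
by rewrite ac bc xyz addrAC subrr add0r.
Qed.

Section zz_dynamics.
Context {R} {d : nat}.
Variables (U : 'rV[R]_d -> R) (gamma : R) (mu kappa : rVlaw R d).
Local Notation state := (phase R d).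
Local Notation leb := (@lebesgue_measure R).
Local Notation tot := (zz_tot U gamma).
Local Notation cum := (zz_cum U gamma).
Local Notation rev := (@zz_rev R d).
Local Notation m := (mu \x kappa)%E.
Local Notation mp := (m : probability state R).
Local Notation rate := (flip_rate U).
Local Notation Pi := (refresh kappa).
Hypotheses (CU : Cn 1 U) (gamma0 : 0 < gamma).
Hypothesis flip_inv : flip_invariant kappa.
Hypothesis quasi_inv : flow_quasi_invariant U mu kappa.
Hypothesis itot : intble m tot.
Let mtot : mfunT tot. Proof. exact: m_zz_tot. Qed.
Let mrate k : mfunT (rate k). Proof. exact: (m_flip_rate gamma CU). Qed.
Let mflip k : mfunT (@zz_flip R d k). Proof. exact: m_zz_flip. Qed.

Lemma intble_flip_rate k : intble m (rate k).
Proof.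
apply: (intble_EFin_le _ itot) => // z.
rewrite ger0_norm ?flip_rate_ge0// ger0_norm ?zz_tot_ge0// (totE _ _ z) (bigD1 k)//= -addrA lerDl.
by apply: addr_ge0; [apply: sumr_ge0 => i _; exact: flip_rate_ge0|exact: ltW].
Qed.

Lemma zz_tot_revE z : tot (rev z) = \sum_k rate k (zz_flip k z) + gamma.
Proof. by rewrite totE; congr (_ + _); apply: eq_bigr => k _; rewrite flip_rate_flip. Qed.

Lemma intble_zz_tot_rev : intble m (fun z => tot (rev z)).
Proof.
have : intble m (fun z => \sum_k rate k (zz_flip k z) + gamma).
 apply: intble_add => //.
  by apply: intble_bigsum => // k _; apply: (intble_flip flip_inv k); exact: intble_flip_rate.
 by apply: (intble_by _ `|gamma|) => //; exact: m_cst.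
by apply: eq_integrable => // z _; rewrite /= zz_tot_revE.
Qed.

Section form.
Variables (h : state -> R) (M : R).
Hypotheses (mh : mfunT h) (hM : forall z, `|h z| <= M).
Let ibd (w g : state -> R) (C : R) : intble m w -> mfunT g ->
 (forall z, `|g z| <= C) -> intble m (fun z => w z * g z).
Proof.
move=> iw mg gC; have mw : mfunT w by move/measurable_int : iw => /mEFinP.
apply: (intble_EFin_le _ (intble_cmul msT C iw)); first exact: mfunM.
move=> z; rewrite !normrM mulrC ler_wpM2r//; apply: le_trans (gC z) _; exact: ler_norm.
Qed.
Let sqM (x : R) : `|x| <= M -> `|x ^+ 2| <= M ^+ 2.
Proof. by move=> xM; rewrite normrX lerXn2r// nnegrE; exact: le_trans xM. Qed.
Let mPi : mfunT (fun z : state => Pi h z.1).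
Proof. exact: (mcomp (m_refresh kappa mh) m_fst). Qed.
Let i2 (g : state -> R) C : mfunT g -> (forall z, `|g z| <= C) -> intble m g.
Proof. by move=> mg gC; exact: (intble_by _ C). Qed.
Let ih : intble m h. Proof. exact: (i2 mh hM). Qed.
Let PiM (z : state) : `|Pi h z.1| <= M. Proof. exact: (refresh_le kappa mh hM _). Qed.
Let ihPi : intble m (fun z => h z * Pi h z.1).
Proof. exact: (ibd ih mPi PiM). Qed.
Let iPi2 : intble m (fun z => Pi h z.1 ^+ 2).
Proof. by apply: (i2 (C := M ^+ 2)) => [|z]; [exact: mfunX|exact: sqM]. Qed.
Let ih2 : intble m (fun z => h z ^+ 2).
Proof. by apply: (i2 (C := M ^+ 2)) => [|z]; [exact: mfunX|exact: sqM]. Qed.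

Lemma refresh_proj : \int[m]_z (h z * Pi h z.1) = \int[m]_z (Pi h z.1 ^+ 2).
Proof.
under eq_Rintegral do rewrite mulrC.
rewrite (Rintegral_fst_mul (h := Pi h) (g := h)) => [|x|]; last 2 first.
- exact: (intble_section kappa mh hM).
- by apply: eq_integrable ihPi => // z _; rewrite /= mulrC.
rewrite (Rintegral_fst kappa (h := fun x => Pi h x ^+ 2)).
 by apply: eq_Rintegral => x _; rewrite expr2.
apply: (intble_by _ (M ^+ 2)).
 by apply: mfunX; exact: m_refresh.
by move=> x; apply: sqM; exact: (refresh_le kappa mh hM _).
Qed.

Lemma refresh_pythagoras :
 \int[m]_z (h z ^+ 2) = \int[m]_z (Pi h z.1 ^+ 2) + \int[m]_z ((h z - Pi h z.1) ^+ 2).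
Proof.
transitivity (\int[m]_z (Pi h z.1 ^+ 2) + (\int[m]_z (h z ^+ 2) -
  2 * \int[m]_z (h z * Pi h z.1) + \int[m]_z (Pi h z.1 ^+ 2))); first by rewrite refresh_proj; ring.
congr (_ + _); rewrite -RintegralZl//.
have i3 : intble m (fun z => 2 * (h z * Pi h z.1)) by exact: intble_cmul.
rewrite -RintegralB// -RintegralD//; last exact: intble_sub.
by apply: eq_Rintegral => z _; ring.
Qed.

(** Write r, r' for the k-th rate before and after the flip and h' for the flipped function. Then 2
    r h h' - (r + r') h^2 = (r h'^2 - r' h^2) - r (h - h')^2: the bracket has integral 0 by flip
    invariance, the last term is dropped, and what is left is the dissipation of the
    refreshments. *)
Lemma zz_form_le :
 \int[m]_z (2 * h z * zz_jumps U gamma kappa h z - (tot z + tot (rev z)) * h z ^+ 2) <=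
 - (2 * gamma) * \int[m]_z ((h z - Pi h z.1) ^+ 2).
Proof.
pose A k z := rate k z * (h z - h (zz_flip k z)) ^+ 2.
pose B k z := rate k z * h (zz_flip k z) ^+ 2.
have mhf k : mfunT (fun z => h (zz_flip k z)) by exact: mcomp mh _.
have hf2 k z : `|h (zz_flip k z) ^+ 2| <= M ^+ 2 by exact: sqM.
have iA k : intble m (A k).
 apply: (ibd (C := (2 * M) ^+ 2) (intble_flip_rate k)).
  by apply: mfunX; exact: mfunB.
 move=> z; have MM : 0 <= M by apply: le_trans (hM z).
 rewrite normrX lerXn2r ?nnegrE ?mulr_ge0//.
 by rewrite (le_trans (ler_normB _ _))// mulr_natl mulr2n lerD.
have iB k : intble m (B k).
 by apply: (ibd (intble_flip_rate k) _ (hf2 k)); exact: mfunX.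
have iBf k : intble m (fun z => B k (zz_flip k z)).
 exact: (intble_flip flip_inv).
pose C z := 2 * gamma * (h z * Pi h z.1 - h z ^+ 2).
have iC : intble m C.
 by apply: intble_cmul => //; exact: intble_sub.
have E z : 2 * h z * zz_jumps U gamma kappa h z - (tot z + tot (rev z)) * h z ^+ 2 =
  \sum_k (B k z - B k (zz_flip k z) - A k z) + C z.
 rewrite (zz_tot_revE z) totE /zz_jumps /C.
 suff -> : \sum_k (B k z - B k (zz_flip k z) - A k z) =
  2 * h z * (\sum_k rate k z * h (zz_flip k z)) -
   (\sum_k rate k z + \sum_k rate k (zz_flip k z)) * h z ^+ 2 by ring.
 rewrite -big_split/= mulr_sumr mulr_suml -sumrB; apply: eq_bigr => k _.
 by rewrite /A /B zz_flipK; ring.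
under eq_Rintegral do rewrite E.
have iBA k : intble m (fun z => B k z - B k (zz_flip k z) - A k z).
 by apply: intble_sub => //; exact: intble_sub.
rewrite RintegralD//; last exact: intble_bigsum.
rewrite Rintegral_bigsum//.
have -> : \int[m]_z C z = - (2 * gamma) * \int[m]_z ((h z - Pi h z.1) ^+ 2).
 rewrite RintegralZl//; last exact: intble_sub.
 rewrite RintegralB// refresh_proj refresh_pythagoras; ring.
rewrite gerDr; apply: sumr_le0 => k _.
rewrite RintegralB//; last exact: intble_sub.
rewrite RintegralB// (Rintegral_flip mu flip_inv k); last first.
 by move/measurable_int : (iB k) => /mEFinP.
rewrite subrr sub0r oppr_le0; apply: Rintegral_ge0 => z _.
by rewrite mulr_ge0 ?flip_rate_ge0 ?sqr_ge0.
Qed.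
End form.

(** The bound is required at all real times, including the negative ones on which the formula is
    silent, so that functions of time built from [u] are bounded on the whole line and integrable on
    every interval. *)
Definition zz_mild (f : state -> R) (u : R -> state -> R) (M : R) : Prop :=
 [/\ mild_solution U gamma f (fun q => zz_jumps U gamma kappa (u q)) u,
   mfunT (fun p : R * state => u p.1 p.2) &
   forall t z, `|u t z| <= M].

Section solution.
Variables (f : state -> R) (u : R -> state -> R) (M : R).
Hypothesis zu : zz_mild f u M.
Let mild := let: And3 h _ _ := zu in h.
Let mu_ := let: And3 _ h _ := zu in h.
Let uM t z : `|u t z| <= M. Proof. by case: zu. Qed.
Let uM' t z (_ : 0 <= t) : `|u t z| <= M. Proof. exact: uM. Qed.
Let M0 : 0 <= M. Proof. exact: le_trans (uM 0 (0, 0)). Qed.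
Let mut t : mfunT (u t). Proof. exact: m_mild mu_ t. Qed.
Let b q := zz_jumps U gamma kappa (u q).
Let mb : mfunT (fun p : R * state => b p.1 p.2).
Proof. exact: (m_zz_jumps gamma kappa CU mu_). Qed.
Let bM t z (_ : 0 <= t) : `|b t z| <= M * tot z.
Proof. exact: (zz_jumps_le U kappa gamma0 (mut t) (uM t)). Qed.
Let mRint (K : R -> state -> R) : mfunT (fun p : R * state => K p.1 p.2) ->
 mfunT (fun q => \int[m]_z K q z).
Proof. by move=> mK; exact: (m_Rintegral mp mK). Qed.

Definition refresh_defect (h : state -> R) : R := \int[m]_z ((h z - Pi h z.1) ^+ 2).

Lemma m_refresh_defect : mfunT (fun q => refresh_defect (u q)).
Proof.
apply: (@mRint (fun q z => (u q z - Pi (u q) z.1) ^+ 2)).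
apply: mfunX; apply: mfunB => //.
apply: (@m_Rintegral _ _ _ _ R kappa (fun (p : R * state) w => u p.1 (p.2.1, w))).
apply: (m_uncurry mu_); first exact: (mcomp m_fst m_fst).
apply: m_pair; last exact: m_snd.
by apply: (mcomp m_fst); exact: (mcomp m_snd m_fst).
Qed.
Let Q q := \int[m]_z (2 * u q z * b q z - (tot z + tot (rev z)) * u q z ^+ 2).
Let mQ : mfunT Q.
Proof.
apply: (@mRint (fun q z => 2 * u q z * b q z - (tot z + tot (rev z)) * u q z ^+ 2)).
apply: mfunB; first by apply: mfunM => //; exact: mfunM.
apply: mfunM; last exact: mfunX.
apply: mfunD; first exact: (mcomp mtot m_snd).
by apply: (mcomp mtot); apply: (mcomp m_rev m_snd).
Qed.
Let sq_le (x : R) : `|x| <= M -> x ^+ 2 <= M ^+ 2.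
Proof. by move=> xM; rewrite -[x ^+ 2]ger0_norm ?sqr_ge0// normrX lerXn2r// nnegrE. Qed.
Let bound k q z : k = (fun z => (3 * M ^+ 2) * tot z + M ^+ 2 * tot (rev z)) ->
 `|2 * u q z * b q z - (tot z + tot (rev z)) * u q z ^+ 2| <= k z.
Proof.
move=> ->; have h1 : `|2 * u q z * b q z| <= 2 * (M * (M * tot z)).
 rewrite -mulrA !normrM ger0_norm// ler_wpM2l// ler_pM//.
 exact: (zz_jumps_le U kappa gamma0 (mut q) (uM q)).
have h2 : `|(tot z + tot (rev z)) * u q z ^+ 2| <= (tot z + tot (rev z)) * M ^+ 2.
 rewrite normrM ger0_norm ?addr_ge0 ?zz_tot_ge0// ler_wpM2l ?addr_ge0 ?zz_tot_ge0//.
 by rewrite ger0_norm ?sqr_ge0// sq_le.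
by apply: (le_trans (ler_normB _ _)); move: h1 h2; lra.
Qed.
Let mQ' q : mfunT (fun z => 2 * u q z * b q z - (tot z + tot (rev z)) * u q z ^+ 2).
Proof.
apply: mfunB.
 by apply: mfunM; [exact: mfunM|exact: m_mild mb q].
apply: mfunM; last exact: mfunX.
by apply: mfunD => //; apply: (mcomp mtot); exact: m_rev.
Qed.
Let iQ a c : intble_on leb `[a, c] Q.
Proof.
pose k z := (3 * M ^+ 2) * tot z + M ^+ 2 * tot (rev z).
have ik : intble m k.
 by apply: intble_add => //; apply: intble_cmul => //; exact: intble_zz_tot_rev.
apply: (@intble_itv_bounded _ _ (\int[m]_z k z)) => // q.
have b2 z : `|2 * u q z * b q z - (tot z + tot (rev z)) * u q z ^+ 2| <= `|k z|.
 by apply: le_trans (ler_norm _); exact: bound.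
have iq := intble_EFin_le (mQ' q) ik b2.
rewrite /Q (le_trans (le_normr_Rintegral _ iq))//; apply: le_Rintegral => //.
 exact: integrable_norm.
by move=> z _; exact: bound.
Qed.
Let defect_le q : `|refresh_defect (u q)| <= (2 * M) ^+ 2.
Proof.
have h z : `|u q z - Pi (u q) z.1| <= 2 * M.
 by rewrite (le_trans (ler_normB _ _))// mulr_natl mulr2n lerD//; exact: (refresh_le kappa (mut q) (uM q) _).
have h2 z : (u q z - Pi (u q) z.1) ^+ 2 <= (2 * M) ^+ 2.
 by rewrite -[_ ^+ 2]ger0_norm ?sqr_ge0// normrX lerXn2r// nnegrE mulr_ge0.
rewrite /refresh_defect ger0_norm; last by apply: Rintegral_ge0 => z _; exact: sqr_ge0.
rewrite -[leRHS](Rintegral_cst_prob mp); apply: le_Rintegral => //.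
 apply: (intble_by mp ((2 * M) ^+ 2)).
  apply: mfunX; apply: mfunB => //.
  exact: (mcomp (m_refresh kappa (mut q)) m_fst).
 by move=> z; rewrite ger0_norm ?sqr_ge0.
by apply: (intble_by mp `|(2 * M) ^+ 2|).
Qed.

Lemma zz_energy s t : 0 <= s -> s <= t ->
 \int[m]_z (u t z ^+ 2) - \int[m]_z (u s z ^+ 2) <=
 - (2 * gamma) * \int[leb]_(q in `[s, t]) refresh_defect (u q).
Proof.
move=> s0 st; have t0 := le_trans s0 st.
have E r : 0 <= r -> \int[m]_z (u r z ^+ 2) - \int[m]_z (f z ^+ 2) = \int[leb]_(q in `[0, r]) Q q.
 move=> r0; apply: (mild_energy CU quasi_inv gamma0 mild mu_ mb M0 uM' bM itot _ r0).
 exact: intble_zz_tot_rev.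
have -> : \int[m]_z (u t z ^+ 2) - \int[m]_z (u s z ^+ 2) = \int[leb]_(q in `[s, t]) Q q.
 apply: (subr_chasles (E _ t0) (E _ s0)); exact: Rintegral_itv_chasles.
have idf : intble_on leb `[s, t] (fun q => refresh_defect (u q)).
 by apply: (intble_itv_bounded _ _ _ defect_le); exact: m_refresh_defect.
rewrite -RintegralZl//; apply: le_Rintegral => //.
- exact: intble_cmul.
- by move=> q _; exact: (zz_form_le (mut q) (uM q)).
Qed.

Section weak.
Variables (g Dg : state -> R).
Hypotheses (dg : forall z (r : R), is_derive r 1 (fun r => g (zz_flow z r)) (Dg (zz_flow z r)))
 (cDg : forall z, continuous (fun r => Dg (zz_flow z r))) (mg : mfunT g) (mDg : mfunT Dg) (ig : intble m g)
 (iDg : intble m Dg) (itg : intble m (fun z => tot z * g z)) (itrg : intble m (fun z => tot (rev z) * g z))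
 (igx : forall x, intble kappa (fun w => g (x, w))).

(** In L^2(mu x kappa) the adjoint of v . grad is - v . grad + v . grad U. Together with - tot, the
    zeroth-order term becomes minus the total rate at the reversed velocity. *)
Definition zz_adjoint z : R :=
 zz_jumps_adj U gamma kappa g z - (Dg z + tot (rev z) * g z).

Lemma zz_weak s t : 0 <= s -> s <= t ->
 \int[m]_z (u t z * g z) - \int[m]_z (u s z * g z) =
 \int[leb]_(q in `[s, t]) \int[m]_z (u q z * zz_adjoint z).
Proof.
move=> s0 st; have t0 := le_trans s0 st.
have mtr : mfunT (fun z => tot (rev z)).
 by apply: (mcomp mtot); exact: m_rev.
have irg k : intble m (fun z => rate k z * g z).
 apply: (intble_EFin_le _ itg); first exact: mfunM.
 move=> z; rewrite !normrM ler_wpM2r// ger0_norm ?flip_rate_ge0// ger0_norm ?zz_tot_ge0//.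
 rewrite (totE _ _ z) (bigD1 k)//= -addrA lerDl.
 by apply: addr_ge0; [apply: sumr_ge0 => i _; exact: flip_rate_ge0|exact: ltW].
have iadj : intble m (zz_jumps_adj U gamma kappa g).
 apply: intble_add => //.
  apply: intble_bigsum => // k _.
  apply: eq_integrable (intble_flip flip_inv k (irg k)) => // z _.
  by rewrite /= flip_rate_flip.
 apply: intble_cmul => //; apply: intble_fst.
 exact: intble_Rintegral1 ig.
have iDt : intble m (fun z => Dg z + tot (rev z) * g z).
 exact: intble_add.
have mrm (h : state -> R) : intble m h -> mfunT h.
 by move/measurable_int => /mEFinP.
have iuh q (h : state -> R) : intble m h ->
  intble m (fun z => u q z * h z).
 move=> ih; apply: (intble_EFin_le _ (intble_cmul msT M ih)).
  by apply: mfunM => //; exact: mrm.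
 by move=> z; rewrite !normrM ler_wpM2r// (ger0_norm M0).
have iA : intble m zz_adjoint by exact: intble_sub.
have IE q : \int[m]_z (b q z * g z - u q z * (Dg z + tot (rev z) * g z)) =
  \int[m]_z (u q z * zz_adjoint z).
 rewrite RintegralB//; last 2 first.
 - apply: (intble_EFin_le _ (intble_cmul msT M itg)).
   by apply: mfunM => //; exact: m_mild mb q.
  move=> z; rewrite mulrA !normrM ler_wpM2r//.
  by rewrite -normrM (le_trans (zz_jumps_le U kappa gamma0 (mut q) (uM q) z))// ler_norm.
 - exact: iuh.
 rewrite (zz_jumps_adjoint gamma flip_inv (mut q) (uM q) mg ig igx irg) -RintegralB//; last 2 first.
 - exact: iuh.
 - exact: iuh.
 by apply: eq_Rintegral => z _; rewrite -mulrBr.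
have E r : 0 <= r -> \int[m]_z (u r z * g z) - \int[m]_z (f z * g z) =
  \int[leb]_(q in `[0, r]) \int[m]_z (u q z * zz_adjoint z).
 move=> r0; rewrite (mild_weak CU quasi_inv gamma0 mild mu_ mb M0 uM' bM dg cDg mg mDg ig iDg itg itrg r0).
 by apply: eq_Rintegral => q _; exact: IE.
have iI : intble_on leb `[0, t] (fun q => \int[m]_z (u q z * zz_adjoint z)).
 apply: (@intble_itv_bounded _ _ (\int[m]_z (M * `|zz_adjoint z|))).
  apply: (@mRint (fun q z => u q z * zz_adjoint z)); apply: mfunM => //.
  exact: (mcomp (mrm _ iA) m_snd).
 move=> q; rewrite (le_trans (le_normr_Rintegral _ (iuh q _ iA)))//; apply: le_Rintegral => //.
 - exact: integrable_norm (iuh q _ iA).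
 - by apply: intble_cmul => //; exact: integrable_norm.
 - by move=> z _; rewrite /= normrM ler_wpM2r.
apply: (subr_chasles (E _ t0) (E _ s0)); exact: Rintegral_itv_chasles.
Qed.
End weak.

Lemma zz_mild_shift s : 0 <= s -> zz_mild (u s) (fun q => u (s + q)) M.
Proof.
move=> s0; split => //; first exact: (mild_shift CU gamma0 mild mb bM s0).
by apply: (m_uncurry mu_); [exact: mfunD|exact: m_snd].
Qed.

Lemma zz_mild_sub f' u' M' : zz_mild f' u' M' ->
 zz_mild (fun z => f z - f' z) (fun t z => u t z - u' t z) (M + M').
Proof.
move=> zu'; have [mild' mu' uM'_] := zu'.
have mut' t : mfunT (u' t) := m_mild mu' t.
split; last by move=> t z; rewrite (le_trans (ler_normB _ _))// lerD.
 have mb' := m_zz_jumps gamma kappa CU mu'.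
 have bM' t z (_ : 0 <= t) := zz_jumps_le U kappa gamma0 (mut' t) (uM'_ t) z.
 have := mild_sub CU gamma0 mild mb bM mild' mb' bM'.
 congr mild_solution; apply/funext => t; apply/funext => z.
 rewrite /b /zz_jumps /refresh RintegralB//; last 2 first.
 - exact: (intble_section kappa (mut t) (uM t)).
 - exact: (intble_section kappa (mut' t) (uM'_ t)).
 rewrite mulrBr opprD addrACA -sumrB; congr (_ + _).
 by apply: eq_bigr => k _; rewrite mulrBr.
exact: mfunB.
Qed.

End solution.
End zz_dynamics.

(** * The law of the process *)

Section hazard.
Context {R} {d : nat}.
Variables (U : 'rV[R]_d -> R) (gamma : R).
Local Notation state := (phase R d).
Local Notation leb := (@lebesgue_measure R).
Local Notation rate := (zz_rate U gamma).
Local Notation time := (zz_time U gamma).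
Local Notation first := (zz_first U gamma).
Hypotheses (CU : Cn 1 U) (gamma0 : 0 < gamma).
Implicit Types (y z : state) (o : option 'I_d) (r s t a b : R).

Definition zz_hazard y o r : R := \int[leb]_(s in `[0, r]) rate (zz_flow y s) o.
Local Notation hz := zz_hazard.

Lemma m_zz_hazard o : mfunT (fun p : state * R => hz p.1 o p.2).
Proof.
apply: (@m_cumulative _ _ (fun z => rate z o)); first exact: m_zz_rate.
by move=> z; exact: zz_rate_ge0.
Qed.
Let crate y o : continuous (fun s => rate (zz_flow y s) o).
Proof. exact: continuous_zz_rate. Qed.
Let irate y o a b : intble_on leb `[a, b] (fun s => rate (zz_flow y s) o).
Proof. by apply: continuous_itv_integrable => x _; exact: crate. Qed.

Lemma zz_hazard0 y o : hz y o 0 = 0.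
Proof. by rewrite /hz set_itv1 Rintegral_set1. Qed.

Lemma zz_hazardB y o a b : 0 <= a -> a <= b ->
 hz y o b - hz y o a = \int[leb]_(s in `[a, b]) rate (zz_flow y s) o.
Proof.
by move=> a0 ab; rewrite /hz (@Rintegral_itv_chasles _ _ 0 a b)// addrAC subrr add0r.
Qed.

Lemma le_zz_hazard y o a b : 0 <= a -> a <= b -> hz y o a <= hz y o b.
Proof.
move=> a0 ab; rewrite -subr_ge0 zz_hazardB//; apply: Rintegral_ge0 => s _.
exact: zz_rate_ge0.
Qed.

(** The total rate is continuous along the line, hence bounded on [0, T] by its maximum, and it
    dominates every single rate; so one constant serves all events. *)
Lemma zz_hazard_lipschitz y (T : R) : 0 <= T ->
 exists2 C, 0 <= C & forall o a b, 0 <= a -> a <= b -> b <= T -> hz y o b - hz y o a <= C * (b - a).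
Proof.
move=> T0; have ct : {within `[0, T], continuous (fun s => zz_tot U gamma (zz_flow y s))}.
 by apply: continuous_subspaceT => s; exact: continuous_zz_tot.
have [c _ cmax] := @EVT_max R _ 0 T T0 ct.
exists (zz_tot U gamma (zz_flow y c)); first exact: zz_tot_ge0.
move=> o a b a0 ab bT; rewrite zz_hazardB//.
have -> : zz_tot U gamma (zz_flow y c) * (b - a) =
  \int[leb]_(s in `[a, b]) zz_tot U gamma (zz_flow y c).
 rewrite Rintegral_cst//= ?lebesgue_measure_itv/= ?lte_fin.
 by rewrite lt_neqAle ab andbT; case: eqVneq => [->|_]; rewrite ?subrr//= ?mulr0.
apply: le_Rintegral => //; first by apply: continuous_itv_integrable => x _; exact: cst_continuous.
move=> s; rewrite /= in_itv/= => /andP[sa sb].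
apply: (@le_trans _ _ (zz_tot U gamma (zz_flow y s))).
 rewrite /zz_tot (bigD1 o)//= lerDl; apply: sumr_ge0 => i _; exact: zz_rate_ge0.
by apply: cmax; rewrite in_itv/= (le_trans a0 sa) (le_trans sb bT).
Qed.

(** The hazard starts at time 0; its continuation by an integral from -1 has a two-sided derivative
    there too. *)
Lemma is_derive_zz_hazard y o : exists H : R -> R,
 (forall r, 0 <= r -> H r = hz y o r) /\
 forall r, 0 <= r -> is_derive r (1 : R) H (rate (zz_flow y r) o).
Proof.
exists (fun r => \int[leb]_(s in `[-1, r]) rate (zz_flow y s) o -
 \int[leb]_(s in `[-1, 0]) rate (zz_flow y s) o); split => r r0.
 by rewrite (@Rintegral_itv_chasles _ _ (-1) 0 r)// addrAC subrr add0r.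
have h := @is_derive_prim _ _ (-1) r (@crate y o) (lt_le_trans (ltrN10 R) r0).
have := is_deriveB h (is_derive_cst _ r 1 : is_derive r 1 (fun=> \int[leb]_(s in `[-1, 0]) rate (zz_flow y s) o) 0).
by rewrite subr0.
Qed.

Lemma zz_timeE y o (e : R) : time y o e = ereal_inf [set t%:E | t in [set t | 0 <= t /\ e <= hz y o t]].
Proof.
rewrite /time; congr (ereal_inf (image _ _)); apply/seteqP; split => t [t0] H; split=> //.
 rewrite -lee_fin (le_trans H)// /hz /Rintegral fineK//.
 by apply: integral_fune_fin_num => //; exact: irate.
rewrite (@le_trans _ _ (hz y o t)%:E)// ?lee_fin// /hz /Rintegral fineK//.
by apply: integral_fune_fin_num => //; exact: irate.
Qed.

Lemma zz_time_ge0 y o (e : R) : (0 <= time y o e)%E.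
Proof. by rewrite zz_timeE; apply: le_ereal_inf_tmp => _ [t [t0 _] <-]; rewrite lee_fin. Qed.

(** The infimum defining the event time is attained, by continuity of the hazard: if the hazard at r
    is below [e], it stays below for some time after r, so the event time exceeds r strictly. *)
Lemma zz_time_le y o (e : R) r : 0 <= r -> (time y o e <= r%:E)%E = (e <= hz y o r).
Proof.
move=> r0; rewrite zz_timeE; apply/idP/idP; last first.
 by move=> er; apply: ereal_inf_lbound; exists r.
apply: contraTT; rewrite -!ltNge => er.
have [C C0 HC] := zz_hazard_lipschitz y (addr_ge0 r0 ler01).
(* h <= 1 keeps r + h in the interval where [C] is a Lipschitz constant; C + 1 instead of C gives a
   positive denominator and a strict inequality. *)
pose h := Num.min 1 ((e - hz y o r) / (C + 1)).
have C1 : 0 < C + 1 by rewrite ltr_wpDl.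
have h0 : 0 < h by rewrite lt_min ltr01 divr_gt0// subr_gt0.
have eh : hz y o (r + h) < e.
 have := HC o r (r + h) r0; rewrite lerDl (ltW h0) lerD2l ge_min lexx => /(_ isT isT).
 rewrite [r + h - r]addrAC subrr add0r lerBlDr => /le_lt_trans; apply.
 rewrite -ltrBrDr (@lt_le_trans _ _ ((C + 1) * h))// ?ltr_pM2r ?ltrDl//.
 by rewrite -ler_pdivlMl// mulrC ge_min lexx orbT.
apply: (@lt_le_trans _ _ (r + h)%:E); first by rewrite lte_fin ltrDl.
apply: le_ereal_inf_tmp => _ [t [t0 et] <-]; rewrite lee_fin leNgt; apply/negP => tr.
by move: et; rewrite leNgt => /negP; apply; rewrite (le_lt_trans _ eh)// le_zz_hazard// ltW.
Qed.

Lemma m_zz_time dA (A : measurableType dA) (y : A -> state) (e : A -> R) o :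
 mfunT y -> mfunT e ->
 mfunT (fun x => time (y x) o (e x)).
Proof.
move=> my me; apply: (measurability _ (ErealGenOInfty.measurableE R)) => // _ [_ [r ->] <-].
rewrite setTI (_ : _ @^-1` _ = ~` [set x | (0 <= r) && (e x <= hz (y x) o r)]); last first.
 apply/seteqP; split => x /=; rewrite in_itv/= andbT; have [r0|r0] := leP 0 r.
 - by rewrite -(zz_time_le _ _ _ r0) ltNge => /negP.
 - by move=> _; rewrite andFb.
 - by rewrite andTb -(zz_time_le _ _ _ r0) ltNge => /negP.
 - by move=> _; apply: lt_le_trans (zz_time_ge0 _ _ _); rewrite lte_fin.
apply: measurableC; have [r0|r0] := leP 0 r; last first.
 by rewrite (_ : [set x | _] = set0); [exact: measurable0|apply/seteqP; split].
have mf : mfunT (fun x => e x <= hz (y x) o r).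
 apply: measurable_fun_ler => //; apply: (mcomp (m_zz_hazard o) (m_pair my _)).
 exact: m_cst.
by have := mf msT [set true]; rewrite setTI; apply.
Qed.

Lemma zz_first_le y (e : option 'I_d -> R) o :
 (time y (first y e) (e (first y e)) <= time y o (e o))%E.
Proof. by rewrite /first; case: arg_minP => // i _; apply. Qed.

Lemma zz_firstP y (e : option 'I_d -> R) o :
 (forall o', o' != o -> (time y o (e o) < time y o' (e o'))%E) -> first y e = o.
Proof.
move=> H; apply/eqP/negPn/negP => /H; rewrite ltNge => /negP; apply; exact: zz_first_le.
Qed.

(** The arg min is a function of the finite table of comparisons between the event times, and every
    entry of the table is measurable. *)
Lemma m_zz_first dA (A : measurableType dA) (y : A -> state) (e : A -> option 'I_d -> R) o :
 mfunT y -> (forall o, mfunT (fun x => e x o)) ->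
 measurable [set x | first (y x) (e x) = o].
Proof.
move=> my me.
pose tab x : {ffun option 'I_d * option 'I_d -> bool} :=
 [ffun p => (time (y x) p.1 (e x p.1) <= time (y x) p.2 (e x p.2))%E].
pose fst_of (c : {ffun option 'I_d * option 'I_d -> bool}) :=
 odflt None [pick i | true && [forall j, true ==> c (i, j)]].
have E x : first (y x) (e x) = fst_of (tab x).
 rewrite /first /Order.arg_min /extremum /fst_of; congr odflt; apply: eq_pick => i /=.
 by apply: eq_forallb => j; rewrite ffunE.
rewrite (_ : [set _ | _] = \bigcup_(c in [set` [pred c | fst_of c == o]])
  \bigcap_(p in [set` predT]) [set x | tab x p = c p]); last first.
 apply/seteqP; split => x /=; rewrite E.
  by move=> <-; exists (tab x) => //=; rewrite inE.
 move=> [c /= /eqP <-] H; congr fst_of; apply/ffunP => p; exact: H.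
apply: fin_bigcup_measurable => [|c _]; first exact: finite_finset.
apply: fin_bigcap_measurable => [|p _]; first exact: finite_finset.
under eq_set do rewrite ffunE.
have mt o' : mfunT (fun x => time (y x) o' (e x o')) by exact: m_zz_time.
have := measurable_fun_lee (mt p.1) (mt p.2).
by move=> /(_ msT [set c p]); rewrite setTI; apply.
Qed.

Lemma m_zz_jump dA (A : measurableType dA) (y : A -> state) o (w : A -> 'rV[R]_d) :
 mfunT y -> mfunT w ->
 mfunT (fun x => zz_jump (y x) o (w x)).
Proof.
move=> my mw; apply/measurable_fun_pairP; case: o => [k|]; split => /=;
 try exact: (mcomp m_fst my); last exact: mw.
exact: (mcomp (@m_flip _ _ k) (mcomp m_snd my)).
Qed.

Lemma m_option_case dA (A : measurableType dA) dB (B : measurableType dB)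
  (c : A -> option 'I_d) (F : option 'I_d -> A -> B) :
 (forall o, measurable [set x | c x = o]) -> (forall o, mfunT (F o)) ->
 mfunT (fun x => F (c x) x).
Proof.
move=> mc mF _ Y mY; rewrite setTI.
rewrite (_ : _ @^-1` _ = \bigcup_(o in [set` predT]) ([set x | c x = o] `&` (F o @^-1` Y))).
 apply: fin_bigcup_measurable => [|o _]; first exact: finite_finset.
 by apply: measurableI => //; rewrite -[X in measurable X]setTI; exact: mF.
apply/seteqP; split => x /=; first by move=> H; exists (c x).
by case=> o _ [] <-.
Qed.

Definition zz_wait y (e : option 'I_d -> R) : R := fine (time y (first y e) (e (first y e))).

Definition zz_step (p : R * state) (e : option 'I_d -> R) (w : 'rV[R]_d) : R * state :=
 (p.1 + zz_wait p.2 e, zz_jump (zz_flow p.2 (zz_wait p.2 e)) (first p.2 e) w).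

Lemma zz_skeletonS e w z n : zz_skeleton U gamma e w z n.+1 =
 zz_step (zz_skeleton U gamma e w z n) (e n) (w n).
Proof. by rewrite /=; case: (zz_skeleton U gamma e w z n). Qed.

Lemma m_zz_wait dA (A : measurableType dA) (y : A -> state) (e : A -> option 'I_d -> R) :
 mfunT y -> (forall o, mfunT (fun x => e x o)) ->
 mfunT (fun x => zz_wait (y x) (e x)).
Proof.
move=> my me; apply: mcomp => //.
apply: (m_option_case (F := fun o x => time (y x) o (e x o))).
 by move=> o; exact: m_zz_first.
by move=> o; exact: m_zz_time.
Qed.

Lemma m_zz_step dA (A : measurableType dA) (p : A -> R * state) (e : A -> option 'I_d -> R)
  (w : A -> 'rV[R]_d) :
 mfunT p -> (forall o, mfunT (fun x => e x o)) ->
 mfunT w -> mfunT (fun x => zz_step (p x) (e x) (w x)).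
Proof.
move=> mp me mw.
have my : mfunT (fun x => (p x).2) by exact: mcomp m_snd mp.
have mt := m_zz_wait my me.
apply: m_pair.
 by apply: mfunD => //; exact: mcomp m_fst mp.
apply: (m_option_case (F := fun o x => zz_jump (zz_flow (p x).2 (zz_wait (p x).2 (e x))) o (w x))).
 by move=> o; exact: m_zz_first.
by move=> o; apply: m_zz_jump => //; exact: m_flow_comp.
Qed.

Lemma m_zz_skeleton dA (A : measurableType dA) (e : A -> nat -> option 'I_d -> R)
  (w : A -> nat -> 'rV[R]_d) (z : A -> state) n :
 (forall k o, (k < n)%N -> mfunT (fun x => e x k o)) ->
 (forall k, (k < n)%N -> mfunT (fun x => w x k)) ->
 mfunT z ->
 mfunT (fun x => zz_skeleton U gamma (e x) (w x) (z x) n).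
Proof.
elim: n => [|n IH] me mw mz; first exact: m_pair.
under eq_fun do rewrite zz_skeletonS.
apply: m_zz_step; [apply: IH => //| |exact: mw] => k *.
- by apply: me; exact: ltnW.
- by apply: mw; exact: ltnW.
- exact: me.
Qed.

Lemma zz_wait_ge0 y e : 0 <= zz_wait y e.
Proof. by apply: fine_ge0; exact: zz_time_ge0. Qed.

(** The maximum with 0 is there because a clock is an arbitrary real: it is positive only almost
    surely, and a nonpositive clock rings at time 0. *)
Lemma zz_time_None y (e : R) : (time y None e <= (Num.max 0 (e / gamma))%:E)%E.
Proof.
rewrite zz_time_le ?le_max ?lexx// /hz /= Rintegral_cst//= lebesgue_measure_itv/= lte_fin.
case: ltP => [h|h]; last first.
 rewrite mulr0 leNgt; apply/negP => e0; move: h; rewrite leNgt => /negP; apply.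
 by rewrite lt_max divr_gt0 ?orbT.
by rewrite oppr0 addr0 mulrC -ler_pdivrMr// le_max lexx orbT.
Qed.

Lemma zz_waitE y e : (zz_wait y e)%:E = time y (first y e) (e (first y e)).
Proof.
rewrite fineK// ge0_fin_numE ?zz_time_ge0//.
apply: le_lt_trans (zz_first_le _ _ None) _.
by apply: le_lt_trans (zz_time_None _ _) _; exact: ltry.
Qed.

Lemma zz_wait_gtP y e r : 0 <= r -> (r < zz_wait y e) <-> (forall o, hz y o r < e o).
Proof.
move=> r0; rewrite -lte_fin zz_waitE; split.
 by move=> h o; rewrite ltNge -zz_time_le// -ltNge (lt_le_trans h)// zz_first_le.
by move=> h; rewrite ltNge zz_time_le// -ltNge.
Qed.

End hazard.

Section density_measure.
Context d (T : measurableType d) R (la : {measure set T -> \bar R}) (w : T -> R).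
Hypotheses (w0 : forall x, 0 <= w x) (mw : mfunT w).

(** The proofs of positivity and measurability are arguments of the definition, so that the measure
    structure can be attached to the resulting term. *)
Definition density_measure of (forall x, 0 <= w x) & mfunT w :=
 fun A => (\int[la]_(x in A) (w x)%:E)%E.
Local Notation dm := (density_measure w0 mw).
Let dm0 : dm set0 = 0%E. Proof. exact: integral_set0. Qed.
Let dm_ge0 A : (0 <= dm A)%E.
Proof. by apply: integral_ge0 => x _; rewrite lee_fin. Qed.
Let dm_sigma_additive : semi_sigma_additive dm.
Proof.
move=> /= F mF tF mUF; rewrite /density_measure; apply: cvg_toP.
 apply: ereal_nondecreasing_is_cvgn => m n mn.
 apply: lee_sum_nneg_natr => // k _ _; apply: integral_ge0 => /= x Fkx.
 by rewrite lee_fin.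
rewrite ge0_integral_bigcup//=.
- by apply/measurable_funTS/mEFinP.
- by move=> x _; rewrite lee_fin.
Qed.

HB.instance Definition _ := isMeasure.Build _ _ _ dm dm0 dm_ge0 dm_sigma_additive.

End density_measure.

Section laws.
Context {R}.
Implicit Types (a b r s t : R).

Lemma measure_eq_cdf (m1 m2 : {measure set (measurableTypeR R) -> \bar R}) :
 (m1 setT < +oo)%E -> (forall t, m1 `]-oo, t]%classic = m2 `]-oo, t]%classic) ->
 forall A, measurable A -> m1 A = m2 A.
Proof.
move=> m1oo m12 A mA.
pose G := [set A : set (measurableTypeR R) | exists t, A = `]-oo, t]%classic].
apply: (@g_sigma_algebra_measure_unique _ R _ G _ (fun n => `]-oo, n%:R]%classic)).
- by move=> _ [t ->]; exact: measurable_itv.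
- by move=> n; exists n%:R.
- apply/seteqP; split => // x _; exists (Num.trunc (Num.max 0 x)).+1 => //=.
 rewrite in_itv/= (le_trans _ (ltW (truncnS_gt _)))// le_max lexx orbT//.
- move=> _ _ [s ->] [t ->]; exists (Num.min s t); apply/seteqP; split => x /=; rewrite !in_itv/= le_min.
  by move=> [-> ->].
 by move=> /andP[-> ->].
- by move=> _ [t ->].
- move=> n; apply: le_lt_trans m1oo; apply: le_measure; rewrite ?inE//; exact: measurable_itv.
have : (@RGenOInfty.G R).-sigma.-measurable A by rewrite -RGenOInfty.measurableE.
apply: smallest_sub.
 exact: smallest_sigma_algebra.
move=> _ [t ->]; rewrite -setCitvl; apply: sigma_algebraC; apply: sub_sigma_algebra.
by exists t.
Qed.
Let mpdf : mfunT (EFin \o @exponential_pdf R 1).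
Proof. by apply/mEFinP; exact: measurable_exponential_pdf. Qed.
Let pdf0 x : (0 <= (@exponential_pdf R 1 x)%:E)%E.
Proof. by rewrite lee_fin exponential_pdf_ge0. Qed.

Lemma exponential_prob_0c r : 0 <= r -> exponential_prob 1 `[0, r] = (1 - expR (- r))%:E.
Proof.
rewrite le_eqVlt => /predU1P[<-|r0]; last by rewrite exponential_prob_itv0c// mulN1r.
by rewrite oppr0 expR0 subrr set_itv1 /exponential_prob integral_set1.
Qed.
Let disj_itv_oy (a : itv_bound R) r : [disjoint [set` Interval a (BRight r)] & `]r, +oo[%classic].
Proof.
apply/disj_setPS => x /=; rewrite !in_itv/= andbT => -[/andP[_ xr]].
by rewrite ltNge xr.
Qed.

Lemma exponential_prob_oy r : 0 <= r -> exponential_prob 1 `]r, +oo[ = (expR (- r))%:E.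
Proof.
move=> r0; have := @integral_exponential_pdf R 1 ltr01.
rewrite -(setUv `[0, +oo[%classic) ge0_integral_setU//=; last 3 first.
- exact: measurableC.
- by rewrite setUv.
- exact/disj_setPCl.
rewrite [X in (_ + X)%E]integral0_eq ?adde0; last first.
 by move=> x x0; rewrite /exponential_pdf patchE ifF// memNset.
rewrite (@itv_bndbnd_setU _ _ _ (BRight r))// ?bnd_simp// ge0_integral_setU//=; last by apply: measurable_funTS.
move=> H; have := exponential_prob_0c r0; rewrite /exponential_prob => H0.
rewrite H0 in H; move: H; case: (integral _ _ _) => [x| |]//= -[] H.
by congr EFin; lra.
Qed.

Lemma exponential_prob_oc r s : 0 <= r -> r <= s ->
 exponential_prob 1 `]r, s] = (expR (- r) - expR (- s))%:E.
Proof.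
move=> r0 rs; have := exponential_prob_oy r0; have := exponential_prob_oy (le_trans r0 rs).
rewrite /exponential_prob (@itv_bndbnd_setU _ _ (BRight r) (BRight s))// ?bnd_simp//.
move=> Hs; rewrite ge0_integral_setU//= ?Hs; last by apply: measurable_funTS.
case: (integral _ _ _) => [x| |]//= -[] H.
by congr EFin; lra.
Qed.

(** n + 1 increments of order 1 / (n + 1)^2 add up to order 1 / (n + 1). This stands in for
    differentiating the distribution function of the first event, of which only two-sided bounds on
    increments are at hand. *)
Lemma quadratic_increments_constant (F : R -> R) (C T : R) : 0 <= T -> 
 (forall a b, 0 <= a -> a <= b -> b <= T -> `|F b - F a| <= C * (b - a) ^+ 2) -> F T = F 0.
Proof.
move=> T0 H; have C0 n : `|F T - F 0| <= C * T ^+ 2 / n.+1%:R.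
 pose h := T / n.+1%:R; have h0 : 0 <= h by rewrite divr_ge0.
 have hT : n.+1%:R * h = T by rewrite mulrC divfK.
 have K k : (k <= n.+1)%N -> `|F (k%:R * h) - F 0| <= k%:R * (C * h ^+ 2).
  elim: k => [|k IH] kn; first by rewrite !mul0r subrr normr0.
  rewrite -(subrKA (F (k%:R * h))) (le_trans (ler_normD _ _))//.
  rewrite -[in leRHS]natr1 mulrDl mul1r addrC lerD ?IH ?(ltnW kn)//.
  have := H (k%:R * h) (k.+1%:R * h); rewrite -mulrBl -natr1 addrAC subrr add0r mul1r.
  apply; rewrite ?mulr_ge0// ?ler_wpM2r ?lerDl// natr1 -hT.
  by rewrite ler_wpM2r// ler_nat.
 have := K n.+1 (leqnn _); rewrite hT => /le_trans; apply.
 rewrite /h expr_div_n expr2 mulrA; apply/eqP/eqP; rewrite le_eqVlt; apply/orP; left; apply/eqP.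
 by field.
apply/eqP; rewrite -subr_eq0 -normr_le0; apply/ler_addgt0Pr => e e0; rewrite add0r.
pose n := Num.trunc (C * T ^+ 2 / e).
apply: le_trans (C0 n) _; rewrite ler_pdivrMr// [leRHS]mulrC -ler_pdivrMr// ltW//.
exact: truncnS_gt.
Qed.

End laws.

Lemma ler_dist_squeeze (R : realFieldType) (fa fb ga gb l u : R) :
 l <= fb - fa -> fb - fa <= u -> l <= gb - ga -> gb - ga <= u ->
 `|fb - gb - (fa - ga)| <= u - l.
Proof. by move=> *; rewrite ler_norml; apply/andP; split; lra. Qed.

(** * The law of the first event and of its time *)

Section first_event.
Context {R} {d : nat}.
Variables (U : 'rV[R]_d -> R) (gamma : R).
Local Notation state := (phase R d).
Local Notation leb := (@lebesgue_measure R).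
Local Notation rate := (zz_rate U gamma).
Local Notation cum := (zz_cum U gamma).
Local Notation hz := (zz_hazard U gamma).
Local Notation time := (zz_time U gamma).
Local Notation first := (zz_first U gamma).
Local Notation wait := (zz_wait U gamma).
Hypotheses (CU : Cn 1 U) (gamma0 : 0 < gamma).

(** The clocks of one round form a single vector of R^(d+1), with the refreshment clock in the first
    entry; their joint law is then a probability on row vectors. *)
Definition clocks (x : 'rV[R]_d.+1) (o : option 'I_d) : R :=
 x ord0 (if o is Some k then lift ord0 k else ord0).

Lemma m_clocks o : mfunT (fun x => clocks x o).
Proof. by rewrite /clocks; exact: measurable_coord. Qed.

Variable m1 : probability 'rV[R]_d.+1 R.
Hypothesis m1_box : forall A : option 'I_d -> set R, (forall o, measurable (A o)) ->
 m1 [set x | forall o, A o (clocks x o)] = (\prod_(o : option 'I_d) exponential_prob 1 (A o))%E.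

Variable y : state.

Lemma zz_cumE t : cum y t = \sum_o hz y o t.
Proof.
rewrite /zz_cum /zz_tot Rintegral_bigsum// => o _.
by apply: continuous_itv_integrable => x _; exact: continuous_zz_rate.
Qed.

Lemma zz_cumD1 o t : cum y t = hz y o t + \sum_(i | i != o) hz y i t.
Proof. by rewrite zz_cumE (bigD1 o). Qed.
Let mwait : mfunT (fun x => wait y (clocks x)).
Proof. by apply: m_zz_wait => //; exact: m_clocks. Qed.
Let mfirst o : measurable [set x | first y (clocks x) = o].
Proof. by apply: m_zz_first => //; exact: m_clocks. Qed.
Let mwait_gt (r : R) : measurable [set x | r < wait y (clocks x)].
Proof.
have := measurable_fun_ltr (m_cst r) mwait msT (Y := [set true]).
by rewrite setTI; apply.
Qed.

(** No event up to time r means that every clock exceeds its hazard at r. By independence the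
    probabilities exp(- hazard) multiply, and the hazards add up to [zz_cum]. *)
Lemma zz_wait_tail r : 0 <= r -> m1 [set x | r < wait y (clocks x)] = (expR (- cum y r))%:E.
Proof.
move=> r0; rewrite (_ : [set x | _] = [set x | forall o, `]hz y o r, +oo[%classic (clocks x o)]).
 rewrite (m1_box (A := fun o => `]hz y o r, +oo[%classic)) => [|o]; last exact: measurable_itv.
 rewrite (eq_bigr (fun o => (expR (- hz y o r))%:E)) => [|o _].
  by rewrite prodEFin -expR_sum sumrN zz_cumE.
 by rewrite exponential_prob_oy// -(zz_hazard0 U gamma y o) le_zz_hazard.
apply/seteqP; split => x /=.
 by move=> /(zz_wait_gtP CU gamma0 y _ r0) H o; rewrite in_itv/= andbT.
by move=> H; apply/(zz_wait_gtP CU gamma0 y _ r0) => o; have := H o; rewrite in_itv/= andbT.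
Qed.

Section event.
Variable o : option 'I_d.
Let S t := \sum_(i | i != o) hz y i t.
Let H t := hz y o t.
Let Fset t := [set x | first y (clocks x) = o /\ wait y (clocks x) <= t].
Let F t := fine (m1 (Fset t)).
Let hz_ge0 i r : 0 <= r -> 0 <= hz y i r.
Proof. by move=> r0; rewrite -(zz_hazard0 U gamma y i) le_zz_hazard. Qed.
Let mFset t : measurable (Fset t).
Proof.
apply: measurableI; first exact: mfirst.
have := measurable_fun_ler mwait (m_cst t) msT (Y := [set true]).
by rewrite setTI; apply.
Qed.
(** The clock of [o] falls between its hazards at a and b, and the other clocks exceed their hazards
    at c. With c = b the box is contained in the event that [o] occurs first at a time in ]a, b];
    with c = a it contains this event. *)
Let box a b c i := if i == o then `]H a, H b]%classic else `]hz y i c, +oo[%classic.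
Let m1_box_abc a b c : 0 <= a -> a <= b -> 0 <= c ->
 m1 [set x | forall i, box a b c i (clocks x i)] =
 (expR (- S c) * (expR (- H a) - expR (- H b)))%:E.
Proof.
move=> a0 ab c0; rewrite m1_box => [|i]; last by rewrite /box; case: ifP => _; exact: measurable_itv.
rewrite (bigD1 o)//= {1}/box eqxx exponential_prob_oc ?hz_ge0 ?le_zz_hazard//.
rewrite (eq_bigr (fun i => (expR (- hz y i c))%:E)) => [|i /negbTE io].
 by rewrite prodEFin -expR_sum sumrN mulrC.
by rewrite /box io exponential_prob_oy ?hz_ge0.
Qed.
Let mbox a b c : measurable [set x | forall i, box a b c i (clocks x i)].
Proof.
rewrite (_ : [set x | _] = \bigcap_(i in [set` predT]) ((fun x => clocks x i) @^-1` box a b c i)).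
 apply: fin_bigcap_measurable => [|i _]; first exact: finite_finset.
 rewrite -[X in measurable X]setTI; apply: m_clocks => //.
 by rewrite /box; case: ifP => _; exact: measurable_itv.
by apply/seteqP; split => x Hx i => [_|]; exact: Hx.
Qed.
Let FsetD a b : [set x | first y (clocks x) = o /\ a < wait y (clocks x) <= b] = Fset b `\` Fset a.
Proof.
apply/seteqP; split => x /=.
 by move=> [fo /andP[aw wb]]; split => // -[_]; rewrite leNgt aw.
move=> [[fo wb] na]; split => //; rewrite wb andbT ltNge; apply/negP => wa.
exact: na.
Qed.
Let FB a b : a <= b -> (F b - F a)%:E = m1 [set x | first y (clocks x) = o /\ a < wait y (clocks x) <= b].
Proof.
move=> ab; rewrite EFinB /F !fineK ?fin_num_measure//.
rewrite FsetD measureD//; last by rewrite ltey_eq fin_num_measure.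
congr (_ - m1 _)%E; apply/seteqP; split => x /=; last by move=> [].
by move=> [fo wa]; split => //; split => //; exact: le_trans wa ab.
Qed.
Let F_lower a b : 0 <= a -> a <= b -> expR (- S b) * (expR (- H a) - expR (- H b)) <= F b - F a.
Proof.
move=> a0 ab; have b0 := le_trans a0 ab.
rewrite -lee_fin -m1_box_abc// FB//; apply: le_measure; rewrite ?inE//.
 by rewrite FsetD; exact: measurableD.
move=> x /= Hx; have tb : (time y o (clocks x o) <= b%:E)%E.
 by rewrite zz_time_le//; have := Hx o; rewrite /box eqxx/= in_itv/= => /andP[].
have ta : (a%:E < time y o (clocks x o))%E.
 by rewrite ltNge zz_time_le// -ltNge; have := Hx o; rewrite /box eqxx/= in_itv/= => /andP[].
have fo : first y (clocks x) = o.
 apply: zz_firstP => i io; apply: le_lt_trans tb _; rewrite ltNge zz_time_le// -ltNge.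
 by have := Hx i; rewrite /box (negbTE io)/= in_itv/= andbT.
by split => //; rewrite -lte_fin -lee_fin zz_waitE// fo ta tb.
Qed.
Let F_upper a b : 0 <= a -> a <= b -> F b - F a <= expR (- S a) * (expR (- H a) - expR (- H b)).
Proof.
move=> a0 ab; have b0 := le_trans a0 ab.
rewrite -lee_fin -m1_box_abc// FB//; apply: le_measure; rewrite ?inE//.
 by rewrite FsetD; exact: measurableD.
move=> x /= [fo /andP[aw wb]] i.
have /(zz_wait_gtP CU gamma0 y _ a0) ha := aw.
rewrite /box; case: eqVneq => [->|io]; rewrite /= in_itv/= ?ha//=.
by rewrite -zz_time_le// -[in leLHS]fo -zz_waitE// lee_fin.
Qed.
Let g s := rate (zz_flow y s) o * expR (- cum y s).
Let G t := \int[leb]_(s in `[0, t]) g s.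
Let mg : mfunT g.
Proof.
apply: mfunM.
 by apply: continuous_measurable_fun => s; exact: continuous_zz_rate.
apply: mcomp => //; apply: mcomp => //.
exact: (mcomp (m_zz_cum CU gamma0) (@m_pair1 _ _ _ _ y)).
Qed.
Let g_ge0 s : 0 <= g s.
Proof. by rewrite mulr_ge0 ?expR_ge0// zz_rate_ge0. Qed.
Let ig a b : 0 <= a -> intble_on leb `[a, b] g.
Proof.
move=> a0; have ir : intble_on leb `[a, b] (fun s => rate (zz_flow y s) o).
 by apply: continuous_itv_integrable => x _; exact: continuous_zz_rate.
apply: (le_integrable _ _ _ ir) => //; first exact/mEFinP/measurable_funTS.
move=> s; rewrite /= in_itv/= => /andP[sa sb].
rewrite lee_fin !ger0_norm ?zz_rate_ge0// ler_piMr ?zz_rate_ge0//.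
by rewrite -expR0 ler_expR oppr_le0 zz_cum_ge0.
Qed.
Let GB a b : 0 <= a -> a <= b -> G b - G a = \int[leb]_(s in `[a, b]) g s.
Proof.
move=> a0 ab; rewrite /G (@Rintegral_itv_chasles _ _ 0 a b)//; last exact: ig.
by rewrite addrAC subrr add0r.
Qed.
Let int_rate_exp a b : 0 <= a -> a <= b ->
 intble_on leb `[a, b] (fun s => rate (zz_flow y s) o * expR (- H s)) /\
 \int[leb]_(s in `[a, b]) (rate (zz_flow y s) o * expR (- H s)) = expR (- H a) - expR (- H b).
Proof.
move=> a0 ab; have [K [KE dK]] := is_derive_zz_hazard gamma CU y o.
pose f s := rate (zz_flow y s) o * expR (- K s).
have cf x : a <= x <= b -> {for x, continuous f}.
 move=> /andP[ax _]; have d1 := dK _ (le_trans a0 ax).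
 apply: cvgM; first exact: continuous_zz_rate.
 apply: (@continuous_comp _ _ _ (fun s => - K s) expR x); last exact: continuous_expR.
 by apply: cvgN; apply/differentiable_continuous/derivable1_diffP; case: d1.
have fE s : a <= s <= b -> f s = rate (zz_flow y s) o * expR (- H s).
 by move=> /andP[sa _]; rewrite /f KE// (le_trans a0 sa).
split.
 have := continuous_itv_integrable cf; apply: eq_integrable => // s.
 by rewrite inE/= in_itv/= => sab; rewrite fE.
transitivity (\int[leb]_(s in `[a, b]) f s).
 by apply: eq_Rintegral => s; rewrite inE/= in_itv/= => sab; rewrite fE.
have dF x : a <= x <= b -> is_derive x 1 (fun s => - expR (- K s)) (f x).
 move=> /andP[ax _]; have d1 := dK _ (le_trans a0 ax).
 have d2 := is_deriveN d1.
 have d3 : is_derive x 1 (expR \o (- K)) _ := is_derive1_comp (is_derive_expR ((- K) x)) d2.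
 have := is_deriveN d3; rewrite /f; congr is_derive.
 by rewrite mulrN opprK mulrC.
rewrite (Rintegral_FTC ab cf dF) !KE//; last exact: le_trans ab.
by rewrite opprK addrC.
Qed.
Let S_le s t : 0 <= s -> s <= t -> S s <= S t.
Proof. by move=> s0 st; apply: ler_sum => i _; exact: le_zz_hazard. Qed.
Let gE s : g s = rate (zz_flow y s) o * expR (- H s) * expR (- S s).
Proof. by rewrite /g (zz_cumD1 o) opprD expRD mulrA. Qed.
Let G_lower a b : 0 <= a -> a <= b -> expR (- S b) * (expR (- H a) - expR (- H b)) <= G b - G a.
Proof.
move=> a0 ab; have [i1 <-] := int_rate_exp a0 ab; rewrite GB// -RintegralZl//.
apply: le_Rintegral => //; [exact: intble_cmul|exact: ig|move=> s].
rewrite /= in_itv/= => /andP[sa sb]; rewrite gE mulrC ler_wpM2l ?ler_expR ?lerN2//.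
 by rewrite mulr_ge0 ?expR_ge0// zz_rate_ge0.
by apply: S_le => //; exact: le_trans sa.
Qed.
Let G_upper a b : 0 <= a -> a <= b -> G b - G a <= expR (- S a) * (expR (- H a) - expR (- H b)).
Proof.
move=> a0 ab; have [i1 <-] := int_rate_exp a0 ab; rewrite GB// -RintegralZl//.
apply: le_Rintegral => //; [exact: ig|exact: intble_cmul|move=> s].
rewrite /= in_itv/= => /andP[sa sb]; rewrite gE mulrC ler_wpM2r ?ler_expR ?lerN2//.
 by rewrite mulr_ge0 ?expR_ge0// zz_rate_ge0.
exact: S_le.
Qed.
Let expN_le (s t : R) : 0 <= s -> s <= t -> expR (- s) - expR (- t) <= t - s.
Proof.
move=> s0 st; have e1 : expR (- t) = expR (- s) * expR (s - t) by rewrite -expRD; congr expR; ring.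
rewrite e1 -[X in X - _]mulr1 -mulrBr.
have h1 : 1 - expR (s - t) <= t - s by have := expR_ge1Dx (s - t); lra.
apply: le_trans h1; rewrite ler_piMl//.
 by rewrite subr_ge0 -expR0 ler_expR subr_le0.
by rewrite -expR0 ler_expR oppr_le0.
Qed.
(** The distribution function [F] and the integral [G] of the expected density obey the same two
    bounds on increments. The gap between these bounds is a product of two increments, each O(b -
    a), so [F] - [G] is constant. *)
Let FG_eq T : 0 <= T -> F T - G T = F 0 - G 0.
Proof.
move=> T0; have [C C0 HC] := zz_hazard_lipschitz CU gamma0 y T0.
suff q a b : 0 <= a -> a <= b -> b <= T -> `|(F b - G b) - (F a - G a)| <= C *+ #|{: option 'I_d}| * C * (b - a) ^+ 2.
 exact: (@quadratic_increments_constant R (fun t => F t - G t) _ T T0 q).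
move=> a0 ab bT; have b0 := le_trans a0 ab.
have ba : 0 <= b - a by rewrite subr_ge0.
have hH : H b - H a <= C * (b - a) := HC o a b a0 ab bT.
have hH0 : 0 <= expR (- H a) - expR (- H b) by rewrite subr_ge0 ler_expR lerN2 le_zz_hazard.
have hS : S b - S a <= C *+ #|{: option 'I_d}| * (b - a).
 rewrite /S -sumrB (le_trans (y := \sum_(i | i != o) C * (b - a)))//.
  by apply: ler_sum => i _; exact: HC.
 rewrite (le_trans (y := \sum_(i : option 'I_d) C * (b - a)))//.
  by rewrite [leRHS](bigD1 o)//= lerDr mulr_ge0.
 by rewrite sumr_const mulrnAl.
have S0 s : 0 <= s -> 0 <= S s by move=> s0; apply: sumr_ge0 => i _; exact: hz_ge0.
have h1 : (expR (- S a) - expR (- S b)) * (expR (- H a) - expR (- H b)) <=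
  C *+ #|{: option 'I_d}| * C * (b - a) ^+ 2.
 rewrite expr2 mulrACA ler_pM//.
 - by rewrite subr_ge0 ler_expR lerN2 S_le.
 - by apply: le_trans hS; rewrite expN_le ?S0 ?S_le.
 - by apply: le_trans hH; rewrite expN_le ?hz_ge0 ?le_zz_hazard.
apply: le_trans h1; have := F_lower a0 ab; have := F_upper a0 ab.
have := G_lower a0 ab; have := G_upper a0 ab.
by move=> h1 h2 h3 h4; rewrite mulrBl; exact: ler_dist_squeeze.
Qed.
Let F0 : F 0 = 0.
Proof.
have h : m1 (Fset 0) = 0%E.
 apply/eqP; rewrite eq_le measure_ge0 andbT.
 apply: (@le_trans _ _ (m1 (~` [set x | 0 < wait y (clocks x)]))).
  apply: le_measure; rewrite ?inE//.
   by apply: measurableC; exact: mwait_gt.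
  by move=> x /= [_]; rewrite leNgt => /negP.
 rewrite probability_setC.
  rewrite zz_wait_tail// zz_cumE big1 => [|i _]; last exact: zz_hazard0.
  by rewrite oppr0 expR0 subee.
 exact: mwait_gt.
by rewrite /F h.
Qed.
Let FG t : 0 <= t -> F t = G t.
Proof.
move=> t0; have := FG_eq t0; rewrite F0 {2}/G set_itv1 Rintegral_set1 subrr => /eqP.
by rewrite subr_eq0 => /eqP.
Qed.
Let dens s := if 0 <= s then g s else 0.
Let dens_ge0 s : 0 <= dens s. Proof. by rewrite /dens; case: ifP. Qed.
Let mdens : mfunT dens.
Proof. by apply: measurable_fun_ifT => //; exact: measurable_fun_ler. Qed.
Let mwaitR : @measurable_fun _ _ 'rV[R]_d.+1 (measurableTypeR R) setT (fun x => wait y (clocks x)).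
Proof. exact: mwait. Qed.
Let nu : {measure set (measurableTypeR R) -> \bar R} :=
 @measure_function_pushforward__canonical__measure_function_Measure _ _ _ _ R
  (mrestr m1 (mfirst o)) _ mwaitR.
Let nu_dens A : measurable A -> nu A = density_measure leb dens_ge0 mdens A.
Proof.
move=> mA.
apply: (@measure_eq_cdf R nu (density_measure leb dens_ge0 mdens)) => // [|t].
 by rewrite /nu /= /pushforward /mrestr preimage_setT setTI ltey_eq fin_num_measure.
have -> : nu `]-oo, t]%classic = m1 (Fset t).
 by rewrite /nu /= /pushforward /mrestr setIC; congr (m1 _).
transitivity (\int[leb]_(s in `[0%R, t]) (g s)%:E)%E; last first.
 rewrite /density_measure/= integral_mkcond [RHS]integral_mkcond; apply: eq_integral => s _.
 rewrite !patchE /dens; case: (boolP (s \in `]-oo, t]%classic)); case: (boolP (s \in `[0, t]%classic));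
  rewrite ?inE ?notin_setE/= !in_itv/= => h1 h2.
 - by case/andP: h1 => ->.
 - by case: ifP => // s0; exfalso; apply: h1; rewrite s0 h2.
 - by case/andP: h1 => _ h; exfalso; exact: h2.
 - by [].
have [t0|t0] := leP 0 t.
 have E := congr1 EFin (FG t0); move: E; rewrite /F /G /Rintegral !fineK//.
  by apply: integral_fune_fin_num => //; exact: ig.
 by rewrite fin_num_measure.
rewrite set_itv_ge ?integral_set0 ?bnd_simp -?ltNge//.
rewrite (_ : Fset t = set0) ?measure0//; apply/seteqP; split => // x /= [_].
by move/le_lt_trans => /(_ _ t0); rewrite ltNge zz_wait_ge0.
Qed.

(** Restricted to the occurrence of [o], the law of the waiting time and the measure of density rate
    times exp(- cum) have the same distribution function by [FG], hence they are equal. *)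
Lemma zz_first_event1 (h : R -> \bar R) : mfunT h -> (forall s, (0 <= h s)%E) ->
 (\int[m1]_x (h (wait y (clocks x)) * (\1_[set x | first y (clocks x) = o] x)%:E) =
  \int[leb]_(s in `[0%R, +oo[) (h s * (rate (zz_flow y s) o * expR (- cum y s))%:E))%E.
Proof.
move=> mh h0; have mD := mfirst o.
transitivity (\int[mrestr m1 mD]_x h (wait y (clocks x)))%E.
 rewrite (@ge0_integral_density _ _ _ m1 (mrestr m1 mD) (\1_[set x | first y (clocks x) = o]))//.
 - by move=> A mA; rewrite integral_indic//= /mrestr setIC.
 - exact: mcomp mh mwait.
transitivity (\int[nu]_s h s)%E.
 by rewrite /nu (@ge0_integral_pushforward _ _ _ (measurableTypeR R) R _ mwaitR).
rewrite (@ge0_integral_density _ (measurableTypeR R) R leb nu dens mdens dens_ge0 nu_dens h mh h0).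
rewrite [RHS]integral_mkcond.
apply: eq_integral => s _; rewrite patchE /dens.
case: (boolP (s \in _)); rewrite ?inE ?notin_setE/= in_itv/= andbT; first by move=> ->.
by move=> /negP/negbTE ->; rewrite mule0.
Qed.
End event.

Lemma zz_first_event (h : R -> option 'I_d -> \bar R) : (forall o, mfunT (h ^~ o)) ->
 (forall s o, (0 <= h s o)%E) ->
 (\int[m1]_x h (wait y (clocks x)) (first y (clocks x)) =
  \sum_o \int[leb]_(s in `[0%R, +oo[) (h s o * (rate (zz_flow y s) o * expR (- cum y s))%:E))%E.
Proof.
move=> mh h0; under [RHS]eq_bigr do rewrite -zz_first_event1//.
rewrite -ge0_integral_sum//; last 2 first.
- move=> o; apply: emeasurable_funM; first exact: mcomp (mh o) mwait.
 by apply/mEFinP; exact: measurable_indic.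
- by move=> o x _; rewrite mule_ge0// lee_fin.
apply: eq_integral => x _; rewrite (bigD1 (first y (clocks x)))//= big1 => [|o /eqP oo].
 by rewrite indicE mem_set// mule1 adde0.
by rewrite indicE memNset ?mule0//= => /esym.
Qed.

End first_event.

(** * Independence of the rounds and the chain of events *)

Section independence.
Context d (O : measurableType d) R (P : probability O R).
Local Open Scope ereal_scope.

(* [F] is independent of every event of [G]. *)
Definition independent_of (G : set (set O)) (F : set O) : Prop :=
 forall D, G D -> P (D `&` F) = P D * P F.

(** Both sides are finite measures in [D] that agree on a family stable under intersection and
    containing the whole space. *)
Lemma independent_of_sigma (G : set (set O)) (F : set O) :
 G `<=` measurable -> G setT -> setI_closed G -> measurable F ->
 independent_of G F -> independent_of <<s G >> F.
Proof.
move=> mG GT GI mF GF D GD.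
pose c : {nonneg R} := NngNum (fine_ge0 (measure_ge0 P F)).
have cE : c%:num%:E = P F by rewrite /= fineK// fin_num_measure.
have := @g_sigma_algebra_measure_unique _ R O G mG (fun=> setT) (fun=> GT) _
 (mrestr P mF) (mscale c P) GI _ _ D GD.
rewrite /= /mrestr /mscale/= fineK ?fin_num_measure//.
move=> ->; first by rewrite muleC.
- by apply/seteqP; split => // x _; exists 0%N.
- by move=> A GA; rewrite GF// muleC.
- by move=> _; rewrite setTI ltey_eq fin_num_measure.
Qed.

Lemma independent_integral dA dB (A : measurableType dA) (B : measurableType dB)
  (X : O -> A) (Y : O -> B) (h : A * B -> \bar R) :
 mfunT X -> mfunT Y ->
 (forall S T, measurable S -> measurable T ->
  P (X @^-1` S `&` Y @^-1` T) = P (X @^-1` S) * P (Y @^-1` T)) ->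
 mfunT h -> (forall p, 0 <= h p) ->
 \int[P]_om h (X om, Y om) = \int[P]_om \int[P]_om' h (X om, Y om').
Proof.
move=> mX mY XY mh h0.
pose X' : {RV P >-> A} := mfun_Sub (mem_set mX).
pose Y' : {RV P >-> B} := mfun_Sub (mem_set mY).
have mXY : mfunT (fun om => (X om, Y om)) by exact: m_pair.
pose XY' : {RV P >-> (A * B)%type} := mfun_Sub (mem_set mXY).
rewrite -[LHS](ge0_integral_distribution XY' mh h0).
have E S : measurable S -> (distribution P X' \x distribution P Y') S = distribution P XY' S.
 by apply: product_measure_unique => S1 S2 mS1 mS2; rewrite -XY.
transitivity (\int[distribution P X' \x distribution P Y']_y h y).
 by apply: eq_measure_integral => S mS _; apply/esym; exact: E.
rewrite fubini_tonelli1// ge0_integral_distribution//; last 2 first.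
- exact: measurable_fun_fubini_tonelli_F.
- by move=> a; exact: integral_ge0.
apply: eq_integral => om _ /=; rewrite /fubini_F.
rewrite (@ge0_integral_distribution _ _ _ _ _ P Y' (fun b => h (X om, b)))//.
exact: (mcomp mh (@m_pair1 _ _ _ _ _)).
Qed.

End independence.

Section noise.
Context {R} {d : nat}.
Context {dO : measure_display} {O : measurableType dO} {P : probability O R}.
Variables (kappa : rVlaw R d).
Variables (E : nat -> option 'I_d -> {RV P >-> R}) (W : nat -> {RV P >-> 'rV[R]_d}).
Hypothesis noise : zz_noise E W kappa.
Local Open Scope ereal_scope.

Definition clock_row n om : 'rV[R]_d.+1 := \row_i E n (unlift ord0 i) om.

Lemma clocks_row n om : clocks (clock_row n om) = E n ^~ om.
Proof. by apply/funext => -[k|]; rewrite /clocks mxE ?liftK ?unlift_none. Qed.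

Lemma m_clock_row n : mfunT (clock_row n).
Proof.
apply: measurable_fun_rV => i; under eq_fun do rewrite mxE.
exact: measurable_funPT.
Qed.
Let box (A : option 'I_d -> set R) : set 'rV[R]_d.+1 := [set x | forall o, A o (clocks x o)].
Let mbox A : (forall o, measurable (A o)) -> measurable (box A).
Proof.
move=> mA; rewrite (_ : box A = \bigcap_(o in [set` predT]) ((fun x => clocks x o) @^-1` A o)).
 apply: fin_bigcap_measurable => [|o _]; first exact: finite_finset.
 by rewrite -[X in measurable X]setTI; apply: m_clocks.
by apply/seteqP; split => x Hx i => [_|]; exact: Hx.
Qed.

Definition noise_cylinder (n : nat) (A : nat -> option 'I_d -> set R) (B : nat -> set 'rV[R]_d) : set O :=
 [set om | forall k, (k < n)%N -> (forall o, A k o (E k o om)) /\ B k (W k om)].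

Definition noise_cylinders n : set (set O) := [set D | exists A B,
 [/\ forall k o, measurable (A k o), forall k, measurable (B k) & D = noise_cylinder n A B]].
Let mcyl n A B : (forall k o, measurable (A k o)) -> (forall k, measurable (B k)) ->
 measurable (noise_cylinder n A B).
Proof.
move=> mA mB; rewrite (_ : noise_cylinder n A B =
 \bigcap_(k in `I_n) (clock_row k @^-1` box (A k) `&` W k @^-1` B k)).
 apply: fin_bigcap_measurable => [|k _]; first exact: finite_II.
 apply: measurableI; rewrite -[X in measurable X]setTI.
  by apply: m_clock_row => //; exact: mbox.
 exact: measurable_funPT.
apply/seteqP; split => om /= H k kn; have := H k kn.
 by move=> [HA HB]; split => //=; rewrite /box/= clocks_row.
by move=> [HA HB]; split => //; move: HA; rewrite /box/= clocks_row.
Qed.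
Let cylT n : noise_cylinders n setT.
Proof. by exists (fun _ _ => setT), (fun=> setT); split => //; apply/seteqP; split. Qed.
Let cylI n : setI_closed (noise_cylinders n).
Proof.
move=> _ _ [A [B [mA mB ->]]] [A' [B' [mA' mB' ->]]].
exists (fun k o => A k o `&` A' k o), (fun k => B k `&` B' k); split.
- by move=> k o; exact: measurableI.
- by move=> k; exact: measurableI.
apply/seteqP; split => om /=.
 by move=> [H H'] k kn; have [? ?] := H k kn; have [? ?] := H' k kn.
move=> H; split => k kn; have [HA HB] := H k kn; split.
- by move=> o; case: (HA o).
- by case: HB.
- by move=> o; case: (HA o).
- by case: HB.
Qed.

Lemma noise_cylinder_prob n A B : (forall k o, measurable (A k o)) -> (forall k, measurable (B k)) ->
 P (noise_cylinder n A B) =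
 \prod_(k < n) ((\prod_(o : option 'I_d) exponential_prob 1 (A k o)) * kappa (B k)).
Proof. by move=> mA mB; exact: noise. Qed.
Let exp_setT : exponential_prob (1 : R) setT = 1.
Proof. by rewrite /exponential_prob integral_exponential_pdf. Qed.
Let kT : kappa setT = 1. Proof. exact: probability_setT. Qed.

Lemma noise_slice n A B : (forall o, measurable (A o)) -> measurable B ->
 P (clock_row n @^-1` box A `&` W n @^-1` B) = (\prod_o exponential_prob 1 (A o)) * kappa B.
Proof.
move=> mA mB.
pose A' k o := if k == n then A o else setT.
pose B' k := if k == n then B else setT.
rewrite (_ : _ `&` _ = noise_cylinder n.+1 A' B').
 rewrite noise_cylinder_prob.
 - rewrite big_ord_recr /= /A' /B' eqxx big1 ?mul1e// => k _.
  by rewrite (ltn_eqF (ltn_ord k)) kT mule1 big1.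
 - by move=> k o; rewrite /A'; case: ifP.
 - by move=> k; rewrite /B'; case: ifP.
apply/seteqP; split => om /=.
 move=> [HA HB] k kn; rewrite /A' /B'; case: eqP => // ->; split => //.
 by move: HA; rewrite /box/= clocks_row.
move=> /(_ n (ltnSn n)); rewrite /A' /B' eqxx => -[HA HB]; split => //.
by rewrite /box/= clocks_row.
Qed.

Lemma clock_row_law n A : (forall o, measurable (A o)) ->
 P (clock_row n @^-1` box A) = \prod_o exponential_prob 1 (A o).
Proof.
move=> mA; have := noise_slice n mA msT.
by rewrite preimage_setT setIT kT mule1.
Qed.

Lemma resample_law n B : measurable B -> P (W n @^-1` B) = kappa B.
Proof.
move=> mB; have := @noise_slice n (fun=> setT) _ (fun=> msT) mB.
by rewrite big1 ?mul1e// (_ : box _ = setT) ?preimage_setT ?setTI//; apply/seteqP; split.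
Qed.
Let cyl_slice n D A B : noise_cylinders n D -> (forall o, measurable (A o)) -> measurable B ->
 P (D `&` (clock_row n @^-1` box A `&` W n @^-1` B)) =
 P D * ((\prod_o exponential_prob 1 (A o)) * kappa B).
Proof.
move=> [A1 [B1 [mA1 mB1 ->]]] mA mB.
pose A' k o := if k == n then A o else A1 k o.
pose B' k := if k == n then B else B1 k.
rewrite (_ : _ `&` _ = noise_cylinder n.+1 A' B').
 rewrite !noise_cylinder_prob//.
 - rewrite big_ord_recr /= /A' /B' eqxx; congr (_ * _); apply: eq_bigr => k _.
  by rewrite (ltn_eqF (ltn_ord k)).
 - by move=> k o; rewrite /A'; case: ifP.
 - by move=> k; rewrite /B'; case: ifP.
apply/seteqP; split => om /=.
 move=> [H1 [HA HB]] k; rewrite ltnS leq_eqVlt /A' /B' => /predU1P[->|kn].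
  by rewrite eqxx; split => //; move: HA; rewrite /box/= clocks_row.
 by rewrite (ltn_eqF kn); exact: H1.
move=> H; split.
 by move=> k kn; have := H k (ltnW kn); rewrite /A' /B' (ltn_eqF kn).
have := H n (ltnSn n); rewrite /A' /B' eqxx => -[HA HB]; split => //.
by rewrite /box/= clocks_row.
Qed.

Definition past n : set (set O) := <<s noise_cylinders n >>.
Let cylm n : noise_cylinders n `<=` measurable.
Proof. by move=> _ [A' [B' [mA' mB' ->]]]; exact: mcyl. Qed.
Let mclk n B : measurable B -> measurable (clock_row n @^-1` B).
Proof. by move=> mB; rewrite -[X in measurable X]setTI; exact: m_clock_row. Qed.
Let mW n B : measurable B -> measurable (W n @^-1` B).
Proof. by move=> mB; rewrite -[X in measurable X]setTI; exact: measurable_funPT. Qed.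
Let clk_boxes n : set (set O) := [set F | exists2 A, (forall o, measurable (A o)) &
 F = clock_row n @^-1` box A].
Let clk_boxes_sigma n B : measurable B -> <<s clk_boxes n >> (clock_row n @^-1` B).
Proof.
move=> mB; pose OG := g_sigma_algebraType (clk_boxes n).
suff : @measurable_fun _ _ OG 'rV[R]_d.+1 setT (clock_row n) by move=> /(_ msT B mB); rewrite setTI.
apply: measurable_fun_rV => i; under eq_fun do rewrite mxE.
move=> _ Y mY; rewrite setTI; apply: sub_sigma_algebra.
exists (fun o => if o == unlift ord0 i then Y else setT).
 by move=> o; case: ifP.
apply/seteqP; split => om /=.
 by move=> HY o; rewrite clocks_row; case: eqP => // ->.
by move=> /(_ (unlift ord0 i)); rewrite clocks_row eqxx.
Qed.
Let boxI (A A' : option 'I_d -> set R) : box A `&` box A' = box (fun o => A o `&` A' o).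
Proof.
apply/seteqP; split => x /=; first by move=> [H H'] o; split.
by move=> H; split => o; case: (H o).
Qed.
Let clk_boxesI n : setI_closed (clk_boxes n).
Proof.
move=> _ _ [A mA ->] [A' mA' ->]; rewrite -preimage_setI boxI.
by exists (fun o => A o `&` A' o) => // o; exact: measurableI.
Qed.
Let boxT : box (fun=> setT) = setT. Proof. by apply/seteqP; split. Qed.
Let clk_boxesT n : clk_boxes n setT.
Proof. by exists (fun=> setT) => //; rewrite boxT. Qed.
Let clk_boxesm n : clk_boxes n `<=` measurable.
Proof. by move=> _ [A mA ->]; apply: mclk; exact: mbox. Qed.
Let slice_clock n D B : noise_cylinders n D -> measurable B ->
 P (clock_row n @^-1` B `&` D) = P (clock_row n @^-1` B) * P D.
Proof.
move=> cD mB; apply: (@independent_of_sigma _ _ _ _ (clk_boxes n)) => //; last exact: clk_boxes_sigma.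
 exact: (cylm cD).
move=> _ [A mA ->]; rewrite setIC muleC clock_row_law//.
by have := cyl_slice cD mA msT; rewrite preimage_setT setIT kT mule1.
Qed.
Let slice_clock_resample n D B B' : noise_cylinders n D -> measurable B -> measurable B' ->
 P (clock_row n @^-1` B `&` (D `&` W n @^-1` B')) = P (clock_row n @^-1` B) * P (D `&` W n @^-1` B').
Proof.
move=> cD mB mB'; apply: (@independent_of_sigma _ _ _ _ (clk_boxes n)) => //; last exact: clk_boxes_sigma.
 by apply: measurableI; [exact: (cylm cD)|exact: mW].
have kW : P (D `&` W n @^-1` B') = P D * kappa B'.
 have := cyl_slice cD (fun=> msT) mB'; rewrite big1 ?mul1e// => <-.
 by rewrite boxT preimage_setT setTI.
move=> _ [A mA ->]; rewrite setICA kW clock_row_law//.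
by rewrite (cyl_slice cD mA mB') muleCA.
Qed.

Lemma past_clock_independent n (B : set 'rV[R]_d.+1) : measurable B ->
 independent_of P (past n) (clock_row n @^-1` B).
Proof.
move=> mB; apply: independent_of_sigma; [exact: cylm|exact: cylT|exact: cylI|exact: mclk|].
by move=> D cD; rewrite setIC slice_clock// muleC.
Qed.

(** Which event occurs in round n depends on the clocks of that round. The new velocity must
    therefore be independent of the past together with these clocks, and this is the sigma-algebra
    that they generate. *)
Definition past_clock n : set (set O) :=
 <<s [set C | exists D B, [/\ noise_cylinders n D, measurable B & C = D `&` clock_row n @^-1` B]] >>.

Lemma past_clock_resample_independent n (B : set 'rV[R]_d) : measurable B ->
 independent_of P (past_clock n) (W n @^-1` B).
Proof.
move=> mB; apply: independent_of_sigma.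
- by move=> _ [D [B' [cD mB' ->]]]; apply: measurableI; [exact: (cylm cD)|exact: mclk].
- by exists setT, setT; split => //; rewrite preimage_setT setTI.
- move=> _ _ [D [B1 [cD mB1 ->]]] [D' [B2 [cD' mB2 ->]]].
 exists (D `&` D'), (B1 `&` B2); split; [exact: cylI|exact: measurableI|].
 by rewrite preimage_setI setIACA.
- exact: mW.
- move=> _ [D [B' [cD mB' ->]]].
 have kW : P (D `&` W n @^-1` B) = P D * kappa B.
  have := cyl_slice cD (fun=> msT) mB; rewrite big1 ?mul1e// => <-.
  by rewrite boxT preimage_setT setTI.
 rewrite -setIA setICA slice_clock_resample// kW resample_law// [D `&` _]setIC slice_clock//.
 by rewrite muleA.
Qed.
Let past_noise_measurable n k o : (k < n)%N ->
 @measurable_fun _ _ (g_sigma_algebraType (noise_cylinders n)) R setT (E k o).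
Proof.
move=> kn _ Y mY; rewrite setTI; apply: sub_sigma_algebra.
exists (fun k' o' => if (k' == k) && (o' == o) then Y else setT), (fun=> setT); split => //.
 by move=> k' o'; case: ifP.
apply/seteqP; split => om /=.
 by move=> HY k' _; split => // o'; case: ifP => // /andP[/eqP -> /eqP ->].
by move=> /(_ k kn)[/(_ o)]; rewrite !eqxx.
Qed.
Let past_resample_measurable n k : (k < n)%N ->
 @measurable_fun _ _ (g_sigma_algebraType (noise_cylinders n)) 'rV[R]_d setT (W k).
Proof.
move=> kn _ Y mY; rewrite setTI; apply: sub_sigma_algebra.
exists (fun _ _ => setT), (fun k' => if k' == k then Y else setT); split => //.
 by move=> k'; case: ifP.
apply/seteqP; split => om /=.
 by move=> HY k' _; split => //; case: ifP => // /eqP ->.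
by move=> /(_ k kn)[_]; rewrite eqxx.
Qed.

Variables (U : 'rV[R]_d -> R) (gamma : R).
Hypotheses (CU : Cn 1 U) (gamma0 : (0 < gamma)%R).
Local Notation state := (phase R d).

Definition zz_event z n om : R * state := zz_skeleton U gamma (fun n o => E n o om) (fun n => W n om) z n.

(** [m_zz_skeleton] is applied with the smaller sigma-algebra of the first n rounds on the sample
    space, so that measurability becomes adaptedness. *)
Lemma past_zz_event z n S : measurable S -> past n (zz_event z n @^-1` S).
Proof.
move=> mS; pose OG := g_sigma_algebraType (noise_cylinders n).
have := @m_zz_skeleton R d U gamma CU gamma0 _ OG (fun om n o => E n o om) (fun om n => W n om)
 (fun=> z) n (fun k o => @past_noise_measurable n k o) (@past_resample_measurable n)
 (m_cst z).
by move=> /(_ msT S mS); rewrite setTI.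
Qed.

Lemma past_clock_zz_event z n S : measurable S ->
 past_clock n ((fun om => (zz_event z n om, clock_row n om)) @^-1` S).
Proof.
move=> mS; pose OG := g_sigma_algebraType [set C | exists D B, [/\ noise_cylinders n D, measurable B & C = D `&` clock_row n @^-1` B]].
suff : @measurable_fun _ _ OG _ setT (fun om => (zz_event z n om, clock_row n om)).
 by move=> /(_ msT S mS); rewrite setTI.
have sub : past n `<=` (@measurable _ OG).
 apply: smallest_sub; first exact: smallest_sigma_algebra.
 move=> D cD; apply: sub_sigma_algebra; exists D, setT; split => //.
 by rewrite preimage_setT setIT.
apply: m_pair.
 by move=> _ S' mS'; rewrite setTI; apply: sub; exact: past_zz_event.
move=> _ B mB; rewrite setTI; apply: sub_sigma_algebra; exists setT, B; split => //.
by rewrite setTI.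
Qed.

Lemma m_zz_event dA (A : measurableType dA) (z : A -> state) (om : A -> O) n :
 mfunT z -> mfunT om ->
 mfunT (fun a => zz_event (z a) n (om a)).
Proof.
move=> mz mom; apply: (m_zz_skeleton CU gamma0 (e := fun a n o => E n o (om a)) (w := fun a n => W n (om a))) => //.
- by move=> k o _; exact: (mcomp (measurable_funPT (E k o)) mom).
- by move=> k _; exact: (mcomp (measurable_funPT (W k)) mom).
Qed.

End noise.

Section visits.
Context {R} {d : nat}.
Variables (U : 'rV[R]_d -> R) (gamma : R) (kappa : rVlaw R d).
Local Notation state := (phase R d).
Local Notation leb := (@lebesgue_measure R).
Local Notation rate := (zz_rate U gamma).
Local Notation cum := (zz_cum U gamma).
Hypotheses (CU : Cn 1 U) (gamma0 : 0 < gamma).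
Local Open Scope ereal_scope.

(** The jump operator on functions with values in [0, +oo], so that the series over the number of
    events can be manipulated before it is known to converge. *)
Definition ejumps (h : state -> \bar R) (z : state) : \bar R :=
 \sum_o (rate z o)%:E * \int[kappa]_w h (zz_jump z o w).

Definition eduhamel (v : R -> state -> \bar R) (r : R) (y : state) : \bar R :=
 \int[leb]_(q in `[0%R, r]) ((expR (- cum y q))%:E * ejumps (v (r - q)%R) (zz_flow y q)).

(* [visit f n t z] is the contribution to [E f(Z_t)] of the paths from z with
  exactly n events before time t. *)
Fixpoint visit (f : state -> \bar R) (n : nat) : R -> state -> \bar R :=
 if n is n'.+1 then eduhamel (visit f n')
 else fun r y => (expR (- cum y r))%:E * f (zz_flow y r).

Lemma ejumps_ge0 h z : (forall z, 0 <= h z) -> 0 <= ejumps h z.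
Proof.
move=> h0; apply: sume_ge0 => o _; rewrite mule_ge0 ?lee_fin ?zz_rate_ge0//.
exact: integral_ge0.
Qed.

Lemma eduhamel_ge0 v r y : (forall r z, 0 <= v r z) -> 0 <= eduhamel v r y.
Proof.
move=> v0; apply: integral_ge0 => q _; rewrite mule_ge0 ?lee_fin ?expR_ge0//.
exact: ejumps_ge0.
Qed.

Lemma visit_ge0 f n r y : (forall z, 0 <= f z) -> 0 <= visit f n r y.
Proof.
move=> f0; elim: n r y => [|n IH] r y /=; first by rewrite mule_ge0// lee_fin expR_ge0.
exact: eduhamel_ge0.
Qed.
Let zz_jump_uncurry dA (A : measurableType dA) (y : A -> state) o : mfunT y ->
 mfunT (fun p : A * 'rV[R]_d => zz_jump (y p.1) o p.2).
Proof.
by move=> my; apply: m_zz_jump; [exact: mcomp my m_fst|exact: m_snd].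
Qed.

Lemma m_ejumps dA (A : measurableType dA) (v : A -> state -> \bar R) (y : A -> state) :
 mfunT (fun p : A * state => v p.1 p.2) -> (forall a z, 0 <= v a z) ->
 mfunT y -> mfunT (fun a => ejumps (v a) (y a)).
Proof.
move=> mv v0 my; apply: emeasurable_sum => o; apply: emeasurable_funM.
 by apply/mEFinP; exact: (mcomp (m_zz_rate gamma CU o) my).
apply: (@measurable_fun_fubini_tonelli_F _ _ _ _ _ kappa (fun p => v p.1 (zz_jump (y p.1) o p.2))) => //.
by apply: (m_uncurry mv); [exact: m_fst|exact: zz_jump_uncurry].
Qed.

Lemma m_eduhamel (v : R -> state -> \bar R) :
 mfunT (fun p : R * state => v p.1 p.2) -> (forall a z, 0 <= v a z) ->
 mfunT (fun p : R * state => eduhamel v p.1 p.2).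
Proof.
move=> mv v0.
pose K (a : (R * state) * measurableTypeR R) : \bar R :=
 if ((0 <= a.2) && (a.2 <= a.1.1))%R then
  (expR (- cum a.1.2 a.2))%:E * ejumps (v (a.1.1 - a.2)%R) (zz_flow a.1.2 a.2) else 0.
have m1 : mfunT (fun a : (R * state) * measurableTypeR R => a.1.1).
 exact: (mcomp m_fst m_fst).
have m2 : mfunT (fun a : (R * state) * measurableTypeR R => a.1.2).
 exact: (mcomp m_snd m_fst).
have m3 : mfunT (fun a : (R * state) * measurableTypeR R => a.2 : R).
 exact: m_snd.
have mK : mfunT K.
 apply: measurable_fun_ifT => //.
  by apply: measurable_and; exact: measurable_fun_ler.
 apply: emeasurable_funM.
  apply/mEFinP; apply: mcomp => //; apply: mcomp => //.
  exact: (mcomp (m_zz_cum CU gamma0) (m_pair m2 m3)).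
 apply: m_ejumps => //; last exact: m_flow_comp.
 apply: (m_uncurry mv); last exact: m_snd.
 by apply: mfunB; [exact: mcomp m1 m_fst|exact: mcomp m3 m_fst].
have K0 a : 0 <= K a.
 by rewrite /K; case: ifP => // _; rewrite mule_ge0 ?lee_fin ?expR_ge0// ejumps_ge0.
apply: (eq_measurable_fun (fubini_F leb K)).
 move=> p _; rewrite /fubini_F /K /eduhamel [RHS]integral_mkcond; apply: eq_integral => q _.
 rewrite patchE; case: (boolP (q \in _)); rewrite ?inE ?notin_setE/= in_itv/=; first by move=> ->.
 by move=> /negP/negbTE ->.
exact: measurable_fun_fubini_tonelli_F.
Qed.

Lemma m_visit f n : mfunT f -> (forall z, 0 <= f z) ->
 mfunT (fun p : R * state => visit f n p.1 p.2).
Proof.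
move=> mf f0; elim: n => [|n IH] /=; last first.
 by apply: m_eduhamel => // a z; exact: visit_ge0.
apply: emeasurable_funM.
 apply/mEFinP; apply: mcomp => //; apply: mcomp => //.
 exact: (mcomp (m_zz_cum CU gamma0) (m_pair m_snd m_fst)).
by apply: (mcomp mf); exact: m_flow_comp.
Qed.

(* One step of the chain of events, as an operator on functions of (time, state). *)
Definition event_step (g : R * state -> \bar R) (p : R * state) : \bar R :=
 \sum_o \int[leb]_(q in `[0%R, +oo[) ((\int[kappa]_w g ((p.1 + q)%R, zz_jump (zz_flow p.2 q) o w)) *
   (rate (zz_flow p.2 q) o * expR (- cum p.2 q))%:E).

(** [visit] as a function on the chain of events: from time p.1 and state p.2, exactly n further
    events occur before t. The value is 0 once the chain has passed t. *)
Definition visit_at f (t : R) n (p : R * state) : \bar R :=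
 if (p.1 <= t)%R then visit f n (t - p.1)%R p.2 else 0.

Lemma m_visit_at f t n : mfunT f -> (forall z, 0 <= f z) ->
 mfunT (visit_at f t n).
Proof.
move=> mf f0; apply: measurable_fun_ifT => //.
 by apply: measurable_fun_ler => //; exact: m_fst.
apply: (m_uncurry (m_visit n mf f0)); last exact: m_snd.
by apply: mfunB => //; exact: m_fst.
Qed.

Lemma visit_at_ge0 f t n p : (forall z, 0 <= f z) -> 0 <= visit_at f t n p.
Proof. by move=> f0; rewrite /visit_at; case: ifP => // _; exact: visit_ge0. Qed.

Lemma event_step_visit f t n p : mfunT f -> (forall z, 0 <= f z) ->
 event_step (visit_at f t n) p = visit_at f t n.+1 p.
Proof.
move=> mf f0; rewrite /event_step {2}/visit_at; case: ifPn => [pt|]; last first.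
 rewrite -ltNge => tp; rewrite big1// => o _; apply: integral0_eq => q.
 rewrite /= in_itv/= andbT => q0; rewrite integral0_eq ?mul0e// => w _.
 by rewrite /visit_at/= leNgt (lt_le_trans tp) ?lerDl.
rewrite /= /eduhamel.
transitivity (\sum_o \int[leb]_(q in `[0%R, (t - p.1)%R]) ((expR (- cum p.2 q))%:E *
  ((rate (zz_flow p.2 q) o)%:E * \int[kappa]_w visit f n (t - p.1 - q)%R (zz_jump (zz_flow p.2 q) o w)))).
 apply: eq_bigr => o _; rewrite integral_mkcond [RHS]integral_mkcond; apply: eq_integral => q _.
 rewrite !patchE; case: (boolP (q \in `[0%R, +oo[%classic)); rewrite ?inE ?notin_setE/= !in_itv/= andbT.
  move=> q0; case: (boolP (q \in _)); rewrite ?inE ?notin_setE/= !in_itv/= q0/=.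
   move=> qt; rewrite muleC EFinM -!muleA; rewrite muleCA; congr (_ * (_ * _)).
   apply: eq_integral => w _; rewrite /visit_at/= -lerBrDl qt opprD addrA//.
  move=> /negP; rewrite -ltNge => tq; rewrite integral0_eq ?mul0e// => w _.
  by rewrite /visit_at/= -lerBrDl leNgt tq.
 by move=> q0; case: (boolP (q \in _)) => //; rewrite inE/= in_itv/= => /andP[/q0].
rewrite -ge0_integral_sum//; last 2 first.
- move=> o; apply: measurable_funTS; apply: emeasurable_funM.
  apply/mEFinP; apply: mcomp => //; apply: mcomp => //.
  exact: (mcomp (m_zz_cum CU gamma0) (@m_pair1 _ _ _ _ p.2)).
 have mfl : mfunT (fun q : R => zz_flow p.2 q) by exact: m_flow_comp.
 apply: emeasurable_funM.
  by apply/mEFinP; exact: (mcomp (m_zz_rate gamma CU o) mfl).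
 apply: (@measurable_fun_fubini_tonelli_F _ _ (measurableTypeR R) _ _ kappa
  (fun a => visit f n (t - p.1 - a.1)%R (zz_jump (zz_flow p.2 a.1) o a.2))).
  apply: (m_uncurry (m_visit n mf f0)).
   by apply: mfunB => //; exact: m_fst.
  exact: (@zz_jump_uncurry _ (measurableTypeR R) (fun q => zz_flow p.2 q)).
 by move=> a; exact: visit_ge0.
- move=> o q _; rewrite mule_ge0 ?lee_fin ?expR_ge0// mule_ge0 ?lee_fin ?zz_rate_ge0//.
 by apply: integral_ge0 => w _; exact: visit_ge0.
apply: eq_integral => q _; rewrite /ejumps ge0_sume_distrr// => o _.
rewrite mule_ge0 ?lee_fin ?zz_rate_ge0//.
by apply: integral_ge0 => w _; exact: visit_ge0.
Qed.

End visits.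

Section event_chain.
Context {R} {d : nat}.
Context {dO : measure_display} {O : measurableType dO} {P : probability O R}.
Variables (kappa : rVlaw R d).
Variables (E : nat -> option 'I_d -> {RV P >-> R}) (W : nat -> {RV P >-> 'rV[R]_d}).
Hypothesis noise : zz_noise E W kappa.
Variables (U : 'rV[R]_d -> R) (gamma : R).
Hypotheses (CU : Cn 1 U) (gamma0 : 0 < gamma).
Local Notation state := (phase R d).
Local Notation X := (zz_event E W U gamma).
Local Open Scope ereal_scope.
Let mX z n : mfunT (X z n).
Proof. exact: (m_zz_event _ _ CU gamma0 n (m_cst z) (@measurable_id _ _ _)). Qed.
Let mclk n : mfunT (clock_row E n). Proof. exact: m_clock_row. Qed.
Let clk_rv n : {RV P >-> 'rV[R]_d.+1} := mfun_Sub (mem_set (mclk n)).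
Let law n : probability 'rV[R]_d.+1 R := distribution P (clk_rv n).
Let lawE n S : law n S = P (clock_row E n @^-1` S). Proof. by []. Qed.
Let law_int n (h : 'rV[R]_d.+1 -> \bar R) : mfunT h -> (forall x, 0 <= h x) ->
 \int[law n]_x h x = \int[P]_om h (clock_row E n om).
Proof. by move=> mh h0; rewrite ge0_integral_distribution. Qed.
Let law_box n A : (forall o, measurable (A o)) ->
 law n [set x | forall o, A o (clocks x o)] = \prod_(o : option 'I_d) exponential_prob 1 (A o).
Proof. by move=> mA; exact: (clock_row_law noise). Qed.
Let XS z n om : X z n.+1 om = zz_step U gamma (X z n om) (E n ^~ om) (W n om).
Proof. exact: zz_skeletonS. Qed.

(** The Markov property, by two independence statements. The new velocity is integrated out given
    the past and the clocks of round n; then the clocks are integrated out given the past, and the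
    pair of the waiting time and the event has the law of [zz_first_event]. *)
Lemma event_stepE z n g : mfunT g -> (forall p, 0 <= g p) ->
 \int[P]_om g (X z n.+1 om) = \int[P]_om event_step U gamma kappa g (X z n om).
Proof.
move=> mg g0.
pose F (a : ((R * state) * 'rV[R]_d.+1) * 'rV[R]_d) := zz_step U gamma a.1.1 (clocks a.1.2) a.2.
have mF : mfunT F.
 apply: m_zz_step => //.
 - exact: (mcomp m_fst m_fst).
 - move=> o; apply: (mcomp (m_clocks o)).
  exact: (mcomp m_snd m_fst).
transitivity (\int[P]_om g (F ((X z n om, clock_row E n om), W n om))).
 by apply: eq_integral => om _; rewrite XS /F/= clocks_row.
have ind S T : measurable S -> measurable T ->
  P ((fun om => (X z n om, clock_row E n om)) @^-1` S `&` W n @^-1` T) =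
  P ((fun om => (X z n om, clock_row E n om)) @^-1` S) * P (W n @^-1` T).
 move=> mS msT; apply: (past_clock_resample_independent noise msT).
 exact: past_clock_zz_event.
rewrite (independent_integral (m_pair (mX z n) (mclk n)) (measurable_funPT (W n)) ind
 (mcomp mg mF) (fun a => g0 (F a))).
pose H (a : (R * state) * 'rV[R]_d.+1) := \int[kappa]_w g (F (a, w)).
have mH : mfunT H.
 apply: (@measurable_fun_fubini_tonelli_F _ _ _ _ _ kappa (g \o F)); first exact: mcomp mg mF.
 by move=> a; exact: g0.
have H0 a : 0 <= H a by exact: integral_ge0.
transitivity (\int[P]_om H (X z n om, clock_row E n om)).
 apply: eq_integral => om _; rewrite /H.
 have mgw : mfunT (fun w => g (F (X z n om, clock_row E n om, w))).
  exact: (mcomp (mcomp mg mF) (@m_pair1 _ _ _ _ _)).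
 rewrite -(ge0_integral_distribution (W n) mgw)//; apply: eq_measure_integral => S mS _.
 exact: (resample_law noise).
rewrite (independent_integral (X := X z n) (Y := clock_row E n) (h := H))//; last first.
 move=> S T mS msT; apply: (past_clock_independent noise msT).
 exact: past_zz_event.
apply: eq_integral => om _; set p := X z n om.
pose h s o := \int[kappa]_w g ((p.1 + s)%R, zz_jump (zz_flow p.2 s) o w).
have mh o : mfunT (h ^~ o).
 apply: (@measurable_fun_fubini_tonelli_F _ _ (measurableTypeR R) _ _ kappa
  (fun a => g ((p.1 + a.1)%R, zz_jump (zz_flow p.2 a.1) o a.2))) => //.
 apply: (mcomp mg); apply: m_pair.
  by apply: mfunD => //; exact: m_fst.
 apply: m_zz_jump; last exact: m_snd.
 by apply: m_flow_comp => //; exact: m_fst.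
have h0 s o : 0 <= h s o by exact: integral_ge0.
have fe := zz_first_event CU gamma0 (@law_box n) p.2 mh h0.
have -> : event_step U gamma kappa g p = \int[law n]_x h (zz_wait U gamma p.2 (clocks x)) (zz_first U gamma p.2 (clocks x)).
 by rewrite fe.
rewrite law_int; [by []| |by move=> x; exact: h0].
have mw : mfunT (fun x => zz_wait U gamma p.2 (clocks x)).
 by apply: m_zz_wait => //; exact: m_clocks.
apply: (m_option_case (c := fun x => zz_first U gamma p.2 (clocks x)) (F := fun o x => h (zz_wait U gamma p.2 (clocks x)) o)).
 by move=> o; apply: m_zz_first => //; exact: m_clocks.
by move=> o; exact: mcomp (mh o) mw.
Qed.

Lemma visit_chain f t z k n : mfunT f -> (forall z, 0 <= f z) ->
 \int[P]_om visit_at U gamma kappa f t n (X z k om) = visit_at U gamma kappa f t (n + k) (0%R, z).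
Proof.
move=> mf f0; elim: k n => [|k IH] n.
 rewrite addn0 /= /zz_event/= integral_cst// [X in _ * X](_ : _ = 1) ?mule1//; exact: probability_setT.
rewrite event_stepE//; last 2 first.
- exact: m_visit_at.
- by move=> p; exact: visit_at_ge0.
by under eq_integral do rewrite event_step_visit//; rewrite IH addSnnS.
Qed.

(** By [visit_chain] the right-hand side is the expectation of [visit] with no further event,
    evaluated after n events. Its factor exp(- cum) is the probability that round n outlasts t,
    which is independent of the first n rounds. *)
Lemma visit_prob f t z n : (0 <= t)%R -> mfunT f -> (forall z, 0 <= f z) ->
 \int[P]_om (if ((X z n om).1 <= t < (X z n.+1 om).1)%R
   then f (zz_flow (X z n om).2 (t - (X z n om).1)%R) else 0) =
 visit U gamma kappa f n t z.
Proof.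
move=> t0 mf f0; have := visit_chain t z n 0 mf f0.
rewrite add0n {2}/visit_at/= t0 subr0 => <-.
pose h (a : (R * state) * 'rV[R]_d.+1) := if ((a.1.1 <= t) && (t < a.1.1 + zz_wait U gamma a.1.2 (clocks a.2)))%R
  then f (zz_flow a.1.2 (t - a.1.1)%R) else 0.
have m11 : mfunT (fun a : (R * state) * 'rV[R]_d.+1 => a.1.1).
 exact: (mcomp m_fst m_fst).
have m12 : mfunT (fun a : (R * state) * 'rV[R]_d.+1 => a.1.2).
 exact: (mcomp m_snd m_fst).
have mh : mfunT h.
 apply: measurable_fun_ifT => //.
  apply: measurable_and; first exact: measurable_fun_ler.
  apply: measurable_fun_ltr => //; apply: mfunD => //.
  apply: m_zz_wait => // o.
  exact: (mcomp (m_clocks o) m_snd).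
 by apply: (mcomp mf); apply: m_flow_comp => //; exact: mfunB.
have h0 a : 0 <= h a by rewrite /h; case: ifP.
transitivity (\int[P]_om h (X z n om, clock_row E n om)).
 by apply: eq_integral => om _; rewrite XS /h/= clocks_row.
rewrite (independent_integral (X := X z n) (Y := clock_row E n) (h := h))//; last first.
 move=> S T mS msT; apply: (past_clock_independent noise msT).
 exact: past_zz_event.
apply: eq_integral => om _; set p := X z n om; rewrite /visit_at /h/=.
case: (leP p.1 t) => pt; last by apply: integral0_eq.
under eq_integral do rewrite -ltrBlDl.
set c := f _.
transitivity (\int[P]_om' (c * (\1_[set om' | (t - p.1 < zz_wait U gamma p.2 (clocks (clock_row E n om')))%R] om')%:E)).
 apply: eq_integral => om' _; rewrite indicE; case: ifPn => H.
  by rewrite mem_set ?mule1.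
 by rewrite memNset ?mule0//=; apply/negP.
have mS : measurable [set om' | (t - p.1 < zz_wait U gamma p.2 (clocks (clock_row E n om')))%R].
 have mw : mfunT (fun om' => zz_wait U gamma p.2 (clocks (clock_row E n om'))).
  apply: m_zz_wait => // o.
  exact: (mcomp (m_clocks o) (mclk n)).
 have := measurable_fun_ltr (m_cst (t - p.1)%R) mw msT (Y := [set true]).
 by rewrite setTI; apply.
rewrite (@ge0_integralZl _ _ _ P setT msT (fun om' => (\1_[set om' | (t - p.1 < zz_wait U gamma p.2 (clocks (clock_row E n om')))%R] om')%:E)); last 3 first.
- by apply/mEFinP; exact: measurable_indic.
- by move=> x _; rewrite lee_fin.
- exact: f0.
rewrite integral_indic// setIT muleC; congr (_ * _).
have r0 : (0 <= t - p.1)%R by rewrite subr_ge0.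
by rewrite -(zz_wait_tail CU gamma0 (@law_box n) p.2 r0) lawE.
Qed.

End event_chain.

Lemma nneseries_single R (g : nat -> \bar R) n :
 (0 <= g n)%E -> (forall k, k != n -> g k = 0%E) -> (\sum_(k <oo) g k = g n)%E.
Proof.
move=> gn g0; rewrite (@nneseriesD1 _ g n predT)//; last first.
 by move=> k _; have [->//|/g0 ->] := eqVneq k n.
by rewrite eseries0 ?adde0// => k _ /g0.
Qed.

Section visit_series.
Context {R} {d : nat}.
Variables (U : 'rV[R]_d -> R) (gamma : R) (kappa : rVlaw R d).
Local Notation state := (phase R d).
Local Notation leb := (@lebesgue_measure R).
Local Notation rate := (zz_rate U gamma).
Local Notation cum := (zz_cum U gamma).
Local Notation visit := (visit U gamma kappa).
Hypotheses (CU : Cn 1 U) (gamma0 : 0 < gamma).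
Local Open Scope ereal_scope.
Let mflow (z : state) : mfunT (fun q : R => zz_flow z q).
Proof. exact: m_flow_comp. Qed.
Let mjump z o : mfunT (fun w : 'rV[R]_d => zz_jump z o w).
Proof. by apply: m_zz_jump => //; exact: m_cst. Qed.
Let mexp z : mfunT (fun q => (expR (- cum z q))%:E).
Proof.
apply/mEFinP; apply: mcomp => //; apply: mcomp => //.
exact: (mcomp (m_zz_cum CU gamma0) (@m_pair1 _ _ _ _ z)).
Qed.

Lemma ejumps_nneseries (h : nat -> state -> \bar R) z :
 (forall n, mfunT (h n)) -> (forall n y, 0 <= h n y) ->
 ejumps U gamma kappa (fun y => \sum_(n <oo) h n y) z = \sum_(n <oo) ejumps U gamma kappa (h n) z.
Proof.
move=> mh h0; rewrite /ejumps nneseries_sum; last first.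
 move=> o n _; rewrite mule_ge0 ?lee_fin ?zz_rate_ge0//; exact: integral_ge0.
apply: eq_bigr => o _; rewrite nneseriesZl; last by move=> n _; exact: integral_ge0.
congr (_ * _); rewrite integral_nneseries// => n.
exact: (mcomp (mh n) (mjump z o)).
Qed.

Lemma visit_series (f : state -> \bar R) t z : mfunT f -> (forall y, 0 <= f y) ->
 \sum_(n <oo) visit f n t z = (expR (- cum z t))%:E * f (zz_flow z t) +
  eduhamel U gamma kappa (fun r y => \sum_(n <oo) visit f n r y) t z.
Proof.
move=> mf f0.
have mv n r : mfunT (visit f n r).
 exact: (mcomp (m_visit kappa CU gamma0 n mf f0) (@m_pair1 _ _ _ _ r)).
rewrite nneseries_recl//; last by move=> n _; exact: visit_ge0.
rewrite -nneseries_addn; last by move=> n; exact: visit_ge0.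
congr (_ + _); rewrite /eduhamel.
transitivity (\sum_(n <oo) \int[leb]_(q in `[0%R, t])
  ((expR (- cum z q))%:E * ejumps U gamma kappa (visit f n (t - q)%R) (zz_flow z q))).
 by apply: eq_eseriesr => n _; rewrite addn1.
rewrite -integral_nneseries//.
- apply: eq_integral => q _; rewrite ejumps_nneseries//; last by move=> n y; exact: visit_ge0.
 rewrite nneseriesZl// => n _; apply: ejumps_ge0 => // y; exact: visit_ge0.
- move=> n; apply: measurable_funTS; apply: emeasurable_funM; first exact: mexp.
 apply: (@m_ejumps _ _ _ _ _ CU _ (measurableTypeR R) (fun q => visit f n (t - q)%R) (fun q => zz_flow z q)) => //.
  apply: (m_uncurry (m_visit kappa CU gamma0 n mf f0)); last exact: m_snd.
  by apply: mfunB => //; exact: m_fst.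
  by move=> q y; exact: visit_ge0.
 exact: mflow.
- move=> n q _; rewrite mule_ge0 ?lee_fin ?expR_ge0//.
 by apply: ejumps_ge0 => // y; exact: visit_ge0.
Qed.

Lemma ejumps_EFin (h : state -> R) (M : R) z : mfunT h -> (forall y, `|h y| <= M)%R ->
 ejumps U gamma kappa (EFin \o h) z = (zz_jumps U gamma kappa h z)%:E.
Proof.
move=> mh hM.
have E o : \int[kappa]_w (EFin \o h) (zz_jump z o w) = (\int[kappa]_w h (zz_jump z o w))%R%:E.
 rewrite /Rintegral fineK//; apply: integral_fune_fin_num => //.
 apply: (intble_by kappa M) => //; exact: (mcomp mh (mjump z o)).
rewrite /ejumps; under eq_bigr do rewrite E -EFinM.
rewrite sumEFin; congr EFin; rewrite /zz_jumps.
have -> : (\sum_o rate z o * \int[kappa]_w h (zz_jump z o w) = rate z None * \int[kappa]_w h (zz_jump z None w) +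
  \sum_k rate z (Some k) * \int[kappa]_w h (zz_jump z (Some k) w))%R.
 rewrite (bigD1 None)//=; congr (_ + _)%R.
 rewrite (reindex_omap Some id)/=; last by case.
 by under eq_bigl do rewrite eqxx.
rewrite addrC; congr (_ + _)%R.
by apply: eq_bigr => k _; rewrite /= Rintegral_cst_prob.
Qed.

End visit_series.

Section chain_properties.
Context {R} {d : nat}.
Context {dO : measure_display} {O : measurableType dO} {P : probability O R}.
Variables (kappa : rVlaw R d).
Variables (E : nat -> option 'I_d -> {RV P >-> R}) (W : nat -> {RV P >-> 'rV[R]_d}).
Hypothesis noise : zz_noise E W kappa.
Variables (U : 'rV[R]_d -> R) (gamma : R).
Hypotheses (CU : Cn 1 U) (gamma0 : 0 < gamma).
Local Notation state := (phase R d).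
Local Notation X := (zz_event E W U gamma).
Local Notation visit := (visit U gamma kappa).
Local Notation path t z om := (zz_path U gamma (fun n o => E n o om) (fun n => W n om) z t).
Implicit Types (z : state) (om : O) (t : R).

Lemma zz_event_time_le z om n k : (n <= k)%N -> (X z n om).1 <= (X z k om).1.
Proof.
move=> /subnK <-; elim: (k - n)%N => [|j IH]; first by rewrite add0n.
rewrite addSn; apply: le_trans IH _.
rewrite [X in _ <= X.1](_ : _ = zz_step U gamma (X z (j + n) om) (E (j + n) ^~ om) (W (j + n) om)).
 by rewrite /= lerDl; exact: zz_wait_ge0.
exact: zz_skeletonS.
Qed.

Definition zz_stage z t n om : bool := (X z n om).1 <= t < (X z n.+1 om).1.

Lemma zz_stage_unique z t om n k : zz_stage z t n om -> zz_stage z t k om -> n = k.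
Proof.
wlog nk : n k / (n <= k)%N => [hw|].
 by case: (leqP n k) => [/hw|/ltnW /hw h] //; move=> h1 h2; rewrite h.
move=> /andP[_ t1] /andP[t2 _]; apply/eqP; rewrite eqn_leq nk/= leqNgt; apply/negP => kn.
by move: t1; rewrite ltNge => /negP; apply; apply: le_trans (zz_event_time_le z om kn) _.
Qed.

Definition zz_at z t n om : state := zz_flow (X z n om).2 (t - (X z n om).1).

Lemma zz_path_stage z t om n : zz_stage z t n om -> path t z om = zz_at z t n om.
Proof.
move=> sn; rewrite /zz_path; case: xgetP => [k _ sk|/(_ n)]; last by move=> /(_ sn).
by rewrite (zz_stage_unique sn (sk : zz_stage z t k om)).
Qed.

(** No stage contains t, so the default 0 is taken, and the skeleton at 0 is (0, z). *)
Lemma zz_path_dead z t om : (forall n, ~~ zz_stage z t n om) -> path t z om = zz_flow z t.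
Proof.
move=> sn; rewrite /zz_path; case: xgetP => [k _ sk|_]; last by rewrite /= subr0.
by have := sn k; rewrite /zz_stage sk.
Qed.

Section joint.
Context dA (A : measurableType dA) (z : A -> state) (om : A -> O) (t : R).
Hypotheses (mz : mfunT z) (mom : mfunT om).
Let mX n : mfunT (fun a => X (z a) n (om a)).
Proof. exact: (m_zz_event E W CU gamma0 n mz mom). Qed.
Let mX1 n : mfunT (fun a => (X (z a) n (om a)).1).
Proof. exact: (mcomp m_fst (mX n)). Qed.
Let mX2 n : mfunT (fun a => (X (z a) n (om a)).2).
Proof. exact: (mcomp m_snd (mX n)). Qed.

Lemma m_zz_stage n : mfunT (fun a => zz_stage (z a) t n (om a)).
Proof. by apply: measurable_and; [exact: measurable_fun_ler|exact: measurable_fun_ltr]. Qed.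

Lemma m_zz_at n : mfunT (fun a => zz_at (z a) t n (om a)).
Proof. by apply: m_flow_comp => //; exact: mfunB. Qed.
Let mstage n : measurable [set a | zz_stage (z a) t n (om a)].
Proof. by have := @m_zz_stage n msT [set true]; rewrite setTI; apply. Qed.

(** The path is defined by a choice, so its preimages are cut according to the stage that contains
    t, with one more piece for the outcomes in which none does. *)
Lemma m_zz_path : mfunT (fun a => path t (z a) (om a)).
Proof.
move=> _ Y mY; rewrite setTI.
rewrite (_ : _ @^-1` Y = \bigcup_n ([set a | zz_stage (z a) t n (om a)] `&` (fun a => zz_at (z a) t n (om a)) @^-1` Y) `|`
  (~` (\bigcup_n [set a | zz_stage (z a) t n (om a)]) `&` (fun a => zz_flow (z a) t) @^-1` Y)).
 apply: measurableU.
  apply: bigcupT_measurable => n; apply: measurableI => //.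
  by rewrite -[X in measurable X]setTI; exact: m_zz_at.
 apply: measurableI; first by apply: measurableC; exact: bigcupT_measurable.
 by rewrite -[X in measurable X]setTI; apply: m_flow_comp.
apply/seteqP; split => a /=.
 case: (pselect (exists n, zz_stage (z a) t n (om a))) => [[n sn]|H].
  by rewrite (zz_path_stage sn) => HY; left; exists n.
 rewrite zz_path_dead => [HY|n]; last by apply/negP => sn; apply: H; exists n.
 by right; split => // -[n _ sn]; apply: H; exists n.
move=> [[n _ [sn]]|[H]] /=; first by rewrite (zz_path_stage sn).
by rewrite zz_path_dead// => n; apply/negP => sn; apply: H; exists n.
Qed.
End joint.
Let msom z n t (f : state -> \bar R) : mfunT f ->
 mfunT (fun om => if zz_stage z t n om then f (zz_at z t n om) else 0%E).
Proof.
move=> mf; apply: measurable_fun_ifT => //.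
 exact: (m_zz_stage t (m_cst z) (@measurable_id _ _ _)).
by apply: (mcomp mf); exact: (m_zz_at t (m_cst z) (@measurable_id _ _ _)).
Qed.
Let mst z t n : measurable [set om | zz_stage z t n om].
Proof.
have := @m_zz_stage _ O (fun=> z) id t (m_cst z) (@measurable_id _ O setT) n msT [set true].
by rewrite setTI; apply.
Qed.

Local Open Scope ereal_scope.

Lemma visit_seriesE (f : state -> \bar R) t z : (0 <= t)%R -> mfunT f -> (forall y, 0 <= f y) ->
 \sum_(n <oo) visit f n t z =
 \int[P]_om \sum_(n <oo) (if zz_stage z t n om then f (zz_at z t n om) else 0).
Proof.
move=> t0 mf f0; rewrite integral_nneseries//; last 2 first.
- by move=> n; exact: msom.
- by move=> n om _; case: ifP.
by apply: eq_eseriesr => n _; rewrite -(visit_prob noise CU gamma0 z n t0 mf f0).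
Qed.

Lemma stage_series (f : state -> \bar R) t z om : (forall y, 0 <= f y) ->
 \sum_(n <oo) (if zz_stage z t n om then f (zz_at z t n om) else 0) =
 if `[< exists n, zz_stage z t n om >] then f (path t z om) else 0.
Proof.
move=> f0; case: asboolP => [[n sn]|H].
 rewrite (zz_path_stage sn) (nneseries_single (n := n)) ?sn// => k kn.
 by case: ifPn => // sk; move: kn; rewrite (zz_stage_unique sk sn) eqxx.
by rewrite eseries0// => n _ _; case: ifPn => // sn; exfalso; apply: H; exists n.
Qed.

(** The stages are disjoint, so the series is the expectation of a single value of [f] or of 0. *)
Lemma visit_series_le (f : state -> R) (M : R) t z : (0 <= t)%R -> mfunT f ->
 (forall y, 0 <= f y <= M)%R -> \sum_(n <oo) visit (EFin \o f) n t z <= M%:E.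
Proof.
move=> t0 mf fM; have f0 y : 0 <= (EFin \o f) y by rewrite lee_fin; case/andP: (fM y).
have M0 : (0 <= M)%R by case/andP: (fM (0, 0)%R) => h; exact: le_trans.
rewrite visit_seriesE//; last exact/mEFinP.
have -> : M%:E = \int[P]_om (cst M%:E om).
 rewrite integral_cst// [X in _ * X](_ : _ = 1) ?mule1//; exact: probability_setT.
apply: ge0_le_integral => //.
- by move=> om _; apply: nneseries_ge0 => n _ _; case: ifP.
- apply: (eq_measurable_fun (fun om => \sum_(n <oo | n \in predT) (if zz_stage z t n om then (EFin \o f) (zz_at z t n om) else 0))).
  by move=> om _.
 apply: ge0_emeasurable_sum => [n om _ _|n _]; first by case: ifP.
 by apply: msom; exact/mEFinP.
move=> om _; rewrite stage_series//; case: ifP => _; last by rewrite lee_fin.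
by rewrite lee_fin; case/andP: (fM (path t z om)).
Qed.

Lemma zz_dead_prob t z : (0 <= t)%R ->
 \sum_(n <oo) visit (EFin \o cst 1%R) n t z = 1 ->
 P (~` [set om | exists n, zz_stage z t n om]) = 0.
Proof.
move=> t0; rewrite visit_seriesE//; last exact/mEFinP.
move=> H.
have mS : measurable [set om | exists n, zz_stage z t n om].
 rewrite (_ : [set om | _] = \bigcup_n [set om | zz_stage z t n om]); first exact: bigcupT_measurable.
 by apply/seteqP; split => om /= [n]; [exists n|move=> _; exists n].
rewrite probability_setC// (_ : P _ = 1) ?subee//.
rewrite -H -[P _]mul1e -[X in P X]setIT -integral_indic// mul1e.
apply: eq_integral => om _; rewrite stage_series// indicE; case: asboolP => h.
 by rewrite mem_set.
by rewrite memNset.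
Qed.

Lemma zz_pathE (f : state -> \bar R) t z : (0 <= t)%R -> mfunT f -> (forall y, 0 <= f y) ->
 P (~` [set om | exists n, zz_stage z t n om]) = 0 ->
 \int[P]_om f (path t z om) = \sum_(n <oo) visit f n t z.
Proof.
move=> t0 mf f0 dead; rewrite visit_seriesE//.
have mp : mfunT (fun om => path t z om).
 exact: (m_zz_path t (m_cst z) (@measurable_id _ _ _)).
apply: ae_eq_integral => //.
- exact: mcomp mf mp.
- apply: (eq_measurable_fun (fun om => \sum_(n <oo | n \in predT) (if zz_stage z t n om then f (zz_at z t n om) else 0))).
  by move=> om _.
 by apply: ge0_emeasurable_sum => [n om _ _|n _]; [case: ifP|exact: msom].
exists (~` [set om | exists n, zz_stage z t n om]); split => //.
 apply: measurableC; rewrite (_ : [set om | _] = \bigcup_n [set om | zz_stage z t n om]).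
  by apply: bigcupT_measurable => n.
 by apply/seteqP; split => om /= [n]; [exists n|move=> _; exists n].
move=> om /=; apply: contra_not => H _; rewrite stage_series//.
by rewrite asboolT.
Qed.

End chain_properties.

Lemma quadratic_form_disc (R : realFieldType) (a b c : R) : 0 <= a -> 0 <= b ->
 (forall s t, 0 <= s ^+ 2 * a ^+ 2 + (2 * s * t * c + t ^+ 2 * b ^+ 2)) -> `|c| <= a * b.
Proof.
move=> a0 b0 Q; rewrite -(ler_pXn2r (n := 2))// ?nnegrE ?mulr_ge0// -normrX ger0_norm ?sqr_ge0// exprMn.
have [z|an] := eqVneq a 0.
 rewrite z in Q *.
 (* When a = 0 this choice of s and t makes the form equal to - (b^2 + 2) c^4, which forces c =
    0. *)
 have := Q (- (b ^+ 2 + 1) * c) (c ^+ 2); rewrite expr0n/= mul0r mulr0 add0r.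
 have := sqr_ge0 b; move: (b ^+ 2) => B B0 h.
 have : (B + 2) * (c ^+ 2) ^+ 2 <= 0 by nra.
 rewrite pmulr_rle0 => [h2|]; last by lra.
 have : (c ^+ 2) ^+ 2 == 0 by rewrite eq_le h2 sqr_ge0.
 by rewrite !expf_eq0/= => /eqP ->; rewrite expr0n.
have a2 : 0 < a ^+ 2 by rewrite exprn_even_gt0.
(* With s = - c and t = a^2 the form is a^2 (a^2 b^2 - c^2). *)
have := Q (- c) (a ^+ 2); rewrite sqrrN; move: (a ^+ 2) a2 => A A0 h.
have : 0 <= A * (A * b ^+ 2 - c ^+ 2) by nra.
by rewrite pmulr_rge0// subr_ge0.
Qed.

(** * Square integrable functions *)

Section inL2.
Context d (T : measurableType d) R (m : {measure set T -> \bar R}).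
Implicit Types (f g : T -> R).

(** The space [L2] in terms of real-valued integrals; [L2_inL2] and [inL2_L2] translate, and
    [L2norm_l2] relates the norms. *)
Definition inL2 f : Prop :=
 mfunT f /\ intble m (fun x => f x ^+ 2).

Definition l2 f : R := Num.sqrt (\int[m]_x (f x ^+ 2)).

Lemma inL2_mul f g : inL2 f -> inL2 g ->
 intble m (fun x => f x * g x).
Proof.
move=> [mf if2] [mg ig2]; apply: (intble_EFin_le _ (intble_add msT if2 ig2)).
 exact: mfunM.
move=> x; rewrite ler_norml [X in _ <= _ <= X]ger0_norm ?addr_ge0 ?sqr_ge0//.
move: (f x) (g x) => a b; have := sqr_ge0 (a - b); have := sqr_ge0 (a + b) => h1 h2.
by rewrite ger0_norm ?addr_ge0 ?sqr_ge0//; apply/andP; split; nra.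
Qed.

Lemma inL2_add f g : inL2 f -> inL2 g -> inL2 (fun x => f x + g x).
Proof.
move=> sf sg; have [mf if2] := sf; have [mg ig2] := sg; split; first exact: mfunD.
rewrite (_ : (fun x => _) = fun x => f x ^+ 2 + (2 * (f x * g x) + g x ^+ 2)); last first.
 by apply/funext => x; ring.
apply: intble_add => //; apply: intble_add => //; apply: intble_cmul => //.
exact: inL2_mul.
Qed.

Lemma inL2_cmul (k : R) f : inL2 f -> inL2 (fun x => k * f x).
Proof.
move=> [mf if2]; split; first exact: mfunM.
rewrite (_ : (fun x => _) = fun x => k ^+ 2 * f x ^+ 2); first exact: intble_cmul.
by apply/funext => x; rewrite exprMn.
Qed.

Lemma inL2_sub f g : inL2 f -> inL2 g -> inL2 (fun x => f x - g x).
Proof.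
move=> sf sg; have := inL2_add sf (inL2_cmul (-1) sg).
by congr inL2; apply/funext => x; rewrite mulN1r.
Qed.

Lemma inL2_sum (I : Type) (r : seq I) (Q : pred I) (F : I -> T -> R) :
 (forall i, Q i -> inL2 (F i)) -> inL2 (fun x => \sum_(i <- r | Q i) F i x).
Proof.
move=> sF; elim: r => [|i r IH].
 under eq_fun do rewrite big_nil; split; first exact: m_cst.
 by under eq_fun do rewrite expr0n; exact: integrable0.
have [Qi|Qi] := boolP (Q i); last by under eq_fun do rewrite big_cons (negbTE Qi).
by under eq_fun do rewrite big_cons Qi; apply: inL2_add => //; exact: sF.
Qed.

Lemma l2_ge0 f : 0 <= l2 f. Proof. exact: sqrtr_ge0. Qed.

Lemma l2_sqr f : l2 f ^+ 2 = \int[m]_x (f x ^+ 2).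
Proof. by rewrite sqr_sqrtr//; apply: Rintegral_ge0 => x _; exact: sqr_ge0. Qed.
Let quad f g : inL2 f -> inL2 g -> forall s t : R,
 \int[m]_x ((s * f x + t * g x) ^+ 2) =
 s ^+ 2 * \int[m]_x (f x ^+ 2) + (2 * s * t * \int[m]_x (f x * g x) + t ^+ 2 * \int[m]_x (g x ^+ 2)).
Proof.
move=> sf sg s t; have [_ if2] := sf; have [_ ig2] := sg; have ifg := inL2_mul sf sg.
rewrite -!RintegralZl//.
have i1 := intble_cmul msT (s ^+ 2) if2.
have i2 := intble_cmul msT (t ^+ 2) ig2.
have i3 := intble_cmul msT (2 * s * t) ifg.
rewrite -(RintegralD msT i3 i2) -(RintegralD msT i1 (intble_add msT i3 i2)).
by apply: eq_Rintegral => x _; ring.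
Qed.

Lemma cauchy_schwarz f g : inL2 f -> inL2 g ->
 `|\int[m]_x (f x * g x)| <= l2 f * l2 g.
Proof.
move=> sf sg; apply: quadratic_form_disc; [exact: l2_ge0|exact: l2_ge0|move=> s t].
by rewrite !l2_sqr -(quad sf sg); apply: Rintegral_ge0 => x _; exact: sqr_ge0.
Qed.

Lemma l2_triangle f g : inL2 f -> inL2 g -> l2 (fun x => f x + g x) <= l2 f + l2 g.
Proof.
move=> sf sg; rewrite -(ler_pXn2r (n := 2))// ?nnegrE ?addr_ge0 ?l2_ge0// l2_sqr.
have := quad sf sg 1 1; rewrite -!l2_sqr expr1n !mul1r mulr1.
rewrite [X in l2 X](_ : _ = fun x => f x + g x); last by apply/funext => x; rewrite !mul1r.
move=> ->; have := le_trans (ler_norm _) (cauchy_schwarz sf sg).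
by move: (\int[m]_x _) (l2 f) (l2 g) => c a b; nra.
Qed.

Lemma l2_cmul (k : R) f : inL2 f -> l2 (fun x => k * f x) = `|k| * l2 f.
Proof.
move=> [mf if2]; rewrite /l2; under eq_Rintegral do rewrite exprMn.
by rewrite RintegralZl// sqrtrM ?sqr_ge0// sqrtr_sqr.
Qed.

Lemma l2_opp f : l2 (fun x => - f x) = l2 f.
Proof. by rewrite /l2; under eq_Rintegral do rewrite sqrrN. Qed.

Lemma l2_dist f g : inL2 f -> inL2 g -> `|l2 f - l2 g| <= l2 (fun x => f x - g x).
Proof.
move=> sf sg; have h1 := l2_triangle (inL2_sub sf sg) sg.
have h2 := l2_triangle (inL2_sub sg sf) sf.
have e : l2 (fun x => g x - f x) = l2 (fun x => f x - g x).
 by rewrite -l2_opp; congr l2; apply/funext => x; rewrite opprB.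
move: h1 h2; rewrite e.
rewrite [X in l2 X <= _](_ : _ = f); last by apply/funext => x; rewrite subrK.
rewrite [X in _ -> l2 X <= _ -> _](_ : _ = g); last by apply/funext => x; rewrite subrK.
by rewrite ler_norml; move: (l2 f) (l2 g) (l2 _) => a b c h1 h2; apply/andP; split; lra.
Qed.

Lemma L2norm_sqr f : (L2norm m f ^+ 2 = \int[m]_x (f x ^+ 2)%:E)%E.
Proof.
rewrite /L2norm unlock poweR12_sqrt ?sqr_sqrte//.
- by apply: eq_integral => x _; rewrite /= powR_mulrn// -normrX ger0_norm// sqr_ge0.
- by apply: integral_ge0 => x _; exact: poweR_ge0.
- by apply: integral_ge0 => x _; exact: poweR_ge0.
Qed.

Lemma L2norm_l2 f : inL2 f -> L2norm m f = (l2 f)%:E.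
Proof.
move=> [mf if2]; rewrite /L2norm unlock poweR12_sqrt; last by apply: integral_ge0 => x _; exact: poweR_ge0.
under eq_integral do rewrite /= powR_mulrn// -normrX ger0_norm ?sqr_ge0//.
by rewrite /l2 /Rintegral -[in LHS](fineK (integral_fune_fin_num msT if2)).
Qed.

Lemma L2_inL2 f : L2 m f -> inL2 f.
Proof.
move=> Lf; split; last exact: Lfun2_integrable_sqr.
by move: Lf; rewrite /L2 inE => /andP[]; rewrite inE.
Qed.

Lemma inL2_L2 f : inL2 f -> L2 m f.
Proof.
move=> sf; rewrite /L2 inE; apply/andP; split; rewrite inE/=; first by case: sf.
by rewrite /finite_norm; have := L2norm_l2 sf; rewrite /L2norm => ->; exact: ltry.
Qed.

Lemma ae_eq_l2 f g : mfunT f -> mfunT g -> {ae m, forall x, f x = g x} ->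
 l2 f = l2 g.
Proof.
move=> mf mg fg; rewrite /l2 /Rintegral; congr (Num.sqrt (fine _)).
apply: ae_eq_integral => //; try by apply/mEFinP; exact: mfunX.
by apply: filterS fg => x /= ->.
Qed.

End inL2.

Lemma inL2_bounded d (T : measurableType d) R (m : probability T R) (f : T -> R) (M : R) :
 mfunT f -> (forall z, `|f z| <= M) -> inL2 m f.
Proof.
move=> mf fM; split => //; apply: (intble_by m (M ^+ 2)); first exact: mfunX.
by move=> z; rewrite normrX lerXn2r// nnegrE; exact: le_trans (fM z).
Qed.

Lemma inL2_integrable d (T : measurableType d) R (m : probability T R) (f : T -> R) :
 inL2 m f -> intble m f.
Proof.
move=> sf; have s1 : inL2 m (cst 1 : T -> R).
 by apply: (@inL2_bounded _ _ _ _ _ 1) => // z; rewrite /cst normr1.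
by apply: eq_integrable (inL2_mul sf s1) => // x _; rewrite /= mulr1.
Qed.

Lemma EFin_Rintegral d (T : measurableType d) R (m : {measure set T -> \bar R}) (f : T -> R) :
 intble m f -> (\int[m]_x (f x)%:E = (\int[m]_x f x)%:E)%E.
Proof. by move=> fi; rewrite /Rintegral fineK// (integral_fune_fin_num msT fi). Qed.

Lemma ae_eq0_l2 d (T : measurableType d) R (m : {measure set T -> \bar R}) (f : T -> R) :
 inL2 m f -> l2 m f <= 0 -> {ae m, forall x, f x = 0}.
Proof.
move=> [mf if2] f0; have z : l2 m f = 0 by apply/eqP; rewrite eq_le f0 l2_ge0.
have mf2 : mfunT (EFin \o (fun x => f x ^+ 2)) by apply/mEFinP; exact: mfunX.
have := (ae_eq_integral_abs m msT mf2).1.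
rewrite (eq_integral (EFin \o (fun x => f x ^+ 2))) => [|x _]; last by rewrite /= ger0_norm ?sqr_ge0.
rewrite (EFin_Rintegral if2) -l2_sqr z expr0n => /(_ erefl).
by apply: filterS => x /(_ Logic.I) /= [] /eqP; rewrite sqrf_eq0 => /eqP.
Qed.

Lemma Rintegral_dominated_cvg d (T : measurableType d) R (m : {measure set T -> \bar R})
  (D : set T) (f_ : nat -> T -> R) (f g : T -> R) : measurable D ->
 (forall n, measurable_fun D (f_ n)) -> measurable_fun D f ->
 {ae m, forall x, D x -> f_ ^~ x @ \oo --> f x} ->
 intble_on m D g -> (forall n x, D x -> `|f_ n x| <= g x) ->
 (fun n => \int[m]_(x in D) f_ n x) @ \oo --> \int[m]_(x in D) f x.
Proof.
move=> mD mf_ mf fcv ig fg.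
have mf_' n : measurable_fun D (EFin \o f_ n) by exact/mEFinP.
have mf' : measurable_fun D (EFin \o f) by exact/mEFinP.
have cv : {ae m, forall x, D x -> (fun n => (f_ n x)%:E) @ \oo --> (f x)%:E}.
 by apply: filterS fcv => x /[apply] h; apply/fine_cvgP; split => //; exact: nearW.
have fg' : {ae m, forall x n, D x -> (`|(f_ n x)%:E| <= (g x)%:E)%E}.
 by apply: aeW => x n Dx; rewrite lee_fin fg.
have [iF h0 h] := dominated_convergence mD mf_' mf' cv ig fg'.
apply: fine_cvg; rewrite /Rintegral fineK ?integral_fune_fin_num//.
Qed.

Lemma l2_le_cst d (T : measurableType d) R (m : probability T R) (f : T -> R) (c : R) :
 mfunT f -> (forall x, `|f x| <= c) -> l2 m f <= c.
Proof.
move=> mf fc; have [[t _]|T0] := pselect (exists t : T, True); last first.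
 have : m setT = 0%E by rewrite (_ : setT = set0) ?measure0//; apply/seteqP; split => // t; case: T0; exists t.
 by rewrite probability_setT => -[] /eqP; rewrite oner_eq0.
have c0 : 0 <= c by exact: le_trans (fc t).
rewrite -(ler_pXn2r (n := 2))// ?nnegrE ?l2_ge0// l2_sqr -[leRHS](Rintegral_cst_prob m).
apply: le_Rintegral => //.
- by have [] := inL2_bounded m mf fc.
- by apply: (intble_by m `|c ^+ 2|).
- by move=> x _; rewrite -(ger0_norm (sqr_ge0 (f x))) normrX lerXn2r// nnegrE.
Qed.

(** * Non-explosion, the semigroup and invariance *)

Section process_solution.
Context {R} {d : nat}.
Context {dO : measure_display} {O : measurableType dO} {P : probability O R}.
Variables (E : nat -> option 'I_d -> {RV P >-> R}) (W : nat -> {RV P >-> 'rV[R]_d}).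
Variables (mu kappa : rVlaw R d).
Hypothesis noise : zz_noise E W kappa.
Variables (U : 'rV[R]_d -> R) (gamma : R).
Hypotheses (CU : Cn 1 U) (gamma0 : 0 < gamma).
Local Notation state := (phase R d).
Local Notation leb := (@lebesgue_measure R).
Local Notation m := (mu \x kappa)%E.
Local Notation mp := (m : probability state R).
Local Notation tot := (zz_tot U gamma).
Local Notation cum := (zz_cum U gamma).
Local Notation visit := (visit U gamma kappa).
Local Notation path t z om := (zz_path U gamma (fun n o => E n o om) (fun n => W n om) z t).
Local Notation stage := (zz_stage E W U gamma).

(** Set to 0 at negative times, because [zz_mild] demands its bound at all times. *)
Definition zz_series (f : state -> R) (t : R) (z : state) : R :=
 if 0 <= t then fine (\sum_(n <oo) visit (EFin \o f) n t z)%E else 0.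

Section bounded.
Variables (f : state -> R) (M : R).
Hypotheses (mf : mfunT f) (fM : forall y, 0 <= f y <= M).
Local Notation u := (zz_series f).
Let M0 : 0 <= M. Proof. by case/andP: (fM (0, 0)) => h; exact: le_trans. Qed.
Let mEf : mfunT (EFin \o f). Proof. exact/mEFinP. Qed.
Let f0 y : (0 <= (EFin \o f) y)%E. Proof. by rewrite lee_fin; case/andP: (fM y). Qed.
Let S_ge0 t z : (0 <= \sum_(n <oo) visit (EFin \o f) n t z)%E.
Proof. by apply: nneseries_ge0 => n _ _; exact: visit_ge0. Qed.

Lemma zz_seriesE t z : 0 <= t -> (\sum_(n <oo) visit (EFin \o f) n t z)%E = (u t z)%:E.
Proof.
move=> t0; rewrite /zz_series t0 fineK// ge0_fin_numE//.
exact: le_lt_trans (visit_series_le noise CU gamma0 z t0 mf fM) (ltry _).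
Qed.

Lemma zz_series_bound t z : 0 <= u t z <= M.
Proof.
have [t0|t0] := leP 0 t; last by rewrite /zz_series (leNgt 0 t) t0/= lexx.
by rewrite -!lee_fin -(zz_seriesE z t0) S_ge0 (visit_series_le noise CU gamma0).
Qed.
Let uM t z : `|u t z| <= M.
Proof. by case/andP: (zz_series_bound t z) => u0 uM; rewrite ger0_norm. Qed.

Lemma m_zz_series : mfunT (fun p : R * state => u p.1 p.2).
Proof.
apply: measurable_fun_ifT => //.
 by apply: measurable_fun_ler => //; exact: m_fst.
apply: mcomp => //.
apply: (eq_measurable_fun (fun p : R * state => \sum_(n <oo | n \in predT) visit (EFin \o f) n p.1 p.2)%E).
 by move=> p _.
apply: ge0_emeasurable_sum => [n p _ _|n _]; first exact: visit_ge0.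
exact: (m_visit kappa CU gamma0).
Qed.
Let mut t : mfunT (u t).
Proof. exact: (mcomp m_zz_series (@m_pair1 _ _ _ _ t)). Qed.

Lemma zz_series_mild : zz_mild U gamma kappa f u M.
Proof.
split; [|exact: m_zz_series|exact: uM].
move=> t z t0; have := visit_series kappa CU gamma0 t z mEf f0.
rewrite (zz_seriesE z t0).
have -> : eduhamel U gamma kappa (fun r y => \sum_(n <oo) visit (EFin \o f) n r y)%E t z =
  (\int[leb]_(s in `[0%R, t]) (expR (- cum z s) * zz_jumps U gamma kappa (u (t - s)) (zz_flow z s))%:E)%E.
 apply: eq_integral => q; rewrite inE/= in_itv/= => /andP[q0 qt]; rewrite EFinM; congr (_ * _)%E.
 rewrite -(ejumps_EFin U gamma kappa (zz_flow z q) (mut (t - q)) (uM (t - q))).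
 congr (ejumps _ _ _ _ _); apply/funext => y; apply: zz_seriesE; rewrite subr_ge0//.
rewrite /Rintegral; case: (\int[leb]_(s in _) _)%E => [x| |]//=.
by rewrite -EFinM -EFinD => -[].
Qed.

End bounded.

Lemma zz_jumps_cst1 z : zz_jumps U gamma kappa (cst 1) z = tot z.
Proof.
rewrite /zz_jumps totE /refresh Rintegral_cst_prob mulr1; congr (_ + _).
by apply: eq_bigr => k _; rewrite mulr1.
Qed.

(** The jump operator maps 1 to the total rate, and exp(- cum) times this rate is minus the
    derivative of exp(- cum) along the line. *)
Lemma zz_mild_cst1 : zz_mild U gamma kappa (cst 1) (fun _ => cst 1) 1.
Proof.
split => [t z t0||t z]; [|exact: m_cst|by rewrite /cst normr1].
under eq_Rintegral do rewrite zz_jumps_cst1.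
pose L (r : R) := \int[leb]_(q in `[-1, r]) tot (zz_flow z q) - \int[leb]_(q in `[-1, 0]) tot (zz_flow z q).
have LE (r : R) : 0 <= r -> L r = cum z r.
 move=> r0; rewrite /L (@Rintegral_itv_chasles _ _ (-1) 0 r)//.
  by rewrite addrAC subrr add0r.
 by apply: continuous_itv_integrable => x _; exact: continuous_zz_tot.
have dL (r : R) : 0 <= r -> is_derive r (1 : R) L (tot (zz_flow z r)).
 move=> r0; have h := @is_derive_prim R (fun q => tot (zz_flow z q)) (-1) r (@continuous_zz_tot _ _ _ gamma CU z)
  (lt_le_trans (ltrN10 _) r0).
 have := is_deriveB h (is_derive_cst _ r 1 : is_derive r (1 : R) (fun=> \int[leb]_(q in `[-1, 0]) tot (zz_flow z q)) 0).
 by rewrite subr0.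
have dE (x : R) : 0 <= x <= t -> is_derive x (1 : R) (fun s => - expR (- L s)) (expR (- L x) * tot (zz_flow z x)).
 move=> /andP[x0 _]; have d2 := is_deriveN (dL _ x0).
 have d3 : is_derive x 1 (expR \o (- L)) _ := is_derive1_comp (is_derive_expR ((- L) x)) d2.
 have := is_deriveN d3; congr is_derive.
 by rewrite mulrN opprK.
have cE (x : R) : 0 <= x <= t -> {for x, continuous (fun s => expR (- L s) * tot (zz_flow z s))}.
 move=> /andP[x0 _]; apply: cvgM; last exact: continuous_zz_tot.
 apply: (@continuous_comp _ _ _ (fun s => - L s) expR x); last exact: continuous_expR.
 by apply: cvgN; apply/differentiable_continuous/derivable1_diffP; case: (dL _ x0).
have H := Rintegral_FTC t0 cE dE.
rewrite mulr1 -(LE _ t0).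
transitivity (expR (- L t) + (- expR (- L t) - - expR (- L 0))).
 by rewrite (LE 0)// /zz_cum set_itv1 Rintegral_set1 oppr0 expR0 /cst; ring.
rewrite -H; congr (_ + _); apply: eq_Rintegral => s; rewrite inE/= in_itv/= => /andP[s0 _].
by rewrite LE.
Qed.

Hypothesis flip_inv : flip_invariant kappa.
Hypothesis quasi_inv : flow_quasi_invariant U mu kappa.
Hypothesis itot : intble m tot.

Lemma refresh_defect_ge0 (h : state -> R) : 0 <= refresh_defect mu kappa h.
Proof. by apply: Rintegral_ge0 => z _; exact: sqr_ge0. Qed.

Lemma zz_contraction f u M t : zz_mild U gamma kappa f u M -> 0 <= t ->
 \int[m]_z (u t z ^+ 2) <= \int[m]_z (f z ^+ 2).
Proof.
move=> zu t0; have := zz_energy CU gamma0 flip_inv quasi_inv itot zu (lexx 0) t0.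
have [mi mu_ _] := zu.
have -> : u 0 = f by apply/funext => z; exact: mild0 mi z.
rewrite lerBlDr => /le_trans; apply; rewrite gerDr mulNr oppr_le0 mulr_ge0//.
 by rewrite mulr_ge0// ltW.
by apply: Rintegral_ge0 => q _; exact: refresh_defect_ge0.
Qed.

(** The series started from 1 is the probability that some stage contains t. It and the constant 1
    are bounded solutions of the Duhamel formula with the same data; their difference is a solution
    with data 0, and the energy inequality makes it vanish almost everywhere. *)
Lemma zz_nonexplosion t : 0 <= t ->
 {ae m, forall z, P (~` [set om | exists n, stage z t n om]) = 0%E}.
Proof.
move=> t0; have m1 : mfunT (cst 1 : state -> R) by exact: m_cst.
have b1 (y : state) : 0 <= (cst 1 y : R) <= 1 by rewrite /cst ler01 lexx.
have z1 := zz_series_mild m1 b1.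
have zw := zz_mild_sub CU gamma0 zz_mild_cst1 z1.
have mw : mfunT (fun z => 1 - zz_series (cst 1) t z).
 by apply: mfunB => //; exact: (mcomp (m_zz_series m1 b1) (@m_pair1 _ _ _ _ t)).
have : {ae m, forall z, 1 - zz_series (cst 1) t z = 0}.
 have [_ _ zM] := zw; apply: ae_eq0_l2.
  exact: (@inL2_bounded _ _ _ mp _ _ mw (zM t)).
 rewrite /l2 ler0_sqrtr//; apply: le_trans (zz_contraction zw t0) _.
 by under eq_Rintegral do rewrite /cst subrr expr0n/=; rewrite Rintegral_cst_prob.
apply: filterS => z /eqP; rewrite subr_eq0 => /eqP H.
apply: (zz_dead_prob noise CU gamma0 t0).
by rewrite (zz_seriesE m1 b1)// -H.
Qed.
Let mpath t : mfunT (fun p : state * O => path t p.1 p.2).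
Proof. exact: (m_zz_path E W CU gamma0 t m_fst m_snd). Qed.
Let mpathz t z : mfunT (fun om => path t z om).
Proof. exact: (mcomp (mpath t) (@m_pair1 _ _ _ _ z)). Qed.
Let zz_semigroup_nneg (f : state -> R) (M t : R) : 0 <= t -> mfunT f -> (forall y, 0 <= f y <= M) ->
 {ae m, forall z, zz_semigroup U gamma E W t f z = zz_series f t z}.
Proof.
move=> t0 mf fM; apply: filterS (zz_nonexplosion t0) => z dead.
have mEf : mfunT (EFin \o f) by exact/mEFinP.
have f0 y : (0 <= (EFin \o f) y)%E by rewrite lee_fin; case/andP: (fM y).
rewrite /zz_semigroup /Rintegral -[RHS]/(fine (zz_series f t z)%:E) -(zz_seriesE mf fM z t0).
by rewrite -(zz_pathE noise CU gamma0 t0 mEf f0 dead).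
Qed.

(** The series represents the semigroup on nonnegative functions, so the positive and negative parts
    are treated separately; this doubles the bound. *)
Lemma zz_semigroup_mild (f : state -> R) (M : R) : mfunT f -> (forall y, `|f y| <= M) ->
 exists2 u, zz_mild U gamma kappa f u (M + M) &
  forall t, 0 <= t -> {ae m, forall z, zz_semigroup U gamma E W t f z = u t z}.
Proof.
move=> mf fM; have M0 : 0 <= M by exact: le_trans (fM (0, 0)).
pose fp y := Num.max (f y) 0; pose fn y := Num.max (- f y) 0.
have fE : f = (fun y => fp y - fn y).
 apply/funext => y; rewrite /fp /fn; have [f0|f0] := leP (f y) 0.
  by rewrite max_l ?oppr_ge0// sub0r opprK.
 by rewrite max_r ?subr0// oppr_le0 ltW.
have mfp : mfunT fp by apply: measurable_maxr.
have mfn : mfunT fn by apply: measurable_maxr => //; exact: mcomp.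
have fpM y : 0 <= fp y <= M.
 by rewrite le_max lexx orbT ge_max M0 andbT (le_trans (ler_norm _)).
have fnM y : 0 <= fn y <= M.
 by rewrite le_max lexx orbT ge_max M0 andbT (le_trans (ler_norm _))// normrN.
exists (fun t z => zz_series fp t z - zz_series fn t z).
 rewrite fE; apply: (zz_mild_sub CU gamma0); exact: zz_series_mild.
move=> t t0; apply: filterS2 (zz_semigroup_nneg t0 mfp fpM) (zz_semigroup_nneg t0 mfn fnM) => z <- <-.
have ib (h : state -> R) : mfunT h -> (forall y, 0 <= h y <= M) ->
  intble P (fun om => h (path t z om)).
 move=> mh hM; apply: (intble_by P M); first exact: mcomp mh (mpathz t z).
 by move=> om; case/andP: (hM (path t z om)) => h0 ?; rewrite ger0_norm.
rewrite /zz_semigroup -(RintegralB msT (ib _ mfp fpM) (ib _ mfn fnM)).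
by apply: eq_Rintegral => om _; rewrite [in LHS]fE.
Qed.

(** The test function is 1: its adjoint is the sum of the reversed rates minus the reversed total
    rate, which is 0. *)
Lemma zz_mild_mass f u M t : zz_mild U gamma kappa f u M -> 0 <= t ->
 \int[m]_z u t z = \int[m]_z f z.
Proof.
move=> zu t0; have [mi _ _] := zu.
have u0 : u 0 = f by apply/funext => z; exact: mild0 mi z.
have i1 : intble m (cst 1 : state -> R).
 by apply: (intble_by mp 1) => // z; rewrite /cst normr1.
have i0 : intble m (cst 0 : state -> R).
 by apply: (intble_by mp 0) => // z; rewrite /cst normr0.
have := @zz_weak _ _ U gamma mu kappa CU gamma0 flip_inv quasi_inv f u M zu (cst 1) (cst 0).
have dg (z : state) (r : R) : is_derive r 1 (fun r => (cst 1 : state -> R) (zz_flow z r)) ((cst 0 : state -> R) (zz_flow z r)).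
 exact: is_derive_cst.
move=> /(_ dg _ _ _ i1 i0 _ _ _ 0 t (lexx 0) t0) H.
apply/eqP; rewrite -subr_eq0; apply/eqP; rewrite -u0.
transitivity (\int[m]_z (u t z * cst 1 z) - \int[m]_z (u 0 z * cst 1 z)).
 by congr (_ - _); apply: eq_Rintegral => z _; rewrite /cst mulr1.
rewrite H.
- rewrite (_ : (fun q => _) = cst 0) ?Rintegral_cst ?mul0r//.
 apply/funext => q; rewrite -[RHS](Rintegral_cst_prob mp 0).
 apply: eq_Rintegral => z _; rewrite /zz_adjoint /zz_jumps_adj /cst mulr1 add0r totE.
 rewrite /refresh Rintegral_cst_prob mulr1 [X in u q z * (X - _)](_ : _ = \sum_k flip_rate U k (zz_rev z) + gamma).
  by rewrite subrr mulr0.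
 by congr (_ + _); apply: eq_bigr => k _; rewrite mulr1.
- by move=> z; exact: cst_continuous.
- exact: m_cst.
- exact: m_cst.
- by apply: eq_integrable itot => // z _; rewrite /= mulr1.
- apply: eq_integrable (intble_zz_tot_rev CU gamma0 flip_inv itot) => // z _.
 by rewrite /= mulr1.
- by move=> x; apply: (intble_by kappa 1) => // w; rewrite /cst normr1.
Qed.

(** For an indicator the expectation is a bounded solution almost everywhere, and its integral is
    conserved. This identifies the law of the path at time t with mu x kappa, hence the claim for
    every nonnegative measurable [g], bounded or not. *)
Lemma zz_invariance t (g : state -> \bar R) : 0 <= t -> mfunT g -> (forall z, (0 <= g z)%E) ->
 (\int[m]_z \int[P]_om g (path t z om) = \int[m]_z g z)%E.
Proof.
move=> t0 mg g0.
have mgp : mfunT (fun p : state * O => g (path t p.1 p.2)) by exact: mcomp mg (mpath t).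
have := @fubini_tonelli1 _ _ _ _ R mp P (fun p => g (path t p.1 p.2)) mgp (fun p => g0 _).
rewrite /fubini_F/= => <-.
pose X : {RV (mp \x P)%E >-> state} := mfun_Sub (mem_set (mpath t)).
rewrite -(ge0_integral_distribution X mg g0); apply: eq_measure_integral => A mA _.
have m1A : mfunT (\1_A : state -> R) by exact: measurable_indic.
have b1A (y : state) : 0 <= (\1_A y : R) <= 1.
 by rewrite indicE; case: (y \in A); rewrite ?lexx ?ler01.
have iA : (m A = \int[m]_z (\1_A z)%:E)%E by rewrite integral_indic// setIT.
have mP : measurable (X @^-1` A) by rewrite -[X in measurable X]setTI; exact: mpath.
have m1E : mfunT (EFin \o (\1_A : state -> R)) by exact/mEFinP.
have m1p : mfunT (fun p : state * O => (\1_A (path t p.1 p.2) : R)%:E).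
 exact: mcomp m1E (mpath t).
have mu1 : mfunT (fun z => zz_series \1_A t z).
 exact: (mcomp (m_zz_series m1A b1A) (@m_pair1 _ _ _ _ t)).
have iu : intble m (zz_series \1_A t).
 apply: (intble_by mp 1) => // z.
 by case/andP: (zz_series_bound m1A b1A t z) => u0 u1; rewrite ger0_norm.
have h0 (p : state * O) : (0 <= (\1_A (path t p.1 p.2) : R)%:E)%E.
 by rewrite lee_fin; case/andP: (b1A (path t p.1 p.2)).
transitivity (\int[m]_z \int[P]_om (\1_A (path t z om))%:E)%E.
 have := @fubini_tonelli1 _ _ _ _ R mp P _ m1p h0.
 rewrite /fubini_F/= => <-; rewrite -[LHS]mul1e.
 by rewrite -[X in (_ * _ X)%E]setIT -integral_indic// mul1e.
transitivity (\int[m]_z (zz_series \1_A t z)%:E)%E.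
 apply: ae_eq_integral => //.
 - exact: (@measurable_fun_fubini_tonelli_F _ _ _ _ R P _ m1p h0).
 - exact/mEFinP.
 apply: filterS (zz_nonexplosion t0) => z dead _.
 rewrite (zz_pathE noise CU gamma0 t0 m1E _ dead) ?(zz_seriesE m1A b1A z t0)// => y.
 by rewrite lee_fin; case/andP: (b1A y).
transitivity (\int[m]_z zz_series \1_A t z)%:E.
 by rewrite /Rintegral fineK//; exact: integral_fune_fin_num.
rewrite (zz_mild_mass (zz_series_mild m1A b1A) t0) /Rintegral integral_indic//= setIT.
by rewrite fineK//; exact: (fin_num_measure mp).
Qed.

End process_solution.

(** * Calculus and the Gibbs measure *)

Section calculus_rV.
Context {R} {d : nat}.
Implicit Types (f g : 'rV[R]_d -> R) (x : 'rV[R]_d) (i j k : 'I_d).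
Local Notation e_ i := (delta_mx ord0 i : 'rV[R]_d).

Definition csupp f : Prop := exists K : set 'rV[R]_d, compact K /\ forall x, ~ K x -> f x = 0.

Lemma continuous_rVM f g : continuous f -> continuous g -> continuous (fun x => f x * g x).
Proof. by move=> cf cg x; apply: (@continuousM _ _ f g x); [exact: cf|exact: cg]. Qed.

Lemma continuous_rVD f g : continuous f -> continuous g -> continuous (fun x => f x + g x).
Proof. by move=> cf cg x; apply: (@continuousD _ _ _ f g x); [exact: cf|exact: cg]. Qed.

Lemma continuous_rVB f g : continuous f -> continuous g -> continuous (fun x => f x - g x).
Proof. by move=> cf cg x; apply: (@continuousB _ _ _ f g x); [exact: cf|exact: cg]. Qed.

Lemma Cn_leS n f : Cn n.+1 f -> Cn n f.
Proof.
elim: n f => [|n IH] f [cf Cf]; split => // i.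
by have [df Cpf] := Cf i; split => //; exact: IH.
Qed.

Lemma Cn_partial n f i : Cn n.+1 f -> Cn n (partial i f).
Proof. by case=> _ /(_ i)[]. Qed.

Lemma Cn1_cont f : Cn 1 f -> continuous f. Proof. by case. Qed.

Lemma Cn1_derivable f i x : Cn 1 f -> derivable f x (e_ i).
Proof. by case=> _ /(_ i)[]. Qed.

Lemma Cn1_cont_partial f i : Cn 1 f -> continuous (partial i f).
Proof. by case=> _ /(_ i)[_ []]. Qed.

Lemma Cn1_intro f : continuous f -> (forall i x, derivable f x (e_ i)) ->
 (forall i, continuous (partial i f)) -> Cn 1 f.
Proof. by move=> cf df cpf; split => // i; split => //; split. Qed.

Lemma partialM f g i x : Cn 1 f -> Cn 1 g ->
 partial i (fun x => f x * g x) x = partial i f x * g x + f x * partial i g x.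
Proof.
move=> Cf Cg; rewrite /partial (@deriveM _ _ f g); [|exact: Cn1_derivable|exact: Cn1_derivable].
by rewrite addrC /GRing.scale/= [g x * _]mulrC.
Qed.

Lemma partialD f g i x : Cn 1 f -> Cn 1 g ->
 partial i (fun x => f x + g x) x = partial i f x + partial i g x.
Proof. by move=> Cf Cg; rewrite /partial (@deriveD _ _ _ f g) //; exact: Cn1_derivable. Qed.

Lemma partialB f g i x : Cn 1 f -> Cn 1 g ->
 partial i (fun x => f x - g x) x = partial i f x - partial i g x.
Proof. by move=> Cf Cg; rewrite /partial (@deriveB _ _ _ f g) //; exact: Cn1_derivable. Qed.

Lemma Cn1M f g : Cn 1 f -> Cn 1 g -> Cn 1 (fun x => f x * g x).
Proof.
move=> Cf Cg; apply: Cn1_intro.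
- by apply: continuous_rVM; exact: Cn1_cont.
- by move=> i x; apply: (@derivableM _ _ f g); exact: Cn1_derivable.
move=> i; rewrite (_ : partial i _ = fun x => partial i f x * g x + f x * partial i g x).
 apply: continuous_rVD; apply: continuous_rVM.
 - exact: Cn1_cont_partial.
 - exact: Cn1_cont.
 - exact: Cn1_cont.
 - exact: Cn1_cont_partial.
by apply/funext => x; exact: partialM.
Qed.

Lemma Cn1D f g : Cn 1 f -> Cn 1 g -> Cn 1 (fun x => f x + g x).
Proof.
move=> Cf Cg; apply: Cn1_intro.
- by apply: continuous_rVD; exact: Cn1_cont.
- by move=> i x; apply: (@derivableD _ _ _ f g); exact: Cn1_derivable.
move=> i; rewrite (_ : partial i _ = fun x => partial i f x + partial i g x).
 by apply: continuous_rVD; exact: Cn1_cont_partial.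
by apply/funext => x; exact: partialD.
Qed.

Lemma Cn1B f g : Cn 1 f -> Cn 1 g -> Cn 1 (fun x => f x - g x).
Proof.
move=> Cf Cg; apply: Cn1_intro.
- by apply: continuous_rVB; exact: Cn1_cont.
- by move=> i x; apply: (@derivableB _ _ _ f g); exact: Cn1_derivable.
move=> i; rewrite (_ : partial i _ = fun x => partial i f x - partial i g x).
 by apply: continuous_rVB; exact: Cn1_cont_partial.
by apply/funext => x; exact: partialB.
Qed.

Lemma Cn1_cst (c : R) : Cn 1 (fun _ : 'rV[R]_d => c).
Proof.
apply: Cn1_intro => [|i x|i]; first exact: cst_continuous.
 exact: derivable_cst.
rewrite (_ : partial i _ = cst 0); first exact: cst_continuous.
by apply/funext => x; rewrite /partial derive_cst.
Qed.

Lemma partial_cst (c : R) i x : partial i (fun _ : 'rV[R]_d => c) x = 0.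
Proof. by rewrite /partial derive_cst. Qed.

Lemma Cn1_sum (I : Type) (r : seq I) (F : I -> 'rV[R]_d -> R) :
 (forall a, Cn 1 (F a)) -> Cn 1 (fun x => \sum_(i <- r) F i x).
Proof.
move=> CF; elim: r => [|a r IH].
 by under eq_fun do rewrite big_nil; exact: Cn1_cst.
by under eq_fun do rewrite big_cons; exact: Cn1D.
Qed.

Lemma partial_sum (I : Type) (r : seq I) (F : I -> 'rV[R]_d -> R) k x :
 (forall a, Cn 1 (F a)) ->
 partial k (fun x => \sum_(i <- r) F i x) x = \sum_(i <- r) partial k (F i) x.
Proof.
move=> CF; elim: r => [|a r IH].
 rewrite big_nil (_ : (fun x => _) = fun=> 0) ?partial_cst//.
 by apply/funext => y; rewrite big_nil.
rewrite big_cons -IH -partialD//; last exact: Cn1_sum.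
by congr (partial k _ x); apply/funext => y; rewrite big_cons.
Qed.

Lemma csupp_bounded f : continuous f -> csupp f -> exists2 M, 0 <= M & forall x, `|f x| <= M.
Proof.
move=> cf [K [cK fK]].
have : bounded_set (f @` K).
 by apply: compact_bounded; apply: continuous_compact => //; exact: continuous_subspaceT.
move=> [M0 [_ HM]]; exists (`|M0| + 1); first by rewrite addr_ge0.
move=> x; have [Kx|nKx] := pselect (K x).
 have h : M0 < `|M0| + 1 by rewrite (le_lt_trans (ler_norm M0))// ltrDl.
 by apply: (HM _ h); exists x.
by rewrite fK// normr0 addr_ge0.
Qed.

Lemma csupp_partial f i : csupp f -> csupp (partial i f).
Proof.
move=> [K [cK fK]]; exists K; split => // x nKx.
have oK : open (~` K).
 by apply: closed_openC; apply: compact_closed => //; exact: norm_hausdorff.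
rewrite /partial -(derive_cst (0 : R) x (e_ i)); apply: near_eq_derive.
have : \forall y \near x, (~` K) y by exact: open_nbhs_nbhs.
by apply: filterS => y; exact: fK.
Qed.

Lemma csuppMl f g : csupp f -> csupp (fun x => f x * g x).
Proof. by move=> [K [cK fK]]; exists K; split => // x /fK ->; rewrite mul0r. Qed.

Lemma csuppMr f g : csupp g -> csupp (fun x => f x * g x).
Proof. by move=> [K [cK fK]]; exists K; split => // x /fK ->; rewrite mulr0. Qed.

Lemma csuppD f g : csupp f -> csupp g -> csupp (fun x => f x + g x).
Proof.
move=> [K [cK fK]] [K' [cK' gK]]; exists (K `|` K'); split; first exact: compactU.
by move=> x nK; rewrite fK ?gK ?addr0// => H; apply: nK; [right|left].
Qed.

Lemma csupp0 : csupp (fun=> 0). Proof. by exists set0; split => //; exact: compact0. Qed.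

Lemma csupp_sum (I : Type) (r : seq I) (F : I -> 'rV[R]_d -> R) :
 (forall a, csupp (F a)) -> csupp (fun x => \sum_(i <- r) F i x).
Proof.
move=> CF; elim: r => [|a r IH].
 by under eq_fun do rewrite big_nil; exact: csupp0.
by under eq_fun do rewrite big_cons; exact: csuppD.
Qed.

Lemma Cc_infty_partial f i : Cc_infty f -> Cc_infty (partial i f).
Proof. by move=> [Cf sf]; split; [move=> n; exact: Cn_partial|exact: csupp_partial]. Qed.

End calculus_rV.

Section gibbs_ibp.
Context {R} {d : nat}.
Variables (U : 'rV[R]_d -> R) (mu : rVlaw R d).
Hypotheses (CU : Cn 1 U) (gU : gibbs_measure U mu).
Local Notation e_ i := (delta_mx ord0 i : 'rV[R]_d).

Lemma intble_csupp f : continuous f -> csupp f -> intble mu f.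
Proof.
move=> cf sf; have [M _ fM] := csupp_bounded cf sf.
by apply: (intble_by mu M) => //; exact: cont_meas_rV.
Qed.

(** Translations along the axis are a quasi-invariant flow. On each line F times the weight has
    derivative (partial_i F - F partial_i U) times the weight, and [flow_balance] over unit time
    with F at both ends says that the integral of this derivative is 0. *)
Lemma gibbs_ibp F i : Cn 1 F -> csupp F ->
 \int[mu]_x partial i F x = \int[mu]_x (F x * partial i U x).
Proof.
move=> CF sF; have cU := Cn1_cont CU; have cF := Cn1_cont CF.
pose phi (r : R) (x : 'rV[R]_d) := x + r *: e_ i.
have mphi : mfunT (fun p : R * 'rV[R]_d => phi p.1 p.2) by exact: m_rV_line.
have mU := cont_meas_rV cU.
have qi (r : R) (G : 'rV[R]_d -> \bar R) : mfunT G -> (forall x, (0 <= G x)%E) ->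
  (\int[mu]_x (G (phi r x) * (flow_weight phi U r x)%:E) = \int[mu]_x G x)%E.
 by move=> mG G0; rewrite -(gibbs_quasi_inv cU gU (r *: e_ i) mG G0); apply: eq_integral => x _; rewrite /flow_weight -opprB.
pose g x := partial i F x - F x * partial i U x.
have cg : continuous g.
 by apply: continuous_rVB; [exact: Cn1_cont_partial|apply: continuous_rVM => //; exact: Cn1_cont_partial].
have sg : csupp g.
 rewrite (_ : g = (fun x => partial i F x + (F x * - partial i U x))); last first.
  by apply/funext => x; rewrite mulrN.
 by apply: csuppD; [exact: csupp_partial|exact: csuppMl].
have [M M0 gM] := csupp_bounded cg sg.
have mg := cont_meas_rV cg.
have iF := intble_csupp cF sF; have ig := intble_csupp cg sg.
have iM : intble mu (fun=> M).
 by apply: (intble_by mu `|M|).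
have mG : mfunT (fun p : R * 'rV[R]_d => g p.2) by exact: mcomp mg m_snd.
have := @flow_balance _ _ R mu phi U mphi mU qi F F (fun=> M) (fun p => g p.2) 1 ler01 mG iM iF iF (fun r x _ => gM x).
rewrite subrr => /(_ _)/esym E.
have : \int[lebesgue_measure]_(r in `[0, 1]) \int[mu]_x g x = 0 :> R.
 apply: E => x.
 pose p (r : R) := F (x + r *: e_ i) * flow_weight phi U r x.
 pose dp (r : R) := g (x + r *: e_ i) * flow_weight phi U r x.
 have cw : continuous (fun r => flow_weight phi U r x).
  move=> r; apply: (@continuous_comp _ _ _ (fun r => U x - U (phi r x)) expR r); last exact: continuous_expR.
  apply: cvgB; first exact: cvg_cst.
  by apply: (@continuous_comp _ _ _ (fun r => phi r x) U r); [exact: continuous_line|exact: cU].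
 have dpE (r : R) : 0 <= r <= 1 -> is_derive r (1 : R) p (dp r).
  move=> _; have d1 : is_derive r 1 (fun s : R => F (x + s *: e_ i)) (partial i F (x + r *: e_ i)).
   by apply: is_derive_line; exact: Cn1_derivable.
  have d2 : is_derive r 1 (fun s : R => U (x + s *: e_ i)) (partial i U (x + r *: e_ i)).
   by apply: is_derive_line; exact: Cn1_derivable.
  have d3 := is_deriveB (is_derive_cst (U x) r (1 : R)) d2.
  pose h : R -> R := cst (U x) - (fun s : R => U (x + s *: e_ i)).
  have d4 : is_derive r 1 (expR \o h) _ := is_derive1_comp (is_derive_expR (h r)) d3.
  have := is_deriveM d1 d4; congr is_derive.
  by rewrite /dp /g /flow_weight /GRing.scale/=; ring.
 have cdp (r : R) : 0 <= r <= 1 -> {for r, continuous dp}.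
  move=> _; apply: cvgM; last exact: cw.
  by apply: (@continuous_comp _ _ _ (fun r => phi r x) g r); [exact: continuous_line|exact: cg].
 have := Rintegral_FTC ler01 cdp dpE; rewrite /p /dp /phi => ->.
 by rewrite scale1r /flow_weight /phi scale0r addr0 subrr expR0 mulr1.
rewrite Rintegral_cst//= lebesgue_measure_itv/= lte_fin ltr01/= subr0 mulr1.
rewrite RintegralB//; last 2 first.
- by apply: intble_csupp; [exact: Cn1_cont_partial|exact: csupp_partial].
- apply: intble_csupp; last exact: csuppMl.
 by apply: continuous_rVM => //; exact: Cn1_cont_partial.
by move/eqP; rewrite subr_eq0 => /eqP.
Qed.
End gibbs_ibp.

(** * Bochner's formula and bounds with the weight partial_k U *)

Section bochner.
Context {R} {d : nat}.
Variables (U : 'rV[R]_d -> R) (mu : rVlaw R d).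
Hypotheses (C2 : Cn 2 U) (gU : gibbs_measure U mu).
Implicit Types (f g h phi psi : 'rV[R]_d -> R) (x : 'rV[R]_d) (i j k : 'I_d).
Let CU : Cn 1 U. Proof. exact: Cn_leS. Qed.

(** The nonnegative operator grad^* grad, with the adjoint taken in L^2(mu). *)
Definition dirichlet_op phi x : R := \sum_i (partial i U x * partial i phi x - partial i (partial i phi) x).
Local Notation Lam := dirichlet_op.

Lemma dirichlet_opE phi x : Lam phi x = - 2 * langevin U phi x.
Proof. by rewrite /Lam /langevin sumrB; field. Qed.
Let CpU i : Cn 1 (partial i U). Proof. exact: Cn_partial. Qed.
Let icont f : continuous f -> csupp f -> intble mu f.
Proof. exact: intble_csupp. Qed.

Lemma dirichlet_form phi psi : Cn 1 phi -> Cn 2 psi -> csupp psi ->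
 \int[mu]_x (phi x * Lam psi x) = \sum_i \int[mu]_x (partial i phi x * partial i psi x).
Proof.
move=> Cphi Cpsi spsi.
have Cp i : Cn 1 (partial i psi) by exact: Cn_partial.
have sp i : csupp (partial i psi) by exact: csupp_partial.
have i1 i : intble mu (fun x => phi x * partial i psi x * partial i U x).
 apply: icont; last by apply: csuppMl; exact: csuppMr.
 by apply: continuous_rVM; [apply: continuous_rVM|]; first [exact: Cn1_cont|exact: Cn1_cont_partial].
have i2 i : intble mu (fun x => phi x * partial i (partial i psi) x).
 apply: icont; last by apply: csuppMr; exact: csupp_partial.
 by apply: continuous_rVM; first [exact: Cn1_cont|exact: Cn1_cont_partial].
have i3 i : intble mu (fun x => partial i phi x * partial i psi x).
 apply: icont; last by apply: csuppMr.
 by apply: continuous_rVM; exact: Cn1_cont_partial || exact: Cn1_cont.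
transitivity (\sum_i \int[mu]_x (phi x * partial i psi x * partial i U x - phi x * partial i (partial i psi) x)).
 rewrite -Rintegral_bigsum//; last by move=> i _; exact: intble_sub.
 by apply: eq_Rintegral => x _; rewrite /Lam mulr_sumr; apply: eq_bigr => i _; ring.
apply: eq_bigr => i _; rewrite RintegralB//.
rewrite -(gibbs_ibp CU gU i (F := fun x => phi x * partial i psi x)); last 2 first.
- exact: Cn1M.
- exact: csuppMr.
under eq_Rintegral do rewrite partialM//.
by rewrite RintegralD// addrK.
Qed.

Lemma Cn1_dirichlet_op phi : Cc_infty phi -> Cn 1 (Lam phi).
Proof.
move=> [Cphi _]; apply: Cn1_sum => i; apply: Cn1B; last by do 2 apply: Cn_partial; exact: Cphi.
by apply: Cn1M => //; apply: Cn_partial; exact: Cphi.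
Qed.

Lemma csupp_dirichlet_op phi : csupp phi -> csupp (Lam phi).
Proof.
move=> sphi; apply: csupp_sum => i.
rewrite (_ : (fun x => _) = fun x => partial i U x * partial i phi x + (partial i (partial i phi) x) * -1).
 by apply: csuppD; [apply: csuppMr|apply: csuppMl]; do ?apply: csupp_partial.
by apply/funext => x; rewrite mulrN1.
Qed.

(** The commutator of a partial derivative with this operator is a row of the Hessian of U; this is
    where the convexity assumption will enter. *)
Lemma partial_dirichlet_op phi i x : Cc_infty phi ->
 partial i (Lam phi) x = Lam (partial i phi) x + \sum_j partial i (partial j U) x * partial j phi x.
Proof.
move=> [Cphi _].
have Cp j : Cn 1 (partial j phi) by apply: Cn_partial; exact: Cphi.
have Cpp j k : Cn 1 (partial j (partial k phi)) by do 2 apply: Cn_partial; exact: Cphi.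
rewrite /Lam partial_sum => [|j]; last by apply: Cn1B => //; exact: Cn1M.
rewrite -big_split/=; apply: eq_bigr => j _.
rewrite partialB//; last exact: Cn1M.
rewrite partialM//.
have Epc : partial i (partial j phi) = partial j (partial i phi).
 by apply/funext => y; apply: partial_comm; exact: (Cphi 2%N).
have -> : partial i (partial j (partial j phi)) x = partial j (partial j (partial i phi)) x.
 by rewrite -Epc; apply: partial_comm; apply: Cn_partial; exact: (Cphi 3%N).
rewrite Epc.
move: (partial i (partial j U) x * _) (partial j U x * _) (partial j (partial j _) x) => a b c; ring.
Qed.

Definition hess_sq phi x : R := \sum_i \sum_j partial j (partial i phi) x ^+ 2.

(** In the square of Lam phi one factor is integrated by parts and the derivative is commuted with
    Lam. The leading terms are the Dirichlet energies of the partial derivatives, which sum up to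
    the squared Hessian; the commutator is bounded below by [hU]. *)
Lemma bochner (c : R) phi : Cc_infty phi -> hessian_ge U (- c) ->
 \int[mu]_x hess_sq phi x <= \int[mu]_x (Lam phi x ^+ 2) + c * \int[mu]_x gradient_sq phi x.
Proof.
move=> Cphi hU; have [Cphi' sphi] := Cphi.
have Cp j : Cn 1 (partial j phi) by apply: Cn_partial; exact: Cphi'.
have sp j : csupp (partial j phi) by exact: csupp_partial.
have Cpp j k : Cn 1 (partial j (partial k phi)) by do 2 apply: Cn_partial; exact: Cphi'.
have spp j k : csupp (partial j (partial k phi)) by exact: csupp_partial.
have csum (F : 'I_d -> 'rV[R]_d -> R) : (forall i, continuous (F i)) -> continuous (fun x => \sum_i F i x).
 by move=> cF; exact: continuous_bigsum.
have cc := (Cn1_cont, Cn1_cont_partial).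
have iL i : intble mu (fun x => partial i phi x * Lam (partial i phi) x).
 apply: icont; last exact: csuppMl.
 apply: continuous_rVM; first exact: Cn1_cont.
 by apply: Cn1_cont; apply: Cn1_dirichlet_op; exact: Cc_infty_partial.
pose Hs i x := \sum_j partial i (partial j U) x * partial j phi x.
have cH i : continuous (Hs i).
 by apply: csum => j; apply: continuous_rVM; [exact: Cn1_cont_partial|exact: Cn1_cont].
have iH i : intble mu (fun x => partial i phi x * Hs i x).
 apply: icont; last exact: csuppMl.
 by apply: continuous_rVM => //; exact: Cn1_cont.
have ih i j : intble mu (fun x => partial j (partial i phi) x ^+ 2).
 under eq_fun do rewrite expr2.
 by apply: icont; [apply: continuous_rVM; exact: Cn1_cont|exact: csuppMl].
have ig : intble mu (gradient_sq phi).
 apply: intble_bigsum => // i _; rewrite (_ : (fun x => _) = fun x => partial i phi x * partial i phi x); last first.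
  by apply/funext => x; rewrite expr2.
 by apply: icont; [apply: continuous_rVM; exact: Cn1_cont|exact: csuppMl].
have E1 : \int[mu]_x (Lam phi x ^+ 2) =
  \sum_i \int[mu]_x (partial i phi x * Lam (partial i phi) x) + \sum_i \int[mu]_x (partial i phi x * Hs i x).
 transitivity (\int[mu]_x (Lam phi x * Lam phi x)); first by apply: eq_Rintegral => x _; rewrite expr2.
 transitivity (\sum_i \int[mu]_x (partial i (Lam phi) x * partial i phi x)).
  exact: (dirichlet_form (Cn1_dirichlet_op Cphi) (Cphi' 2%N) sphi).
 rewrite -big_split/=; apply: eq_bigr => i _; rewrite -RintegralD; [|exact: msT|exact: iL|exact: iH].
 by apply: eq_Rintegral => x _; rewrite partial_dirichlet_op// mulrC -mulrDr.
have E2 : \sum_i \int[mu]_x (partial i phi x * Lam (partial i phi) x) = \int[mu]_x hess_sq phi x.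
 have ih' i : intble mu (fun x => \sum_j partial j (partial i phi) x ^+ 2).
  exact: intble_bigsum.
 transitivity (\int[mu]_x \sum_i \sum_j partial j (partial i phi) x ^+ 2).
  rewrite Rintegral_bigsum//; apply: eq_bigr => i _.
  rewrite (dirichlet_form (Cp i) (Cn_partial i (Cphi' 3%N)) (sp i)) Rintegral_bigsum//.
 by [].
have E3 : - c * \int[mu]_x gradient_sq phi x <= \sum_i \int[mu]_x (partial i phi x * Hs i x).
 rewrite -RintegralZl// -Rintegral_bigsum//; apply: le_Rintegral => //.
 - exact: intble_cmul.
 - exact: intble_bigsum.
 move=> x _; have := hU x (\row_i partial i phi x).
 under eq_bigr do rewrite mxE; move=> /le_trans; apply.
 rewrite le_eqVlt; apply/orP; left; apply/eqP; apply: eq_bigr => i _.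
 by rewrite /Hs mulr_sumr; apply: eq_bigr => j _; rewrite !mxE mulrA.
by move: E3; rewrite E1 E2; lra.
Qed.

(** Integrate (partial_k U)^2 h^2 by parts, one factor partial_k U coming from the weight. The
    derivative falling on partial_k U gives at most L h^2. The cross term 2 partial_k U h partial_k
    h is at most half of the integrand plus 2 (partial_k h)^2, and the half is absorbed on the
    left. *)
Lemma gradient_weight_bound (L : R) k h : 0 <= L -> (forall x, partial k (partial k U) x <= L) ->
 Cn 1 h -> csupp h ->
 \int[mu]_x (partial k U x ^+ 2 * h x ^+ 2) <=
  4 * \int[mu]_x (partial k h x ^+ 2) + 2 * L * \int[mu]_x (h x ^+ 2).
Proof.
move=> L0 HL Ch sh.
have ch := Cn1_cont Ch; have cU := Cn1_cont (CpU k).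
have cph : continuous (partial k h) := Cn1_cont_partial Ch.
have cppU : continuous (partial k (partial k U)) := Cn1_cont_partial (CpU k).
pose F x := partial k U x * (h x * h x).
have Chh : Cn 1 (fun x => h x * h x) by exact: Cn1M.
have shh : csupp (fun x => h x * h x) by exact: csuppMl.
have i1 : intble mu (fun x => F x * partial k U x).
 apply: icont; last by apply: csuppMl; exact: csuppMr.
 by do ?apply: continuous_rVM.
have i2 : intble mu (fun x => h x ^+ 2).
 by under eq_fun do rewrite expr2; apply: icont => //; exact: Cn1_cont.
have i3 : intble mu (fun x => partial k h x ^+ 2).
 under eq_fun do rewrite expr2; apply: icont; first by apply: continuous_rVM.
 by apply: csuppMl; exact: csupp_partial.
have i4 : intble mu (partial k F).
 apply: icont; first by apply: Cn1_cont_partial; exact: Cn1M.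
 by apply: csupp_partial; exact: csuppMr.
have H : \int[mu]_x (F x * partial k U x) <=
  L * \int[mu]_x (h x ^+ 2) + (2^-1 * \int[mu]_x (F x * partial k U x) + 2 * \int[mu]_x (partial k h x ^+ 2)).
 rewrite -{1}(gibbs_ibp CU gU k (F := F)); [|exact: Cn1M|exact: csuppMr].
 rewrite -!RintegralZl//.
 have i5 : intble mu (fun x => 2^-1 * (F x * partial k U x)) by exact: intble_cmul.
 have i6 : intble mu (fun x => 2 * partial k h x ^+ 2) by exact: intble_cmul.
 have i7 : intble mu (fun x => L * h x ^+ 2) by exact: intble_cmul.
 rewrite -(RintegralD msT i5 i6).
 rewrite -(RintegralD msT i7 (intble_add msT i5 i6)).
 apply: le_Rintegral => //; first by apply: intble_add => //; exact: intble_add.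
 move=> x _; rewrite /F partialM// partialM//.
 have := HL x; have := sqr_ge0 (h x).
 have := sqr_ge0 (partial k U x * h x - 2 * partial k h x); nra.
have -> : \int[mu]_x (partial k U x ^+ 2 * h x ^+ 2) = \int[mu]_x (F x * partial k U x).
 by apply: eq_Rintegral => x _; rewrite /F; ring.
move: H; move: (\int[mu]_x (F x * partial k U x)) (\int[mu]_x (partial k h x ^+ 2)) (\int[mu]_x (h x ^+ 2)) => I A B.
lra.
Qed.

(* x |-> max(x, 0)^2 is C^1 with derivative 2 max(x, 0). *)
Lemma is_derive_pos_sq (x : R) : is_derive x 1 (fun y : R => Num.max y 0 ^+ 2) (2 * Num.max x 0).
Proof.
have K (h : R) : `|Num.max (h + x) 0 ^+ 2 - Num.max x 0 ^+ 2 - 2 * Num.max x 0 * h| <= h ^+ 2.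
 rewrite ler_norml; apply/andP; case: (leP x 0) => x0; case: (leP (h + x) 0) => h0; split; nra.
have L : h^-1 *: (Num.max (h *: (1 : R) + x) 0 ^+ 2 - Num.max x 0 ^+ 2) @[h --> 0^'] --> 2 * Num.max x 0.
 apply/cvgrPdist_le => e e0; near=> h.
 have hn0 : h != 0 by near: h; exact: nbhs_dnbhs_neq.
 have -> : h *: (1 : R) = h by exact: mulr1.
 rewrite distrC -(mulfK hn0 (2 * Num.max x 0)) -[_ *: _]mulrC -mulrBl normrM normfV.
 rewrite ler_pdivrMr ?normr_gt0// (le_trans (K h))//.
 have -> : h ^+ 2 = `|h| * `|h| by rewrite -normrM -expr2 ger0_norm ?sqr_ge0.
 rewrite ler_wpM2r//.
 by near: h; apply: dnbhs0_le.
by apply: DeriveDef; [apply/cvg_ex; exists (2 * Num.max x 0)|apply: cvg_lim].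
Unshelve. all: by end_near. Qed.

Lemma is_derive_from_line f x v (df : R) :
 is_derive (0 : R) 1 (fun s => f (x + s *: v)) df -> is_derive x v f df.
Proof.
have E : (fun h : R => h^-1 *: (f (x + (h *: (1 : R) + 0) *: v) - f (x + 0 *: v))) =
     (fun h : R => h^-1 *: (f (h *: v + x) - f x)).
 apply/funext => h; have -> : h *: (1 : R) + 0 = h by rewrite addr0; exact: mulr1.
 by rewrite scale0r addr0 [x + _]addrC.
by move=> [d1 d2]; apply: DeriveDef; [rewrite /derivable -E|rewrite /derive -E].
Qed.

(** Squaring the positive part removes its kink, so the function is C^1, with compact support and
    explicit derivatives; it increases to 1 with n. *)
Definition cutoff (n : nat) x : R := Num.max (1 - (\sum_i x ord0 i ^+ 2) / n.+1%:R ^+ 2) 0 ^+ 2.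
Let rho n x : R := 1 - (\sum_i x ord0 i ^+ 2) / n.+1%:R ^+ 2.

Lemma is_derive_cutoff n x k : is_derive x (delta_mx ord0 k) (cutoff n)
 (2 * Num.max (rho n x) 0 * (- (2 * x ord0 k) / n.+1%:R ^+ 2)).
Proof.
apply: is_derive_from_line.
have E (s : R) : rho n (x + s *: delta_mx ord0 k) = rho n x - (2 * x ord0 k * s + s * s) / n.+1%:R ^+ 2.
 rewrite /rho (bigD1 k)//= [in RHS](bigD1 k)//= !mxE !eqxx mulr1.
 have -> : \sum_(i | i != k) (x + s *: delta_mx ord0 k) ord0 i ^+ 2 = \sum_(i | i != k) x ord0 i ^+ 2.
  by apply: eq_bigr => i /negbTE ik; rewrite !mxE ik andbF mulr0 addr0.
 by move: (\sum_(i | _) _) (x ord0 k) (n.+1%:R ^+ 2)^-1 => S y a; ring.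
pose a : R := (n.+1%:R ^+ 2)^-1; pose b := 2 * x ord0 k.
have dr : is_derive (0 : R) 1 (fun s : R => rho n x - (b * s + s * s) * a) (- (b * a)).
 have d1 := @is_derive_id R R (0 : R) (1 : R).
 have d2 := is_deriveM (is_derive_cst b (0 : R) (1 : R)) d1.
 have d3 := is_deriveM d1 d1.
 have d4 := is_deriveM (is_deriveD d2 d3) (is_derive_cst a (0:R) (1:R)).
 have d5 := is_deriveB (is_derive_cst (rho n x) (0 : R) (1 : R)) d4.
 have := d5; congr is_derive.
 by rewrite /GRing.scale/= /cst; ring.
pose g (s : R) := rho n x - (b * s + s * s) * a.
have g0 : g 0 = rho n x by rewrite /g; ring.
have := is_derive1_comp (is_derive_pos_sq (g 0)) dr.
rewrite g0; congr is_derive; first by apply/funext => s; rewrite /cutoff /= -/(rho n _) E.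
by rewrite /b /a mulNr.
Qed.

Lemma csupp_cutoff n : csupp (cutoff n).
Proof.
pose B := [set x : 'rV[R]_d | forall i, `[- n.+1%:R, n.+1%:R]%classic (x ord0 i)].
exists B; split.
 have := @rV_compact R d (fun i => `[- n.+1%:R, n.+1%:R]%classic) (fun i => @segment_compact R _ _).
 by congr compact.
move=> x nB; rewrite /cutoff -/(rho n x) max_r ?expr0n//.
rewrite leNgt; apply/negP => r0; apply: nB => i; rewrite /= in_itv/= -ler_norml.
rewrite leNgt; apply/negP => xn; move: r0; rewrite ltNge => /negP; apply.
rewrite /rho subr_le0 ler_pdivlMr ?exprn_gt0// mul1r (bigD1 i)//=.
rewrite (@le_trans _ _ (x ord0 i ^+ 2))//; last by rewrite lerDl; apply: sumr_ge0 => j _; exact: sqr_ge0.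
by rewrite -[leRHS]ger0_norm ?sqr_ge0// normrX lerXn2r ?nnegrE// ltW.
Qed.

Lemma Cn1_cutoff n : Cn 1 (cutoff n).
Proof.
have cr : continuous (rho n).
 apply: continuous_rVB; first exact: cst_continuous.
 apply: continuous_rVM; last exact: cst_continuous.
 by apply: continuous_bigsum => i; under eq_fun do rewrite expr2; apply: continuous_rVM; exact: coord_continuous.
have cm : continuous (fun x => Num.max (rho n x) 0).
 by move=> x; apply: (@continuous_max _ _ (rho n) (fun=> 0)); [exact: cr|exact: cst_continuous].
apply: Cn1_intro.
- rewrite (_ : cutoff n = fun x => Num.max (rho n x) 0 * Num.max (rho n x) 0); first exact: continuous_rVM.
 by apply/funext => x; rewrite -expr2.
- by move=> i x; case: (is_derive_cutoff n x i).
move=> i; rewrite (_ : partial i _ = fun x => 2 * Num.max (rho n x) 0 * ((2 * x ord0 i) * - (n.+1%:R ^+ 2)^-1)); last first.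
 by apply/funext => x; rewrite /partial; have [_ ->] := is_derive_cutoff n x i; congr (_ * _); rewrite mulNr mulrN.
apply: continuous_rVM.
 by apply: continuous_rVM => //; exact: cst_continuous.
apply: continuous_rVM; last exact: cst_continuous.
apply: continuous_rVM; [exact: cst_continuous|exact: coord_continuous].
Qed.

Lemma cutoff01 n x : 0 <= cutoff n x <= 1.
Proof.
rewrite /cutoff sqr_ge0/= exprn_ile1 ?le_max ?lexx ?orbT// ge_max ler01 andbT.
by rewrite lerBlDr lerDl divr_ge0 ?sqr_ge0//; apply: sumr_ge0 => i _; exact: sqr_ge0.
Qed.

(** Where the cutoff does not vanish, |x_k| <= n + 1, hence |x_k| / (n + 1)^2 <= 1 for every n. *)
Lemma partial_cutoff_le n k x : `|partial k (cutoff n) x| <= 4.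
Proof.
rewrite /partial; have [_ ->] := is_derive_cutoff n x k.
have [r0|r0] := leP (rho n x) 0; first by rewrite mulr0 mul0r normr0.
have N1 : (1 : R) <= n.+1%:R by rewrite ler1n.
have N0 : (0 : R) < n.+1%:R ^+ 2 by rewrite exprn_gt0.
have S0 i : 0 <= x ord0 i ^+ 2 by exact: sqr_ge0.
have r1 : rho n x <= 1 by rewrite /rho lerBlDr lerDl divr_ge0 ?sqr_ge0//; apply: sumr_ge0.
have xk : x ord0 k ^+ 2 <= n.+1%:R ^+ 2.
 move: r0; rewrite /rho subr_gt0 ltr_pdivrMr// mul1r => /ltW; apply: le_trans.
 by rewrite (bigD1 k)//= lerDl; apply: sumr_ge0.
have xk' : `|x ord0 k| <= n.+1%:R.
 by rewrite -(ler_pXn2r (n := 2))// ?nnegrE// -normrX ger0_norm.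
have xN : `|x ord0 k| / n.+1%:R ^+ 2 <= 1.
 by rewrite ler_pdivrMr// mul1r (le_trans xk')// expr2 ler_peMl// ler0n.
rewrite normrM [`|_ * rho n x|]normrM [`|- _ / _|]normrM normrN [`|2 * x _ _|]normrM normfV.
rewrite (ger0_norm (ltW r0)) (ger0_norm (ltW N0)) (ger0_norm (ler0n R 2)).
have h0 : 0 <= `|x ord0 k| / n.+1%:R ^+ 2 by rewrite divr_ge0// ltW.
rewrite -[2 * `|_| / _]mulrA; move: h0 xN r0 r1; move: (`|x ord0 k| / _) (rho n x) => a b; nra.
Qed.

(** On the set 2 |x|^2 <= (n + 1)^2 the cutoff is at least 1/4 and its square at least 1/16, so the
    integral of [f] over this set is at most 16 C; these sets exhaust the space. *)
Lemma intble_cutoff f (C : R) : continuous f -> (forall x, 0 <= f x) ->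
 (forall n, \int[mu]_x (f x * cutoff n x ^+ 2) <= C) -> intble mu f.
Proof.
move=> cf f0 fC.
have mf : mfunT f by exact: cont_meas_rV.
have cS : continuous (fun x : 'rV[R]_d => \sum_i x ord0 i ^+ 2).
 by apply: continuous_bigsum => i; under eq_fun do rewrite expr2; apply: continuous_rVM; exact: coord_continuous.
pose A n := [set x : 'rV[R]_d | 2 * (\sum_i x ord0 i ^+ 2) <= n.+1%:R ^+ 2].
have mA n : measurable (A n).
 have mS : mfunT (fun x : 'rV[R]_d => 2 * (\sum_i x ord0 i ^+ 2)).
  by apply: mfunM => //; exact: cont_meas_rV.
 have := measurable_fun_ler mS (m_cst (n.+1%:R ^+ 2 : R)) msT (Y := [set true]).
 by rewrite setTI; apply.
have HA n : (\int[mu]_(x in A n) (f x)%:E <= (16 * C)%:E)%E.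
 have cc := Cn1_cont (Cn1_cutoff n); have sc := csupp_cutoff n.
 have i1 : intble mu (fun x => f x * cutoff n x ^+ 2).
  rewrite (_ : (fun x => _) = fun x => f x * (cutoff n x * cutoff n x)); last first.
   by apply/funext => x; rewrite expr2.
  apply: icont; last by apply: csuppMr; exact: csuppMl.
  by apply: continuous_rVM => //; exact: continuous_rVM.
 have i2 := intble_cmul msT 16 i1.
 have [mi2 _] := integrableP _ _ _ i2.
 apply: (@le_trans _ _ (\int[mu]_(x in A n) (16 * (f x * cutoff n x ^+ 2))%:E)%E).
  apply: ge0_le_integral => //.
  - by move=> x _; rewrite lee_fin.
  - by apply: measurable_funTS; exact/mEFinP.
  - exact: measurable_funTS.
  move=> x Ax; rewrite lee_fin.
  have c4 : 1 <= 4 * cutoff n x.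
   have N0 : (0 : R) < n.+1%:R ^+ 2 by rewrite exprn_gt0.
   have r2 : 2^-1 <= rho n x.
    have : (\sum_i x ord0 i ^+ 2) / n.+1%:R ^+ 2 <= 2^-1.
     rewrite ler_pdivrMr//; have : 2 * (\sum_i x ord0 i ^+ 2) <= n.+1%:R ^+ 2 := Ax.
     by move: (\sum_i _) (n.+1%:R ^+ 2) => S N; lra.
    move=> h; rewrite /rho lerBrDr; apply: le_trans (lerD (lexx _) h) _.
    by rewrite -[2^-1]mul1r -splitr.
   rewrite /cutoff -/(rho n x) max_l; last by apply: le_trans r2.
   by move: (rho n x) r2 => r; nra.
  have c16 : 1 <= 16 * cutoff n x ^+ 2 by move: (cutoff n x) c4 => c; nra.
  by rewrite mulrCA ler_peMr.
 apply: (@le_trans _ _ (\int[mu]_x (16 * (f x * cutoff n x ^+ 2))%:E)%E).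
  apply: ge0_subset_integral => //.
  by move=> x _; rewrite lee_fin; apply: mulr_ge0 => //; apply: mulr_ge0 => //; exact: sqr_ge0.
 rewrite -(fineK (integral_fune_fin_num msT i2)) lee_fin.
 change (\int[mu]_x (16 * (f x * cutoff n x ^+ 2)) <= 16 * C).
 by rewrite RintegralZl// ler_wpM2l.
apply/integrableP; split; first exact/mEFinP.
apply: (@le_lt_trans _ _ (16 * C)%:E); last exact: ltry.
have UA : \bigcup_n A n = setT.
 apply/seteqP; split => // x _; pose s := 2 * (\sum_i x ord0 i ^+ 2).
 exists (Num.trunc (Num.max 0 s)) => //; rewrite /A /= -/s.
 have h : s <= (Num.trunc (Num.max 0 s)).+1%:R.
  by apply: le_trans (ltW (truncnS_gt _)); rewrite le_max lexx orbT.
 by rewrite (le_trans h)// expr2 ler_peMl// ler1n.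
have ndA : nondecreasing_seq A.
 move=> p q pq; apply/subsetPset => x; rewrite /A/= => /le_trans; apply.
 by rewrite lerXn2r ?nnegrE// ler_nat ltnS.
under eq_integral do rewrite /= ger0_norm//.
rewrite -UA.
have mf' n : measurable_fun (A n) (fun x => (f x)%:E).
 by apply: measurable_funTS; exact/mEFinP.
have f0' n x : A n x -> (0 <= (f x)%:E)%E by rewrite lee_fin.
have cv := ge0_nondecreasing_set_cvg_integral (mu := mu) ndA mA mf' f0'.
rewrite -(cvg_lim _ cv)//; apply: lime_le; last by apply: nearW.
by apply/cvg_ex; eexists; exact: cv.
Qed.

Lemma Rintegral_le_bounded f (M : R) : mfunT f -> (forall x, `|f x| <= M) -> \int[mu]_x f x <= M.
Proof.
move=> mf fM; rewrite -[leRHS](Rintegral_cst_prob mu); apply: le_Rintegral => //.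
- exact: (intble_by mu M).
- by apply: (intble_by mu `|M|).
- by move=> x _; exact: le_trans (ler_norm _) (fM x).
Qed.

(** [gradient_weight_bound] with h the cutoff itself: its derivatives are at most 4 and its values
    at most 1, uniformly in n. *)
Lemma partial_inL2 (L : R) k : 0 <= L -> (forall x, partial k (partial k U) x <= L) ->
 intble mu (fun x => partial k U x ^+ 2).
Proof.
move=> L0 HL; have cU := Cn1_cont (CpU k).
apply: (@intble_cutoff _ (4 * 16 + 2 * L * 1)).
- by under eq_fun do rewrite expr2; exact: continuous_rVM.
- by move=> x; exact: sqr_ge0.
move=> n; have Cc := Cn1_cutoff n; have cc := Cn1_cont Cc.
apply: le_trans (gradient_weight_bound L0 HL Cc (csupp_cutoff n)) _; apply: lerD; apply: ler_wpM2l => //.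
- apply: Rintegral_le_bounded.
  by apply: mfunX; apply: cont_meas_rV; exact: Cn1_cont_partial.
 move=> x; rewrite normrX; have := partial_cutoff_le n k x; have := normr_ge0 (partial k (cutoff n) x); nra.
- by rewrite mulr_ge0.
- apply: Rintegral_le_bounded; first by apply: mfunX; exact: cont_meas_rV.
 by move=> x; case/andP: (cutoff01 n x) => c0 c1; rewrite normrX ger0_norm// exprn_ile1.
Qed.

End bochner.

(** All that the estimates use about kappa: flip symmetry, unit variances, and fourth-order moments
    controlled by one number omega, which is 3 for the Gaussian and the hypercube and d for the
    axes. The last clause bounds the covariance matrix of the squares v_k^2. Integrals are extended,
    so that finiteness is part of the statement. *)
Definition velocity_law R d (kappa : rVlaw R d) (omega : R) : Prop :=
 [/\ forall (k : 'I_d) (F : 'rV[R]_d -> \bar R), mfunT F -> (forall v, (0 <= F v)%E) ->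
    (\int[kappa]_v F (flip k v) = \int[kappa]_v F v)%E,
   forall k, (\int[kappa]_v (v ord0 k ^+ 2)%:E = 1)%E,
   forall k, (\int[kappa]_v (v ord0 k ^+ 4)%:E <= (2 * omega)%:E)%E,
   forall i j, i != j -> (\int[kappa]_v (v ord0 i ^+ 2 * v ord0 j ^+ 2)%:E <= omega%:E)%E &
   forall a : 'I_d -> R,
    (\int[kappa]_v ((\sum_k a k * (v ord0 k ^+ 2 - 1)) ^+ 2)%:E <= (omega * \sum_k a k ^+ 2)%:E)%E].

(** * Moments of the velocity laws *)

Section uniform_on.
Context {R} {d : nat}.
Variables (I : finType) (p : I -> 'rV[R]_d) (kappa : rVlaw R d) (i0 : I).
Hypothesis kE : uniform_on p kappa.
Let N0 : (0 < #|I|)%N. Proof. by apply/card_gt0P; exists i0. Qed.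
Let m_ (n : nat) : {measure set 'rV[R]_d -> \bar R} := \d_(p (nth i0 (enum I) n)).

Lemma ge0_integral_uniform_on (F : 'rV[R]_d -> \bar R) : mfunT F -> (forall v, (0 <= F v)%E) ->
 (\int[kappa]_v F v = (#|I|%:R^-1)%:E * \sum_i F (p i))%E.
Proof.
move=> mF F0.
have c0 : 0 <= (#|I|%:R^-1 : R) by rewrite invr_ge0.
have esum (g : I -> \bar R) : (\sum_(n < #|I|) g (nth i0 (enum I) n) = \sum_i g i)%E.
 by rewrite -[RHS]big_enum (big_nth i0) -cardE big_mkord.
rewrite (@eq_measure_integral _ _ _ _ (mscale (NngNum c0) (msum m_ #|I|))).
 rewrite ge0_integral_mscale//; congr (_ * _)%E.
 rewrite ge0_integral_measure_sum// -esum; apply: eq_bigr => n _.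
 by rewrite /m_ integral_dirac// diracT mul1e.
move=> A mA _; apply: etrans (kE mA) _; rewrite /mscale/= /msum; congr (_ * _)%E.
exact/esym/(esum (fun i => \d_(p i) A)).
Qed.

Lemma integral_uniform_on (G : 'rV[R]_d -> R) : mfunT G -> (forall v, 0 <= G v) ->
 (\int[kappa]_v (G v)%:E = (#|I|%:R^-1 * \sum_i G (p i))%:E)%E.
Proof.
move=> mG G0; rewrite ge0_integral_uniform_on//; last exact/mEFinP.
by rewrite EFinM -sumEFin.
Qed.

Lemma integral_uniform_on_cst (G : 'rV[R]_d -> R) (c : R) : mfunT G -> (forall v, 0 <= G v) ->
 (forall i, G (p i) = c) -> (\int[kappa]_v (G v)%:E = c%:E)%E.
Proof.
move=> mG G0 Gc; rewrite integral_uniform_on//; congr EFin.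
rewrite (eq_bigr (fun=> c)) => [|i _]; last exact: Gc.
by rewrite sumr_const -[c *+ _]mulr_natl mulKf// pnatr_eq0 -lt0n.
Qed.

Lemma uniform_on_flip (tau : I -> I) k : involutive tau -> (forall i, p (tau i) = flip k (p i)) ->
 forall F : 'rV[R]_d -> \bar R, mfunT F -> (forall v, (0 <= F v)%E) ->
  (\int[kappa]_v F (flip k v) = \int[kappa]_v F v)%E.
Proof.
move=> tauK ptau F mF F0; rewrite !ge0_integral_uniform_on//; last first.
 exact: mcomp mF (m_flip k).
congr (_ * _)%E; rewrite [RHS](reindex_inj (inv_inj tauK)).
by apply: eq_bigr => i _; rewrite ptau.
Qed.

End uniform_on.

Section finite_laws.
Context {R} {d : nat}.
Implicit Type kappa : rVlaw R d.
Let mc k : mfunT (fun v : 'rV[R]_d => v ord0 k) := measurable_coord k.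
Let mpoly2 i j (a b : nat) : mfunT (fun v : 'rV[R]_d => v ord0 i ^+ a * v ord0 j ^+ b).
Proof. by apply: mfunM; apply: mfunX. Qed.
Let mdev (a : 'I_d -> R) : mfunT (fun v : 'rV[R]_d => (\sum_k a k * (v ord0 k ^+ 2 - 1)) ^+ 2).
Proof.
apply: mfunX; apply: measurable_sum => k; apply: mfunM => //.
by apply: mfunB => //; exact: mfunX.
Qed.

(** Every v_k^2 equals 1, so all fluctuations of the squares vanish, and flipping v_k is an
    involution of the index set. The value 3 is chosen to share a constant with the Gaussian. *)
Lemma hypercube_velocity_law kappa : uniform_hypercube kappa -> velocity_law kappa 3.
Proof.
move=> kE; pose s0 : {ffun 'I_d -> bool} := [ffun=> false].
have sq s k : ((-1) ^+ (s : {ffun 'I_d -> bool}) k : R) ^+ 2 = 1 by rewrite -exprM mulnC exprM sqrrN !expr1n.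
have p4 (x : R) : x ^+ 4 = (x ^+ 2) ^+ 2 by rewrite -exprM.
split.
- move=> k; pose tau (s : {ffun 'I_d -> bool}) : {ffun 'I_d -> bool} := [ffun i => (i == k) (+) s i].
 apply: (uniform_on_flip s0 kE (tau := tau)).
  by move=> s; apply/ffunP => i; rewrite !ffunE addKb.
 move=> s; apply/rowP => i; rewrite !mxE ffunE; case: (i == k) => //=.
 by rewrite -signrN.
- move=> k; apply: (integral_uniform_on_cst s0 kE).
 + exact: mfunX.
 + by move=> v; exact: sqr_ge0.
 + by move=> s; rewrite mxE.
- move=> k; rewrite (integral_uniform_on_cst s0 kE (c := 1)).
 + by rewrite lee_fin; lra.
 + exact: mfunX.
 + by move=> v; rewrite p4 sqr_ge0.
 + by move=> s; rewrite mxE p4 sq expr1n.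
- move=> i j _; rewrite (integral_uniform_on_cst s0 kE (c := 1)).
 + by rewrite lee_fin; lra.
 + exact: mpoly2.
 + by move=> v; rewrite mulr_ge0 ?sqr_ge0.
 + by move=> s; rewrite !mxE !sq mulr1.
- move=> a; rewrite (integral_uniform_on_cst s0 kE (c := 0)).
 + by rewrite lee_fin mulr_ge0// sumr_ge0// => k _; exact: sqr_ge0.
 + exact: mdev.
 + by move=> v; exact: sqr_ge0.
 + by move=> s; rewrite big1 ?expr0n// => k _; rewrite mxE sq subrr mulr0.
Qed.

(** One coordinate is nonzero and has square d, so the fourth moment of v_k is d^2 / d and mixed
    products vanish. In the last clause the polynomial equals d a_i - S on the axis i, with S the
    sum of the a_k, and its mean square is d times the sum of the a_k^2, minus S^2. *)
Lemma axes_velocity_law kappa : (0 < d)%N -> uniform_axes kappa -> velocity_law kappa d%:R.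
Proof.
move=> d0 kE; pose s0 : 'I_d * bool := (Ordinal d0, false).
have p4 (x : R) : x ^+ 4 = (x ^+ 2) ^+ 2 by rewrite -exprM.
pose p (s : 'I_d * bool) : 'rV[R]_d := ((-1) ^+ s.2 * Num.sqrt d%:R) *: delta_mx ord0 s.1.
have sq s k : p s ord0 k ^+ 2 = d%:R * (s.1 == k)%:R.
 rewrite /p !mxE eqxx/= !exprMn sqr_sqrtr// -exprM mulnC exprM sqrrN !expr1n mul1r eq_sym.
 by case: (_ == _); rewrite ?expr1n ?expr0n.
have dn0 : d%:R != 0 :> R by rewrite pnatr_eq0 -lt0n.
have avg (G : 'rV[R]_d -> R) (H : 'I_d -> R) : mfunT G -> (forall v, 0 <= G v) ->
  (forall s, G (p s) = H s.1) -> (\int[kappa]_v (G v)%:E = (d%:R^-1 * \sum_i H i)%:E)%E.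
 move=> mG G0 GH; rewrite (integral_uniform_on s0 kE)//; congr EFin.
 rewrite (eq_bigr (fun s : 'I_d * bool => H s.1)) => [|s _]; last exact: GH.
 rewrite -(pair_big predT predT (fun i (b : bool) => H i))/=.
 under eq_bigr do rewrite sumr_const card_bool.
 rewrite card_prod card_ord card_bool natrM; under eq_bigr do rewrite -mulr_natr.
 by rewrite -mulr_suml; move: (\sum_i _) => S; field; rewrite dn0.
have pick (c : R) k : \sum_(i < d) c * (i == k)%:R = c.
 by rewrite (bigD1 k)//= eqxx mulr1 big1 ?addr0// => i /negbTE ->; rewrite mulr0.
split.
- move=> k; pose tau (s : 'I_d * bool) : 'I_d * bool := (s.1, (s.1 == k) (+) s.2).
 apply: (uniform_on_flip s0 kE (tau := tau)).
  by move=> [i b]; rewrite /tau/= addKb.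
 move=> [i b]; apply/rowP => j; rewrite !mxE /tau/=.
 have [->|jk] := eqVneq j k; last first.
  case: (eqVneq j i) => [ji|_]; last by rewrite !mulr0.
  by rewrite -ji (negbTE jk).
 case: (eqVneq i k) => _; last by rewrite !mulr0 oppr0.
 by rewrite /= signrN !mulr1 mulNr.
- move=> k; rewrite (avg _ (fun i => d%:R * (i == k)%:R)).
 + by rewrite pick mulVf.
 + exact: mfunX.
 + by move=> v; exact: sqr_ge0.
 + by move=> s; rewrite sq.
- move=> k; rewrite (avg _ (fun i => d%:R ^+ 2 * (i == k)%:R)).
 + by rewrite pick expr2 mulKf// lee_fin mulr2n mulrDl !mul1r lerDl.
 + exact: mfunX.
 + by move=> v; rewrite p4 sqr_ge0.
 + by move=> s; rewrite p4 sq exprMn; case: (_ == _); rewrite ?expr1n ?expr0n.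
- move=> i j ij; rewrite (avg _ (fun=> 0)).
 + by rewrite sumr_const mul0rn mulr0 lee_fin.
 + exact: mpoly2.
 + by move=> v; rewrite mulr_ge0 ?sqr_ge0.
 + move=> s; rewrite !sq; have [->|] := eqVneq s.1 i; last by rewrite mulr0 mul0r.
  by rewrite (negbTE ij) !mulr0.
- move=> a; pose S := \sum_k a k; rewrite (avg _ (fun i => (d%:R * a i - S) ^+ 2)).
 + rewrite lee_fin.
  have -> : \sum_i (d%:R * a i - S) ^+ 2 = d%:R ^+ 2 * \sum_i a i ^+ 2 - d%:R * S ^+ 2.
   transitivity (\sum_i (d%:R ^+ 2 * a i ^+ 2 + - (2 * d%:R * S) * a i + S ^+ 2)).
    by apply: eq_bigr => i _; ring.
   by rewrite !big_split/= -!mulr_sumr -/S sumr_const card_ord -mulr_natl; ring.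
  by rewrite mulrBr !expr2 -mulrA mulKf// mulKf// gerBl -expr2 sqr_ge0.
 + exact: mdev.
 + by move=> v; exact: sqr_ge0.
 + move=> s; congr (_ ^+ 2); rewrite /S.
  transitivity (\sum_k (a k * d%:R * (s.1 == k)%:R - a k)).
   by apply: eq_bigr => k _; rewrite sq; ring.
  rewrite sumrB; congr (_ - _).
  rewrite (bigD1 s.1)//= eqxx mulr1 big1 ?addr0 1?mulrC// => i /negbTE.
  by rewrite eq_sym => ->; rewrite mulr0.
Qed.

End finite_laws.

Section ibp.
Context {R} {d : nat}.
Variables (U : 'rV[R]_d -> R) (mu : rVlaw R d).
Hypotheses (CU : Cn 1 U) (gU : gibbs_measure U mu).
Implicit Types (x : 'rV[R]_d) (F : 'rV[R]_d -> R).
Let sqn x : R := \sum_i x ord0 i ^+ 2.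
Let sqn_ge0 x : 0 <= sqn x. Proof. by apply: sumr_ge0 => i _; exact: sqr_ge0. Qed.
Let cvg0_harmonic (c : R) : (fun n => c * n.+1%:R^-1) @ \oo --> (0 : R).
Proof. by rewrite -(mulr0 c); apply: cvgMr; exact: cvg_harmonic. Qed.
Let inv_sq_le n : (n.+1%:R ^+ 2)^-1 <= n.+1%:R^-1 :> R.
Proof. by rewrite lef_pV2 ?posrE ?exprn_gt0// expr2 ler_peMr// ler1n. Qed.

Lemma cutoff_cvg x : (fun n => cutoff n x) @ \oo --> (1 : R).
Proof.
apply: (@squeeze_cvgr _ _ _ _ (fun n => 1 - (2 * sqn x) * n.+1%:R^-1) (fun=> 1)).
- apply: nearW => n; have /andP[c0 ->] := cutoff01 n x; rewrite andbT.
 rewrite /cutoff -/(sqn x); have := sqn_ge0 x; have := inv_sq_le n.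
 have : 0 <= (n.+1%:R ^+ 2)^-1 :> R by rewrite invr_ge0 sqr_ge0.
 move: (sqn x) (_^-1) (n.+1%:R^-1) => S a b a0 ab S0.
 have h : S * a <= S * b by rewrite ler_wpM2l.
 have : 0 <= S * a by exact: mulr_ge0.
 by rewrite -mulrA; move: (S * a) (S * b) h => p q pq p0; case: (leP (1 - p) 0) => ?; nra.
- by rewrite -[X in _ --> X]subr0; apply: cvgB; [exact: cvg_cst|exact: cvg0_harmonic].
- exact: cvg_cst.
Qed.

Lemma partial_cutoff_cvg i x : (fun n => partial i (cutoff n) x) @ \oo --> (0 : R).
Proof.
apply: norm_cvg0.
apply: (@squeeze_cvgr _ _ _ _ (fun=> 0) (fun n => (4 * `|x ord0 i|) * n.+1%:R^-1)).
- apply: nearW => n; rewrite normr_ge0/= /partial; have [_ ->] := is_derive_cutoff n x i.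
 rewrite -/(sqn x); have := sqn_ge0 x; have := inv_sq_le n.
 have : 0 <= (n.+1%:R ^+ 2)^-1 :> R by rewrite invr_ge0 sqr_ge0.
 rewrite normrM [`|- _ / _|]normrM normrN !normrM (ger0_norm (ler0n R 2)).
 move: (sqn x) (_^-1) (n.+1%:R^-1) (normr_ge0 (x ord0 i)) => S a b; move: `|x ord0 i| => y y0 a0 ab S0.
 have m0 : 0 <= Num.max (1 - S * a) 0 by rewrite le_max lexx orbT.
 have m1 : Num.max (1 - S * a) 0 <= 1 by rewrite ge_max ler01 andbT lerBlDr lerDl mulr_ge0.
 rewrite (ger0_norm m0) (ger0_norm a0).
 have h : 2 * y * a <= 2 * y * b by rewrite ler_wpM2l// mulr_ge0.
 have h0 : 0 <= 2 * y * a by rewrite !mulr_ge0.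
 move: (Num.max _ _) m0 m1 => M M0 M1.
 have -> : 4 * y * b = 2 * (2 * y * b) by ring.
 by move: (2 * y * a) (2 * y * b) h h0 => p q pq p0; nra.
- exact: cvg_cst.
- exact: cvg0_harmonic.
Qed.

(** The factor x_k is compensated by the support of the cutoff. This uniform bound is what allows
    v_k times the cutoff as a test function for the fourth Gaussian moment. *)
Lemma coord_partial_cutoff_le n k x : `|x ord0 k * partial k (cutoff n) x| <= 4.
Proof.
rewrite /partial; have [_ ->] := is_derive_cutoff n x k; rewrite -/(sqn x).
have N0 : (0 : R) < n.+1%:R ^+ 2 by rewrite exprn_gt0.
have Sx : x ord0 k ^+ 2 <= sqn x.
 by rewrite /sqn (bigD1 k)//= lerDl; apply: sumr_ge0 => i _; exact: sqr_ge0.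
have -> : x ord0 k * (2 * Num.max (1 - sqn x / n.+1%:R ^+ 2) 0 * (- (2 * x ord0 k) / n.+1%:R ^+ 2)) =
  - (4 * Num.max (1 - sqn x / n.+1%:R ^+ 2) 0 * (x ord0 k ^+ 2 / n.+1%:R ^+ 2)) by ring.
have : x ord0 k ^+ 2 / n.+1%:R ^+ 2 <= sqn x / n.+1%:R ^+ 2 by rewrite ler_pM2r// invr_gt0.
have : 0 <= x ord0 k ^+ 2 / n.+1%:R ^+ 2 by rewrite divr_ge0 ?sqr_ge0// ltW.
rewrite normrN; move: (_ / _) (_ / _) => b a a0 ab.
case: (leP (1 - b) 0) => b1; first by rewrite mulr0 mul0r normr0.
by rewrite ger0_norm; nra.
Qed.

(** [gibbs_ibp] for F times the cutoff, and dominated convergence: the derivatives of the cutoff are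
    bounded by 4 and tend to 0. *)
Lemma gibbs_ibp_integrable F i : Cn 1 F -> intble mu F ->
 intble mu (partial i F) ->
 intble mu (fun x => F x * partial i U x) ->
 \int[mu]_x partial i F x = \int[mu]_x (F x * partial i U x).
Proof.
move=> CF iF ipF iFU.
have mF := cont_meas_rV (Cn1_cont CF).
have mpF := cont_meas_rV (@Cn1_cont_partial _ _ _ i CF).
have mpU := cont_meas_rV (@Cn1_cont_partial _ _ _ i CU).
have mc n : mfunT (cutoff n : 'rV[R]_d -> R).
 exact: cont_meas_rV (Cn1_cont (Cn1_cutoff n)).
have mpc n : mfunT (partial i (cutoff n : 'rV[R]_d -> R)).
 exact: cont_meas_rV (Cn1_cont_partial (Cn1_cutoff n)).
have L : (fun n => \int[mu]_x (partial i F x * cutoff n x + F x * partial i (cutoff n) x)) @ \oo -->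
  \int[mu]_x partial i F x.
 apply: (@Rintegral_dominated_cvg _ _ _ _ _ _ _ (fun x => `|partial i F x| + 4 * `|F x|)) => //.
 - by move=> n; apply: mfunD; exact: mfunM.
 - apply: aeW => x _; rewrite -[X in _ --> X]addr0; apply: cvgD.
   by rewrite -[X in _ --> X]mulr1; apply: cvgMr; exact: cutoff_cvg.
  by rewrite -(mulr0 (F x)); apply: cvgMr; exact: partial_cutoff_cvg.
 - apply: intble_add => //; first exact: integrable_norm.
  by apply: intble_cmul => //; exact: integrable_norm.
 - move=> n x _; rewrite (le_trans (ler_normD _ _))// lerD// normrM.
   by have /andP[c0 c1] := cutoff01 n x; rewrite (ger0_norm c0) ler_piMr.
  by rewrite mulrC ler_wpM2r// partial_cutoff_le.
have L' : (fun n => \int[mu]_x (F x * partial i U x * cutoff n x)) @ \oo --> \int[mu]_x (F x * partial i U x).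
 apply: (@Rintegral_dominated_cvg _ _ _ _ _ _ _ (fun x => `|F x * partial i U x|)) => //.
 - by move=> n; apply: mfunM => //; exact: mfunM.
 - exact: mfunM.
 - by apply: aeW => x _; rewrite -[X in _ --> X]mulr1; apply: cvgMr; exact: cutoff_cvg.
 - exact: integrable_norm.
 - by move=> n x _; rewrite normrM; have /andP[c0 c1] := cutoff01 n x; rewrite (ger0_norm c0) ler_piMr.
suff E : (fun n => \int[mu]_x (partial i F x * cutoff n x + F x * partial i (cutoff n) x)) =
  (fun n => \int[mu]_x (F x * partial i U x * cutoff n x)).
 by rewrite E in L; exact: (cvg_unique _ L L').
apply/funext => n.
have := gibbs_ibp CU gU i (F := fun x => F x * cutoff n x) (Cn1M CF (Cn1_cutoff n)) (csuppMr _ (csupp_cutoff n)).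
under eq_Rintegral => x _ do rewrite (partialM i x CF (Cn1_cutoff n)).
by move=> ->; apply: eq_Rintegral => x _; rewrite mulrAC.
Qed.

End ibp.

Section gaussian.
Context {R} {d : nat}.
Variable kappa : rVlaw R d.
Hypothesis gk : standard_gaussian kappa.
Implicit Types (v : 'rV[R]_d) (i j k : 'I_d).

Lemma is_derive_coord i k v : is_derive v (delta_mx ord0 i) (fun w : 'rV[R]_d => w ord0 k) (i == k)%:R.
Proof.
apply: is_derive_from_line.
have d1 := is_derive_id (0 : R) (1 : R).
have d2 := is_deriveM d1 (is_derive_cst ((i == k)%:R : R) (0 : R) (1 : R)).
have := is_deriveD (is_derive_cst (v ord0 k) (0 : R) (1 : R)) d2; congr is_derive.
 by apply/funext => s; rewrite /= !mxE eqxx/= [k == i]eq_sym.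
by rewrite /GRing.scale/= /cst; ring.
Qed.

Lemma partial_coord i k v : partial i (fun w : 'rV[R]_d => w ord0 k) v = (i == k)%:R.
Proof. by rewrite /partial; case: (is_derive_coord i k v). Qed.

Lemma Cn1_coord k : Cn 1 (fun w : 'rV[R]_d => w ord0 k).
Proof.
apply: Cn1_intro; first exact: coord_continuous.
- by move=> i x; case: (is_derive_coord i k x).
- by move=> i; rewrite (_ : partial i _ = fun=> (i == k)%:R); [exact: cst_continuous|apply/funext => x; exact: partial_coord].
Qed.
Let Q v : R := \sum_i 2^-1 * (v ord0 i * v ord0 i).
Let CQ1 : Cn 1 Q.
Proof. by apply: Cn1_sum => i; apply: Cn1M; [exact: Cn1_cst|apply: Cn1M; exact: Cn1_coord]. Qed.
Let pQ i : partial i Q = fun v => v ord0 i.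
Proof.
apply/funext => v; have C k : Cn 1 (fun w : 'rV[R]_d => w ord0 k * w ord0 k) by apply: Cn1M; exact: Cn1_coord.
rewrite /Q partial_sum => [|k]; last by apply: Cn1M; [exact: Cn1_cst|exact: C].
rewrite (bigD1 i)//= big1 => [|k ki].
 rewrite partialM//; [rewrite partial_cst partialM; [|exact: Cn1_coord..]|exact: Cn1_cst].
 by rewrite partial_coord eqxx /=; field.
rewrite partialM//; [rewrite partial_cst partialM; [|exact: Cn1_coord..]|exact: Cn1_cst].
by rewrite partial_coord eq_sym (negbTE ki) /=; ring.
Qed.
Let CQ : Cn 2 Q.
Proof.
split; first exact: Cn1_cont.
by move=> i; split; [move=> x; exact: Cn1_derivable|rewrite pQ; exact: Cn1_coord].
Qed.
Let pdfE v : \prod_i normal_pdf 0 1 (v ord0 i) = normal_peak 1 ^+ d * expR (- Q v) :> R.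
Proof.
have -> : normal_peak 1 ^+ d = \prod_(i < d) normal_peak 1 :> R by rewrite prodr_const card_ord.
rewrite /Q -sumrN expR_sum -big_split/=; apply: eq_bigr => i _.
rewrite normal_pdfE ?oner_eq0//; congr (_ * expR _).
by rewrite subr0 expr1n; field.
Qed.
Let peak0 : 0 < (normal_peak 1 ^+ d : R).
Proof. by rewrite exprn_gt0// normal_peak_gt0 ?oner_eq0. Qed.
Let mQ : mfunT (fun v => expR (- Q v)).
Proof.
apply: mcomp => //; apply: mcomp => //.
exact: cont_meas_rV (Cn1_cont CQ1).
Qed.
Let kappaE A : measurable A -> kappa A = ((normal_peak 1 ^+ d)%:E * \int[lebesgue_rV d]_(v in A) (expR (- Q v))%:E)%E.
Proof.
move=> mA; rewrite gk//; under eq_integral do rewrite pdfE EFinM.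
rewrite ge0_integralZl//.
- by apply: measurable_funTS; exact/mEFinP.
- by rewrite lee_fin ltW.
Qed.

(** The Gaussian is the Gibbs measure of |v|^2 / 2, so its moments come from the integration by
    parts already proved for mu, with partial_k of the potential equal to v_k. If exp(- |v|^2 / 2)
    had infinite integral, the total mass of kappa would be infinite. *)
Lemma gaussian_gibbs : gibbs_measure Q kappa.
Proof.
split; last by exists (normal_peak 1 ^+ d) => A mA; exact: kappaE.
rewrite ltNge leye_eq; apply/negP => /eqP E.
have := kappaE msT; rewrite E probability_setT gt0_muley ?lte_fin//.
Qed.
Let mc k : mfunT (fun v : 'rV[R]_d => v ord0 k) := measurable_coord k.

Lemma gaussian_flip k (F : 'rV[R]_d -> \bar R) : mfunT F -> (forall v, (0 <= F v)%E) ->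
 (\int[kappa]_v F (flip k v) = \int[kappa]_v F v)%E.
Proof.
move=> mF F0; pose w v : R := \prod_i normal_pdf 0 1 (v ord0 i).
have mw : mfunT w.
 rewrite (_ : w = fun v => normal_peak 1 ^+ d * expR (- Q v)); last by apply/funext => v; exact: pdfE.
 exact: mfunM.
have w0 v : 0 <= w v by rewrite /w pdfE mulr_ge0 ?expR_ge0// ltW.
have mFf : mfunT (fun v => F (flip k v)) by exact: mcomp mF (m_flip k).
rewrite !(ge0_integral_density mw w0 gk)//.
pose phi (i : 'I_d) (a : R) : R := if i == k then 0 - a else a.
rewrite -[RHS](@lebesgue_rV_coordwise R d phi (fun v => F v * (w v)%:E)%E).
- apply: eq_integral => v _.
 have fE : \row_i phi i (v ord0 i) = flip k v.
  by apply/rowP => i; rewrite !mxE /phi; case: (i == k) => //; rewrite sub0r.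
 rewrite fE; congr (_ * (_)%:E)%E; rewrite /w !pdfE; congr (_ * expR (- _)); apply: eq_bigr => i _.
 by rewrite !mxE; case: (i == k) => //; rewrite mulrNN.
- move=> i; rewrite /phi; case: (i == k) => //; exact: mfunB.
- move=> i g mg g0; rewrite /phi; case: (i == k) => //.
 exact: lebesgue_measure_reflect_integral.
- by apply: emeasurable_funM => //; exact/mEFinP.
- by move=> v; rewrite mule_ge0// lee_fin.
Qed.
Let C1 := (@Cn1_coord).
Let Ccont f : Cn 1 f -> mfunT (f : 'rV[R]_d -> R).
Proof. by move=> Cf; apply: cont_meas_rV; exact: Cn1_cont. Qed.
Let i2 k : intble kappa (fun v => v ord0 k ^+ 2).
Proof.
have := @partial_inL2 _ _ Q kappa CQ gaussian_gibbs 1 k ler01.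
rewrite pQ; apply => x; rewrite partial_coord eqxx//.
Qed.
(** [gradient_weight_bound] with L = 1 and h = v_k times the cutoff. The derivative of h is at most
    1 + 4 in absolute value, hence the 25, and h^2 <= v_k^2 gives the second term. *)
Let i4 k : intble kappa (fun v => v ord0 k ^+ 4).
Proof.
have cvk : continuous (fun v : 'rV[R]_d => v ord0 k) by move=> x; exact: coord_continuous.
pose C := \int[kappa]_v (v ord0 k ^+ 2).
apply: (intble_cutoff (C := 4 * 25 + 2 * C)).
- rewrite (_ : (fun v : 'rV[R]_d => v ord0 k ^+ 4) = fun v => (v ord0 k * v ord0 k) * (v ord0 k * v ord0 k)).
  by do ?apply: continuous_rVM.
 by apply/funext => v; ring.
- by move=> v; rewrite (exprM _ 2 2) sqr_ge0.
move=> n; pose h v : R := v ord0 k * cutoff n v.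
have Ch : Cn 1 h by apply: Cn1M; [exact: Cn1_coord|exact: Cn1_cutoff].
have sh : csupp h by apply: csuppMr; exact: csupp_cutoff.
have := @gradient_weight_bound _ _ Q kappa CQ gaussian_gibbs 1 k h ler01.
rewrite pQ => /(_ _ Ch sh); rewrite mulr1 => H.
have -> : \int[kappa]_v (v ord0 k ^+ 4 * cutoff n v ^+ 2) = \int[kappa]_v (v ord0 k ^+ 2 * h v ^+ 2).
 by apply: eq_Rintegral => v _; rewrite /h; ring.
apply: le_trans (H _) _; first by move=> x; rewrite partial_coord eqxx.
apply: lerD; apply: ler_wpM2l => //.
- apply: Rintegral_le_bounded; first by apply: mfunX; apply: cont_meas_rV; exact: Cn1_cont_partial.
 move=> v; have /andP[c0 c1] := cutoff01 n v; have := coord_partial_cutoff_le n k v.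
 rewrite /h partialM; [|exact: Cn1_coord|exact: Cn1_cutoff].
 rewrite partial_coord eqxx mul1r normrX !ler_norml => /andP[h1 h2].
 move: (v ord0 k * _) h1 h2 => b h1 h2.
 by rewrite -normrX ger0_norm ?sqr_ge0//; nra.
- apply: le_Rintegral => //.
  by under eq_fun do rewrite expr2; apply: intble_csupp; [apply: continuous_rVM; exact: Cn1_cont|exact: csuppMl].
 move=> v _; have /andP[c0 c1] := cutoff01 n v; rewrite /h exprMn ler_piMr ?sqr_ge0// exprn_ile1//.
Qed.
Let i22 i j : intble kappa (fun v => v ord0 i ^+ 2 * v ord0 j ^+ 2).
Proof.
apply: (intble_EFin_le _ (intble_add msT (i4 i) (i4 j))).
 by apply: mfunM; exact: mfunX.
move=> v; move: (v ord0 i) (v ord0 j) => a b.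
have p4 (x : R) : 0 <= x ^+ 4 by rewrite (exprM _ 2 2) sqr_ge0.
rewrite [leRHS]ger0_norm ?addr_ge0// ger0_norm; last by apply: mulr_ge0; exact: sqr_ge0.
by rewrite !(exprM _ 2 2); have := sqr_ge0 (a ^+ 2 - b ^+ 2); move: (sqr_ge0 (a ^+ 2)) (sqr_ge0 (b ^+ 2)); nra.
Qed.
Let ibp F k : Cn 1 F -> intble kappa F -> intble kappa (partial k F) ->
 intble kappa (fun v => F v * v ord0 k) ->
 \int[kappa]_v partial k F v = \int[kappa]_v (F v * v ord0 k).
Proof.
move=> CF iF ipF iFv; have := @gibbs_ibp_integrable _ _ Q kappa CQ1 gaussian_gibbs F k CF iF ipF.
by rewrite pQ; apply.
Qed.
Let i1 k : intble kappa (fun v => v ord0 k).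
Proof. by apply: inL2_integrable; split. Qed.
Let i0 (c : R) : intble kappa (fun _ : 'rV[R]_d => c).
Proof. by apply: (intble_by kappa `|c|). Qed.
Let E2 k : \int[kappa]_v (v ord0 k ^+ 2) = 1.
Proof.
have pE : partial k (fun v : 'rV[R]_d => v ord0 k) = fun=> 1.
 by apply/funext => v; rewrite partial_coord eqxx.
rewrite -[RHS](Rintegral_cst_prob kappa); have := ibp (k := k) (Cn1_coord k) (i1 k).
rewrite pE => ->; first by apply: eq_Rintegral => v _; rewrite expr2.
 exact: i0.
by under eq_fun do rewrite -expr2; exact: i2.
Qed.
Let E4 k : \int[kappa]_v (v ord0 k ^+ 4) = 3.
Proof.
pose F v : R := v ord0 k * (v ord0 k * v ord0 k).
have CF : Cn 1 F by do ?apply: Cn1M; exact: Cn1_coord.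
have pE : partial k F = fun v => 3 * v ord0 k ^+ 2.
 apply/funext => v; rewrite /F partialM; [|exact: Cn1_coord|by apply: Cn1M; exact: Cn1_coord].
 by rewrite partialM; [rewrite partial_coord eqxx/=; ring|exact: Cn1_coord..].
have iF : intble kappa F.
 apply: (intble_EFin_le (Ccont CF) (intble_add msT (i2 k) (i4 k))) => v.
 rewrite /F; move: (v ord0 k) => a; rewrite [leRHS]ger0_norm.
  rewrite (exprM _ 2 2) ler_norml; apply/andP; split.
   by have := sqr_ge0 (a + a ^+ 2); have := sqr_ge0 (a ^+ 2); have := sqr_ge0 a; nra.
  by have := sqr_ge0 (a - a ^+ 2); have := sqr_ge0 (a ^+ 2); have := sqr_ge0 a; nra.
 by rewrite addr_ge0 ?sqr_ge0// (exprM _ 2 2) sqr_ge0.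
have FE : (fun v : 'rV[R]_d => F v * v ord0 k) = fun v => v ord0 k ^+ 4.
 by apply/funext => v; rewrite /F; ring.
have := ibp (k := k) CF iF; rewrite pE FE RintegralZl// E2 mulr1 => <-//.
exact: intble_cmul.
Qed.
Let E22 i j : i != j -> \int[kappa]_v (v ord0 i ^+ 2 * v ord0 j ^+ 2) = 1.
Proof.
move=> ij; pose F v : R := v ord0 i * (v ord0 j * v ord0 j).
have CF : Cn 1 F by do ?apply: Cn1M; exact: Cn1_coord.
have pE : partial i F = fun v => v ord0 j ^+ 2.
 apply/funext => v; rewrite /F partialM; [|exact: Cn1_coord|by apply: Cn1M; exact: Cn1_coord].
 by rewrite partialM; [rewrite !partial_coord eqxx (negbTE ij)/=; ring|exact: Cn1_coord..].
have iF : intble kappa F.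
 apply: (intble_EFin_le (Ccont CF) (intble_add msT (i2 i) (i4 j))) => v.
 rewrite /F; move: (v ord0 i) (v ord0 j) => a b; rewrite [leRHS]ger0_norm.
  rewrite (exprM _ 2 2) ler_norml; apply/andP; split.
   by have := sqr_ge0 (a + b ^+ 2); have := sqr_ge0 (b ^+ 2); have := sqr_ge0 a; nra.
  by have := sqr_ge0 (a - b ^+ 2); have := sqr_ge0 (b ^+ 2); have := sqr_ge0 a; nra.
 by rewrite addr_ge0 ?sqr_ge0// (exprM _ 2 2) sqr_ge0.
have FE : (fun v : 'rV[R]_d => F v * v ord0 i) = fun v => v ord0 i ^+ 2 * v ord0 j ^+ 2.
 by apply/funext => v; rewrite /F; ring.
by have := ibp (k := i) CF iF; rewrite pE FE E2 => <-//; exact: i22.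
Qed.

(** The covariance of v_k^2 and v_l^2 is 2 when k = l and 0 otherwise, so the mean square in the
    last clause is twice the sum of the a_k^2. *)
Lemma gaussian_velocity_law : velocity_law kappa 3.
Proof.
split.
- exact: gaussian_flip.
- by move=> k; rewrite EFin_Rintegral// E2.
- by move=> k; rewrite (EFin_Rintegral (i4 k)) E4 lee_fin; lra.
- by move=> i j ij; rewrite (EFin_Rintegral (i22 i j)) E22// lee_fin; lra.
move=> a; pose c k l (v : 'rV[R]_d) := v ord0 k ^+ 2 * v ord0 l ^+ 2 - v ord0 k ^+ 2 - v ord0 l ^+ 2 + 1.
have ic k l : intble kappa (c k l).
 by apply: intble_add => //; apply: intble_sub => //; exact: intble_sub.
have Ec k l : \int[kappa]_v c k l v = 2 * (k == l)%:R.
 have j1 := intble_sub msT (i22 k l) (i2 k).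
 rewrite /c (RintegralD msT (intble_sub msT j1 (i2 l)) (i0 1)).
 rewrite (RintegralB msT j1 (i2 l)) (RintegralB msT (i22 k l) (i2 k)) !E2 Rintegral_cst_prob.
 have [->|kl] := eqVneq k l; last by rewrite E22//=; ring.
 rewrite (_ : \int[kappa]_v (v ord0 l ^+ 2 * v ord0 l ^+ 2) = 3) /=; last first.
  by rewrite -[RHS](E4 l); apply: eq_Rintegral => v _; ring.
 by ring.
have sE v : (\sum_k a k * (v ord0 k ^+ 2 - 1)) ^+ 2 = \sum_k \sum_l a k * a l * c k l v.
 rewrite expr2 mulr_suml; apply: eq_bigr => k _; rewrite mulr_sumr; apply: eq_bigr => l _.
 by rewrite /c; ring.
have ik k l : intble kappa (fun v => a k * a l * c k l v) by exact: intble_cmul.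
have isk k : intble kappa (fun v => \sum_l a k * a l * c k l v) by exact: intble_bigsum.
under eq_integral do rewrite sE.
rewrite (EFin_Rintegral (f := fun v => \sum_k \sum_l a k * a l * c k l v)); last exact: intble_bigsum.
rewrite lee_fin Rintegral_bigsum// mulr_sumr; apply: ler_sum => k _.
rewrite Rintegral_bigsum// (bigD1 k)//= big1 => [|l lk].
 by rewrite RintegralZl// Ec eqxx/= addr0; have := sqr_ge0 (a k); nra.
by rewrite RintegralZl// Ec eq_sym (negbTE lk) /= !mulr0.
Qed.

End gaussian.

Section velocity_moments.
Context {R} {d : nat}.
Variables (kappa : rVlaw R d) (omega : R).
Hypothesis vl : velocity_law kappa omega.
Implicit Types (v : 'rV[R]_d) (i j k : 'I_d).
Let flip_inv := let: And5 h _ _ _ _ := vl in h.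
Let mc k : mfunT (fun v : 'rV[R]_d => v ord0 k) := measurable_coord k.
Let p4 (x : R) : x ^+ 4 = (x ^+ 2) ^+ 2. Proof. by rewrite -exprM. Qed.

Lemma intble_ge0_le d' (T : measurableType d') (m : {measure set T -> \bar R}) (f : T -> R) (C : R) :
 mfunT f -> (forall x, 0 <= f x) -> (\int[m]_x (f x)%:E <= C%:E)%E ->
 intble m f.
Proof.
move=> mf f0 fC; apply/integrableP; split; first exact/mEFinP.
under eq_integral do rewrite /= ger0_norm//.
exact: le_lt_trans fC (ltry _).
Qed.

Lemma Rintegral_ge0_le d' (T : measurableType d') (m : {measure set T -> \bar R}) (f : T -> R) (C : R) :
 mfunT f -> (forall x, 0 <= f x) -> (\int[m]_x (f x)%:E <= C%:E)%E ->
 \int[m]_x f x <= C.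
Proof.
move=> mf f0 fC; have fi := intble_ge0_le mf f0 fC.
by rewrite -lee_fin /Rintegral fineK// (integral_fune_fin_num msT fi).
Qed.

Lemma Rintegral_flip_velocity k (g : 'rV[R]_d -> R) : mfunT g ->
 \int[kappa]_v g (flip k v) = \int[kappa]_v g v.
Proof.
move=> mg; rewrite /Rintegral; congr fine; rewrite integralE [RHS]integralE; congr (_ - _)%E.
- transitivity (\int[kappa]_v ((EFin \o g)^\+ (flip k v)))%E; first by apply: eq_integral => v _; rewrite !funeposE.
 by rewrite flip_inv//; apply: measurable_funepos; exact/mEFinP.
- transitivity (\int[kappa]_v ((EFin \o g)^\- (flip k v)))%E; first by apply: eq_integral => v _; rewrite !funenegE.
 by rewrite flip_inv//; apply: measurable_funeneg; exact/mEFinP.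
Qed.

Lemma Rintegral_odd k (g : 'rV[R]_d -> R) : mfunT g -> (forall v, g (flip k v) = - g v) ->
 \int[kappa]_v g v = 0.
Proof.
move=> mg godd; have := Rintegral_flip_velocity k mg.
under eq_Rintegral do rewrite godd.
by rewrite Rintegral_opp => h; lra.
Qed.

Lemma inL2_velocity_sq k : inL2 kappa (fun v => v ord0 k ^+ 2).
Proof.
case: vl => _ _ /(_ k) h4 _ _; split; first exact: mfunX.
have := @intble_ge0_le _ _ kappa (fun v => v ord0 k ^+ 4) (2 * omega) (mfunX 4 (mc k)) _ h4.
rewrite (_ : (fun v : 'rV[R]_d => v ord0 k ^+ 4) = fun v => (v ord0 k ^+ 2) ^+ 2); last by apply/funext => v; rewrite p4.
by apply => v; rewrite p4 sqr_ge0.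
Qed.

Lemma inL2_velocity_abs k : inL2 kappa (fun v => v ord0 k * `|v ord0 k|).
Proof.
have [_ h] := inL2_velocity_sq k; split; first by apply: mfunM => //; exact: mcomp.
congr (kappa.-integrable _ _): h; apply/funext => v /=; congr EFin.
by rewrite [RHS]exprMn -normrX (ger0_norm (sqr_ge0 _)) -expr2.
Qed.

Lemma inL2_velocity k : inL2 kappa (fun v => v ord0 k).
Proof. by split=> //; exact: inL2_integrable (inL2_velocity_sq k). Qed.

Lemma intble_velocity_mul i j : intble kappa (fun v => v ord0 i * v ord0 j).
Proof. by apply: inL2_mul; exact: inL2_velocity. Qed.

Lemma inL2_velocity_mul i j : inL2 kappa (fun v => v ord0 i * v ord0 j).
Proof.
split; first exact: mfunM.
have h := inL2_mul (inL2_velocity_sq i) (inL2_velocity_sq j).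
congr (kappa.-integrable _ _): h; apply/funext => v /=; congr EFin; ring.
Qed.

Lemma Rintegral_velocity_sq k : \int[kappa]_v (v ord0 k ^+ 2) = 1.
Proof. by case: vl => _ /(_ k) h _ _ _; rewrite /Rintegral h. Qed.

Lemma Rintegral_velocity_mul i j : \int[kappa]_v (v ord0 i * v ord0 j) = (i == j)%:R.
Proof.
have [->|ij] := eqVneq i j.
 by rewrite -[RHS](Rintegral_velocity_sq j); apply: eq_Rintegral => v _; rewrite expr2.
apply: (@Rintegral_odd i); first exact: mfunM.
by move=> v; rewrite !mxE eqxx eq_sym (negbTE ij) mulNr.
Qed.

Section quadratic.
Variables (c : 'I_d * 'I_d -> R) (a b : 'I_d -> R).
Hypothesis c0 : forall i, c (i, i) = 0.

Definition cross_part v : R := \sum_p c p * (v ord0 p.1 * v ord0 p.2).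
Definition square_part v : R := \sum_k a k * (v ord0 k ^+ 2 - 1).
Definition abs_part v : R := \sum_k b k * (v ord0 k * `|v ord0 k|).

Lemma inL2_cross : inL2 kappa cross_part.
Proof. by apply: inL2_sum => p _; apply: inL2_cmul; exact: inL2_velocity_mul. Qed.

Lemma inL2_square : inL2 kappa square_part.
Proof.
apply: inL2_sum => k _; apply: inL2_cmul; apply: inL2_sub.
 exact: inL2_velocity_sq.
by apply: (@inL2_bounded _ _ _ _ _ 1) => // v; rewrite normr1.
Qed.

Lemma inL2_abs : inL2 kappa abs_part.
Proof. by apply: inL2_sum => p _; apply: inL2_cmul; exact: inL2_velocity_abs. Qed.

Lemma Rintegral_cross : \int[kappa]_v cross_part v = 0.
Proof.
rewrite /cross_part Rintegral_bigsum// => [|p _]; last by apply: intble_cmul => //; exact: intble_velocity_mul.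
rewrite big1// => -[i j] _; rewrite RintegralZl//=; last exact: intble_velocity_mul.
rewrite Rintegral_velocity_mul; have [->|] := eqVneq i j; first by rewrite c0 mul0r.
by rewrite mulr0.
Qed.

Lemma Rintegral_square : \int[kappa]_v square_part v = 0.
Proof.
have i1 : intble kappa (fun _ : 'rV[R]_d => (1 : R)).
 by apply: (intble_by kappa 1) => // v; rewrite normr1.
have i2 k : intble kappa (fun v : 'rV[R]_d => v ord0 k ^+ 2).
 exact: inL2_integrable (inL2_velocity_sq k).
rewrite /square_part Rintegral_bigsum// => [|k _]; last by apply: intble_cmul => //; exact: intble_sub.
rewrite big1// => k _; rewrite RintegralZl//; last exact: intble_sub.
by rewrite (RintegralB msT (i2 k) i1) Rintegral_velocity_sq Rintegral_cst_prob subrr mulr0.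
Qed.

Lemma Rintegral_abs : \int[kappa]_v abs_part v = 0.
Proof.
have ia k := inL2_integrable (inL2_velocity_abs k).
rewrite /abs_part Rintegral_bigsum// => [|k _]; last by apply: intble_cmul.
rewrite big1// => k _; rewrite RintegralZl// (@Rintegral_odd k) ?mulr0//; first by case: (inL2_velocity_abs k).
by move=> v; rewrite !mxE eqxx normrN mulNr.
Qed.
Let M (p q : 'I_d * 'I_d) : R := \int[kappa]_v ((v ord0 p.1 * v ord0 p.2) * (v ord0 q.1 * v ord0 q.2)).
(** The indices of each pair are distinct. If q is neither p nor its transposition, some index
    occurs exactly once among the four, and the product is odd under the flip of that coordinate. *)
Let M0 p q : p.1 != p.2 -> q.1 != q.2 -> q != p -> q != (p.2, p.1) -> M p q = 0.
Proof.
case: p q => [i j] [k l] /= ij kl qp qs.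
have mM : mfunT (fun v : 'rV[R]_d => (v ord0 i * v ord0 j) * (v ord0 k * v ord0 l)).
 by apply: mfunM; exact: mfunM.
have [ik|ik] := eqVneq i k; last have [il|il] := eqVneq i l.
- apply: (@Rintegral_odd j) => // v; rewrite !mxE eqxx (negbTE ij) -ik (negbTE ij).
 have -> : (l == j) = false by apply: contraNF qp => /eqP ->; rewrite ik.
 ring.
- apply: (@Rintegral_odd j) => // v; rewrite !mxE eqxx (negbTE ij) -il (negbTE ij).
 have -> : (k == j) = false by apply: contraNF qs => /eqP ->; rewrite il.
 ring.
- apply: (@Rintegral_odd i) => // v; rewrite !mxE eqxx.
 by rewrite [j == i]eq_sym (negbTE ij) [k == i]eq_sym (negbTE ik) [l == i]eq_sym (negbTE il); ring.
Qed.
Let Mle p : p.1 != p.2 -> 0 <= M p p <= omega.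
Proof.
move=> pp; have E : M p p = \int[kappa]_v (v ord0 p.1 ^+ 2 * v ord0 p.2 ^+ 2).
 by apply: eq_Rintegral => v _; ring.
rewrite E; have h0 v : 0 <= v ord0 p.1 ^+ 2 * v ord0 p.2 ^+ 2 by rewrite mulr_ge0 ?sqr_ge0.
rewrite Rintegral_ge0//=; apply: Rintegral_ge0_le => //; last by case: vl => _ _ _ + _; exact.
by apply: mfunM; exact: mfunX.
Qed.

Lemma Rintegral_cross_sq : \int[kappa]_v (cross_part v ^+ 2) <= 2 * omega * \sum_p c p ^+ 2.
Proof.
have ipq p q : intble kappa (fun v : 'rV[R]_d =>
  (c p * c q) * ((v ord0 p.1 * v ord0 p.2) * (v ord0 q.1 * v ord0 q.2))).
 by apply: intble_cmul => //; apply: inL2_mul; exact: inL2_velocity_mul.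
have -> : \int[kappa]_v (cross_part v ^+ 2) = \sum_p \sum_q c p * c q * M p q.
 transitivity (\int[kappa]_v \sum_p \sum_q (c p * c q) * ((v ord0 p.1 * v ord0 p.2) * (v ord0 q.1 * v ord0 q.2))).
  apply: eq_Rintegral => v _; rewrite expr2 /cross_part mulr_suml; apply: eq_bigr => p _.
  by rewrite mulr_sumr; apply: eq_bigr => q _; ring.
 rewrite Rintegral_bigsum// => [|p _]; last exact: intble_bigsum.
 apply: eq_bigr => p _; rewrite Rintegral_bigsum//; apply: eq_bigr => q _.
 by rewrite RintegralZl//; apply: inL2_mul; exact: inL2_velocity_mul.
pose sw (p : 'I_d * 'I_d) := (p.2, p.1).
have swK : involutive sw by case.
have Esw : \sum_p c (sw p) ^+ 2 = \sum_p c p ^+ 2 by rewrite [RHS](reindex_inj (inv_inj swK)).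
(* Each ordered pair p meets itself and its transposition. With x, y the two coefficients and m the
   moment, m x^2 + m x y <= m (3/2 x^2 + 1/2 y^2); summed over p, the weights 3/2 and 1/2 recombine
   into 2. *)
have -> : 2 * omega * \sum_p c p ^+ 2 = \sum_p (omega * (3 / 2) * c p ^+ 2 + omega * 2^-1 * c (sw p) ^+ 2).
 by rewrite big_split/= -!mulr_sumr Esw; move: (\sum_p _) => S; field.
apply: ler_sum => -[i j] _; rewrite /sw/=.
have [->|ij] := eqVneq i j.
 by rewrite big1 => [|q _]; rewrite c0 ?mul0r// expr0n/= !mulr0 addr0.
have pp : (i, j).1 != (i, j).2 by [].
have sp : (j, i) != (i, j) by apply: contra ij => /eqP[->].
rewrite (bigD1 (i, j))//= (bigD1 (j, i))//= big1 ?addr0; last first.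
 move=> q /andP[qp qs]; have [qq|qq] := eqVneq q.1 q.2.
  by rewrite (surjective_pairing q) qq c0 mulr0 mul0r.
 by rewrite M0 ?mulr0.
have -> : M (i, j) (j, i) = M (i, j) (i, j) by apply: eq_Rintegral => v _ /=; ring.
have /andP[m0 m1] := Mle pp; move: (M _ _) (c (i, j)) (c (j, i)) m0 m1 => m x y m0 m1.
have h1 : m * x ^+ 2 <= omega * x ^+ 2 by rewrite ler_wpM2r ?sqr_ge0.
have h2 : m * (x + y) ^+ 2 <= omega * (x + y) ^+ 2 by rewrite ler_wpM2r ?sqr_ge0.
have h3 : m * (x - y) ^+ 2 >= 0 by rewrite mulr_ge0 ?sqr_ge0.
have h4 : m * y ^+ 2 <= omega * y ^+ 2 by rewrite ler_wpM2r ?sqr_ge0.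
nra.
Qed.

Lemma Rintegral_square_sq : \int[kappa]_v (square_part v ^+ 2) <= omega * \sum_k a k ^+ 2.
Proof.
have [ms _] := inL2_square.
apply: Rintegral_ge0_le; [exact: mfunX|by move=> v; exact: sqr_ge0|].
by case: vl => _ _ _ _; exact.
Qed.

Lemma Rintegral_abs_sq : \int[kappa]_v (abs_part v ^+ 2) <= 2 * omega * \sum_k b k ^+ 2.
Proof.
pose g k v : R := v ord0 k * `|v ord0 k|.
have sg k : inL2 kappa (g k) by exact: inL2_velocity_abs.
have ikl k l : intble kappa (fun v => (b k * b l) * (g k v * g l v)).
 by apply: intble_cmul => //; exact: inL2_mul.
have -> : \int[kappa]_v (abs_part v ^+ 2) = \sum_k \sum_l b k * b l * \int[kappa]_v (g k v * g l v).
 transitivity (\int[kappa]_v \sum_k \sum_l (b k * b l) * (g k v * g l v)).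
  apply: eq_Rintegral => v _; rewrite expr2 /abs_part mulr_suml; apply: eq_bigr => k _.
  by rewrite mulr_sumr; apply: eq_bigr => l _; rewrite /g; ring.
 rewrite Rintegral_bigsum// => [|k _]; last exact: intble_bigsum.
 apply: eq_bigr => k _; rewrite Rintegral_bigsum//; apply: eq_bigr => l _.
 by rewrite RintegralZl//; exact: inL2_mul.
rewrite mulr_sumr; apply: ler_sum => k _.
rewrite (bigD1 k)//= big1 ?addr0 => [|l lk]; last first.
 rewrite (@Rintegral_odd k) ?mulr0//.
  by apply: mfunM; [case: (sg k)|case: (sg l)].
 by move=> v; rewrite /g !mxE eqxx (negbTE lk) normrN; ring.
rewrite -expr2 mulrC ler_wpM2r ?sqr_ge0//.
have -> : \int[kappa]_v (g k v * g k v) = \int[kappa]_v (v ord0 k ^+ 4).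
 apply: eq_Rintegral => v _; rewrite /g p4 [in RHS]expr2.
 by rewrite mulrACA -expr2 -[`|_| * _]expr2 -normrX (ger0_norm (sqr_ge0 _)).
apply: Rintegral_ge0_le; [exact: mfunX|by move=> v; rewrite p4 sqr_ge0|].
by case: vl.
Qed.

Lemma velocity_polynomial : let V v := cross_part v + square_part v + abs_part v in
 [/\ inL2 kappa V, \int[kappa]_v V v = 0 &
   \int[kappa]_v (V v ^+ 2) <=
    3 * (2 * omega * \sum_p c p ^+ 2 + omega * \sum_k a k ^+ 2 + 2 * omega * \sum_k b k ^+ 2)].
Proof.
move=> V; have s1 := inL2_cross; have s2 := inL2_square; have s3 := inL2_abs.
have s12 := inL2_add s1 s2; have sV := inL2_add s12 s3.
split => //.
 rewrite /V (RintegralD msT (inL2_integrable s12) (inL2_integrable s3)).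
 rewrite (RintegralD msT (inL2_integrable s1) (inL2_integrable s2)).
 by rewrite Rintegral_cross Rintegral_square Rintegral_abs !addr0.
have [_ i1] := s1; have [_ i2] := s2; have [_ i3] := s3; have [_ iV] := sV.
apply: (@le_trans _ _ (3 * (\int[kappa]_v (cross_part v ^+ 2) + \int[kappa]_v (square_part v ^+ 2) +
  \int[kappa]_v (abs_part v ^+ 2)))); last first.
 rewrite ler_wpM2l// lerD ?Rintegral_abs_sq// lerD ?Rintegral_square_sq// Rintegral_cross_sq//.
have i12 := intble_add msT i1 i2.
rewrite -(RintegralD msT i1 i2) -(RintegralD msT i12 i3) -RintegralZl//; last exact: intble_add.
apply: le_Rintegral => //; first by apply: intble_cmul => //; exact: intble_add.
move=> v _; rewrite /V; move: (cross_part v) (square_part v) (abs_part v) => x y z.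
by have := sqr_ge0 (x - y); have := sqr_ge0 (y - z); have := sqr_ge0 (x - z); nra.
Qed.

End quadratic.
End velocity_moments.

(** * The resolvent of the diffusion *)

Section resolvent.
Context {R} {d : nat}.
Variables (U : 'rV[R]_d -> R) (mu : rVlaw R d).
Hypotheses (C2 : Cn 2 U) (gU : gibbs_measure U mu).
Implicit Types (f g h phi psi w : 'rV[R]_d -> R) (x : 'rV[R]_d).
Local Notation Lam := (dirichlet_op U).
Local Notation l2 := (l2 mu).

Lemma Cc_infty_Cn n phi : Cc_infty phi -> Cn n phi. Proof. by case. Qed.
Lemma Cc_infty_csupp phi : Cc_infty phi -> csupp phi. Proof. by case. Qed.
Local Hint Resolve Cc_infty_Cn Cc_infty_csupp : core.

Lemma inL2_csupp f : continuous f -> csupp f -> inL2 mu f.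
Proof.
move=> cf sf; split; first exact: cont_meas_rV.
by under eq_fun do rewrite expr2; apply: intble_csupp; [exact: continuous_rVM|exact: csuppMl].
Qed.

Lemma inL2_Cc phi : Cc_infty phi -> inL2 mu phi.
Proof. by move=> Cphi; apply: inL2_csupp; [exact: (Cn1_cont (Cc_infty_Cn 1 Cphi))|exact: Cc_infty_csupp]. Qed.

Lemma inL2_dirichlet phi : Cc_infty phi -> inL2 mu (Lam phi).
Proof.
move=> Cphi; apply: inL2_csupp; first exact: Cn1_cont (Cn1_dirichlet_op C2 Cphi).
exact: csupp_dirichlet_op (Cc_infty_csupp Cphi).
Qed.
Local Hint Resolve inL2_Cc inL2_dirichlet : core.

Lemma intble_gradient_sq phi : Cc_infty phi -> intble mu (gradient_sq phi).
Proof.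
move=> Cphi; apply: intble_bigsum => // i _.
by have [_] := inL2_Cc (Cc_infty_partial i Cphi).
Qed.

Lemma dirichlet_energy phi : Cc_infty phi -> \int[mu]_x (phi x * Lam phi x) = \int[mu]_x gradient_sq phi x.
Proof.
move=> Cphi; rewrite (dirichlet_form C2 gU (Cc_infty_Cn 1 Cphi) (Cc_infty_Cn 2 Cphi) (Cc_infty_csupp Cphi)).
rewrite /gradient_sq Rintegral_bigsum//; last first.
 by move=> i _; have [_] := inL2_Cc (Cc_infty_partial i Cphi).
Qed.

Lemma gradient_sq_ge0 phi : 0 <= \int[mu]_x gradient_sq phi x.
Proof. by apply: Rintegral_ge0 => x _; apply: sumr_ge0 => i _; exact: sqr_ge0. Qed.

Section estimates.
Variables (p : R) (phi : 'rV[R]_d -> R).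
Hypotheses (p0 : 0 < p) (Cphi : Cc_infty phi).
Let r x := p * phi x + Lam phi x.

Lemma inL2_resolvent : inL2 mu r.
Proof. by apply: inL2_add; [apply: inL2_cmul; exact: inL2_Cc|exact: inL2_dirichlet]. Qed.

Lemma resolvent_inner : \int[mu]_x (r x * phi x) = p * \int[mu]_x (phi x ^+ 2) + \int[mu]_x gradient_sq phi x.
Proof.
rewrite -dirichlet_energy//; have sp := inL2_Cc Cphi; have sL := inL2_dirichlet Cphi.
have [_ i1] := sp; have i2 := inL2_mul sp sL.
rewrite -RintegralZl// -RintegralD//; last exact: intble_cmul.
by apply: eq_Rintegral => x _; rewrite /r; ring.
Qed.

Lemma resolvent_sq : \int[mu]_x (r x ^+ 2) =
 p ^+ 2 * \int[mu]_x (phi x ^+ 2) + 2 * p * \int[mu]_x gradient_sq phi x + \int[mu]_x (Lam phi x ^+ 2).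
Proof.
rewrite -dirichlet_energy//; have sp := inL2_Cc Cphi; have sL := inL2_dirichlet Cphi.
have [_ i1] := sp; have [_ i3] := sL; have i2 := inL2_mul sp sL.
have j1 := intble_cmul msT (p ^+ 2) i1; have j2 := intble_cmul msT (2 * p) i2.
rewrite -!RintegralZl// -(RintegralD msT j1 j2) -(RintegralD msT (intble_add msT j1 j2) i3).
by apply: eq_Rintegral => x _; rewrite /r; ring.
Qed.

Lemma l2_dirichlet_le : l2 (Lam phi) <= l2 r.
Proof.
rewrite -(ler_pXn2r (n := 2))// ?nnegrE ?l2_ge0// !l2_sqr resolvent_sq lerDr addr_ge0//.
 by rewrite mulr_ge0 ?sqr_ge0// -l2_sqr sqr_ge0.
by rewrite mulr_ge0 ?gradient_sq_ge0// mulr_ge0 ?ltW.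
Qed.

Lemma gradient_sq_le : 2 * p * \int[mu]_x gradient_sq phi x <= l2 r ^+ 2.
Proof.
rewrite l2_sqr resolvent_sq; have := sqr_ge0 (l2 (Lam phi)); rewrite l2_sqr.
have : 0 <= p ^+ 2 * \int[mu]_x (phi x ^+ 2) by rewrite mulr_ge0 ?sqr_ge0// -l2_sqr sqr_ge0.
by move: (p ^+ 2 * _) (2 * p * _) (\int[mu]_x (Lam phi x ^+ 2)) => a b c; lra.
Qed.

Lemma Rintegral_resolvent : \int[mu]_x r x = p * \int[mu]_x phi x.
Proof.
have sp := inL2_integrable (inL2_Cc Cphi).
have sL := inL2_integrable (inL2_dirichlet Cphi).
rewrite /r (RintegralD msT (intble_cmul msT p sp) sL) RintegralZl//.
have := dirichlet_form C2 gU (Cn1_cst 1) (Cc_infty_Cn 2 Cphi) (Cc_infty_csupp Cphi).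
under eq_Rintegral do rewrite mul1r; move=> ->.
rewrite big1 ?addr0// => i _; rewrite -[RHS](Rintegral_cst_prob mu).
by apply: eq_Rintegral => x _; rewrite partial_cst mul0r.
Qed.

(** On functions of mean zero Poincaré's inequality reads Lam >= p, hence p / (p + Lam) <= 1/2; the
    constants contribute the square of the mean. That the factor is 1/2 and not 1 is the source of
    the coercivity in [inner_dirichlet]. *)
Lemma resolvent_poincare : poincare mu p^-1 ->
 p * \int[mu]_x (r x * phi x) <= 2^-1 * \int[mu]_x (r x ^+ 2) + (\int[mu]_x r x) ^+ 2.
Proof.
move=> /(_ phi Cphi) P; have sp := inL2_Cc Cphi.
have {}P : p * (\int[mu]_x (phi x ^+ 2) - (\int[mu]_x phi x) ^+ 2) <= \int[mu]_x gradient_sq phi x.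
 rewrite -ler_pdivlMl//; rewrite -lee_fin; move: P; rewrite varianceE; last exact: inL2_L2.
 have [_ i2] := sp; rewrite unlock; rewrite [X in (X - _)%E](EFin_Rintegral i2).
 by rewrite (EFin_Rintegral (inL2_integrable sp)) (EFin_Rintegral (intble_gradient_sq Cphi)).
have e1 := resolvent_inner; have sr := inL2_resolvent.
have Q : p * \int[mu]_x (r x * phi x) <= 4^-1 * \int[mu]_x (r x ^+ 2) + p ^+ 2 * \int[mu]_x (phi x ^+ 2).
 have [_ i1] := sp; have [_ i3] := sr.
 rewrite -!RintegralZl//; last exact: inL2_mul.
 have j1 := intble_cmul msT (4^-1) i3; have j2 := intble_cmul msT (p ^+ 2) i1.
 rewrite -(RintegralD msT j1 j2); apply: le_Rintegral => //.
 - by apply: intble_cmul => //; exact: inL2_mul.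
 - exact: intble_add.
 move=> x _; have := sqr_ge0 (2^-1 * r x - p * phi x); move: (r x) (phi x) => a b; nra.
rewrite Rintegral_resolvent; move: P e1 Q; move: (\int[mu]_x (r x * phi x)) (\int[mu]_x (phi x ^+ 2)) (\int[mu]_x phi x).
move: (\int[mu]_x gradient_sq phi x) (\int[mu]_x (r x ^+ 2)) => G r2 rp pp p1 P e1 Q.
have : p * rp = p ^+ 2 * pp + p * G by rewrite e1; ring.
have : p ^+ 2 * (pp - p1 ^+ 2) <= p * G by rewrite expr2 -mulrA ler_pM2l.
by move=> h1 h2; nra.
Qed.

End estimates.

Lemma closure_graph_approx f g : closure_graph mu Cc_infty (langevin U) f g ->
 [/\ inL2 mu f, inL2 mu g & forall e : R, 0 < e -> exists phi,
  [/\ Cc_infty phi, l2 (fun x => phi x - f x) <= e & l2 (fun x => - 2^-1 * Lam phi x - g x) <= e]].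
Proof.
move=> [/L2_inL2 sf [/L2_inL2 sg [phi [Cphi cphi cL]]]]; split => // e e0.
have sL n : inL2 mu (fun x => - 2^-1 * Lam (phi n) x - g x).
 by apply: inL2_sub => //; apply: inL2_cmul; exact: inL2_dirichlet.
have sphi n : inL2 mu (fun x => phi n x - f x) by apply: inL2_sub => //; exact: inL2_Cc.
have LE n : langevin U (phi n) \- g = (fun x => - 2^-1 * Lam (phi n) x - g x).
 by apply/funext => x /=; rewrite dirichlet_opE; congr (_ - _); field.
have cphi' : (fun n => (l2 (fun x => phi n x - f x))%:E) @ \oo --> 0%E.
 by under eq_fun do rewrite -(L2norm_l2 (sphi _)).
have cL' : (fun n => (l2 (fun x => - 2^-1 * Lam (phi n) x - g x))%:E) @ \oo --> 0%E.
 by under eq_fun do rewrite -(L2norm_l2 (sL _)) -LE.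
have /fine_cvgP[_ /cvgrPdist_le /(_ e e0) h1] := cphi'.
have /fine_cvgP[_ /cvgrPdist_le /(_ e e0) h2] := cL'.
have [n [/= h1n h2n]] := @filter_ex _ \oo _ _ (filterI h1 h2).
exists (phi n); split => //.
- by move: h1n; rewrite sub0r normrN ger0_norm ?l2_ge0.
- by move: h2n; rewrite sub0r normrN ger0_norm ?l2_ge0.
Qed.

Lemma langevin_dissipative (lam : R) phi : 0 < lam -> Cc_infty phi ->
 lam * l2 phi <= l2 (fun x => - 2^-1 * Lam phi x - lam * phi x).
Proof.
move=> l0 Cphi; have p0 : 0 < 2 * lam by rewrite mulr_gt0.
have -> : (fun x => - 2^-1 * Lam phi x - lam * phi x) = (fun x => - 2^-1 * (2 * lam * phi x + Lam phi x)).
 by apply/funext => x; field.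
have sr := inL2_resolvent (2 * lam) Cphi.
rewrite l2_cmul// normrN gtr0_norm ?invr_gt0//.
rewrite -(ler_pXn2r (n := 2))//; [|by rewrite nnegrE mulr_ge0 ?l2_ge0// ltW|by rewrite nnegrE mulr_ge0 ?l2_ge0].
rewrite !exprMn !l2_sqr resolvent_sq//.
have := gradient_sq_ge0 phi; have := sqr_ge0 (l2 (Lam phi)); rewrite l2_sqr.
move: (\int[mu]_x _) (\int[mu]_x _) (\int[mu]_x _) => a b c h1 h2.
have : 0 <= lam * b by rewrite mulr_ge0// ltW.
by rewrite (_ : 2^-1 ^+ 2 = 4^-1 :> R); [move: (lam * b) => x; nra|field].
Qed.

Hypothesis ds : discrete_spectrum mu (closure_graph mu Cc_infty (langevin U)).

(** By discreteness a positive spectral value would be an eigenvalue, but the Langevin generator is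
    dissipative on smooth functions, and this passes to its closure. *)
Lemma resolvent_set_gt0 (lam : R) : 0 < lam -> resolvent_set mu (closure_graph mu Cc_infty (langevin U)) lam.
Proof.
move=> l0; apply: contrapT => /ds[_ [f [[g [Gfg eg]] nf]] _]; apply: nf.
have [sf sg ap] := closure_graph_approx Gfg.
have g0 : l2 (fun x => g x - lam * f x) = 0.
 have sd := inL2_sub sg (inL2_cmul lam sf).
 rewrite (@ae_eq_l2 _ _ _ mu _ (fun=> 0)) //; first by rewrite /l2 expr0n Rintegral_cst_prob sqrtr0.
  by case: sd.
 by apply: filterS eg => x /= ->; rewrite subrr.
(* If phi is close to f up to e in the graph norm, the dissipativity of phi gives that of f with an
   error (1 + 2 lam) e. *)
have H e : 0 < e -> lam * l2 f <= (1 + 2 * lam) * e.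
 move=> e0; have [phi [Cphi h1 h2]] := ap e e0.
 have sp := inL2_Cc Cphi.
 have sL := inL2_cmul (- 2^-1) (inL2_dirichlet Cphi).
 have k1 := langevin_dissipative l0 Cphi.
 have k2 : l2 f <= l2 phi + e.
  by have := l2_dist sp sf; rewrite ler_norml => /andP[+ _]; lra.
 have s1 := inL2_sub sL sg; have s2 := inL2_sub sp sf.
 have s3 := inL2_sub sg (inL2_cmul lam sf).
 have k3 := l2_triangle s1 (inL2_sub s3 (inL2_cmul lam s2)).
 have k4 := l2_triangle s3 (inL2_cmul (- lam) s2).
 rewrite l2_cmul// normrN gtr0_norm// g0 add0r in k4.
 have E1 : (fun x => (- 2^-1 * Lam phi x - g x) + (g x - lam * f x - lam * (phi x - f x))) =
   (fun x => - 2^-1 * Lam phi x - lam * phi x) by apply/funext => x; ring.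
 have E2 : (fun x => g x - lam * f x + - lam * (phi x - f x)) =
   (fun x => g x - lam * f x - lam * (phi x - f x)) by apply/funext => x; ring.
 rewrite E1 in k3; rewrite E2 in k4.
 have : lam * l2 f <= lam * (l2 phi + e) by rewrite ler_pM2l.
 have : lam * l2 (fun x => phi x - f x) <= lam * e by rewrite ler_pM2l.
 by move: k1 k3 k4 h2; move: (l2 f) (l2 phi) => lf lp; move: (l2 _) (l2 _) (l2 _) (lam * l2 _) => *; nra.
apply: ae_eq0_l2 => //; rewrite leNgt; apply/negP => fp.
have c0 : 0 < 1 + 2 * lam by rewrite addr_gt0// mulr_gt0.
(* This e turns [H] into lam |f| <= lam |f| / 2, a contradiction unless f vanishes. *)
have := H (lam * l2 f / (2 * (1 + 2 * lam))) (divr_gt0 (mulr_gt0 l0 fp) (mulr_gt0 (ltr0n R 2) c0)).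
have -> : (1 + 2 * lam) * (lam * l2 f / (2 * (1 + 2 * lam))) = lam * l2 f / 2 by field; rewrite gt_eqF.
by have := mulr_gt0 l0 fp; move: (lam * _) => a; lra.
Qed.

(** The resolvent at p / 2 solves g - (p / 2) f = - w / 2 for some (f, g) in the closed graph. As
    Lam is - 2 times the generator, a smooth phi close to f in the graph norm satisfies p phi + Lam
    phi = w up to a small error. The tolerance e / (2 + p) is split according to the factors 2 and
    p. *)
Lemma resolvent_dense (p : R) w (e : R) : 0 < p -> inL2 mu w -> 0 < e ->
 exists2 phi, Cc_infty phi & l2 (fun x => p * phi x + Lam phi x - w x) <= e.
Proof.
move=> p0 sw e0; have p2 : 0 < p / 2 by rewrite divr_gt0.
have [+ _] := resolvent_set_gt0 p2.
have sh := inL2_cmul (- 2^-1) sw.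
move=> /(_ _ (inL2_L2 sh)) [f [g [Gfg fg]]].
have [sf sg ap] := closure_graph_approx Gfg.
have c0 : 0 < 2 + p by rewrite addr_gt0.
have [phi [Cphi h1 h2]] := ap (e / (2 + p)) (divr_gt0 e0 c0); exists phi => //.
have sp := inL2_Cc Cphi.
have sL := inL2_cmul (- 2^-1) (inL2_dirichlet Cphi).
have s1 := inL2_sub sL sg; have s2 := inL2_sub sp sf.
have s3 := inL2_sub sg (inL2_cmul (p / 2) sf).
have k3 := l2_triangle (inL2_cmul (- 2) s1) (inL2_cmul p s2).
rewrite !l2_cmul// normrN !gtr0_norm// in k3.
have -> : l2 (fun x => p * phi x + Lam phi x - w x) =
  l2 (fun x => - 2 * (- 2^-1 * Lam phi x - g x) + p * (phi x - f x)).
 apply: ae_eq_l2.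
 - by case: (inL2_sub (inL2_resolvent p Cphi) sw).
 - by case: (inL2_add (inL2_cmul (- 2) s1) (inL2_cmul p s2)).
 apply: filterS fg => x /= E; have -> : w x = - 2 * (g x - p / 2 * f x) by rewrite E; field.
 by field.
apply: (le_trans k3); have := ler_pM2l (x := 2) (ltr0n R 2).
have H1 : 2 * l2 (fun x => - 2^-1 * Lam phi x - g x) <= 2 * (e / (2 + p)) by rewrite ler_pM2l.
have H2 : p * l2 (fun x => phi x - f x) <= p * (e / (2 + p)) by rewrite ler_pM2l.
move=> _; apply: (le_trans (lerD H1 H2)); rewrite -mulrDl mulrCA divff ?mulr1// gt_eqF//.
Qed.

End resolvent.

Section prod_fun.
Context d1 d2 (T1 : measurableType d1) (T2 : measurableType d2) R.
Variables (m1 : probability T1 R) (m2 : probability T2 R).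
Local Notation m := (m1 \x m2)%E.

Lemma intble_prod_fun (h : T1 -> R) (g : T2 -> R) : intble m1 h ->
 intble m2 g -> intble m (fun z => h z.1 * g z.2).
Proof.
move=> ih ig; have mh : mfunT h by move/measurable_int : ih => /mEFinP.
have mg : mfunT g by move/measurable_int : ig => /mEFinP.
apply/integrable12ltyP.
 apply/mEFinP; apply: mfunM; first exact: (mcomp mh m_fst).
 exact: (mcomp mg m_snd).
pose C := (\int[m2]_y `|(g y)%:E|)%E.
have Cfin : C \is a fin_num.
 rewrite ge0_fin_numE; first by case/integrableP : ig.
 by apply: integral_ge0 => y _; exact: abse_ge0.
rewrite (eq_integral (fun x => `|(h x)%:E| * C)%E) => [|x _]; last first.
 rewrite /C -ge0_integralZl//.
 - by apply: eq_integral => y _; rewrite /= normrM EFinM.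
 - by apply: mcomp => //; exact/mEFinP.
rewrite -(fineK Cfin) ge0_integralZr//.
- by rewrite fineK//; apply: lte_mul_pinfty => //; [exact: integral_ge0|rewrite ge0_fin_numE ?integral_ge0//; case/integrableP : ih|rewrite -ge0_fin_numE// integral_ge0].
- by apply: mcomp => //; exact/mEFinP.
- by rewrite fineK// integral_ge0.
Qed.

Lemma inL2_prod_fun (h : T1 -> R) (g : T2 -> R) : inL2 m1 h -> inL2 m2 g ->
 inL2 m (fun z => h z.1 * g z.2).
Proof.
move=> [mh ih] [mg ig]; split.
 apply: mfunM; first exact: (mcomp mh m_fst).
 exact: (mcomp mg m_snd).
by under eq_fun do rewrite exprMn; exact: (intble_prod_fun ih ig).
Qed.

Lemma Rintegral_prod_fun (h : T1 -> R) (g : T2 -> R) : intble m1 h ->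
 intble m2 g -> \int[m]_z (h z.1 * g z.2) = \int[m1]_x h x * \int[m2]_y g y.
Proof.
move=> ih ig; rewrite (Rintegral_fst_mul (g := fun z => g z.2))//; last exact: intble_prod_fun.
by transitivity (\int[m1]_x (h x * \int[m2]_y g y)) => //; rewrite RintegralZr.
Qed.

Lemma inL2_fst (h : T1 -> R) : inL2 m1 h -> inL2 m (fun z => h z.1).
Proof.
move=> [mh ih]; split; first exact: (mcomp mh m_fst).
exact: (intble_fst m2 ih).
Qed.

End prod_fun.

(** * The weak equation for phi and for v . grad phi *)

Section transport.
Context {R} {d : nat}.
Variables (U : 'rV[R]_d -> R) (mu kappa : rVlaw R d) (omega gamma L c : R).
Hypotheses (vl : velocity_law kappa omega) (omega0 : 0 <= omega) (gamma0 : 0 < gamma) (C2 : Cn 2 U)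
 (gU : gibbs_measure U mu) (L0 : 0 <= L) (HL : forall k x, partial k (partial k U) x <= L).
Local Notation state := (phase R d).
Local Notation m := (mu \x kappa)%E.
Local Notation mp := (m : probability state R).
Local Notation tot := (zz_tot U gamma).
Local Notation rev := (@zz_rev R d).
Local Notation rate := (flip_rate U).
Local Notation Lam := (dirichlet_op U).
Implicit Types (x v : 'rV[R]_d) (z : state) (phi : 'rV[R]_d -> R) (i j k : 'I_d).
Let CU : Cn 1 U. Proof. exact: Cn_leS. Qed.
Let flip_inv := let: And5 h _ _ _ _ := vl in h.
Let quasi_inv := zz_quasi_inv (Cn1_cont CU) gU kappa.
Let su k : inL2 mu (partial k U).
Proof.
split; last exact: (partial_inL2 C2 gU L0 (HL k)).
exact: cont_meas_rV (Cn1_cont_partial CU).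
Qed.
Let su_abs k : inL2 mu (fun x => `|partial k U x|).
Proof.
have [mu_ iu] := su k; split; first exact: mcomp.
by under eq_fun do rewrite -normrX ger0_norm ?sqr_ge0//.
Qed.
Let sv_abs k : inL2 kappa (fun v => `|v ord0 k|).
Proof.
have [mv iv] := inL2_velocity vl k; split; first exact: mcomp.
by under eq_fun do rewrite -normrX ger0_norm ?sqr_ge0//.
Qed.
Let inL2_cst (a : R) : inL2 m (fun _ => a).
Proof. by apply: (@inL2_bounded _ _ _ mp _ `|a|). Qed.
Let inL2_le (f g : state -> R) : mfunT f -> inL2 m g ->
 (forall z, `|f z| <= g z) -> inL2 m f.
Proof.
move=> mf [mg ig] fg; split => //; apply: (intble_EFin_le _ ig); first exact: mfunX.
move=> z; rewrite !ger0_norm ?sqr_ge0// -(ger0_norm (sqr_ge0 (f z))) normrX.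
by rewrite lerXn2r// nnegrE// (le_trans _ (fg z)).
Qed.
Let rate_le k z : `|rate k z| <= `|partial k U z.1| * `|z.2 ord0 k|.
Proof.
rewrite ger0_norm ?flip_rate_ge0// /flip_rate ge_max mulr_ge0// andbT.
by rewrite -normrM mulrC ler_norm.
Qed.

Lemma inL2_tot : inL2 m tot.
Proof.
rewrite (_ : tot = fun z => \sum_k rate k z + gamma); last by apply/funext => z; exact: totE.
apply: inL2_add; last exact: inL2_cst.
apply: inL2_sum => k _; apply: (inL2_le _ _ (rate_le k)).
 exact: (m_flip_rate gamma CU k).
exact: (inL2_prod_fun (su_abs k) (sv_abs k)).
Qed.

Lemma inL2_tot_rev : inL2 m (fun z => tot (rev z)).
Proof.
rewrite (_ : (fun z => tot (rev z)) = fun z => \sum_k rate k (rev z) + gamma); last first.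
 by apply/funext => z; exact: totE.
apply: inL2_add; last exact: inL2_cst.
apply: inL2_sum => k _.
apply: (inL2_le _ (inL2_prod_fun (su_abs k) (sv_abs k))).
 apply: (mcomp (m_flip_rate gamma CU k)); exact: m_rev.
by move=> z; apply: le_trans (rate_le k _) _; rewrite /= mxE normrN.
Qed.

Lemma zz_integrable_tot : intble m tot.
Proof. exact: (inL2_integrable (m := mp) inL2_tot). Qed.
Let itot := zz_integrable_tot.

Definition transport phi z : R := \sum_k partial k phi z.1 * z.2 ord0 k.

Definition transport2 phi z : R :=
 \sum_p partial p.2 (partial p.1 phi) z.1 * (z.2 ord0 p.1 * z.2 ord0 p.2).

Lemma continuous_line_comp (f : 'rV[R]_d -> R) x v : continuous f -> continuous (fun r : R => f (x + r *: v)).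
Proof.
move=> cf r; apply: (@continuous_comp _ _ _ (fun r : R => x + r *: v) f); last exact: cf.
apply: cvgD; first exact: cvg_cst.
by apply: cvgZr_tmp; exact: cvg_id.
Qed.

Section test.
Variable phi : 'rV[R]_d -> R.
Hypothesis Cphi : Cc_infty phi.
Let Cn1p k : Cn 1 (partial k phi). Proof. by apply: Cc_infty_Cn; exact: Cc_infty_partial. Qed.
Let sp k : inL2 mu (partial k phi). Proof. by apply: inL2_Cc; exact: Cc_infty_partial. Qed.
Let spp k l : inL2 mu (partial k (partial l phi)).
Proof. by apply: inL2_Cc; do 2 apply: Cc_infty_partial. Qed.
Let cp k : continuous (partial k phi). Proof. exact: Cn1_cont. Qed.
Let cpp k l : continuous (partial k (partial l phi)). Proof. exact: Cn1_cont_partial. Qed.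

Lemma inL2_transport : inL2 m (transport phi).
Proof.
apply: inL2_sum => k _.
exact: (inL2_prod_fun (sp k) (inL2_velocity vl k)).
Qed.

Lemma inL2_transport2 : inL2 m (transport2 phi).
Proof.
apply: inL2_sum => p _.
exact: (inL2_prod_fun (spp p.2 p.1) (inL2_velocity_mul vl p.1 p.2)).
Qed.

Lemma intble_transport_section x : intble kappa (fun v => transport phi (x, v)).
Proof.
apply: intble_bigsum => // k _.
exact: (intble_cmul msT (partial k phi x) (inL2_integrable (inL2_velocity vl k))).
Qed.

Lemma refresh_transport x : refresh kappa (transport phi) x = 0.
Proof.
have iv k := inL2_integrable (inL2_velocity vl k).
rewrite /refresh /transport Rintegral_bigsum// ; last first.
 by move=> k _; exact: (intble_cmul msT (partial k phi x) (iv k)).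
rewrite big1// => k _ /=.
rewrite RintegralZl// (@Rintegral_odd _ _ _ _ vl k) ?mulr0//.
 exact: measurable_coord.
by move=> v; rewrite !mxE eqxx.
Qed.

Lemma refresh_transport_mul h : inL2 mu h ->
 \int[m]_z (h z.1 * transport phi z) = 0.
Proof.
move=> sh; rewrite (Rintegral_fst_mul (g := transport phi)).
- rewrite -[RHS](Rintegral_cst_prob mu); apply: eq_Rintegral => x _.
 by have := refresh_transport x; rewrite /refresh => ->; rewrite mulr0.
- exact: intble_transport_section.
- exact: inL2_mul (inL2_fst kappa sh) inL2_transport.
Qed.

Lemma transport_sq : \int[m]_z (transport phi z ^+ 2) = \int[mu]_x gradient_sq phi x.
Proof.
have ikl k l : intble mu (fun x => partial k phi x * partial l phi x).
 exact: inL2_mul.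
have jkl k l := intble_velocity_mul vl k l.
have iz k l := intble_prod_fun (ikl k l) (jkl k l).
transitivity (\int[m]_z \sum_k \sum_l (partial k phi z.1 * partial l phi z.1) * (z.2 ord0 k * z.2 ord0 l)).
 apply: eq_Rintegral => z _; rewrite expr2 /transport mulr_suml; apply: eq_bigr => k _.
 by rewrite mulr_sumr; apply: eq_bigr => l _; ring.
rewrite Rintegral_bigsum// => [|k _]; last by apply: intble_bigsum => // l _; exact: iz.
rewrite /gradient_sq Rintegral_bigsum//; last by move=> k _; case: (sp k).
apply: eq_bigr => k _; rewrite Rintegral_bigsum//.
rewrite (bigD1 k)//= big1 => [|l lk]; last first.
 by rewrite (Rintegral_prod_fun (ikl k l) (jkl k l)) (Rintegral_velocity_mul vl) eq_sym (negbTE lk) mulr0.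
rewrite (Rintegral_prod_fun (ikl k k) (jkl k k)) (Rintegral_velocity_mul vl) eqxx mulr1 addr0.
by apply: eq_Rintegral => x _; rewrite expr2.
Qed.

Lemma is_derive_transport0 z (r : R) :
 is_derive r 1 (fun r => phi (zz_flow z r).1) (transport phi (zz_flow z r)).
Proof.
have := is_derive_Cn1_line z.1 z.2 r (Cc_infty_Cn 1 Cphi); congr is_derive.
by apply: eq_bigr => k _; rewrite mulrC.
Qed.

Lemma is_derive_transport1 z (r : R) :
 is_derive r 1 (fun r => transport phi (zz_flow z r)) (transport2 phi (zz_flow z r)).
Proof.
have dk k := is_deriveM (is_derive_Cn1_line z.1 z.2 r (Cn1p k)) (is_derive_cst (z.2 ord0 k) r (1 : R)).
have := is_derive_sum (h := fun k => (fun s : R => partial k phi (z.1 + s *: z.2)) * cst (z.2 ord0 k)) dk.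
congr is_derive; first by apply/funext => s; rewrite fct_sumE.
rewrite /transport2 -(pair_big predT predT (fun i j => partial j (partial i phi) (zz_flow z r).1 * (z.2 ord0 i * z.2 ord0 j)))/=.
apply: eq_bigr => i _; rewrite /GRing.scale/= mulr0 add0r mulr_sumr; apply: eq_bigr => j _.
by rewrite /cst; ring.
Qed.

Lemma continuous_transport z : continuous (fun r => transport phi (zz_flow z r)).
Proof.
apply: continuous_bigsum => k r.
by apply: (@continuousM _ _ (fun r => partial k phi (zz_flow z r).1) (fun=> z.2 ord0 k)); [exact: continuous_line_comp|exact: cst_continuous].
Qed.

Lemma continuous_transport2 z : continuous (fun r => transport2 phi (zz_flow z r)).
Proof.
apply: continuous_bigsum => p r.
by apply: (@continuousM _ _ (fun r => partial p.2 (partial p.1 phi) (zz_flow z r).1) (fun=> z.2 ord0 p.1 * z.2 ord0 p.2)); [exact: continuous_line_comp|exact: cst_continuous].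
Qed.

(** A function of x alone is unchanged by flips and by refreshment, so the jump terms cancel and
    only the transport remains. *)
Lemma zz_adjoint_fst z : zz_adjoint U gamma kappa (fun z => phi z.1) (transport phi) z = - transport phi z.
Proof.
rewrite /zz_adjoint /zz_jumps_adj /refresh /= Rintegral_cst_prob -mulr_suml -mulrDl.
by rewrite totE opprD addrCA subrr addr0.
Qed.

(** What is left of the adjoint applied to v . grad phi once its velocity average Lam phi and the
    refreshment term are taken out: the off-diagonal Hessian of phi, the fluctuations of v_k^2, and
    the signed squares. *)
Definition residual z : R :=
 cross_part (fun p => if p.1 == p.2 then 0 else - partial p.2 (partial p.1 phi) z.1) z.2 +
 square_part (fun k => partial k U z.1 * partial k phi z.1 - partial k (partial k phi) z.1) z.2 +
 abs_part (fun k => - `|partial k U z.1| * partial k phi z.1) z.2.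

(** A flip changes v . grad phi by - 2 v_k partial_k phi. With a = v_k partial_k U, the reversed
    rate satisfies 2 (- a)_+ = |a| - a: the part in a yields v_k^2 partial_k U partial_k phi, whose
    average belongs to Lam phi, and the part in |a| yields v_k |v_k|. *)
Lemma zz_adjoint_transport z :
 zz_adjoint U gamma kappa (transport phi) (transport2 phi) z =
 Lam phi z.1 + residual z - gamma * transport phi z.
Proof.
have tf k : transport phi (zz_flip k z) = transport phi z - 2 * (partial k phi z.1 * z.2 ord0 k).
 rewrite /transport (bigD1 k)//= [in RHS](bigD1 k)//= mxE eqxx.
 rewrite (eq_bigr (fun i => partial i phi z.1 * z.2 ord0 i)) => [|i /negbTE ik].
  by move: (\sum_(i | _) _) (partial k phi z.1) (z.2 ord0 k) => S a b; ring.
 by rewrite mxE ik.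
rewrite /zz_adjoint /zz_jumps_adj refresh_transport mulr0 addr0.
under eq_bigr do rewrite tf mulrBr; rewrite sumrB -mulr_suml totE.
have -> : transport2 phi z = - cross_part (fun p => if p.1 == p.2 then 0 else - partial p.2 (partial p.1 phi) z.1) z.2 +
  \sum_k partial k (partial k phi) z.1 * z.2 ord0 k ^+ 2.
 rewrite /transport2 /cross_part -sumrN (bigID (fun p : 'I_d * 'I_d => p.1 == p.2))/= addrC; congr (_ + _).
  rewrite big_mkcond/=; apply: eq_bigr => p _; case: (p.1 == p.2); first by rewrite mul0r oppr0.
  by rewrite mulNr opprK.
 rewrite (reindex_onto (fun k => (k, k)) fst)/=.
  by apply: eq_big => [k|k _]; [rewrite eqxx|rewrite expr2].
 by case=> i j /= /eqP ->.
pose r k := rate k (rev z).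
have rE k : 2 * r k * (partial k phi z.1 * z.2 ord0 k) =
  - (partial k U z.1 * partial k phi z.1 * z.2 ord0 k ^+ 2) + `|partial k U z.1| * partial k phi z.1 * (z.2 ord0 k * `|z.2 ord0 k|).
 rewrite /r /flip_rate /= mxE mulNr.
 have -> : `|partial k U z.1| * partial k phi z.1 * (z.2 ord0 k * `|z.2 ord0 k|) =
   `|z.2 ord0 k * partial k U z.1| * (partial k phi z.1 * z.2 ord0 k) by rewrite normrM; ring.
 have -> : partial k U z.1 * partial k phi z.1 * z.2 ord0 k ^+ 2 = (z.2 ord0 k * partial k U z.1) * (partial k phi z.1 * z.2 ord0 k) by ring.
 move: (z.2 ord0 k * partial k U z.1) (partial k phi z.1 * _) => a b.
 by have [a0|a0] := leP 0 a; [rewrite max_r ?oppr_le0// ger0_norm//|rewrite max_l ?oppr_ge0 ?ltW// ltr0_norm//]; ring.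
have sE : \sum_k r k * (2 * (partial k phi z.1 * z.2 ord0 k)) =
  - (\sum_k partial k U z.1 * partial k phi z.1 * z.2 ord0 k ^+ 2) -
  abs_part (fun k => - `|partial k U z.1| * partial k phi z.1) z.2.
 rewrite /abs_part -!sumrN -big_split/=; apply: eq_bigr => k _.
 by rewrite mulrCA [2 * _]mulrA rE !mulNr opprK.
rewrite -/r in sE *; rewrite sE /residual.
have -> : square_part (fun k => partial k U z.1 * partial k phi z.1 - partial k (partial k phi) z.1) z.2 =
 \sum_k partial k U z.1 * partial k phi z.1 * z.2 ord0 k ^+ 2 -
 \sum_k partial k (partial k phi) z.1 * z.2 ord0 k ^+ 2 - Lam phi z.1.
 by rewrite /square_part /dirichlet_op -!sumrB; apply: eq_bigr => k _; ring.
move: (\sum_k _) (\sum_k _) (\sum_k _) (cross_part _ _) (abs_part _ _) (Lam _ _) (transport _ _) => a b e f g h t.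
ring.
Qed.
Let suk k : intble mu (fun x => (partial k U x * partial k phi x) ^+ 2).
Proof.
under eq_fun do rewrite expr2; apply: intble_csupp.
 by do ?apply: continuous_rVM => //; exact: Cn1_cont_partial.
by apply: csuppMl; apply: csuppMr; apply: csupp_partial; exact: Cc_infty_csupp.
Qed.
Let sukp k : inL2 mu (fun x => partial k U x * partial k phi x).
Proof.
split => //; apply: cont_meas_rV; apply: continuous_rVM => //; exact: Cn1_cont_partial.
Qed.

Lemma inL2_residual : inL2 m residual.
Proof.
apply: inL2_add; [apply: inL2_add|]; apply: inL2_sum => k _.
- case: (k.1 == k.2).
  by under eq_fun do rewrite mul0r; exact: inL2_cst.
 have sN : inL2 mu (fun x => - partial k.2 (partial k.1 phi) x).
  by have := inL2_cmul (-1) (spp k.2 k.1); congr inL2; apply/funext => x; rewrite mulN1r.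
 exact: (inL2_prod_fun sN (inL2_velocity_mul vl k.1 k.2)).
- have s1 : inL2 kappa (fun _ : 'rV[R]_d => (1 : R)).
  by apply: (@inL2_bounded _ _ _ _ _ 1) => // v; rewrite normr1.
 exact: (inL2_prod_fun (inL2_sub (sukp k) (spp k k)) (inL2_sub (inL2_velocity_sq vl k) s1)).
- have sb : inL2 mu (fun x => - `|partial k U x| * partial k phi x).
  split.
   apply: mfunM; last by case: (sp k).
   by apply: mcomp => //; case: (su_abs k).
  have h := suk k; congr (mu.-integrable _ _): h; apply/funext => x /=; congr EFin.
  by rewrite mulNr sqrrN !exprMn -normrX ger0_norm ?sqr_ge0.
 exact: (inL2_prod_fun sb (inL2_velocity_abs vl k)).
Qed.

Lemma residual_section x :
 [/\ intble kappa (fun v => residual (x, v)), \int[kappa]_v residual (x, v) = 0 &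
  \int[kappa]_v (residual (x, v) ^+ 2) <=
  omega * (6 * hess_sq phi x + 12 * \sum_k (partial k U x * partial k phi x) ^+ 2)].
Proof.
pose cc (p : 'I_d * 'I_d) : R := if p.1 == p.2 then 0 else - partial p.2 (partial p.1 phi) x.
pose aa k := partial k U x * partial k phi x - partial k (partial k phi) x.
pose bb k := - `|partial k U x| * partial k phi x.
have c0 i : cc (i, i) = 0 by rewrite /cc/= eqxx.
have [sV V0 Vle] := velocity_polynomial vl aa bb c0.
split; [exact: (inL2_integrable sV)|exact: V0|].
apply: (le_trans Vle).
have hE : hess_sq phi x = \sum_p cc p ^+ 2 + \sum_k partial k (partial k phi) x ^+ 2.
 rewrite /hess_sq (pair_big predT predT (fun i j => partial j (partial i phi) x ^+ 2))/=.
 rewrite (bigID (fun p : 'I_d * 'I_d => p.1 == p.2))/= addrC; congr (_ + _).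
  rewrite big_mkcond/=; apply: eq_bigr => p _; rewrite /cc; case: (p.1 == p.2); first by rewrite expr0n.
  by rewrite sqrrN.
 rewrite (reindex_onto (fun k => (k, k)) fst)/=.
  by apply: eq_bigl => k; rewrite eqxx.
 by case=> i j /= /eqP ->.
(* With A, B the off-diagonal and diagonal parts of the squared Hessian and C the sum of the
   (partial_k U partial_k phi)^2, the bound to reach is 3 (2 A + (2 B + 2 C) + 2 C) = 6 (A + B) + 12
   C, times omega. *)
have aE : \sum_k aa k ^+ 2 <= 2 * \sum_k (partial k U x * partial k phi x) ^+ 2 + 2 * \sum_k partial k (partial k phi) x ^+ 2.
 rewrite !mulr_sumr -big_split/=; apply: ler_sum => k _; rewrite /aa.
 move: (partial k U x * _) (partial k (partial k phi) x) => a b.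
 by have := sqr_ge0 (a + b); nra.
have bE : \sum_k bb k ^+ 2 = \sum_k (partial k U x * partial k phi x) ^+ 2.
 by apply: eq_bigr => k _; rewrite /bb mulNr sqrrN !exprMn -normrX ger0_norm ?sqr_ge0.
rewrite hE bE; move: aE; move: (\sum_p _) (\sum_k _ ^+ 2) (\sum_k _ ^+ 2) (\sum_k _ ^+ 2) => A B C D aE.
have : 0 <= omega * (2 * C + 2 * B - D) by rewrite mulr_ge0// subr_ge0.
by lra.
Qed.

Lemma refresh_residual_mul h : inL2 mu h -> \int[m]_z (h z.1 * residual z) = 0.
Proof.
move=> sh; rewrite (Rintegral_fst_mul (g := residual)).
- rewrite -[RHS](Rintegral_cst_prob mu); apply: eq_Rintegral => x _.
 by have [_ -> _] := residual_section x; rewrite mulr0.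
- by move=> x; case: (residual_section x).
- exact: inL2_mul (inL2_fst kappa sh) inL2_residual.
Qed.
Let ihess : intble mu (hess_sq phi).
Proof.
apply: intble_bigsum => // i _; apply: intble_bigsum => // j _.
by case: (spp j i).
Qed.

(** [gradient_weight_bound] with h = partial_k phi bounds the sum of the (partial_k U partial_k
    phi)^2 by 4 H + 2 L G, with H the squared Hessian and G the squared gradient. Then 6 H + 12 (4 H
    + 2 L G) = 54 H + 24 L G, and Bochner's formula bounds H. *)
Lemma residual_sq_le : hessian_ge U (- c) ->
 \int[m]_z (residual z ^+ 2) <=
 54 * omega * (\int[mu]_x (Lam phi x ^+ 2) + (c + L) * \int[mu]_x gradient_sq phi x).
Proof.
move=> hU; have [_ ir] := inL2_residual.
have iS : intble mu (fun x => \sum_k (partial k U x * partial k phi x) ^+ 2).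
 by apply: intble_bigsum.
have i1 := intble_cmul msT 6 ihess; have i2 := intble_cmul msT 12 iS.
apply: (@le_trans _ _ (omega * (6 * \int[mu]_x hess_sq phi x +
  12 * \int[mu]_x \sum_k (partial k U x * partial k phi x) ^+ 2))).
 rewrite -!RintegralZl// -(RintegralD msT i1 i2) -RintegralZl//; last exact: intble_add.
 rewrite -(RFubini1 ir); apply: le_Rintegral => //.
 - exact: intble_Rintegral1 ir.
 - by apply: intble_cmul => //; exact: intble_add.
 - by move=> x _; case: (residual_section x).
have B : \int[mu]_x hess_sq phi x <= \int[mu]_x (Lam phi x ^+ 2) + c * \int[mu]_x gradient_sq phi x.
 exact: bochner.
have G : \int[mu]_x \sum_k (partial k U x * partial k phi x) ^+ 2 <=
  4 * \int[mu]_x hess_sq phi x + 2 * L * \int[mu]_x gradient_sq phi x.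
 rewrite Rintegral_bigsum//.
 apply: (@le_trans _ _ (\sum_k (4 * \int[mu]_x (partial k (partial k phi) x ^+ 2) + 2 * L * \int[mu]_x (partial k phi x ^+ 2)))).
  apply: ler_sum => k _; under eq_Rintegral do rewrite exprMn.
  apply: (gradient_weight_bound C2 gU L0 (HL k)); first exact: Cn1p.
  by apply: csupp_partial; exact: Cc_infty_csupp.
 rewrite big_split/= -!mulr_sumr lerD//; last first.
  by rewrite /gradient_sq Rintegral_bigsum// => k _; case: (sp k).
 rewrite ler_wpM2l// -Rintegral_bigsum//; last by move=> k _; case: (spp k k).
 apply: le_Rintegral => //; first by apply: intble_bigsum => // k _; case: (spp k k).
 move=> x _; apply: ler_sum => k _; rewrite (bigD1 k)//= lerDl; apply: sumr_ge0 => j _; exact: sqr_ge0.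
have G0 := gradient_sq_ge0 mu phi.
move: B G G0; move: (\int[mu]_x \sum_k _) (\int[mu]_x hess_sq phi x) (\int[mu]_x (Lam phi x ^+ 2)) (\int[mu]_x gradient_sq phi x) => S H Q g B G g0.
have h1 : omega * (6 * H + 12 * S) <= omega * (6 * H + 12 * (4 * H + 2 * L * g)) by rewrite ler_wpM2l//; lra.
have h2 : omega * (54 * H) <= omega * (54 * (Q + c * g)) by rewrite ler_wpM2l//; lra.
have h3 : 0 <= omega * (L * g) by do ?apply: mulr_ge0.
by move: h1 h2 h3; lra.
Qed.

Section weak.
Variables (f : state -> R) (u : R -> state -> R) (M : R).
Hypothesis zu : zz_mild U gamma kappa f u M.
Let sphi : inL2 m (fun z => phi z.1).
Proof. by apply: inL2_fst; exact: inL2_Cc. Qed.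
Let toint g : inL2 m g -> intble m g.
Proof. exact: (inL2_integrable (m := mp)). Qed.

Lemma zz_weak_fst s t : 0 <= s -> s <= t ->
 \int[m]_z (u t z * phi z.1) - \int[m]_z (u s z * phi z.1) =
 - \int[lebesgue_measure]_(q in `[s, t]) \int[m]_z (u q z * transport phi z).
Proof.
move=> s0 st; have [mphi _] := sphi; have [mt _] := inL2_transport.
have igx x : intble kappa (fun=> phi x).
 by apply: (intble_by kappa `|phi x|).
have H := zz_weak CU gamma0 flip_inv quasi_inv zu is_derive_transport0 continuous_transport mphi mt
 (toint sphi) (toint inL2_transport) (inL2_mul inL2_tot sphi)
 (inL2_mul inL2_tot_rev sphi) igx s0 st.
apply: etrans H _; rewrite -Rintegral_opp; apply: eq_Rintegral => q _.
rewrite -Rintegral_opp; apply: eq_Rintegral => z _.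
by rewrite zz_adjoint_fst mulrN.
Qed.

Lemma zz_weak_transport s t : 0 <= s -> s <= t ->
 \int[m]_z (u t z * transport phi z) - \int[m]_z (u s z * transport phi z) =
 \int[lebesgue_measure]_(q in `[s, t])
  \int[m]_z (u q z * (Lam phi z.1 + residual z - gamma * transport phi z)).
Proof.
move=> s0 st; have [mt _] := inL2_transport; have [mt2 _] := inL2_transport2.
have H := zz_weak CU gamma0 flip_inv quasi_inv zu is_derive_transport1 continuous_transport2 mt mt2
 (toint inL2_transport) (toint inL2_transport2)
 (inL2_mul inL2_tot inL2_transport)
 (inL2_mul inL2_tot_rev inL2_transport) intble_transport_section s0 st.
by apply: etrans H _; apply: eq_Rintegral => q _; apply: eq_Rintegral => z _; rewrite zz_adjoint_transport.
Qed.

End weak.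
End test.
End transport.

Lemma Rintegral_itv_ge R (g : R -> R) (a b c : R) : a <= b ->
 intble_on (@lebesgue_measure R) `[a, b] g -> (forall q, a <= q <= b -> c <= g q) ->
 (b - a) * c <= \int[lebesgue_measure]_(q in `[a, b]) g q.
Proof.
move=> ab ig gc.
have cE : \int[lebesgue_measure]_(q in `[a, b]) c = (b - a) * c.
 rewrite Rintegral_cst//= lebesgue_measure_itv/= lte_fin mulrC.
 have [_|ba] := ltP a b; first by rewrite -EFinB.
 by have -> : a = b by [apply/eqP; rewrite eq_le ab ba]; rewrite subrr.
rewrite -cE; apply: le_Rintegral => //.
by apply: (@intble_itv_bounded _ _ `|c|).
Qed.

Lemma Rintegral_itv_le R (g : R -> R) (a b c : R) : a <= b ->
 intble_on (@lebesgue_measure R) `[a, b] g -> (forall q, a <= q <= b -> g q <= c) ->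
 \int[lebesgue_measure]_(q in `[a, b]) g q <= (b - a) * c.
Proof.
move=> ab ig gc; rewrite -lerN2 -Rintegral_opp -mulrN; apply: Rintegral_itv_ge => //.
 have := @intble_cmul _ _ R (@lebesgue_measure R) `[a, b]%classic (measurable_itv _) (-1) g ig.
 by congr (integrable _ _ _); apply/funext => q /=; rewrite mulN1r.
by move=> q qab; rewrite lerN2; exact: gc.
Qed.

(** The arithmetic of one time step, with tolerance h^2 for the resolvent equation: r is the norm of
    the data actually solved for, C the Lipschitz constant in time, B a bound on n and D, and q
    stands for 1 / sqrt p. Every deviation from h (n^2 / 2 - A n D - D^2) goes into one multiple of
    h^2 whose factor depends neither on the time nor on h. *)
Lemma pairing_step_error (R : realFieldType) (n D r A C B h q : R) :
 0 <= h <= 1 -> 0 <= A -> 0 <= C -> 0 <= q -> 0 <= n <= B -> 0 <= D <= B -> `|r - n| <= h ^+ 2 -> 0 <= r ->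
 h * (2^-1 * n ^+ 2 - A * n * D - D ^+ 2) -
  (B + 1 + (C + 1) * (B + 1) + A * (B + 2 * C * (B + 1)) + (4 * C * B + 4 * C ^+ 2) + q * (B + 2 * C)) * h ^+ 2 <=
 h * (2^-1 * r ^+ 2 - (h ^+ 2) ^+ 2 - (C * h + h ^+ 2) * r - (D + 2 * C * h) * (A * r)) -
 (D + 2 * C * h) * (h * (D + 2 * C * h) + h ^+ 2 * q).
Proof.
move=> /andP[h0 h1] A0 C0 q0 /andP[n0 nB] /andP[D0 DB] + r0; rewrite ler_norml => /andP[rn1 rn2].
have hh : h ^+ 2 <= h by rewrite expr2 ler_piMl.
have hh0 : 0 <= h ^+ 2 by exact: sqr_ge0.
have rh : r <= n + h by lra.
have rB : r <= B + 1 by lra.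
have k1 : 2^-1 * n ^+ 2 - h * B <= 2^-1 * r ^+ 2.
 have [nh|nh] := leP n (h ^+ 2).
  have : n ^+ 2 <= h * B by rewrite expr2 ler_pM// (le_trans nh).
  by have := sqr_ge0 r; have := sqr_ge0 n; lra.
 have : (n - h ^+ 2) ^+ 2 <= r ^+ 2 by rewrite lerXn2r ?nnegrE//; lra.
 have : n * h ^+ 2 <= B * h by exact: ler_pM.
 by have := sqr_ge0 (h ^+ 2); nra.
have k2 : (h ^+ 2) ^+ 2 <= h by rewrite (le_trans _ hh)// [leLHS]expr2 ler_piMl// (le_trans hh).
have k3 : (C * h + h ^+ 2) * r <= h * ((C + 1) * (B + 1)).
 have : (C * h + h ^+ 2) * r <= (C * h + h) * (B + 1) by apply: ler_pM => //; [rewrite addr_ge0 ?mulr_ge0|rewrite lerD2l].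
 by move=> /le_trans; apply; rewrite le_eqVlt; apply/orP; left; apply/eqP; ring.
have k4 : (D + 2 * C * h) * (A * r) <= A * n * D + h * (A * (B + 2 * C * (B + 1))).
 have a1 : (D + 2 * C * h) * r <= D * n + h * (B + 2 * C * (B + 1)).
  have b1 : D * r <= D * n + h * B.
   have : D * r <= D * (n + h) by rewrite ler_wpM2l.
   have : D * h <= B * h by rewrite ler_wpM2r.
   by lra.
  have b2 : (2 * C * h) * r <= (2 * C * h) * (B + 1) by rewrite ler_wpM2l ?mulr_ge0.
  by lra.
 have : A * ((D + 2 * C * h) * r) <= A * (D * n + h * (B + 2 * C * (B + 1))) by rewrite ler_wpM2l.
 by lra.
have k5 : (D + 2 * C * h) ^+ 2 <= D ^+ 2 + h * (4 * C * B + 4 * C ^+ 2).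
 have b1 : C * h * D <= C * h * B by rewrite ler_wpM2l ?mulr_ge0.
 have b2 : C ^+ 2 * h ^+ 2 <= C ^+ 2 * h by rewrite ler_wpM2l ?sqr_ge0.
 by nra.
have k6 : (D + 2 * C * h) * (h ^+ 2 * q) <= h ^+ 2 * (q * (B + 2 * C)).
 have b1 : D + 2 * C * h <= B + 2 * C by rewrite lerD// ler_piMr ?mulr_ge0.
 have : (D + 2 * C * h) * (h ^+ 2 * q) <= (B + 2 * C) * (h ^+ 2 * q) by rewrite ler_wpM2r ?mulr_ge0.
 by lra.
set X := (2^-1 * r ^+ 2 - _ - _ - _); set Y := (2^-1 * n ^+ 2 - _ - _).
set K1 := B + 1 + _ + _ + (4 * C * B + _).
have J : Y - h * K1 <= X - (D + 2 * C * h) ^+ 2 by rewrite /X /Y /K1; lra.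
have : h * (Y - h * K1) <= h * (X - (D + 2 * C * h) ^+ 2) by rewrite ler_wpM2l.
by move: k6; move: X Y K1 {J} => X Y K1; lra.
Qed.

(* The weights 1/48 and 6 in [n D / sqrt 2 <= n^2/48 + 6 D^2] leave half of the term [T N0 / 12] to absorb. *)
Lemma energy_decay_algebra (R : rcfType) (A gamma T p l N0 N1 E1 ns Ds nt Dt IN ID : R) :
 0 < gamma -> 0 < p -> 0 < T -> T ^+ 2 = p^-1 -> T / 3 <= l ->
 0 <= N1 -> ns ^+ 2 + Ds ^+ 2 <= N0 -> nt ^+ 2 + Dt ^+ 2 <= N0 ->
 N1 - N0 <= - (2 * gamma) * E1 -> 0 <= E1 -> T / 3 * Ds ^+ 2 <= E1 -> T / 3 * Dt ^+ 2 <= E1 ->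
 l * N1 <= IN -> ID <= E1 ->
 4^-1 * IN - (A ^+ 2 + 5 / 4) * ID <= (Ds * ns + Dt * nt) / Num.sqrt (2 * p) ->
 T * N0 <= (2 * T + 12 * (A ^+ 2 + 5 / 4 + 36) / gamma) * (N0 - N1).
Proof.
move=> g0 p0 T0 Tp lT N10 Ns Nt en E10 Ds2 Dt2 I1 I2 H.
have sp : (Num.sqrt (2 * p))^-1 ^+ 2 = T ^+ 2 / 2.
 by rewrite exprVn sqr_sqrtr ?mulr_ge0 ?(ltW p0)// Tp invfM mulrC.
have s0 : 0 <= (Num.sqrt (2 * p))^-1 by rewrite invr_ge0 sqrtr_ge0.
have sT : (Num.sqrt (2 * p))^-1 <= T.
 rewrite -(ler_pXn2r (n := 2))// ?nnegrE ?(ltW T0)// sp; have := sqr_ge0 T; lra.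
have key a b : b * a / Num.sqrt (2 * p) <= T * (a ^+ 2 / 48) + 6 * (T * b ^+ 2).
 rewrite -[leLHS]/(_ * _^-1); move: (_^-1) sp s0 sT => s sp s0 sT.
 rewrite -(ler_pM2l T0); have h1 := sqr_ge0 (T * a / 12 - b * s * 6 ).
 have e1 : (b * s) ^+ 2 = T ^+ 2 * b ^+ 2 / 2 by rewrite exprMn sp; ring.
 have h2 := sqr_ge0 (T * a - 24 * (b * s)).
 have : T * (b * a * s) = (T * a) * (b * s) by ring.
 have : T * (T * (a ^+ 2 / 48) + 6 * (T * b ^+ 2)) = (T * a) ^+ 2 / 48 + 12 * (b * s) ^+ 2 by rewrite e1; field.
 by move=> -> ->; move: (T * a) (b * s) h2 => x y h2; nra.
have n1 : T * ns ^+ 2 + T * Ds ^+ 2 <= T * N0 by rewrite -mulrDr ler_pM2l.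
have n2 : T * nt ^+ 2 + T * Dt ^+ 2 <= T * N0 by rewrite -mulrDr ler_pM2l.
have k1 := key ns Ds; have k2 := key nt Dt.
have l1 : T / 3 * N1 <= IN by apply: le_trans I1; rewrite ler_wpM2r.
have a0 : 0 <= A ^+ 2 + 5 / 4 by rewrite addr_ge0 ?sqr_ge0.
have i2 : (A ^+ 2 + 5 / 4) * ID <= (A ^+ 2 + 5 / 4) * E1 by rewrite ler_wpM2l.
have d2 : 0 <= T * Ds ^+ 2 by rewrite mulr_ge0 ?sqr_ge0// ltW.
have d3 : 0 <= T * Dt ^+ 2 by rewrite mulr_ge0 ?sqr_ge0// ltW.
rewrite [(Ds * ns + _) / _]mulrDl in H; move: (A ^+ 2 + 5 / 4) a0 i2 H => a a0 i2 H.
have P : T * N0 <= 2 * T * (N0 - N1) + 24 * (a + 36) * E1 by lra.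
apply: le_trans P _; rewrite [leRHS]mulrDl lerD2l.
have -> : 12 * (a + 36) / gamma * (N0 - N1) = 24 * (a + 36) * ((N0 - N1) / (2 * gamma)) by field; rewrite gt_eqF.
rewrite ler_wpM2l//; first by rewrite mulr_ge0// addr_ge0.
by rewrite ler_pdivlMr ?mulr_gt0//; lra.
Qed.

(** * Decay in time average *)

Section energy_method.
Context {R} (X : Type).
(** The argument in abstract form: [ap t eta phi] says that phi solves the resolvent equation at
    time t up to eta, [nr phi] is the norm of the data for which phi is an exact solution, and
    [pair t phi] is the inner product of u(t) with v . grad phi. [n] and [D] are norms, whereas [N]
    is the square of the full norm. *)
Variables (ap : R -> R -> X -> Prop) (pair : R -> X -> R) (nr : X -> R).
Variables (n D N : R -> R) (A C M gamma p : R).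
Local Notation leb := (@lebesgue_measure R).
Hypotheses (A0 : 0 <= A) (C0 : 0 <= C) (gamma0 : 0 < gamma) (p0 : 0 < p) (nM : forall t, 0 <= n t <= M)
 (DB : forall t, 0 <= D t <= 2 * M) (pyth : forall t, N t = n t ^+ 2 + D t ^+ 2)
 (D_lip : forall s t, 0 <= s -> 0 <= t -> `|D t - D s| <= 2 * C * `|t - s|).
Hypothesis energy : forall s t, 0 <= s -> s <= t ->
 N t - N s <= - (2 * gamma) * \int[leb]_(q in `[s, t]) (D q ^+ 2).
Hypotheses (mD2 : mfunT (fun q => D q ^+ 2)) (mN : mfunT N)
 (ap_ex : forall t (eta : R), 0 < eta -> exists phi, ap t eta phi)
 (ap_norm : forall t eta phi, ap t eta phi -> `|nr phi - n t| <= eta) (nr0 : forall phi, 0 <= nr phi).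
Hypothesis pair_le : forall t eta phi, ap t eta phi ->
 `|pair t phi| <= D t * ((n t + eta) / Num.sqrt (2 * p)).
Hypothesis pair_step : forall s h eta phi phi', 0 <= s -> 0 <= h -> 0 <= eta ->
 ap s eta phi -> ap (s + h) eta phi' ->
 h * (2^-1 * nr phi ^+ 2 - eta ^+ 2 - (C * h + eta) * nr phi -
  (D s + 2 * C * h) * (A * nr phi)) -
 (D s + 2 * C * h) * (h * (D s + 2 * C * h) + eta / Num.sqrt p) <=
 pair (s + h) phi' - pair s phi.
Let B := 2 * M.
Let nB t : 0 <= n t <= B.
Proof. by case/andP: (nM t) => n0 n1; rewrite n0 (le_trans n1)// /B ler_peMl ?ler1n// (le_trans n0). Qed.
Let D2ge0 s t : 0 <= \int[leb]_(q in `[s, t]) (D q ^+ 2).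
Proof. by apply: Rintegral_ge0 => q _; exact: sqr_ge0. Qed.

Lemma energy_nonincreasing s t : 0 <= s -> s <= t -> N t <= N s.
Proof.
move=> s0 st; rewrite -subr_le0 (le_trans (energy s0 st))// mulNr oppr_le0 mulr_ge0//.
by rewrite mulr_ge0// ltW.
Qed.
Let NB q : `|N q| <= B ^+ 2 + B ^+ 2.
Proof.
rewrite pyth ger0_norm ?addr_ge0 ?sqr_ge0//.
case/andP: (nB q) => n0 n1; case/andP: (DB q) => D0 D1.
by rewrite lerD// lerXn2r ?nnegrE// (le_trans n0).
Qed.
Let iN s t : intble_on leb `[s, t] N.
Proof. exact: (intble_itv_bounded _ _ mN NB). Qed.
Let iD2 s t : intble_on leb `[s, t] (fun q => D q ^+ 2).
Proof.
apply: (@intble_itv_bounded _ _ (B ^+ 2)) => // q; case/andP: (DB q) => D0 D1.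
by rewrite ger0_norm ?sqr_ge0// lerXn2r ?nnegrE// (le_trans D0).
Qed.

(** Young's inequality A n D <= n^2 / 4 + A^2 D^2 gives n^2 / 2 - A n D - D^2 >= n^2 / 4 - (A^2 + 1)
    D^2; replacing n^2 by N - D^2 makes the last factor A^2 + 5/4. *)
Definition dissipation q : R := 4^-1 * N q - (A ^+ 2 + 5 / 4) * D q ^+ 2.
Let idis s t : intble_on leb `[s, t] dissipation.
Proof.
apply: intble_sub => //; first by apply: intble_cmul => //; exact: measurable_itv.
by apply: intble_cmul => //; exact: measurable_itv.
Qed.
Let A2' : 0 <= A ^+ 2 + 5 / 4. Proof. by rewrite addr_ge0 ?sqr_ge0// divr_ge0. Qed.
(** Over a short step N does not increase and D is Lipschitz, so the integral is at most h times the
    value at s, up to O(h^2). *)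
Let dissipation_step s h : 0 <= s -> 0 <= h ->
 \int[leb]_(q in `[s, s + h]) dissipation q <=
 h * (2^-1 * n s ^+ 2 - A * n s * D s - D s ^+ 2) + (A ^+ 2 + 5 / 4) * (4 * B * C) * h ^+ 2.
Proof.
move=> s0 h0; have ssh : s <= s + h by rewrite lerDl.
have := @Rintegral_itv_le _ dissipation s (s + h)
 (4^-1 * N s - (A ^+ 2 + 5 / 4) * D s ^+ 2 + (A ^+ 2 + 5 / 4) * (4 * B * C * h)) ssh (idis _ _).
rewrite [s + h - s]addrAC subrr add0r.
have H q : s <= q <= s + h -> dissipation q <=
  4^-1 * N s - (A ^+ 2 + 5 / 4) * D s ^+ 2 + (A ^+ 2 + 5 / 4) * (4 * B * C * h).
 move=> qs; have /andP[sq qsh] := qs.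
 have h1 := energy_nonincreasing s0 sq.
 have h2 : D s ^+ 2 - D q ^+ 2 <= 4 * B * C * h.
  have := D_lip s0 (le_trans s0 sq); rewrite ler_norml => /andP[k _].
  have k1 : 2 * C * `|q - s| <= 2 * C * h by rewrite ler_wpM2l ?mulr_ge0// ger0_norm ?subr_ge0// lerBlDl.
  have k2 : D s - D q <= 2 * C * h by move: k k1; move: (D s) (D q) (2 * C * `|_|) (2 * C * h) => *; lra.
  have e : D s ^+ 2 - D q ^+ 2 = (D s - D q) * (D s + D q) by rewrite subr_sqr.
  have Ds := DB s; have Dq := DB q; move: k2 Ds Dq; rewrite e.
  move: (D s) (D q) => a b k2 /andP[a0 a1] /andP[b0 b1].
  have [ab|ab] := leP a b.
   apply: (@le_trans _ _ 0); first by rewrite mulr_le0_ge0 ?subr_le0// addr_ge0.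
   have B0 : 0 <= B by exact: le_trans a1.
   by do 3 (apply: mulr_ge0 => //).
  have : (a - b) * (a + b) <= (2 * C * h) * (B + B) by apply: ler_pM => //; [rewrite subr_ge0 ltW|exact: addr_ge0|exact: lerD].
  by move=> /le_trans; apply; rewrite le_eqVlt; apply/orP; left; apply/eqP; ring.
 have h3 : (A ^+ 2 + 5 / 4) * (D s ^+ 2 - D q ^+ 2) <= (A ^+ 2 + 5 / 4) * (4 * B * C * h) by rewrite ler_wpM2l.
 rewrite /dissipation; move: h1 h3; move: (N q) (N s) (A ^+ 2 + 5 / 4) (D s ^+ 2) (D q ^+ 2) => *; lra.
move=> /(_ H) /le_trans; apply.
have : 0 <= (2^-1 * n s - A * D s) ^+ 2 by exact: sqr_ge0.
have : 4^-1 * N s - (A ^+ 2 + 5 / 4) * D s ^+ 2 = 2^-1 * n s ^+ 2 - A * n s * D s - D s ^+ 2 - (2^-1 * n s - A * D s) ^+ 2.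
 by rewrite pyth; move: (n s) (D s) A => a b e; field.
move=> ->; move: ((_ - A * D s) ^+ 2) (2^-1 * _ - _ - _) (A ^+ 2 + _) => a b e a0.
have : 0 <= h * a by rewrite mulr_ge0.
by lra.
Qed.
Let Kerr : R := B + 1 + (C + 1) * (B + 1) + A * (B + 2 * C * (B + 1)) + (4 * C * B + 4 * C ^+ 2) +
 (Num.sqrt p)^-1 * (B + 2 * C) + (A ^+ 2 + 5 / 4) * (4 * B * C).
Let pairing_dissipation s h (phi phi' : X) : 0 <= s -> 0 <= h <= 1 ->
 ap s (h ^+ 2) phi -> ap (s + h) (h ^+ 2) phi' ->
 \int[leb]_(q in `[s, s + h]) dissipation q - Kerr * h ^+ 2 <= pair (s + h) phi' - pair s phi.
Proof.
move=> s0 h01 a1 a2; have /andP[h0 h1] := h01.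
apply: le_trans (pair_step s0 h0 (sqr_ge0 h) a1 a2).
have q0 : 0 <= (Num.sqrt p)^-1 by rewrite invr_ge0 sqrtr_ge0.
have rn := ap_norm a1.
apply: le_trans (pairing_step_error h01 A0 C0 q0 (nB s) (DB s) rn (nr0 _)).
have := dissipation_step s0 h0; rewrite /Kerr.
by move: (\int[leb]_(_ in _) _) (h * _) (_ + (Num.sqrt p)^-1 * _) ((A ^+ 2 + _) * _) => *; lra.
Qed.
Let pairing_sum s h (phi_ : nat -> X) k : 0 <= s -> 0 <= h <= 1 ->
 (forall i, ap (s + i%:R * h) (h ^+ 2) (phi_ i)) ->
 \int[leb]_(q in `[s, s + k%:R * h]) dissipation q - k%:R * (Kerr * h ^+ 2) <=
 pair (s + k%:R * h) (phi_ k) - pair s (phi_ 0%N).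
Proof.
move=> s0 h01 aps; have /andP[h0 h1] := h01; elim: k => [|k IH].
 by rewrite !mul0r addr0 subr0 subrr set_itv1 Rintegral_set1.
have kh : 0 <= k%:R * h by rewrite mulr_ge0.
have e : s + k.+1%:R * h = s + k%:R * h + h by rewrite -natr1 mulrDl mul1r addrA.
have sk : 0 <= s + k%:R * h by exact: addr_ge0.
have := pairing_dissipation sk h01 (aps k); rewrite -e => /(_ _ (aps k.+1)).
have ch := @Rintegral_itv_chasles _ dissipation s (s + k%:R * h) (s + k.+1%:R * h).
rewrite ch; [|by rewrite lerDl|by rewrite e lerDl|exact: idis].
rewrite -natr1 [(_ + 1) * (Kerr * _)]mulrDl mul1r.
have alg (i1 i2 x y a b c : R) : i1 - x <= b - a -> i2 - y <= c - b ->
 i1 + i2 - (x + y) <= c - a by lra.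
exact: alg.
Qed.

(** Summing the steps telescopes the pairing, whose end values are bounded by [pair_le]. If the
    inequality failed by I - J, a fine enough grid would make the total error smaller than this
    margin. *)
Lemma dissipation_le s t : 0 <= s -> s <= t ->
 \int[leb]_(q in `[s, t]) dissipation q <= (D s * n s + D t * n t) / Num.sqrt (2 * p).
Proof.
move=> s0; rewrite le_eqVlt => /predU1P[<-|st].
 rewrite set_itv1 Rintegral_set1 divr_ge0 ?sqrtr_ge0//.
 by case/andP: (nB s) => ? _; case/andP: (DB s) => ? _; rewrite addr_ge0// mulr_ge0.
have t0 : 0 <= t by rewrite ltW// (le_lt_trans s0).
rewrite leNgt; apply/negP; set I := \int[leb]_(q in _) _; set J := _ / _ => JI.
pose Q := 2 * B / Num.sqrt (2 * p) + `|Kerr| * (t - s).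
have ts : 0 < t - s by rewrite subr_gt0.
have B0 : 0 <= B by case/andP: (nB 0) => /le_trans; exact.
have tsw := ltW ts.
(* The total error is at most Q h: two end terms, where h^2 <= h bounds the tolerance, and the
   accumulated errors of the steps. The number k of steps below is chosen so that h <= 1 and Q h < I
   - J. *)
have Q0 : 0 <= Q.
 apply: addr_ge0; last exact: mulr_ge0.
 by apply: divr_ge0; [exact: mulr_ge0|exact: sqrtr_ge0].
pose k := (Num.trunc (Num.max (t - s) (Q * (t - s) / (I - J)))).+1.
have k0 : 0 < k%:R :> R by rewrite ltr0n.
have kge : Num.max (t - s) (Q * (t - s) / (I - J)) < k%:R by exact: truncnS_gt.
have k1 : t - s <= k%:R by rewrite ltW// (le_lt_trans _ kge)// le_max lexx.
have k2 : Q * (t - s) / (I - J) < k%:R by rewrite (le_lt_trans _ kge)// le_max lexx orbT.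
pose h := (t - s) / k%:R.
have h0 : 0 < h by rewrite divr_gt0.
have h1 : h <= 1 by rewrite ler_pdivrMr// mul1r.
have hk : k%:R * h = t - s by rewrite /h mulrCA divff ?mulr1// gt_eqF.
have h2 : 0 < h ^+ 2 by rewrite exprn_gt0.
have [phi_ aps] := boolp.choice (fun i : nat => ap_ex (s + i%:R * h) h2).
have h01 : 0 <= h <= 1 by rewrite ltW.
have := pairing_sum k s0 h01 aps; rewrite hk [s + (t - s)]addrC subrK -/I.
have a0 := aps 0%N; rewrite mul0r addr0 in a0.
have ak := aps k; rewrite hk [s + (t - s)]addrC subrK in ak.
have b0 := pair_le a0; have bk := pair_le ak.
have hh : h ^+ 2 <= h by rewrite expr2 ler_piMl// ltW.
have up r : D r * ((n r + h ^+ 2) / Num.sqrt (2 * p)) <= D r * n r / Num.sqrt (2 * p) + B / Num.sqrt (2 * p) * h.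
 have -> : D r * ((n r + h ^+ 2) / Num.sqrt (2 * p)) = D r * n r / Num.sqrt (2 * p) + D r * h ^+ 2 / Num.sqrt (2 * p) by ring.
 rewrite lerD2l [leRHS]mulrAC ler_wpM2r ?invr_ge0 ?sqrtr_ge0//.
 by case/andP: (DB r) => *; apply: ler_pM => //; exact: sqr_ge0.
have Kle : k%:R * (Kerr * h ^+ 2) <= `|Kerr| * (t - s) * h.
 have -> : k%:R * (Kerr * h ^+ 2) = Kerr * ((k%:R * h) * h) by ring.
 rewrite hk -[leRHS]mulrA ler_wpM2r ?ler_norm//.
 by have hw := ltW h0; exact: mulr_ge0.
have Qh : Q * h < I - J.
 by rewrite /h mulrA ltr_pdivrMr// [(I - J) * _]mulrC -ltr_pdivrMr// subr_gt0.
move: b0 bk; rewrite !ler_norml => /andP[_ b0'] /andP[_ bk] H.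
have nb0 : - pair s (phi_ 0%N) <= D s * ((n s + h ^+ 2) / Num.sqrt (2 * p)).
 by apply: le_trans (pair_le a0); rewrite -normrN ler_norm.
have QE : Q * h = 2 * (B / Num.sqrt (2 * p) * h) + `|Kerr| * (t - s) * h by rewrite /Q; ring.
have JE : J = D s * n s / Num.sqrt (2 * p) + D t * n t / Num.sqrt (2 * p) by rewrite /J mulrDl.
have alg (i kk pt ps ds dt js jt bh kh : R) : i - kk <= pt - ps -> pt <= dt -> - ps <= ds ->
 ds <= js + bh -> dt <= jt + bh -> kk <= kh -> 2 * bh + kh < i - (js + jt) -> False by lra.
by rewrite QE JE in Qh; exact: alg H bk nb0 (up s) (up t) Kle Qh.
Qed.

Local Notation T := (Num.sqrt p)^-1.
Let T0 : 0 < T. Proof. by rewrite invr_gt0 sqrtr_gt0. Qed.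
Let N0 t : 0 <= N t. Proof. by rewrite pyth addr_ge0 ?sqr_ge0. Qed.
(** The minimum of D^2 is below its mean. D is Lipschitz on nonnegative times, so it is composed
    with max(q, 0) to have a function that is continuous on the line. *)
Let D2_min s t : 0 <= s -> s < t -> exists2 c, s <= c <= t &
 (t - s) * D c ^+ 2 <= \int[leb]_(q in `[s, t]) (D q ^+ 2).
Proof.
move=> s0 st; pose E (q : R) := D (Num.max q 0) ^+ 2.
have c1 : 0 < 2 * C + 1 by rewrite ltr_wpDl ?mulr_ge0.
have cD : continuous (fun q : R => D (Num.max q 0)).
 move=> x; apply/cvgrPdist_le => e e0; near=> y.
 have mx0 (z : R) : 0 <= Num.max z 0 by rewrite le_max lexx orbT.
 apply: le_trans (D_lip (mx0 y) (mx0 x)) _.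
 have mxle : `|Num.max x 0 - Num.max y 0| <= `|x - y|.
  have [xx|xx] := leP x 0; have [yy|yy] := leP y 0; rewrite ?subrr ?normr0// ?sub0r ?subr0.
  - by rewrite normrN gtr0_norm// ler0_norm; lra.
  - by rewrite gtr0_norm// ger0_norm; lra.
 apply: (@le_trans _ _ (2 * C * `|x - y|)); first by rewrite ler_wpM2l ?mulr_ge0.
 apply: (@le_trans _ _ ((2 * C + 1) * `|x - y|)); first by rewrite ler_wpM2r ?lerDl.
 rewrite -ler_pdivlMl// mulrC; near: y.
 apply/nbhs_ballP; exists (e / (2 * C + 1)); first exact: divr_gt0.
 by move=> y /ltW.
have cE : continuous E.
 rewrite (_ : E = fun q => D (Num.max q 0) * D (Num.max q 0)) => [x|]; last first.
  by apply/funext => q; rewrite /E expr2.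
 exact: (@continuousM _ _ (fun q : R => D (Num.max q 0)) (fun q : R => D (Num.max q 0)) x (cD x) (cD x)).
have [c cst cmin] := EVT_min (ltW st) (continuous_subspaceT (A := `[s, t]%classic) cE).
have /andP[sc ct] : s <= c <= t by move: cst; rewrite in_itv.
have c0 := le_trans s0 sc.
exists c; first by rewrite sc.
apply: Rintegral_itv_ge; [exact: ltW|exact: iD2|move=> q /andP[sq qt]].
have := cmin q; rewrite in_itv/= sq qt => /(_ isT); rewrite /E !max_l//.
exact: le_trans sq.
Unshelve. all: by end_near. Qed.

(** The time scale beta for which the integral of N over a window of length T is at most beta times
    the loss of N over that window; its form comes from [energy_decay_algebra]. *)
Definition relaxation : R := 2 * T + 12 * (A ^+ 2 + 5 / 4 + 36) / gamma.
Local Notation beta := relaxation.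

Lemma relaxation_gt0 : 0 < beta.
Proof.
have gw := ltW gamma0; apply: ltr_pwDl; first exact: mulr_gt0.
by apply: divr_ge0 => //; apply: mulr_ge0 => //; exact: addr_ge0.
Qed.
(** The times s and t are taken in the first and last thirds of the window, where D^2 is at most its
    mean. The end terms of [dissipation_le] are then controlled by the dissipated energy, and t - s
    is still at least T / 3. *)
Let energy_decay t0 : 0 <= t0 -> T * N t0 <= beta * (N t0 - N (t0 + T)).
Proof.
have third (a b c e : R) : a + 2 * (b / 3) <= e -> c <= a + b / 3 -> b / 3 <= e - c by lra.
move=> t00.
have [E1 E1E] : exists E1 : R, E1 = \int[leb]_(q in `[t0, t0 + T]) (D q ^+ 2) by eexists.
have T3 : 0 < T / 3 by rewrite divr_gt0.
have sub a b : t0 <= a -> a <= b -> b <= t0 + T -> \int[leb]_(q in `[a, b]) (D q ^+ 2) <= E1.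
 move=> ta ab bt; rewrite E1E (Rintegral_itv_chasles ta (le_trans ab bt) (iD2 _ _)).
 rewrite (Rintegral_itv_chasles ab bt (iD2 _ _)).
 by have := D2ge0 t0 a; have := D2ge0 b (t0 + T); lra.
have [s /andP[s1 s2] Ds] : exists2 c, t0 <= c <= t0 + T / 3 & T / 3 * D c ^+ 2 <= E1.
 have [|c cb ce] := @D2_min t0 (t0 + T / 3) t00; first by rewrite ltrDl.
 exists c => //; move: ce; rewrite addrAC subrr add0r => /le_trans; apply; apply: sub => //.
  by rewrite lerDl ltW.
 by rewrite lerD2l ler_pdivrMr// ler_peMr ?ltW// ltr1n.
have [t /andP[t1 t2] Dt] : exists2 c, t0 + 2 * (T / 3) <= c <= t0 + T & T / 3 * D c ^+ 2 <= E1.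
 have [| |c cb ce] := @D2_min (t0 + 2 * (T / 3)) (t0 + T).
 - by rewrite addr_ge0// mulr_ge0// ltW.
 - by rewrite ltrD2l; move: T3; lra.
 exists c => //; move: ce; have -> : t0 + T - (t0 + 2 * (T / 3)) = T / 3 by lra.
 move=> /le_trans; apply; apply: sub => //; first by rewrite lerDl mulr_ge0// ltW.
 by rewrite lerD2l; move: T3; lra.
have st : s <= t by apply: le_trans s2 (le_trans _ t1); rewrite lerD2l ler_peMl ?ler1n// ltW.
have s0 := le_trans t00 s1.
have t0' := le_trans s0 st.
have H := dissipation_le s0 st.
have I1 : (t - s) * N (t0 + T) <= \int[leb]_(q in `[s, t]) N q.
 apply: Rintegral_itv_ge => // q /andP[sq qt]; apply: energy_nonincreasing (le_trans s0 sq) _.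
 exact: le_trans t2.
have I2 : \int[leb]_(q in `[s, t]) (D q ^+ 2) <= E1 by exact: sub.
have HE : \int[leb]_(q in `[s, t]) dissipation q = 4^-1 * \int[leb]_(q in `[s, t]) N q -
  (A ^+ 2 + 5 / 4) * \int[leb]_(q in `[s, t]) (D q ^+ 2).
 have j1 : intble_on leb `[s, t] (fun q => 4^-1 * N q).
  by apply: intble_cmul => //; exact: measurable_itv.
 have j2 : intble_on leb `[s, t] (fun q => (A ^+ 2 + 5 / 4) * D q ^+ 2).
  by apply: intble_cmul => //; exact: measurable_itv.
 by rewrite -!RintegralZl// -RintegralB.
have tT : t0 <= t0 + T by rewrite lerDl ltW.
have en := energy t00 tT.
have Ns := energy_nonincreasing t00 s1; have Nt := energy_nonincreasing t00 (le_trans s1 st).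
apply: (@energy_decay_algebra _ A gamma T p (t - s) (N t0) (N (t0 + T)) E1 (n s) (D s) (n t) (D t)
 (\int[leb]_(q in `[s, t]) N q) (\int[leb]_(q in `[s, t]) (D q ^+ 2))) => //.
- by rewrite exprVn sqr_sqrtr// ltW.
- exact: third t1 s2.
- by rewrite -pyth.
- by rewrite -pyth.
- by rewrite E1E.
- by rewrite E1E.
- by rewrite -HE.
Qed.

Local Notation I := (fun t : R => \int[leb]_(q in `[t, (t + T)%R]) N q).
Let I_ge0 t : 0 <= I t. Proof. by apply: Rintegral_ge0. Qed.
Let I_decay t : 0 <= t -> I t <= beta * (N t - N (t + T)).
Proof.
move=> t0; apply: le_trans (energy_decay t0).
have tT : t <= t + T by rewrite lerDl ltW.
have := @Rintegral_itv_le _ N t (t + T) (N t) tT (iN _ _).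
rewrite addrAC subrr add0r; apply => q /andP[tq _]; exact: energy_nonincreasing.
Qed.
Let I_nonincreasing s t : 0 <= s -> s <= t -> I t <= I s.
Proof.
move=> s0 st; have e : t = s + (t - s) by rewrite addrC subrK.
rewrite /= {1}e (_ : t + T = s + T + (t - s)); last by rewrite e; ring.
rewrite -(Rintegral_itv_translate s (s + T) (t - s) mN).
apply: le_Rintegral => //.
 have mNt : mfunT (fun q : R => N (q + (t - s))) by apply: (mcomp mN); exact: mfunD.
 by apply: (intble_itv_bounded _ _ mNt) => q; exact: NB.
move=> q; rewrite /= in_itv/= => /andP[sq _]; apply: energy_nonincreasing; first exact: le_trans sq.
by rewrite lerDl subr_ge0.
Qed.
(** The discrete form of I' = N(t + T) - N(t) <= - I / beta, in which I and N are only known to be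
    monotone. *)
Let I_step t h : 0 <= t -> 0 <= h -> (1 + h / beta) * I (t + h) <= I t.
Proof.
move=> t0 h0; have T0' := ltW T0.
have th : t <= t + h by rewrite lerDl.
have mNT : mfunT (fun q : R => N (q + T)) by apply: (mcomp mN); exact: mfunD.
have iNT a b : intble_on leb `[a, b] (fun q : R => N (q + T)).
 by apply: (intble_itv_bounded _ _ mNT) => q; exact: NB.
have e1 : \int[leb]_(q in `[t, t + h + T]) N q = I t + \int[leb]_(q in `[t + T, t + h + T]) N q.
 by rewrite (@Rintegral_itv_chasles _ N t (t + T) (t + h + T)) ?lerDl// lerD2r.
have e2 : \int[leb]_(q in `[t, t + h + T]) N q = \int[leb]_(q in `[t, t + h]) N q + I (t + h).
 by rewrite (@Rintegral_itv_chasles _ N t (t + h) (t + h + T)) ?lerDl.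
have e3 : \int[leb]_(q in `[t + T, t + h + T]) N q = \int[leb]_(q in `[t, t + h]) N (q + T).
 by rewrite (Rintegral_itv_translate t (t + h) T mN).
have e4 : h * (I (t + h) / beta) <= \int[leb]_(q in `[t, t + h]) N q - \int[leb]_(q in `[t, t + h]) N (q + T).
 rewrite -RintegralB//.
 have := @Rintegral_itv_ge _ (fun q => N q - N (q + T)) t (t + h) (I (t + h) / beta) th.
 rewrite [t + h - t]addrAC subrr add0r; apply; first by apply: intble_sub.
 move=> q /andP[tq qt]; rewrite ler_pdivrMr ?relaxation_gt0// mulrC.
 apply: le_trans (I_decay (le_trans t0 tq)); exact: I_nonincreasing (le_trans t0 tq) qt.
have e5 : h * (I (t + h) / beta) = h / beta * I (t + h) by rewrite mulrCA mulrC.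
move: e1 e2 e4; rewrite e3 e5 mulrDl mul1r; move: (\int[leb]_(_ in _) _) (\int[leb]_(_ in _) _) (\int[leb]_(_ in _) _) (I t) (I (t + h)) (h / beta * _) => *; lra.
Qed.

(** The step h = t / k is taken with h / beta <= 1, and the inequality of [I_step] is iterated k
    times. Keeping h of the order of beta costs the factor 2 in the exponent. *)
Theorem exponential_decay t : 0 <= t -> I t <= expR (- (t / (2 * beta))) * I 0.
Proof.
move=> t0; have b0 := relaxation_gt0.
pose k := (Num.trunc (t / beta)).+1.
have k0 : 0 < k%:R :> R by rewrite ltr0n.
pose h := t / k%:R.
have h0 : 0 <= h by rewrite divr_ge0.
have hb : h / beta <= 1.
 by rewrite /h mulrAC ler_pdivrMr// mul1r ltW//; exact: truncnS_gt.
have step s : 0 <= s -> I (s + h) <= expR (- (h / (2 * beta))) * I s.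
 move=> s0; have := I_step s0 h0; have hb0 : 0 <= h / beta by rewrite divr_ge0// ltW.
 have e : h / (2 * beta) = h / beta / 2 by rewrite invfM; move: (beta^-1) => b; field.
 rewrite e; move: (h / beta) hb hb0 => y y1 y0 H.
 (* For 0 <= y <= 1, exp(y / 2) <= 1 / (1 - y / 2) <= 1 + y. *)
 have ey : expR (y / 2) <= 1 + y.
  have := expR_ge1Dx (- (y / 2)); rewrite expRN.
  have e2 : 0 < 1 - y / 2 by lra.
  move=> H1; have : expR (y / 2) <= (1 - y / 2)^-1 by rewrite -[leLHS]invrK lef_pV2 ?posrE ?invr_gt0 ?expR_gt0.
  by move=> /le_trans; apply; rewrite -[leLHS]mul1r ler_pdivrMr//; nra.
 rewrite expRN -ler_pdivrMl ?invr_gt0 ?expR_gt0// invrK; apply: le_trans H.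
 by rewrite ler_wpM2r// I_ge0.
have H i : I (i%:R * h) <= expR (- (i%:R * h / (2 * beta))) * I 0.
 elim: i => [|i IH]; first by rewrite !mul0r oppr0 expR0 mul1r.
 rewrite -natr1 mulrDl mul1r; apply: (le_trans (step _ _)); first by rewrite mulr_ge0.
 have -> : - ((i%:R * h + h) / (2 * beta)) = - (h / (2 * beta)) + - (i%:R * h / (2 * beta)).
  by rewrite -opprD mulrDl addrC.
 rewrite expRD -mulrA; exact: (ler_wpM2l (expR_ge0 _) IH).
by have := H k; rewrite /h mulrCA divff ?mulr1// gt_eqF.
Qed.

End energy_method.

Lemma RFubini_itv R dY (Y : measurableType dY) (rho : probability Y R)
 (F : Y -> R -> R) (g : R -> R) (a c : R) :
 mfunT (fun p : Y * R => F p.1 p.2) ->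
 intble_on (@lebesgue_measure R) `[a, c] g ->
 (forall r s, `[a, c]%classic s -> `|F r s| <= g s) ->
 intble rho (fun r => \int[(@lebesgue_measure R)]_(s in `[a, c]) F r s) /\
 \int[rho]_r \int[(@lebesgue_measure R)]_(s in `[a, c]) F r s =
 \int[(@lebesgue_measure R)]_(s in `[a, c]) \int[rho]_r F r s.
Proof.
move=> mF ig Fg.
pose K (p : Y * R) := F p.1 p.2 * \1_`[a, c]%classic p.2.
have mI : mfunT (fun p : Y * R => \1_`[a, c]%classic p.2 : R).
 have m1 : mfunT (\1_`[a, c]%classic : R -> R) by exact: measurable_indic.
 exact: (mcomp m1 m_snd).
have mK : mfunT K by exact: mfunM.
have KE r : (fun s => K (r, s)) = (fun s => F r s) \_ `[a, c].
 by apply/funext => s; rewrite /K patchE indicE /=; case: ifPn => sD; rewrite ?mulr1 ?mulr0.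
have ig' : intble (@lebesgue_measure R) (g \_ `[a, c]).
 by move: ig; rewrite integrable_mkcond//= restrict_EFin.
have iK : intble (rho \x (@lebesgue_measure R))%E K.
 apply/integrable12ltyP; first exact/mEFinP.
 have gfin := integral_fune_lt_pinfty msT ig'.
 apply: (@le_lt_trans _ _ (\int[rho]_r \int[(@lebesgue_measure R)]_s (EFin \o (g \_ `[a, c])) s)%E); last first.
  by rewrite integral_cst// -[X in (_ * X)%E]/(rho setT) probability_setT mule1.
 apply: ge0_le_integral => //.
 - by move=> r _; exact: integral_ge0.
 - apply: (@measurable_fun_fubini_tonelli_F _ _ _ _ R (@lebesgue_measure R) (fun p : Y * R => `|(K p)%:E|%E)) => //.
  by apply: mcomp => //; exact/mEFinP.
 - move=> r _; apply: ge0_le_integral => //.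
  + by apply: mcomp => //; apply/mEFinP; exact: (mcomp mK (m_pair1 r)).
  + by case/integrableP : ig'.
  + move=> s _; rewrite /= lee_fin -[K (r, s)]/((fun s => K (r, s)) s) KE !patchE.
   by case: ifPn => [/set_mem sD|_]; [exact: Fg|rewrite normr0].
split.
 have := intble_Rintegral1 iK; apply: eq_integrable => // r _ /=.
 by rewrite KE -Rintegral_mkcond.
transitivity (\int[rho]_r \int[(@lebesgue_measure R)]_s K (r, s)).
 by apply: eq_Rintegral => r _; rewrite KE -Rintegral_mkcond.
rewrite (RFubini iK) [RHS]Rintegral_mkcond; apply: eq_Rintegral => s _.
rewrite patchE; case: ifPn => sD.
 by apply: eq_Rintegral => r _; rewrite /K indicE /= sD mulr1.
under eq_Rintegral do rewrite /K indicE /= (negbTE sD) mulr0.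
by rewrite Rintegral_cst_prob.
Qed.

(** * Averages of solutions over random time shifts *)

Section time_average.
Context {R} {d : nat}.
Variables (kappa : rVlaw R d) (U : 'rV[R]_d -> R) (gamma : R).
Hypotheses (CU : Cn 1 U) (gamma0 : 0 < gamma).
Local Notation state := (phase R d).
Local Notation leb := (@lebesgue_measure R).
Local Notation tot := (zz_tot U gamma).
Local Notation cum := (zz_cum U gamma).
Variables (dY : measure_display) (Y : measurableType dY) (rho : probability Y R).

Lemma zz_jumps_average (h : Y -> state -> R) (M : R) z :
 mfunT (fun p : Y * state => h p.1 p.2) -> (forall r z, `|h r z| <= M) ->
 \int[rho]_r zz_jumps U gamma kappa (h r) z =
 zz_jumps U gamma kappa (fun y => \int[rho]_r h r y) z.
Proof.
move=> mh hM.
have mr y : mfunT (fun r => h r y).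
 by apply: (m_uncurry mh).
have ir y : intble rho (fun r => h r y).
 by apply: (intble_by _ M).
have mh2 : mfunT (fun p : Y * 'rV[R]_d => h p.1 (z.1, p.2)).
 by apply: (m_uncurry mh) => //; exact: m_pair.
have i2 : intble (rho \x kappa)%E (fun p : Y * 'rV[R]_d => h p.1 (z.1, p.2)).
 by apply: (@intble_bounded _ _ _ (rho \x kappa : probability _ R)%E _ M).
have isum : intble rho (fun r => \sum_k flip_rate U k z * h r (zz_flip k z)).
 by apply: intble_bigsum => // k _; exact: (intble_cmul msT _ (ir _)).
have ik : intble rho (fun r => refresh kappa (h r) z.1).
 exact: (intble_Rintegral1 i2).
rewrite /zz_jumps RintegralD//; last exact: (intble_cmul msT gamma ik).
rewrite RintegralZl// Rintegral_bigsum//; last first.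
 by move=> k _; exact: (intble_cmul msT _ (ir _)).
congr (_ + _ * _); first by apply: eq_bigr => k _; rewrite RintegralZl.
exact: (RFubini i2).
Qed.

Variables (f : state -> R) (u : R -> state -> R) (M : R).
Hypothesis zu : zz_mild U gamma kappa f u M.
Let mu_ : mfunT (fun p : R * state => u p.1 p.2). Proof. by case: zu. Qed.
Let uM t z : `|u t z| <= M. Proof. by case: zu. Qed.

Variable lag : Y -> R.
Hypotheses (mlag : mfunT lag) (lag0 : forall r, 0 <= lag r).

Definition time_average (t : R) (z : state) : R := \int[rho]_r u (t + lag r) z.
Let muabs dT (T : measurableType dT) (t : T -> R) (r : T -> Y) (z : T -> state) : mfunT t -> mfunT r ->
 mfunT z -> mfunT (fun a => u (t a + lag (r a)) (z a)).
Proof.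
move=> mt mr mz; apply: (m_uncurry mu_ _ mz).
by apply: mfunD => //; exact: mcomp.
Qed.

Lemma m_time_average : mfunT (fun p : R * state => time_average p.1 p.2).
Proof.
apply: (@m_Rintegral _ _ _ _ R rho (fun (p : R * state) (r : Y) => u (p.1 + lag r) p.2)).
apply: muabs.
- exact: (mcomp m_fst m_fst).
- exact: m_snd.
- exact: (mcomp m_snd m_fst).
Qed.

Lemma intble_time_average t z : intble rho (fun r => u (t + lag r) z).
Proof.
apply: (intble_by _ M) => // .
by apply: muabs => //; exact: m_cst.
Qed.

Lemma time_average_le t z : `|time_average t z| <= M.
Proof.
apply: le_trans (le_normr_Rintegral msT (intble_time_average t z)) _.
rewrite -[leRHS](Rintegral_cst_prob rho); apply: le_Rintegral => //.
- exact: (integrable_norm (intble_time_average t z)).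
- by apply: (intble_by _ `|M|).
Qed.

(** Each shift by a nonnegative lag is a solution, the Duhamel formula is linear, and Fubini takes
    the average inside the time integral and the jumps. *)
Lemma zz_mild_average : zz_mild U gamma kappa (time_average 0) time_average M.
Proof.
split; [|exact: m_time_average|exact: time_average_le] => t z t0.
pose F (r : Y) (s : R) := expR (- cum z s) * zz_jumps U gamma kappa (u (lag r + (t - s))) (zz_flow z s).
have uE r : u (t + lag r) z = expR (- cum z t) * u (lag r) (zz_flow z t) +
  \int[leb]_(s in `[0, t]) F r s.
 by have [+ _ _] := zz_mild_shift CU gamma0 zu (lag0 r); move=> /(_ t z t0); rewrite addrC.
have mb : mfunT (fun p : R * state => zz_jumps U gamma kappa (u p.1) p.2).
 exact: (m_zz_jumps gamma kappa CU mu_).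
have mfl : mfunT (fun p : Y * R => zz_flow z p.2).
 exact: (mcomp (@m_zz_flow R d) (m_pair m_snd (m_cst z))).
have mcum : mfunT (fun p : Y * R => cum z p.2).
 apply: (mcomp (m_zz_cum CU gamma0) (m_pair (m_cst z) m_snd)).
have mF : mfunT (fun p : Y * R => F p.1 p.2).
 apply: mfunM; first by apply: mcomp => //; exact: mcomp.
 apply: (m_uncurry (h := fun q => zz_jumps U gamma kappa (u q))
  (f := fun p : Y * R => lag p.1 + (t - p.2)) (g := fun p : Y * R => zz_flow z p.2) mb _ mfl).
 by apply: mfunD; [exact: mcomp|exact: mfunB].
have mut q : mfunT (u q) by exact: m_mild mu_ q.
have mtb : mfunT (fun p : R * state => M * tot p.2).
 by apply: mfunM => //; apply: (mcomp (m_zz_tot gamma CU)).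
have totle (q : R) y : 0 <= q -> `|M * tot y| <= M * tot y.
 by rewrite ger0_norm// mulr_ge0 ?zz_tot_ge0//; exact: le_trans (uM 0 z).
have itot := @intble_mild _ _ _ _ CU gamma0 (fun _ z => M * tot z) M mtb totle z t.
have Fle r s : `[0, t]%classic s -> `|F r s| <= expR (- cum z s) * (M * tot (zz_flow z s)).
 move=> _; rewrite normrM ger0_norm ?expR_ge0// ler_wpM2l ?expR_ge0//.
 exact: (zz_jumps_le U kappa gamma0 (mut _) (uM _)).
have [iF EF] := RFubini_itv rho mF itot Fle.
have i1 : intble rho (fun r => u (lag r) (zz_flow z t)).
 have := intble_time_average 0 (zz_flow z t).
 by apply: eq_integrable => // r _ /=; rewrite add0r.
rewrite /time_average; under eq_Rintegral do rewrite uE.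
rewrite RintegralD//; last exact: (intble_cmul msT _ i1).
rewrite RintegralZl// EF; congr (_ * _ + _).
 by apply: eq_Rintegral => r _; rewrite add0r.
apply: eq_Rintegral => s _; rewrite RintegralZl//; last first.
 have mJ : mfunT (fun r : Y => zz_jumps U gamma kappa (u (lag r + (t - s))) (zz_flow z s)).
  apply: (m_uncurry (h := fun q => zz_jumps U gamma kappa (u q))
   (f := fun r : Y => lag r + (t - s)) mb _ (m_cst (zz_flow z s))).
  by apply: mfunD => //; exact: m_cst.
 apply: (intble_by _ (M * tot (zz_flow z s))) => // r.
 exact: (zz_jumps_le U kappa gamma0 (mut _) (uM _)).
congr (_ * _); rewrite -(@zz_jumps_average _ M) => [|//|r y]; last exact: uM.
 by apply: eq_Rintegral => r _; rewrite addrC.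
apply: muabs; [exact: m_cst|exact: m_fst|exact: m_snd].
Qed.

End time_average.

Section uniform_average.
Context {R}.
Local Notation leb := (@lebesgue_measure R).

Lemma uniform_Rintegral (h : R) (h0 : 0 < h) (g : R -> R) (M : R) :
 mfunT g -> (forall x, `|g x| <= M) ->
 \int[uniform_prob h0]_x g x = h^-1 * \int[leb]_(x in `[0, h]) g x.
Proof.
move=> mg gM.
have nonneg (k : R -> R) C : mfunT k -> (forall x, 0 <= k x <= C) ->
  \int[uniform_prob h0]_x k x = h^-1 * \int[leb]_(x in `[0, h]) k x.
 move=> mk kC; rewrite /Rintegral integral_uniform; last 2 first.
 - exact/mEFinP.
 - by move=> x; rewrite lee_fin; case/andP: (kC x).
 rewrite subr0 fineM//; apply: integrable_fin_num => //.
 have bk x : `|k x| <= C by case/andP: (kC x) => k0 kx; rewrite ger0_norm.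
 exact: (intble_itv_bounded 0 h mk bk).
have MM : 0 <= M by exact: le_trans (gM 0).
have mgM : mfunT (fun x => g x + M) by exact: mfunD.
have bd x : 0 <= g x + M <= M + M.
 by have := gM x; rewrite ler_norml => /andP[a b]; move: a b; lra.
have := nonneg _ _ mgM bd; have := nonneg (fun=> M) M (m_cst M).
move=> /(_ _) e1; have {}e1 := e1 (fun _ => introT andP (conj MM (lexx M))).
have ig : intble (uniform_prob h0) g.
 exact: (intble_by (uniform_prob h0) M mg gM).
have iM : intble (uniform_prob h0) (fun=> M).
 by apply: (intble_by (uniform_prob h0) M) => // x; rewrite ger0_norm.
have lg : intble_on leb `[0, h] g by exact: (intble_itv_bounded _ _ mg gM).
have lM : intble_on leb `[0, h] (fun=> M).
 by apply: (intble_itv_bounded (C := M)) => // x; rewrite ger0_norm.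
rewrite (RintegralD msT ig iM) e1 RintegralD// mulrDr.
by move=> /addIr.
Qed.

(** The uniform law lives on the whole line, whereas a lag must be nonnegative everywhere; the
    absolute value changes nothing on [0, h]. *)
Definition uniform_lag : g_sigma_algebraType (R.-ocitv.-measurable) -> R := fun r => `|r : R|.

Lemma m_uniform_lag : mfunT uniform_lag.
Proof. exact: normr_measurable. Qed.

Lemma Rintegral_itv_le_bounded (g : R -> R) (M a b : R) : a <= b ->
 mfunT g -> (forall x, `|g x| <= M) -> `|\int[leb]_(x in `[a, b]) g x| <= M * (b - a).
Proof.
move=> ab mg gM; have ig := intble_itv_bounded a b mg gM.
apply: (le_trans (le_normr_Rintegral _ ig)); first exact: measurable_itv.
rewrite mulrC; apply: Rintegral_itv_le => //; exact: integrable_norm.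
Qed.

(** Lebesgue's differentiation theorem for the primitive from -1, whose difference quotients are
    read along the steps 1 / (k + 1). *)
Lemma ae_cvg_average (g : R -> R) (M : R) : mfunT g -> (forall x, `|g x| <= M) ->
 {ae leb, forall t, 0 <= t ->
  k.+1%:R * \int[leb]_(x in `[t, t + k.+1%:R^-1]) g x @[k --> \oo] --> g t}.
Proof.
move=> mg gM.
have ig a b : intble_on leb `[a, b] g by exact: (intble_itv_bounded _ _ mg gM).
have loc : locally_integrable [set: R] g.
 split => //; first exact: openT.
 move=> K _ cK.
 apply: (@le_lt_trans _ _ (\int[leb]_(x in K) (M%:E))%E).
  apply: ge0_le_integral => //.
  - exact: compact_measurable.
  - by apply/mEFinP; apply: measurable_funTS; exact: mcomp.
  - by move=> x _; rewrite lee_fin.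
 rewrite integral_cst; last exact: compact_measurable.
 apply: lte_mul_pinfty => //; last exact: compact_finite_measure.
 by rewrite lee_fin (le_trans (normr_ge0 _) (gM 0)).
have := @FTC1 R g (BLeft (- 1)) (fun y => ig (- 1) y) loc.
move=> /=; apply: filterS; first exact: (ae_filter_ringOfSetsType leb).
move=> t H t0; have [|dG] := H; first by rewrite lte_fin (lt_le_trans _ t0)// ltrN10.
 rewrite derive1E => DG.
have Hl : (fun h : R => h^-1 *: (\int[leb]_(q in `[-1, h *: (1 : R) + t]) g q - \int[leb]_(q in `[-1, t]) g q))
  @ (0 : R)^' --> g t by rewrite -DG; exact: dG.
have cv : (fun k : nat => (k.+1%:R^-1 : R)) @ \oo --> (0 : R)^'.
 move=> B HB; have HB' : nbhs (0 : R) [set x : R | x != 0 -> B x] by exact: HB.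
 have HB2 : \forall k \near \oo, (k.+1%:R^-1 : R) != 0 -> B k.+1%:R^-1 := @cvg_harmonic R _ HB'.
 apply: filterS HB2 => k; apply.
 by rewrite gt_eqF// invr_gt0.
have := cvg_comp _ _ cv Hl; apply: cvg_trans; apply: near_eq_cvg; near=> k => /=.
rewrite invrK -[LHS]/(_ * _) /=; congr (_ * _).
rewrite [_ *: 1]mulr1 [_^-1 + t]addrC.
rewrite (@Rintegral_itv_chasles _ g (- 1) t (t + k.+1%:R^-1)) ?lerDl ?invr_ge0//; last exact: le_trans t0.
by rewrite addrAC subrr add0r.
Unshelve. all: by end_near. Qed.

End uniform_average.

(** Cauchy-Schwarz against the constant 1. The inequality is between extended reals because it is
    applied along the path from every z, where the right-hand side may be infinite. *)
Lemma Rintegral_sqr_le d (T : measurableType d) R (P : probability T R) (h : T -> R) :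
 mfunT h -> (((\int[P]_x h x) ^+ 2)%:E <= \int[P]_x (h x ^+ 2)%:E)%E.
Proof.
move=> mh; have [oo|fin] := eqVneq (\int[P]_x (h x ^+ 2)%:E)%E +oo%E; first by rewrite oo leey.
have mh2 : mfunT (fun x => h x ^+ 2) by exact: mfunX.
have ih2 : intble P (fun x => h x ^+ 2).
 apply/integrableP; split; first exact/mEFinP.
 under eq_integral => x _ do rewrite /= ger0_norm ?sqr_ge0//.
 by rewrite ltey.
have sh : inL2 P h by [].
have s1 : inL2 P (cst (1 : R)).
 by apply: (@inL2_bounded _ _ _ P _ 1) => // z; rewrite normr1.
rewrite EFin_Rintegral// lee_fin -l2_sqr -[(\int[P]_x h x) ^+ 2]ger0_norm ?sqr_ge0//.
rewrite normrX lerXn2r ?nnegrE ?l2_ge0//.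
have := cauchy_schwarz sh s1; rewrite (_ : l2 P (cst 1) = 1).
 by rewrite mulr1; under eq_Rintegral do rewrite mulr1.
by rewrite /l2 /= expr1n Rintegral_cst_prob sqrtr1.
Qed.

(** Truncation at a high level moves [f] by at most e / 2 in L^2, hence its mean, which was 0, by at
    most e / 2 as well; subtracting the mean of the truncation restores mean zero. *)
Lemma bounded_mean0_approx d (T : measurableType d) R (m : probability T R) (f : T -> R) (e : R) :
 inL2 m f -> \int[m]_x f x = 0 -> 0 < e ->
 exists (g : T -> R) (M : R), [/\ mfunT g, forall x, `|g x| <= M, \int[m]_x g x = 0 &
  l2 m (fun x => f x - g x) <= e].
Proof.
move=> sf f0 e0; have [mf if2] := sf.
pose c (n : nat) x := if `|f x| <= n%:R then f x else 0.
have mc n : mfunT (c n).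
 apply: measurable_fun_ifT => //; apply: measurable_fun_ler => //; exact: mcomp.
have cn n x : `|c n x| <= n%:R by rewrite /c; case: ifPn => //; rewrite normr0.
have sc n : inL2 m (c n) by exact: inL2_bounded (mc n) (cn n).
have ic n : intble m (c n) by exact: inL2_integrable.
have cv : \int[m]_x ((f x - c n x) ^+ 2) @[n --> \oo] --> 0.
 rewrite -[0](Rintegral_cst_prob m).
 apply: (@Rintegral_dominated_cvg _ _ _ m setT (fun n x => (f x - c n x) ^+ 2) _ (fun x => f x ^+ 2)) => //.
 - by move=> n; apply: mfunX; exact: mfunB.
 - apply: aeW => x _; apply: cvg_near_cst; near=> n; rewrite /c ifT ?subrr ?expr0n//.
  near: n; exact: nbhs_infty_ger.
 - move=> n x _; rewrite ger0_norm ?sqr_ge0// /c; case: ifPn => _; last by rewrite subr0.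
  by rewrite subrr expr0n/= sqr_ge0.
have e2 : 0 < (e / 2) ^+ 2 by rewrite exprn_gt0// divr_gt0.
have [n _ Hn] := (cvgr_lt _ cv) _ e2.
have ln : l2 m (fun x => f x - c n x) <= e / 2.
 rewrite -(@ler_pXn2r _ 2)// ?nnegrE ?l2_ge0//; last by rewrite ltW// divr_gt0.
 rewrite l2_sqr ltW//; exact: (Hn n (leqnn n)).
pose a := \int[m]_x c n x.
have s1 : inL2 m (cst (1 : R)).
 by apply: (@inL2_bounded _ _ _ m _ 1) => // z; rewrite normr1.
have sa : inL2 m (cst a).
 by apply: (@inL2_bounded _ _ _ m _ `|a|).
have a_le : `|a| <= e / 2.
 apply: le_trans ln.
 have := cauchy_schwarz (inL2_sub sf (sc n)) s1.
 rewrite (_ : l2 m (cst 1) = 1); last by rewrite /l2 /= expr1n Rintegral_cst_prob sqrtr1.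
 rewrite mulr1; under eq_Rintegral do rewrite mulr1.
 by rewrite RintegralB//; [rewrite f0 sub0r normrN|exact: inL2_integrable].
exists (fun x => c n x - a), (n%:R + `|a|); split.
- exact: mfunB.
- by move=> x; apply: le_trans (ler_normB _ _) _; rewrite lerD2r.
- rewrite RintegralB//; last exact: inL2_integrable.
 by rewrite Rintegral_cst_prob subrr.
- rewrite (_ : (fun x => f x - (c n x - a)) = (fun x => (f x - c n x) + cst a x)); last by apply/funext => x /=; ring.
 apply: le_trans (l2_triangle (inL2_sub sf (sc n)) sa) _.
 have : l2 m (cst a) <= e / 2 by exact: l2_le_cst.
 by move: ln; move: (l2 m _) (l2 m _) => *; lra.
Unshelve. all: by end_near. Qed.

Section semigroup_l2.
Context {R} {d : nat} {dO : measure_display} {O : measurableType dO} {P : probability O R}.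
Variables (E : nat -> option 'I_d -> {RV P >-> R}) (W : nat -> {RV P >-> 'rV[R]_d}).
Variables (mu kappa : rVlaw R d) (U : 'rV[R]_d -> R) (gamma : R).
Hypotheses (noise : zz_noise E W kappa) (CU : Cn 1 U) (gamma0 : 0 < gamma).
Local Notation state := (phase R d).
Local Notation m := (mu \x kappa : probability state R)%E.
Local Notation S := (zz_semigroup U gamma E W).
Local Notation path t z om := (zz_path U gamma (fun n o => E n o om) (fun n => W n om) z t).

Hypothesis invariance : forall t (g : state -> \bar R), 0 <= t -> mfunT g ->
 (forall z, 0 <= g z)%E -> (\int[m]_z \int[P]_om g (path t z om) = \int[m]_z g z)%E.
Let mpath t : mfunT (fun p : state * O => path t p.1 p.2).
Proof. by apply: (m_zz_path E W CU gamma0). Qed.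

Lemma m_zz_semigroup t (f : state -> R) : mfunT f -> mfunT (S t f).
Proof.
move=> mf; apply: (@m_Rintegral _ _ _ _ R P (fun z om => f (path t z om))).
exact: (mcomp mf (mpath t)).
Qed.
Let mfp t z (f : state -> R) : mfunT f -> mfunT (fun om => f (path t z om)).
Proof. by move=> mf; exact: (mcomp (mcomp mf (mpath t)) (m_pair1 z)). Qed.
Let mu2 t (f : state -> R) : mfunT f ->
 mfunT (fun z => \int[P]_om (f (path t z om) ^+ 2)%:E)%E.
Proof.
move=> mf; apply: (@measurable_fun_fubini_tonelli_F _ _ _ _ R P (fun p : state * O => (f (path t p.1 p.2) ^+ 2)%:E)) => //.
- by apply/mEFinP; apply: mfunX; exact: (mcomp mf (mpath t)).
- by move=> z; rewrite lee_fin sqr_ge0.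
Qed.
Let energy t (f : state -> R) : 0 <= t -> mfunT f ->
 (\int[m]_z \int[P]_om (f (path t z om) ^+ 2)%:E = \int[m]_z (f z ^+ 2)%:E)%E.
Proof.
move=> t0 mf; apply: (invariance (g := fun z => (f z ^+ 2)%:E) t0).
- by apply/mEFinP; exact: mfunX.
- by move=> z; rewrite lee_fin sqr_ge0.
Qed.
Let ae_path t (f : state -> R) : 0 <= t -> inL2 m f ->
 {ae m, forall z, intble P (fun om => f (path t z om))}.
Proof.
move=> t0 [mf if2].
have ik : m.-integrable setT (fun z => \int[P]_om (f (path t z om) ^+ 2)%:E)%E.
 apply/integrableP; split; first exact: mu2.
 under eq_integral => z _.
  rewrite gee0_abs; last by apply: integral_ge0 => om _; rewrite lee_fin sqr_ge0.
  over.
 rewrite energy//; exact: (integral_fune_lt_pinfty msT if2).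
have := integrable_ae msT ik; apply: filterS => z /(_ I) fin.
apply: inL2_integrable; split; first exact: mfp.
apply/integrableP; split; first by apply/mEFinP; apply: mfunX; exact: mfp.
under eq_integral => om _ do rewrite /= ger0_norm ?sqr_ge0//.
by move: fin; rewrite fin_numE => /andP[_]; rewrite ltey.
Qed.

(** Jensen's inequality under the law of the path, then invariance. The two expectations are
    subtracted at almost every z, where [f] and [g] are integrable along the path. *)
Lemma zz_semigroup_sub_sqr t f g : 0 <= t -> inL2 m f -> inL2 m g ->
 (\int[m]_z ((S t f z - S t g z) ^+ 2)%:E <= \int[m]_z ((f z - g z) ^+ 2)%:E)%E.
Proof.
move=> t0 sf sg; have [mf _] := sf; have [mg _] := sg.
have mfg : mfunT (fun z => f z - g z) by exact: mfunB.
rewrite -(energy t0 mfg); apply: ae_ge0_le_integral => //.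
- by move=> z _; rewrite lee_fin sqr_ge0.
- by apply/mEFinP; apply: mfunX; apply: mfunB; exact: m_zz_semigroup.
- by move=> z _; apply: integral_ge0 => om _; rewrite lee_fin sqr_ge0.
- exact: (mu2 t mfg).
- apply: filterS2 (ae_path t0 sf) (ae_path t0 sg) => z i1 i2 _.
 rewrite /zz_semigroup -RintegralB//; exact: (Rintegral_sqr_le P (mfp t z mfg)).
Qed.

Lemma inL2_zz_semigroup t f : 0 <= t -> inL2 m f -> inL2 m (S t f).
Proof.
move=> t0 sf; have [mf if2] := sf; split; first exact: m_zz_semigroup.
apply/integrableP; split.
 by apply/mEFinP; apply: mfunX; exact: m_zz_semigroup.
under eq_integral => z _ do rewrite /= ger0_norm ?sqr_ge0//.
apply: (@le_lt_trans _ _ (\int[m]_z (f z ^+ 2)%:E)%E); last exact: (integral_fune_lt_pinfty msT if2).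
rewrite -(energy t0 mf); apply: ge0_le_integral => //.
- by move=> z _; rewrite lee_fin sqr_ge0.
- by apply/mEFinP; apply: mfunX; exact: m_zz_semigroup.
- exact: mu2.
- by move=> z _; exact: (Rintegral_sqr_le P (mfp t z mf)).
Qed.

Lemma l2_zz_semigroup_dist t f g : 0 <= t -> inL2 m f -> inL2 m g ->
 `|l2 m (S t f) - l2 m (S t g)| <= l2 m (fun z => f z - g z).
Proof.
move=> t0 sf sg; have s1 := inL2_zz_semigroup t0 sf; have s2 := inL2_zz_semigroup t0 sg.
apply: le_trans (l2_dist s1 s2) _; rewrite ler_sqrt; last by apply: Rintegral_ge0 => z _; exact: sqr_ge0.
have := zz_semigroup_sub_sqr t0 sf sg; have [_ i1] := inL2_sub s1 s2; have [_ i2] := inL2_sub sf sg.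
by rewrite !EFin_Rintegral.
Qed.

End semigroup_l2.

Lemma Cn_sub R d n (f g : 'rV[R]_d -> R) : Cn n f -> Cn n g -> Cn n (fun x => f x - g x).
Proof.
elim: n f g => [|n IH] f g [cf Cf] [cg Cg]; split; try exact: continuous_rVB; first by [].
move=> i; have [df Cpf] := Cf i; have [dg Cpg] := Cg i; split.
 by move=> x; exact: (@derivableB _ _ _ f g).
rewrite (_ : partial i _ = fun x => partial i f x - partial i g x); first exact: IH.
by apply/funext => x; rewrite /partial (@deriveB _ _ _ f g).
Qed.

Lemma Cc_infty_sub R d (f g : 'rV[R]_d -> R) : Cc_infty f -> Cc_infty g -> Cc_infty (fun x => f x - g x).
Proof.
move=> [Cf sf] [Cg sg]; split; first by move=> n; exact: Cn_sub.
have [K [cK fK]] := sf; have [K' [cK' gK]] := sg; exists (K `|` K'); split; first exact: compactU.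
by move=> x nK; rewrite fK ?gK ?subr0// => H; apply: nK; [right|left].
Qed.

(** Young's inequality removes y and leaves x^2 <= a x + b^2 with b = eta / sqrt p, which forces x
    <= a + b. In [step_transport], x is the norm of v . grad psi and y that of psi. *)
Lemma quadratic_root_le (R : rcfType) (p eta a x y : R) : 0 < p -> 0 <= eta -> 0 <= a -> 0 <= x ->
 x ^+ 2 + p * y ^+ 2 <= a * x + 2 * (eta * y) -> x <= a + eta / Num.sqrt p.
Proof.
move=> p0 eta0 a0 x0 H; have ps : 0 < Num.sqrt p by rewrite sqrtr_gt0.
have b0 : 0 <= eta / Num.sqrt p by rewrite divr_ge0// ltW.
have q1 : (eta / Num.sqrt p) ^+ 2 = eta ^+ 2 / p by rewrite expr_div_n sqr_sqrtr// ltW.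
have q2 : 2 * (eta * y) <= p * y ^+ 2 + eta ^+ 2 / p.
 rewrite -(ler_pM2l p0) mulrDr; have -> : p * (eta ^+ 2 / p) = eta ^+ 2 by field; rewrite gt_eqF.
 by have := sqr_ge0 (p * y - eta); nra.
have {}H : x ^+ 2 <= a * x + (eta / Num.sqrt p) ^+ 2 by rewrite q1; lra.
move: (eta / _) b0 H => b b0 H; rewrite leNgt; apply/negP => abx.
have : (x - a) * x <= b ^+ 2 by nra.
have xb : b < x - a by lra.
have : b * b <= (x - a) * b by rewrite ler_wpM2r// ltW.
by nra.
Qed.

(** * The coupling estimate and the decay of solutions *)

Section hypocoercivity.
Context {R} {d : nat}.
Variables (U : 'rV[R]_d -> R) (mu kappa : rVlaw R d) (omega gamma L K p : R).
Hypotheses (vl : velocity_law kappa omega) (omega0 : 0 <= omega) (gamma0 : 0 < gamma) (C2 : Cn 2 U)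
 (gU : gibbs_measure U mu) (L0 : 0 <= L) (HL : forall k x, partial k (partial k U) x <= L) (p0 : 0 < p)
 (K0 : 0 <= K) (hU : hessian_ge U (- (K * p))) (po : poincare mu p^-1)
 (ds : discrete_spectrum mu (closure_graph mu Cc_infty (langevin U))).
Local Notation state := (phase R d).
Local Notation leb := (@lebesgue_measure R).
Local Notation m := (mu \x kappa)%E.
Local Notation mp := (m : probability state R).
Local Notation Lam := (dirichlet_op U).
Local Notation Pi := (refresh kappa).
Implicit Types (x v : 'rV[R]_d) (z : state) (phi psi : 'rV[R]_d -> R).
Let CU : Cn 1 U. Proof. exact: Cn_leS. Qed.
Let flip_inv := let: And5 h _ _ _ _ := vl in h.
Let quasi_inv := zz_quasi_inv (Cn1_cont CU) gU kappa.
Let itot := zz_integrable_tot gamma vl C2 gU L0 HL.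

(** The squared norm of the remainder is at most twice that of [residual] plus 2 gamma^2 times that
    of v . grad phi. With r = p phi + Lam phi, one has |Lam phi| <= |r| and |grad phi|^2 <= |r|^2 /
    (2 p); then 2 times 54 gives 108, and 2 gamma^2 / (2 p) gives the last term. *)
Definition coupling_sq : R := 108 * omega * (1 + K + L / p) + gamma ^+ 2 / p.
Definition coupling : R := Num.sqrt coupling_sq.
Local Notation A := coupling.

Lemma coupling_sq_ge0 : 0 <= coupling_sq.
Proof.
have pw := ltW p0; apply: addr_ge0; last by apply: divr_ge0 => //; exact: sqr_ge0.
by apply: mulr_ge0; [exact: mulr_ge0|apply: addr_ge0; [exact: addr_ge0|exact: divr_ge0]].
Qed.
Let A0 : 0 <= A. Proof. exact: sqrtr_ge0. Qed.
Let A2 : A ^+ 2 = coupling_sq. Proof. by rewrite sqr_sqrtr// coupling_sq_ge0. Qed.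

Section test.
Variable phi : 'rV[R]_d -> R.
Hypothesis Cphi : Cc_infty phi.
Let r x := p * phi x + Lam phi x.
Let res z := residual U phi z - gamma * transport phi z.
Let sT := inL2_transport mu vl Cphi.
Let sR := inL2_residual vl C2 gU L0 HL Cphi.
Lemma inL2_remainder : inL2 m res.
Proof. exact: inL2_sub sR (inL2_cmul gamma sT). Qed.

Lemma remainder_le : l2 m res <= A * l2 mu r.
Proof.
rewrite -(ler_pXn2r (n := 2))//; [|by rewrite nnegrE l2_ge0|by rewrite nnegrE mulr_ge0 ?l2_ge0].
rewrite exprMn A2 l2_sqr.
have [_ iR] := sR; have [_ iT] := sT; have [_ ires] := inL2_remainder.
have i1 := intble_cmul msT 2 iR; have i2 := intble_cmul msT (2 * gamma ^+ 2) iT.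
apply: (@le_trans _ _ (2 * \int[m]_z (residual U phi z ^+ 2) + 2 * gamma ^+ 2 * \int[m]_z (transport phi z ^+ 2))).
 rewrite -!RintegralZl// -(RintegralD msT i1 i2); apply: le_Rintegral => //; first exact: intble_add.
 move=> z _; rewrite /res; move: (residual U phi z) (transport phi z) => a b.
 by have := sqr_ge0 (a + gamma * b); nra.
have h1 := residual_sq_le vl omega0 C2 gU L0 HL Cphi hU.
have h2 := transport_sq mu vl Cphi.
have h3 := gradient_sq_le C2 gU p Cphi; rewrite -/r in h3.
have h4 : \int[mu]_x (Lam phi x ^+ 2) <= l2 mu r ^+ 2.
 by rewrite -l2_sqr lerXn2r ?nnegrE ?l2_ge0//; exact: l2_dirichlet_le.
rewrite h2; move: h1 h3 h4 (gradient_sq_ge0 mu phi) (sqr_ge0 (l2 mu r)); rewrite /coupling_sq.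
move: (\int[m]_z _) (\int[mu]_x _) (\int[mu]_x gradient_sq phi x) (l2 mu r ^+ 2) => I Q G N.
move=> h1 h3 h4 G0 N0.
have G1 : G <= N / (2 * p) by rewrite ler_pdivlMr ?mulr_gt0// mulrC.
have cL : 0 <= K * p + L by rewrite addr_ge0// mulr_ge0// ltW.
have h5 : (K * p + L) * G <= (K * p + L) * (N / (2 * p)) by rewrite ler_wpM2l.
have h6 : omega * (Q + (K * p + L) * G) <= omega * (N + (K * p + L) * (N / (2 * p))).
 by rewrite ler_wpM2l// lerD.
have h7 : gamma ^+ 2 * G <= gamma ^+ 2 * (N / (2 * p)) by rewrite ler_wpM2l// sqr_ge0.
have E1 : 2 * (gamma ^+ 2 * (N / (2 * p))) = gamma ^+ 2 / p * N by field; rewrite gt_eqF.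
have E2 : 2 * (omega * (N + (K * p + L) * (N / (2 * p)))) = omega * (2 * N + (K + L / p) * N) by field; rewrite gt_eqF.
have h9 : 0 <= omega * ((K + L / p) * N).
 have pw := ltW p0; apply: mulr_ge0 => //; apply: mulr_ge0 => //; apply: addr_ge0 => //; exact: divr_ge0.
rewrite -mulrA in h1; move: h1 h6 h7 h9 E1 E2; move: (omega * (N + _)) (omega * (Q + _)) (gamma ^+ 2 * (N / _)) (gamma ^+ 2 / p) (L / p) => a b e g2 Lp h1 h6 h7 h9 E1 E2; lra.
Qed.

Lemma transport_l2_le : l2 m (transport phi) <= (Num.sqrt (2 * p))^-1 * l2 mu r.
Proof.
have p2 : 0 < 2 * p by rewrite mulr_gt0.
have s0 : 0 < Num.sqrt (2 * p) by rewrite sqrtr_gt0.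
rewrite ler_pdivlMl// -(ler_pXn2r (n := 2))//; [|by rewrite nnegrE mulr_ge0 ?l2_ge0// ltW|by rewrite nnegrE l2_ge0].
rewrite exprMn sqr_sqrtr ?(ltW p2)// l2_sqr (transport_sq mu vl Cphi).
exact: gradient_sq_le.
Qed.

End test.

Section solution.
Variables (f : state -> R) (u : R -> state -> R) (M C : R).
Hypotheses (zu : zz_mild U gamma kappa f u M) (C0 : 0 <= C)
 (lip : forall s t z, 0 <= s -> 0 <= t -> `|u t z - u s z| <= C * `|t - s|) (mean0 : \int[m]_z f z = 0).
Let mu_ : mfunT (fun q : R * state => u q.1 q.2). Proof. by case: zu. Qed.
Let uM t z : `|u t z| <= M. Proof. by case: zu. Qed.
Let mut t : mfunT (u t).
Proof. exact: (mcomp mu_ (@m_pair1 _ _ _ _ t)). Qed.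
Let M0 : 0 <= M. Proof. exact: le_trans (uM 0 (0, 0)). Qed.

Definition macro t : 'rV[R]_d -> R := Pi (u t).
Definition micro t z : R := u t z - macro t z.1.
Local Notation w := macro.
Local Notation n := (fun t => l2 mu (macro t)).
Local Notation D := (fun t => l2 m (micro t)).
Local Notation N := (fun t => l2 m (u t) ^+ 2).
Let mw t : mfunT (w t). Proof. exact: m_refresh. Qed.
Let wM t x : `|w t x| <= M. Proof. exact: (refresh_le kappa (mut t) (uM t) x). Qed.
Let su t : inL2 m (u t).
Proof. exact: (@inL2_bounded _ _ _ mp _ M). Qed.
Let sw t : inL2 mu (w t).
Proof. exact: (@inL2_bounded _ _ _ mu _ M). Qed.
Let swf t : inL2 m (fun z => w t z.1). Proof. exact: inL2_fst. Qed.
Let smi t : inL2 m (micro t). Proof. exact: inL2_sub. Qed.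

Lemma pythagoras t : N t = n t ^+ 2 + D t ^+ 2.
Proof.
by rewrite !l2_sqr (refresh_pythagoras mu kappa (mut t) (uM t)) (Rintegral_fst kappa (h := fun x => w t x ^+ 2))//; case: (sw t).
Qed.

Lemma inner_fst t h : inL2 mu h -> \int[m]_z (u t z * h z.1) = \int[mu]_x (w t x * h x).
Proof.
move=> sh; under eq_Rintegral do rewrite mulrC.
rewrite (Rintegral_fst_mul (g := u t)).
- by apply: eq_Rintegral => x _; rewrite mulrC.
- exact: (intble_section kappa (mut t) (uM t)).
- exact: inL2_mul (inL2_fst kappa sh) (su t).
Qed.

Lemma inner_micro t g : inL2 m g -> (forall h, inL2 mu h -> \int[m]_z (h z.1 * g z) = 0) ->
 \int[m]_z (u t z * g z) = \int[m]_z (micro t z * g z).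
Proof.
move=> sg g0; have i1 := inL2_mul (smi t) sg; have i2 := inL2_mul (swf t) sg.
rewrite -[RHS]addr0 -(g0 _ (sw t)) -(RintegralD msT i1 i2).
by apply: eq_Rintegral => z _; rewrite /micro; ring.
Qed.

Lemma inner_transport_le t phi : Cc_infty phi ->
 `|\int[m]_z (u t z * transport phi z)| <= D t * l2 m (transport phi).
Proof.
move=> Cphi; have sT := inL2_transport mu vl Cphi.
rewrite inner_micro//; first exact: cauchy_schwarz.
by move=> h sh; exact: (refresh_transport_mul vl Cphi).
Qed.

Lemma macro_lip s t x : 0 <= s -> 0 <= t -> `|w t x - w s x| <= C * `|t - s|.
Proof.
move=> s0 t0; have mdu : mfunT (fun z => u t z - u s z) by exact: mfunB.
have := refresh_le kappa mdu (fun z => lip z s0 t0) x; congr (`|_| <= _).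
rewrite /refresh RintegralB//; exact: (intble_section kappa (mut _) (uM _)).
Qed.

Lemma micro_lip s t : 0 <= s -> 0 <= t -> `|D t - D s| <= 2 * C * `|t - s|.
Proof.
move=> s0 t0; apply: le_trans (l2_dist (smi t) (smi s)) _.
apply: (@l2_le_cst _ _ _ mp).
 by apply: mfunB; [case: (smi t)|case: (smi s)].
move=> z; have -> : micro t z - micro s z = (u t z - u s z) - (w t z.1 - w s z.1) by rewrite /micro; ring.
apply: le_trans (ler_normB _ _) _; have := lip z s0 t0; have := macro_lip z.1 s0 t0; lra.
Qed.

Lemma micro_up s h q : 0 <= s -> s <= q <= s + h -> D q <= D s + 2 * C * h.
Proof.
move=> s0 /andP[sq qsh]; rewrite -lerBlDl; apply: le_trans (ler_norm _) _.
apply: le_trans (micro_lip s0 (le_trans s0 sq)) _.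
by rewrite ler_wpM2l ?mulr_ge0// ger0_norm ?subr_ge0// lerBlDl.
Qed.

Lemma macro_mean t : 0 <= t -> \int[mu]_x w t x = 0.
Proof.
move=> t0; rewrite -mean0 -(zz_mild_mass CU gamma0 flip_inv quasi_inv itot zu t0).
rewrite -(RFubini1 (inL2_integrable (m := mp) (su t))).
exact: eq_Rintegral.
Qed.
Let p2s : 0 < Num.sqrt (2 * p). Proof. by rewrite sqrtr_gt0 mulr_gt0. Qed.

Definition pairing t phi : R := \int[m]_z (u t z * transport phi z).

Definition approx_resolvent t (eta : R) phi : Prop :=
 Cc_infty phi /\ l2 mu (fun x => p * phi x + Lam phi x - w t x) <= eta.

Lemma approx_resolvent_ex t (eta : R) : 0 < eta -> exists phi, approx_resolvent t eta phi.
Proof.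
by move=> e0; have [phi ? ?] := resolvent_dense C2 gU ds p0 (sw t) e0; exists phi.
Qed.
Let rr phi x := p * phi x + Lam phi x.
Let srr phi : Cc_infty phi -> inL2 mu (rr phi).
Proof. exact: inL2_resolvent. Qed.

Lemma approx_resolvent_norm t eta phi : approx_resolvent t eta phi -> `|l2 mu (rr phi) - n t| <= eta.
Proof. by move=> [Cphi le]; apply: le_trans (l2_dist (srr Cphi) (sw t)) le. Qed.

Lemma pairing_le t eta phi : approx_resolvent t eta phi ->
 `|pairing t phi| <= D t * ((n t + eta) / Num.sqrt (2 * p)).
Proof.
move=> ap; have [Cphi _] := ap; apply: le_trans (inner_transport_le t Cphi) _.
rewrite ler_wpM2l ?l2_ge0// (le_trans (transport_l2_le Cphi))// mulrC ler_pM2r ?invr_gt0//.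
by have := approx_resolvent_norm ap; rewrite ler_norml => /andP[_]; rewrite /rr; lra.
Qed.
Let int_le_l2 g : inL2 mu g -> `|\int[mu]_x g x| <= l2 mu g.
Proof.
move=> sg; have s1 : inL2 mu (cst 1 : 'rV[R]_d -> R).
 by apply: (@inL2_bounded _ _ _ mu _ 1) => // x; rewrite normr1.
have := cauchy_schwarz sg s1; rewrite [l2 mu (cst 1)]/l2.
under [X in _ * Num.sqrt X]eq_Rintegral do rewrite expr1n.
rewrite Rintegral_cst_prob sqrtr1 mulr1; congr (`|_| <= _).
by apply: eq_Rintegral => x _; rewrite mulr1.
Qed.
Let macro_l2 s t : 0 <= s -> 0 <= t -> l2 mu (fun x => w t x - w s x) <= C * `|t - s|.
Proof.
move=> s0 t0; apply: l2_le_cst; first exact: mfunB.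
by move=> x; exact: macro_lip.
Qed.
(** Lam phi = r - p phi, so the inner product is |r|^2 - p <r, phi>, to which [resolvent_poincare]
    applies. The mean of r is at most eta, since Pi u(s) has mean zero. *)
Let inner_dirichlet s eta phi : 0 <= s -> approx_resolvent s eta phi ->
 2^-1 * l2 mu (rr phi) ^+ 2 - eta ^+ 2 <= \int[mu]_x (rr phi x * Lam phi x).
Proof.
move=> s0 [Cphi ap]; have sR := srr Cphi; have [_ iR] := sR.
have P := resolvent_poincare C2 gU p0 Cphi po; rewrite -/(rr phi) in P.
have I : (\int[mu]_x rr phi x) ^+ 2 <= eta ^+ 2.
 have -> : \int[mu]_x rr phi x = \int[mu]_x (rr phi x - w s x).
  by rewrite (RintegralB msT (inL2_integrable sR) (inL2_integrable (sw s))) macro_mean// subr0.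
 have h := le_trans (int_le_l2 (inL2_sub sR (sw s))) ap.
 rewrite -(ger0_norm (sqr_ge0 (Rintegral _ _ _))) normrX lerXn2r// nnegrE//.
 exact: le_trans h.
have -> : \int[mu]_x (rr phi x * Lam phi x) = \int[mu]_x (rr phi x ^+ 2) - p * \int[mu]_x (rr phi x * phi x).
 have i1 := inL2_mul sR (inL2_Cc mu Cphi).
 rewrite -RintegralZl// -(RintegralB msT iR (intble_cmul msT p i1)).
 by apply: eq_Rintegral => x _; rewrite /rr; ring.
move: P I; rewrite l2_sqr /=; move: (\int[mu]_x _) (p * _) ((\int[mu]_x _) ^+ 2) => a b c; lra.
Qed.
(** The weak equation on [s, s + h] with the test function frozen. At time q the average Pi u(q) is
    within C h + eta of r, which costs (C h + eta) |r| because |Lam phi| <= |r|. The remainder is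
    orthogonal to functions of x, so it only sees u - Pi u. *)
Let step_weak s h eta phi : 0 <= s -> 0 <= h -> 0 <= eta -> approx_resolvent s eta phi ->
 h * (2^-1 * l2 mu (rr phi) ^+ 2 - eta ^+ 2 - (C * h + eta) * l2 mu (rr phi) -
  (D s + 2 * C * h) * (A * l2 mu (rr phi))) <= pairing (s + h) phi - pairing s phi.
Proof.
move=> s0 h0 eta0 ap; have [Cphi apl] := ap.
have ssh : s <= s + h by rewrite lerDl.
have sL := inL2_dirichlet mu C2 Cphi; have srem := inL2_remainder Cphi.
have sLf := inL2_fst kappa sL.
rewrite /pairing (zz_weak_transport vl gamma0 C2 gU L0 HL Cphi zu s0 ssh).
pose H z := Lam phi z.1 + residual U phi z - gamma * transport phi z.
have HE z : H z = Lam phi z.1 + (residual U phi z - gamma * transport phi z) by exact: (esym (addrA _ _ _)).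
have sH : inL2 m H.
 by have := inL2_add sLf srem; congr inL2; apply/funext => z; rewrite HE.
have ig : intble_on leb `[s, s + h] (fun q => \int[m]_z (u q z * H z)).
 apply: (@intble_itv_bounded _ _ (M * l2 m H)).
  apply: (@m_Rintegral _ _ _ _ R mp (fun q z => u q z * H z)).
  by apply: mfunM => //; apply: (mcomp _ m_snd); case: sH.
 move=> q; apply: le_trans (cauchy_schwarz (su q) sH) _; rewrite ler_wpM2r ?l2_ge0//.
 by apply: (@l2_le_cst _ _ _ mp) => //; exact: uM.
have := Rintegral_itv_ge ssh ig; rewrite [s + h - s]addrAC subrr add0r; apply => q /andP[sq qsh].
have q0 := le_trans s0 sq.
have qh : `|q - s| <= h by rewrite ger0_norm ?subr_ge0// lerBlDl.
have -> : \int[m]_z (u q z * H z) = \int[mu]_x (w q x * Lam phi x) +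
  \int[m]_z (micro q z * (residual U phi z - gamma * transport phi z)).
 rewrite -(inner_fst q sL) -inner_micro//.
  rewrite -(RintegralD msT (inL2_mul (su q) sLf) (inL2_mul (su q) srem)).
  by apply: eq_Rintegral => z _; rewrite HE mulrDr.
 move=> g sg; have i1 := inL2_mul (inL2_fst kappa sg) (inL2_residual vl C2 gU L0 HL Cphi).
 have i2 := inL2_mul (inL2_fst kappa sg) (inL2_transport mu vl Cphi).
 transitivity (\int[m]_z (g z.1 * residual U phi z) - gamma * \int[m]_z (g z.1 * transport phi z)).
  rewrite -RintegralZl// -(RintegralB msT i1 (intble_cmul msT gamma i2)).
  by apply: eq_Rintegral => z _; ring.
 rewrite (refresh_residual_mul vl omega0 C2 gU L0 HL Cphi sg) (refresh_transport_mul vl Cphi sg).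
 by rewrite mulr0 subr0.
have sR := srr Cphi.
have B1 : 2^-1 * l2 mu (rr phi) ^+ 2 - eta ^+ 2 - (C * h + eta) * l2 mu (rr phi) <= \int[mu]_x (w q x * Lam phi x).
 have -> : \int[mu]_x (w q x * Lam phi x) = \int[mu]_x (rr phi x * Lam phi x) +
   \int[mu]_x ((w q x - rr phi x) * Lam phi x).
  rewrite -(RintegralD msT (inL2_mul sR sL) (inL2_mul (inL2_sub (sw q) sR) sL)).
  by apply: eq_Rintegral => x _; ring.
 have k1 := inner_dirichlet s0 ap.
 have k2 := cauchy_schwarz (inL2_sub (sw q) sR) sL.
 have k3 : l2 mu (fun x => w q x - rr phi x) <= C * h + eta.
  have := l2_triangle (inL2_sub (sw q) (sw s)) (inL2_sub (sw s) sR).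
  rewrite [X in l2 mu X <= _](_ : _ = fun x => w q x - rr phi x); last by apply/funext => x; ring.
  move=> /le_trans; apply; apply: lerD.
   by apply: (le_trans (macro_l2 s0 q0)); rewrite ler_wpM2l.
  by rewrite -l2_opp; apply: le_trans apl; under eq_fun do rewrite opprB.
 have k4 := l2_dirichlet_le C2 gU p0 Cphi; rewrite -/(rr phi) in k4.
 have k5 : l2 mu (fun x => w q x - rr phi x) * l2 mu (Lam phi) <= (C * h + eta) * l2 mu (rr phi).
  by apply: ler_pM => //; exact: l2_ge0.
 move: (le_trans k2 k5); rewrite ler_norml => /andP[k6 _].
 by move: k1 k6; move: (\int[mu]_x _) (\int[mu]_x _) (_ * l2 mu (rr phi)) => a b e; lra.
have B2 : - ((D s + 2 * C * h) * (A * l2 mu (rr phi))) <=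
  \int[m]_z (micro q z * (residual U phi z - gamma * transport phi z)).
 have k1 := cauchy_schwarz (smi q) srem.
 have k2 := remainder_le Cphi; rewrite -/(rr phi) in k2.
 have k3 : D q <= D s + 2 * C * h by apply: micro_up => //; rewrite sq.
 have k4 : D q * l2 m (fun z => residual U phi z - gamma * transport phi z) <= (D s + 2 * C * h) * (A * l2 mu (rr phi)).
  by apply: ler_pM => //; exact: l2_ge0.
 by move: (le_trans k1 k4); rewrite ler_norml => /andP[].
by rewrite /H; move: B1 B2; move: (\int[mu]_x _) (\int[m]_z _) => a b; lra.
Qed.
(** The test function is exchanged at time s + h. The difference psi solves the resolvent equation
    with data Pi u(s + h) - Pi u(s), up to two errors eta. By the weak equation for functions of x,
    pairing these data with psi costs at most h D |v . grad psi|; the energy of psi then bounds |v .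
    grad psi| by h D + eta / sqrt p, with D taken at its bound D s + 2 C h over the step. *)
Let step_transport s h eta phi phi' : 0 <= s -> 0 <= h -> 0 <= eta ->
 approx_resolvent s eta phi -> approx_resolvent (s + h) eta phi' ->
 - ((D s + 2 * C * h) * (h * (D s + 2 * C * h) + eta / Num.sqrt p)) <=
 pairing (s + h) phi' - pairing (s + h) phi.
Proof.
move=> s0 h0 eta0 [Cphi ap] [Cphi' ap']; pose psi x := phi' x - phi x.
have Cpsi : Cc_infty psi by exact: Cc_infty_sub.
have ssh : s <= s + h by rewrite lerDl.
have sh0 := le_trans s0 ssh.
have Dq q (qs : s <= q <= s + h) := micro_up s0 qs.
have pC k x : partial k psi x = partial k phi' x - partial k phi x.
 by rewrite /psi partialB//; exact: Cc_infty_Cn.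
have tE z : transport psi z = transport phi' z - transport phi z.
 by rewrite /transport -sumrB; apply: eq_bigr => k _; rewrite pC mulrBl.
have st := inL2_transport mu vl Cphi; have st' := inL2_transport mu vl Cphi'.
have spsi := inL2_Cc mu Cpsi.
have -> : pairing (s + h) phi' - pairing (s + h) phi = \int[m]_z (u (s + h) z * transport psi z).
 rewrite /pairing -(RintegralB msT (inL2_mul (su _) st') (inL2_mul (su _) st)).
 by apply: eq_Rintegral => z _; rewrite tE mulrBr.
have LE x : Lam psi x = Lam phi' x - Lam phi x.
 rewrite /dirichlet_op -sumrB; apply: eq_bigr => k _; rewrite pC.
 have -> : partial k (partial k psi) x = partial k (partial k phi') x - partial k (partial k phi) x.
  rewrite (_ : partial k psi = fun x => partial k phi' x - partial k phi x); last by apply/funext => y; exact: pC.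
  by rewrite partialB//; apply: Cc_infty_Cn; exact: Cc_infty_partial.
 by move: (partial k U x) (partial k phi' x) (partial k phi x) (partial k (partial k phi') x) (partial k (partial k phi) x) => a b e g i; ring.
have rE x : rr psi x = rr phi' x - rr phi x by rewrite /rr LE /psi; move: (Lam phi' x) (Lam phi x) (phi' x) (phi x) => a b e g; ring.
set x := l2 m (transport psi); set y := l2 mu psi.
have xE : x ^+ 2 + p * y ^+ 2 = \int[mu]_x (rr psi x * psi x).
 by rewrite /x /y !l2_sqr (transport_sq mu vl Cpsi) (resolvent_inner C2 gU p Cpsi) addrC.
pose e1 (x : 'rV[R]_d) := rr phi' x - w (s + h) x; pose e0 (x : 'rV[R]_d) := rr phi x - w s x.
have se1 : inL2 mu e1 by exact: inL2_sub (srr Cphi') (sw _).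
have se0 : inL2 mu e0 by exact: inL2_sub (srr Cphi) (sw _).
have dE : \int[mu]_x (rr psi x * psi x) = (\int[mu]_x (w (s + h) x * psi x) - \int[mu]_x (w s x * psi x)) +
  (\int[mu]_x (e1 x * psi x) - \int[mu]_x (e0 x * psi x)).
 rewrite -(RintegralB msT (inL2_mul (sw _) spsi) (inL2_mul (sw _) spsi)).
 rewrite -(RintegralB msT (inL2_mul se1 spsi) (inL2_mul se0 spsi)).
 rewrite -RintegralD//; [|apply: intble_sub => //; exact: inL2_mul..].
 by apply: eq_Rintegral => z _; rewrite rE /e1 /e0; move: (rr phi' z) (rr phi z) (w (s + h) z) (w s z) (psi z) => a b e g i; ring.
have wE : \int[mu]_x (w (s + h) x * psi x) - \int[mu]_x (w s x * psi x) <= h * ((D s + 2 * C * h) * x).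
 rewrite -!inner_fst// (zz_weak_fst vl gamma0 C2 gU L0 HL Cpsi zu s0 ssh) -Rintegral_opp.
 have := @Rintegral_itv_le _ (fun q => - \int[m]_z (u q z * transport psi z)) s (s + h) ((D s + 2 * C * h) * x) ssh.
 rewrite [s + h - s]addrAC subrr add0r; apply.
  apply: (@intble_itv_bounded _ _ (M * x)).
   apply: mcomp => //.
   apply: (@m_Rintegral _ _ _ _ R mp (fun q z => u q z * transport psi z)).
   by apply: mfunM => //; apply: (mcomp _ m_snd); case: (inL2_transport mu vl Cpsi).
  move=> q; rewrite normrN; apply: le_trans (cauchy_schwarz (su q) (inL2_transport mu vl Cpsi)) _.
  rewrite ler_wpM2r ?l2_ge0//.
  by apply: (@l2_le_cst _ _ _ mp) => //; exact: uM.
 move=> q qs; apply: le_trans (ler_norm _) _; rewrite normrN.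
 by apply: le_trans (inner_transport_le q Cpsi) _; rewrite ler_wpM2r ?l2_ge0// Dq.
have E1 : \int[mu]_x (e1 x * psi x) <= eta * y.
 apply: le_trans (ler_norm _) _; apply: le_trans (cauchy_schwarz se1 spsi) _.
 exact: (ler_wpM2r (l2_ge0 _ _) ap').
have E0 : - (\int[mu]_x (e0 x * psi x)) <= eta * y.
 apply: le_trans (ler_norm _) _; rewrite normrN; apply: le_trans (cauchy_schwarz se0 spsi) _.
 exact: (ler_wpM2r (l2_ge0 _ _) ap).
have x0 : 0 <= x by exact: l2_ge0.
have D0 : 0 <= D s + 2 * C * h by rewrite addr_ge0 ?l2_ge0 ?mulr_ge0.
have xle : x <= h * (D s + 2 * C * h) + eta / Num.sqrt p.
 apply: (@quadratic_root_le _ _ _ _ _ y) => //; first exact: mulr_ge0.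
 have e2 : 2 * (eta * y) = eta * y + eta * y by rewrite mulr_natl mulr2n.
 rewrite xE dE e2; apply: lerD; last exact: lerD.
 by have -> : h * (D s + 2 * C * h) * x = h * ((D s + 2 * C * h) * x) by rewrite mulrA.
have := inner_transport_le (s + h) Cpsi; rewrite ler_norml => /andP[k _]; apply: le_trans k.
rewrite lerN2 -/x; apply: ler_pM => //; first exact: l2_ge0.
by apply: Dq; rewrite ssh lexx.
Qed.

Lemma pairing_step s h eta phi phi' : 0 <= s -> 0 <= h -> 0 <= eta ->
 approx_resolvent s eta phi -> approx_resolvent (s + h) eta phi' ->
 h * (2^-1 * l2 mu (rr phi) ^+ 2 - eta ^+ 2 - (C * h + eta) * l2 mu (rr phi) -
  (D s + 2 * C * h) * (A * l2 mu (rr phi))) -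
 (D s + 2 * C * h) * (h * (D s + 2 * C * h) + eta / Num.sqrt p) <=
 pairing (s + h) phi' - pairing s phi.
Proof.
move=> s0 h0 eta0 ap ap'; have := step_weak s0 h0 eta0 ap; have := step_transport s0 h0 eta0 ap ap'.
by move: (pairing _ _) (pairing _ _) (pairing _ _) (h * _) (_ * (_ + _ / _)) => a b c e g; lra.
Qed.

Lemma macro_le t : n t <= M. Proof. exact: l2_le_cst (mw t) (wM t). Qed.

Lemma micro_le t : D t <= 2 * M.
Proof.
apply: (@l2_le_cst _ _ _ mp); first by case: (smi t).
by move=> z; apply: le_trans (ler_normB _ _) _; rewrite mulr2n mulrDl mul1r lerD.
Qed.

Lemma energy s t : 0 <= s -> s <= t -> N t - N s <= - (2 * gamma) * \int[leb]_(q in `[s, t]) (D q ^+ 2).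
Proof.
move=> s0 st /=; rewrite !l2_sqr; apply: le_trans (zz_energy CU gamma0 flip_inv quasi_inv itot zu s0 st) _.
by rewrite le_eqVlt; apply/orP; left; apply/eqP; congr (_ * _); apply: eq_Rintegral => q _; rewrite l2_sqr.
Qed.

Lemma m_micro_sq : mfunT (fun q => D q ^+ 2).
Proof. by under eq_fun do rewrite l2_sqr; exact: (m_refresh_defect mu zu). Qed.

Lemma m_norm_sq : mfunT N.
Proof.
under eq_fun do rewrite l2_sqr.
apply: (@m_Rintegral _ _ _ _ R mp (fun q z => u q z ^+ 2)).
exact: mfunX.
Qed.

Lemma lipschitz_decay t : 0 <= t ->
 \int[leb]_(q in `[t, t + (Num.sqrt p)^-1]) (l2 m (u q) ^+ 2) <=
 expR (- (t / (2 * relaxation coupling gamma p))) *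
 \int[leb]_(q in `[0, 0 + (Num.sqrt p)^-1]) (l2 m (u q) ^+ 2).
Proof.
move=> t0; apply: (@exponential_decay R ('rV[R]_d -> R) approx_resolvent pairing
 (fun phi => l2 mu (fun x => p * phi x + Lam phi x)) n D N coupling C M gamma p) => //.
- by move=> q; rewrite l2_ge0 macro_le.
- by move=> q; rewrite l2_ge0 micro_le.
- exact: pythagoras.
- exact: micro_lip.
- exact: energy.
- exact: m_micro_sq.
- exact: m_norm_sq.
- exact: approx_resolvent_ex.
- exact: approx_resolvent_norm.
- by move=> phi; exact: l2_ge0.
- exact: pairing_le.
- exact: pairing_step.
Qed.

End solution.

Section bounded.
Variables (f : state -> R) (u : R -> state -> R) (M : R).
Hypotheses (zu : zz_mild U gamma kappa f u M) (mean0 : \int[m]_z f z = 0).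
Let mu_ : mfunT (fun p : R * state => u p.1 p.2). Proof. by case: zu. Qed.
Let uM t z : `|u t z| <= M. Proof. by case: zu. Qed.
Let M0 : 0 <= M. Proof. exact: le_trans (uM 0 (0, 0)). Qed.
Let muz z : mfunT (fun q => u q z).
Proof. by apply: (m_uncurry mu_). Qed.

Section width.
Variables (h : R) (h0 : 0 < h).
Local Notation avg := (time_average (uniform_prob h0) u uniform_lag).

Lemma uniform_averageE t z : avg t z = h^-1 * \int[leb]_(q in `[t, t + h]) u q z.
Proof.
have mg : mfunT (fun r : R => u (t + `|r|) z).
 apply: (mcomp (muz z)); apply: mfunD => //; exact: normr_measurable.
rewrite /time_average (@uniform_Rintegral _ _ h0 (fun r : R => u (t + `|r|) z) M mg); last by move=> r; exact: uM.
congr (_ * _); have := Rintegral_itv_translate 0 h t (muz z); rewrite add0r [h + t]addrC => <-.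
apply: eq_Rintegral => r; rewrite inE/= in_itv/= => /andP[r0 _].
by rewrite ger0_norm// addrC.
Qed.

Lemma uniform_average_mild : zz_mild U gamma kappa (avg 0) avg M.
Proof.
apply: (zz_mild_average CU gamma0 _ zu); first exact: m_uniform_lag.
by move=> r; exact: normr_ge0.
Qed.
(** Two windows of length h, shifted by t - s, differ by two intervals of length t - s on which |u|
    <= M. *)
Let avg_lip s t z : 0 <= s -> 0 <= t -> `|avg t z - avg s z| <= 2 * M / h * `|t - s|.
Proof.
move=> _ _; wlog st : s t / s <= t.
 by move=> H; case/orP: (le_total s t) => st; [exact: H|rewrite distrC [`|t - s|]distrC; exact: H].
have hw := ltW h0.
have iu a b : intble_on leb `[a, b] (fun q => u q z).
 exact: (intble_itv_bounded a b (muz z) (fun q => uM q z)).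
rewrite !uniform_averageE -mulrBr normrM ger0_norm ?invr_ge0// [2 * M / h]mulrC -mulrA ler_wpM2l ?invr_ge0//.
have e1 := @Rintegral_itv_chasles _ (fun q => u q z) s t (t + h) st.
have e2 := @Rintegral_itv_chasles _ (fun q => u q z) s (s + h) (t + h).
have b1 := Rintegral_itv_le_bounded st (muz z) (fun q => uM q z).
have b2 := @Rintegral_itv_le_bounded R (fun q => u q z) M (s + h) (t + h).
have th : t <= t + h by rewrite lerDl.
have sh : s <= s + h by rewrite lerDl.
have sth : s + h <= t + h by rewrite lerD2r.
move: (e1 th (iu _ _)) (e2 sh sth (iu _ _)) b1 (b2 sth (muz z) (fun q => uM q z)).
move=> {}e1 {}e2 b1.
have -> : t + h - (s + h) = t - s by ring.
rewrite (ger0_norm (_ : 0 <= t - s)) ?subr_ge0//.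
move: e1 e2 b1; rewrite !ler_norml => -> {}e2 /andP[a1 a2] /andP[a3 a4].
by move: e2 a1 a2 a3 a4; move: (\int[leb]_(_ in _) _) (\int[leb]_(_ in _) _) (\int[leb]_(_ in _) _) (\int[leb]_(_ in _) _) => *; lra.
Qed.
Let avg_mean : \int[m]_z avg 0 z = 0.
Proof.
have mF : mfunT (fun q : state * g_sigma_algebraType (R.-ocitv.-measurable) =>
  u (0 + uniform_lag q.2) q.1).
 apply: (m_uncurry mu_); last exact: m_fst.
 apply: mfunD => //; exact: (mcomp m_uniform_lag m_snd).
have iF : intble ((mu \x kappa : probability _ R) \x uniform_prob h0)%E (fun q => u (0 + uniform_lag q.2) q.1).
 apply: (@intble_bounded _ _ _ ((mu \x kappa : probability _ R) \x uniform_prob h0 : probability _ R)%E _ M) => //.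
rewrite /time_average (RFubini iF) /=.
under eq_Rintegral => r _.
 rewrite (zz_mild_mass CU gamma0 flip_inv quasi_inv itot zu) ?mean0//; last first.
  by rewrite add0r; exact: normr_ge0.
 over.
by rewrite Rintegral_cst_prob.
Qed.

(** The Lipschitz constant 2 M / h blows up as h tends to 0, but [relaxation] does not depend on it;
    so the rate survives the limit. *)
Lemma uniform_average_decay t : 0 <= t ->
 \int[leb]_(q in `[t, t + (Num.sqrt p)^-1]) (l2 m (avg q) ^+ 2) <=
 expR (- (t / (2 * relaxation coupling gamma p))) *
 \int[leb]_(q in `[0, 0 + (Num.sqrt p)^-1]) (l2 m (avg q) ^+ 2).
Proof.
apply: (lipschitz_decay (uniform_average_mild) _ avg_lip avg_mean).
by apply: divr_ge0; [exact: mulr_ge0|exact: ltW].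
Qed.
End width.
Let hk k : 0 < k.+1%:R^-1 :> R. Proof. by rewrite invr_gt0. Qed.
Local Notation avg k := (time_average (uniform_prob (hk k)) u uniform_lag).
Let avg_measurable k : mfunT (fun q : R * state => avg k q.1 q.2).
Proof. by case: (uniform_average_mild (hk k)). Qed.
Let avg_le k t z : `|avg k t z| <= M.
Proof. by case: (uniform_average_mild (hk k)). Qed.
Let sq_le (x : R) : `|x| <= M -> `|x ^+ 2| <= M ^+ 2.
Proof. by move=> xM; rewrite normrX lerXn2r// nnegrE. Qed.
Let swap (v : R -> state -> R) a c : mfunT (fun q : R * state => v q.1 q.2) ->
 (forall t z, `|v t z| <= M) ->
 intble m (fun z => \int[leb]_(q in `[a, c]) (v q z ^+ 2)) /\
 \int[leb]_(q in `[a, c]) (l2 m (v q) ^+ 2) = \int[m]_z \int[leb]_(q in `[a, c]) (v q z ^+ 2).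
Proof.
move=> mv vM.
have mF : mfunT (fun p : state * R => v p.2 p.1 ^+ 2).
 apply: mfunX; apply: (m_uncurry mv); [exact: m_snd|exact: m_fst].
have ic : intble_on leb `[a, c] (fun=> M ^+ 2).
 by apply: (intble_itv_bounded (C := M ^+ 2)) => // x; rewrite ger0_norm ?sqr_ge0.
have [i1 e1] := @RFubini_itv R _ _ mp (fun z q => v q z ^+ 2) (fun=> M ^+ 2) a c mF ic
 (fun z q _ => sq_le (vM q z)).
split => //; rewrite e1; apply: eq_Rintegral => q _; exact: l2_sqr.
Qed.
(** For fixed z the averages converge at almost every time, by Lebesgue differentiation. Fubini puts
    the integral over z outside, and dominated convergence is applied first in time and then in
    z. *)
Let average_cvg a c : 0 <= a -> a <= c ->
 \int[leb]_(q in `[a, c]) (l2 m (avg k q) ^+ 2) @[k --> \oo] -->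
 \int[leb]_(q in `[a, c]) (l2 m (u q) ^+ 2).
Proof.
move=> a0 ac.
have sw k := swap a c (avg_measurable k) (avg_le k).
have [iu eu] := swap a c mu_ uM; rewrite eu.
under eq_fun do rewrite (sw _).2.
have ic : intble_on leb `[a, c] (fun=> M ^+ 2).
 by apply: (intble_itv_bounded (C := M ^+ 2)) => // x; rewrite ger0_norm ?sqr_ge0.
have sec (v : R -> state -> R) z : mfunT (fun q : R * state => v q.1 q.2) ->
  mfunT (fun q => v q z ^+ 2).
 by move=> mv; apply: mfunX; apply: (m_uncurry mv).
have mi (g : state -> R) : intble m g -> mfunT g.
 by move=> /measurable_int /mEFinP.
apply: (@Rintegral_dominated_cvg _ _ _ m setT _ _ (fun=> M ^+ 2 * (c - a))) => //.
- by move=> k; apply: mi; exact: (sw k).1.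
- exact: mi.
- apply: aeW => z _.
 apply: (@Rintegral_dominated_cvg _ _ _ leb `[a, c]%classic (fun k q => avg k q z ^+ 2) _ (fun=> M ^+ 2)) => //.
 + by move=> k; exact: (measurable_funTS (sec _ z (avg_measurable k))).
 + exact: (measurable_funTS (sec _ z mu_)).
 + have := ae_cvg_average (muz z) (fun q => uM q z).
  apply: filterS; first exact: (ae_filter_ringOfSetsType leb).
  move=> q H; rewrite /= in_itv/= => /andP[aq _].
  have {}H := H (le_trans a0 aq).
  have -> : (fun k => avg k q z ^+ 2) = (fun k => avg k q z * avg k q z) by apply/funext => k; rewrite expr2.
  have {}H : avg k q z @[k --> \oo] --> u q z.
   by move: H; apply: cvg_trans; apply: near_eq_cvg; apply: nearW => k; rewrite uniform_averageE invrK.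
  by rewrite expr2; exact: cvgM.
 + by move=> k q _; apply: sq_le.
- by apply: (intble_by mp `|M ^+ 2 * (c - a)|).
- move=> k z _; apply: (Rintegral_itv_le_bounded ac); first exact: sec.
 by move=> q; apply: sq_le.
Qed.

Theorem bounded_decay t : 0 <= t ->
 \int[leb]_(q in `[t, t + (Num.sqrt p)^-1]) (l2 m (u q) ^+ 2) <=
 expR (- (t / (2 * relaxation coupling gamma p))) *
 \int[leb]_(q in `[0, 0 + (Num.sqrt p)^-1]) (l2 m (u q) ^+ 2).
Proof.
move=> t0; have T0 : 0 <= (Num.sqrt p)^-1 by rewrite invr_ge0 sqrtr_ge0.
have c1 := @average_cvg t (t + (Num.sqrt p)^-1) t0.
have c2 := @average_cvg 0 (0 + (Num.sqrt p)^-1) (lexx _).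
move: c1 c2; rewrite !lerDl T0 => /(_ isT) c1 /(_ isT) c2.
apply: (ler_cvg_to c1 (cvgM (cvg_cst _) c2)).
by apply: nearW => k; exact: uniform_average_decay.
Qed.

End bounded.

Section l2_decay.
Context {dO : measure_display} {O : measurableType dO} {P : probability O R}.
Variables (E : nat -> option 'I_d -> {RV P >-> R}) (W : nat -> {RV P >-> 'rV[R]_d}).
Hypothesis noise : zz_noise E W kappa.
Local Notation m := (mu \x kappa : probability state R)%E.
Local Notation S := (zz_semigroup U gamma E W).
Local Notation T := (Num.sqrt p)^-1.
Local Notation beta := (relaxation coupling gamma p).
Let invariance t (g : state -> \bar R) := @zz_invariance _ _ _ _ _ E W mu kappa noise U gamma CU gamma0 flip_inv quasi_inv itot t g.
Let bounded_semigroup (g : state -> R) (M : R) : mfunT g -> (forall z : state, `|g z| <= M) -> \int[m]_z g z = 0 ->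
 exists u : R -> state -> R, [/\ mfunT (fun t => l2 m (u t) ^+ 2),
  forall t, 0 <= t -> l2 m (S t g) = l2 m (u t) &
  forall t, 0 <= t -> \int[leb]_(q in `[t, t + T]) (l2 m (u q) ^+ 2) <=
   expR (- (t / (2 * beta))) * \int[leb]_(q in `[0, 0 + T]) (l2 m (u q) ^+ 2)].
Proof.
move=> mg gM g0.
have [u zu Su] := zz_semigroup_mild noise CU gamma0 flip_inv quasi_inv itot mg gM.
have [_ mu_ _] := zu.
exists u; split.
- exact: (m_norm_sq zu).
- move=> t t0; apply: ae_eq_l2; [exact: m_zz_semigroup|exact: m_mild|exact: Su].
- by move=> t; apply: (bounded_decay zu g0).
Qed.

Section function.
Variable f : state -> R.
Hypotheses (sf : inL2 m f) (f0 : \int[m]_z f z = 0).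
(** The absolute value extends the norm to all real times, so that it is measurable and bounded on
    the whole line; the integrals only involve t >= 0. *)
Local Notation N := (fun t : R => l2 m (S `|t| f)).
Local Notation B := (l2 m f).
Let S0 t : S t (fun=> 0) = (fun=> 0).
Proof. by apply/funext => z; rewrite /zz_semigroup Rintegral_cst_prob. Qed.
Let NB t : 0 <= N t <= B.
Proof.
rewrite l2_ge0; have s0 : inL2 m (fun=> 0).
 by apply: (@inL2_bounded _ _ _ m _ 0) => // z; rewrite normr0.
have := @l2_zz_semigroup_dist _ _ _ _ _ E W mu kappa U gamma CU gamma0 invariance `|t| f (fun=> 0) (normr_ge0 t) sf s0.
rewrite S0 (_ : l2 m (fun=> 0) = 0); last first.
 by rewrite /l2 expr0n/= Rintegral_cst_prob sqrtr0.
rewrite subr0 ger0_norm ?l2_ge0//.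
by rewrite (_ : (fun z => f z - 0) = f)//; apply/funext => z; rewrite subr0.
Qed.
Let approx (e : R) : 0 < e -> exists u : R -> state -> R, [/\ mfunT (fun t => l2 m (u t) ^+ 2),
  forall t, `|N t - l2 m (u `|t|)| <= e &
  forall t, 0 <= t -> \int[leb]_(q in `[t, t + T]) (l2 m (u q) ^+ 2) <=
   expR (- (t / (2 * beta))) * \int[leb]_(q in `[0, 0 + T]) (l2 m (u q) ^+ 2)].
Proof.
move=> e0; have [g [M [mg gM g0 fg]]] := bounded_mean0_approx sf f0 e0.
have [u [m2 Su dec]] := bounded_semigroup mg gM g0.
exists u; split => // t; rewrite -Su//.
have sg : inL2 m g by exact: inL2_bounded mg gM.
exact: le_trans (@l2_zz_semigroup_dist _ _ _ _ _ E W mu kappa U gamma CU gamma0 invariance _ f g (normr_ge0 t) sf sg) fg.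
Qed.
(** The norm is the limit, at every t, of the norms for bounded data, which are measurable in time
    because they agree with those of solutions of the Duhamel formula. *)
Let mN : mfunT (fun t => N t ^+ 2).
Proof.
have e0 n : 0 < n.+1%:R^-1 :> R by rewrite invr_gt0.
have [u Hu] := boolp.choice (fun n => approx (e0 n)).
apply: (@measurable_fun_cvg _ _ _ _ (fun n (t : R) => l2 m (u n `|t|) ^+ 2)).
- move=> n; have [mu_ _ _] := Hu n; apply: (mcomp mu_); exact: normr_measurable.
- move=> t _; have cv : l2 m (u n `|t|) @[n --> \oo] --> N t.
  apply/cvgrPdist_le => e ee; have := @cvg_harmonic R.
  move=> /cvgrPdist_le /(_ e ee); apply: filterS => n.
  rewrite sub0r normrN ger0_norm ?invr_ge0// => ne.
  by have [_ h _] := Hu n; exact: le_trans (h t) ne.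
 rewrite expr2; under eq_fun do rewrite expr2; exact: cvgM.
Qed.
Let Ncl (n v e : R) : 0 <= n <= B -> 0 <= v -> 0 < e -> `|n - v| <= e ->
 n ^+ 2 <= v ^+ 2 + e * (2 * B + e) /\ v ^+ 2 <= n ^+ 2 + e * (2 * B + e).
Proof.
move=> /andP[n0 nB] v0 e0; rewrite ler_norml => /andP[h1 h2].
have e1 : 0 <= e * (B - n) by rewrite mulr_ge0 ?subr_ge0// ltW.
have vn : v <= n + e by move: h1; lra.
have nv : n <= v + e by move: h2; lra.
have a1 : v ^+ 2 <= (n + e) ^+ 2 by rewrite lerXn2r ?nnegrE// addr_ge0// ltW.
have a2 : n ^+ 2 <= (v + e) ^+ 2 by rewrite lerXn2r ?nnegrE// addr_ge0// ltW.
have e2 : e * v <= e * (n + e) by rewrite ler_wpM2l// ltW.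
by move: a1 a2 e1 e2; rewrite !expr2; move: B => b; nra.
Qed.
Let Nsq t : `|N t ^+ 2| <= B ^+ 2.
Proof.
have /andP[a b] := NB t; rewrite ger0_norm ?sqr_ge0// lerXn2r ?nnegrE//; exact: le_trans b.
Qed.
Let iN a c : intble_on leb `[a, c] (fun t => N t ^+ 2).
Proof. exact: (intble_itv_bounded a c mN Nsq). Qed.

Lemma l2_zz_semigroup_measurable :
 mfunT (fun t : R => l2 m (S `|t| f) ^+ 2) /\
 forall t : R, `|l2 m (S `|t| f) ^+ 2| <= l2 m f ^+ 2.
Proof. by split; [exact: mN|exact: Nsq]. Qed.

Lemma l2_decay t : 0 <= t ->
 \int[leb]_(q in `[t, t + T]) (N q ^+ 2) <=
 expR (- (t / (2 * beta))) * \int[leb]_(q in `[0, 0 + T]) (N q ^+ 2).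
Proof.
move=> t0; have T0 : 0 <= T by rewrite invr_ge0 sqrtr_ge0.
have B0 : 0 <= B by exact: l2_ge0.
apply/ler_addgt0Pr => e e0.
(* Bounded data at distance a <= 1 change the squared norm by at most c = a (2 B + a) <= a (2 B +
   1). This error is integrated over a window of length T on both sides, so the total is at most 2 c
   T <= a D <= e; the added 1 keeps D positive. *)
pose D := 2 * T * (2 * B + 1) + 1.
have D0 : 0 < D by rewrite ltr_wpDl// !mulr_ge0// addr_ge0// mulr_ge0.
pose a := Num.min 1 (e / D).
have a0 : 0 < a by rewrite lt_min ltr01 divr_gt0.
have aD : a * D <= e by rewrite -ler_pdivlMr// ge_min lexx orbT.
have a1 : a <= 1 by rewrite ge_min lexx.
have [u [mu_ uN dec]] := approx a0.
have close q : 0 <= q -> N q ^+ 2 <= l2 m (u q) ^+ 2 + a * (2 * B + a) /\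
  l2 m (u q) ^+ 2 <= N q ^+ 2 + a * (2 * B + a).
 by move=> q0; have := uN q; rewrite {2}(ger0_norm q0) => /(Ncl (NB q) (l2_ge0 _ _) a0).
pose c := a * (2 * B + a).
have c0 : 0 <= c by rewrite mulr_ge0 ?addr_ge0 ?mulr_ge0// ltW.
have mua : mfunT (fun q : R => l2 m (u `|q|) ^+ 2).
 by apply: (mcomp mu_); exact: normr_measurable.
have iu s : 0 <= s -> intble_on leb `[s, s + T] (fun q => l2 m (u q) ^+ 2).
 move=> s0; have : intble_on leb `[s, s + T] (fun q : R => l2 m (u `|q|) ^+ 2).
  apply: (intble_itv_bounded (C := B ^+ 2 + c) _ _ mua) => q.
  rewrite ger0_norm ?sqr_ge0//; have [_] := close `|q| (normr_ge0 q).
  move=> /le_trans; apply; rewrite lerD2r; apply: le_trans (Nsq `|q|); exact: ler_norm.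
 apply: eq_integrable => // q; rewrite inE/= in_itv/= => /andP[sq _].
 by rewrite ger0_norm// (le_trans s0).
have key s (g h : R -> R) : 0 <= s -> intble_on leb `[s, s + T] g -> intble_on leb `[s, s + T] h ->
  (forall q, 0 <= q -> g q <= h q + c) ->
  \int[leb]_(q in `[s, s + T]) g q <= \int[leb]_(q in `[s, s + T]) h q + c * T.
 move=> s0 ig ih gh.
 have isub : intble_on leb `[s, s + T] (fun q => g q - h q) by apply: intble_sub.
 have := @Rintegral_itv_le _ (fun q => g q - h q) s (s + T) c.
 rewrite lerDl T0 => /(_ isT isub); rewrite RintegralB// addrAC subrr add0r lerBlDl [T * c]mulrC; apply.
 by move=> q /andP[sq _]; rewrite lerBlDl; apply: gh; exact: le_trans sq.
have k1 := key t (fun q => N q ^+ 2) (fun q => l2 m (u q) ^+ 2) t0 (iN _ _) (iu _ t0) (fun q q0 => (close q q0).1).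
have k2 := key 0 (fun q => l2 m (u q) ^+ 2) (fun q => N q ^+ 2) (lexx _) (iu _ (lexx _)) (iN _ _) (fun q q0 => (close q q0).2).
have e1 : expR (- (t / (2 * beta))) <= 1.
 rewrite -expR0 ler_expR oppr_le0 divr_ge0// mulr_ge0// ltW// relaxation_gt0//.
have d1 := dec t t0.
have y0 : 0 <= c * T by exact: mulr_ge0.
have cT : 2 * (c * T) <= e.
 apply: le_trans aD; rewrite /c /D -mulrA mulrCA ler_pM2l//.
 rewrite -subr_ge0 (_ : _ - _ = 2 * (T * (1 - a)) + 1); last by ring.
 by rewrite addr_ge0// !mulr_ge0// subr_ge0.
have ee := expR_ge0 (- (t / (2 * beta))).
move: k1 k2 e1 d1 cT ee y0; move: (expR _) (\int[leb]_(_ in _) _) (\int[leb]_(_ in _) _) (\int[leb]_(_ in _) _) (\int[leb]_(_ in _) _) (c * T) => x i1 i2 i3 i4 y.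
move=> k1 k2 e1 d1 cT ee y0.
have : x * i2 <= x * (i1 + y) by rewrite ler_wpM2l.
have : x * y <= y by rewrite ler_piMl.
by rewrite mulrDr; lra.
Qed.

End function.
End l2_decay.

End hypocoercivity.

(** * Rates *)

Section contraction.
Context {R} {d : nat}.
Variables (U : 'rV[R]_d -> R) (mu kappa : rVlaw R d) (omega gamma L K p : R).
Hypotheses (vl : velocity_law kappa omega) (omega0 : 0 <= omega) (gamma0 : 0 < gamma)
 (sa : standing_assumptions U mu p K) (L0 : 0 <= L) (HL : forall k x, partial k (partial k U) x <= L).
Local Notation leb := (@lebesgue_measure R).
Local Notation beta := (relaxation (coupling omega gamma L K p) gamma p).

(** The decay exp(- t / (2 beta)) is to be below exp(- 2 nu t), that is 4 beta nu <= 1. It remains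
    to pass from real-valued integrals of squared norms to the extended ones of the definition. *)
Lemma zigzag_contractive_relaxation (nu : R) : nu * (4 * beta) <= 1 ->
 zigzag_contractive U mu kappa gamma (Num.sqrt p)^-1 nu.
Proof.
move=> nub dO O P E W noise t f t0 L2f mean0.
have [[C2 gU] [p0 po] ds [K0 hU]] := sa.
have T0 : 0 <= (Num.sqrt p)^-1 by rewrite invr_ge0 sqrtr_ge0.
have CU : Cn 1 U := Cn_leS C2.
have flip_inv := let: And5 h _ _ _ _ := vl in h.
have inv := @zz_invariance _ _ _ _ _ E W mu kappa noise U gamma CU gamma0 flip_inv
 (zz_quasi_inv (Cn1_cont CU) gU kappa) (zz_integrable_tot gamma vl C2 gU L0 HL).
have sf := L2_inL2 L2f.
have f0 : \int[(mu \x kappa)%E]_z f z = 0 by rewrite /Rintegral mean0.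
have dec := l2_decay vl omega0 gamma0 C2 gU L0 HL p0 K0 hU po ds noise sf f0 t0.
have [mN NB] := l2_zz_semigroup_measurable vl omega0 gamma0 C2 gU L0 HL p0 K0 hU po ds noise sf f0.
have E1 s : 0 <= s ->
  (\int[leb]_(q in `[s, (s + (Num.sqrt p)^-1)%R]) (L2norm (mu \x kappa)%E (zz_semigroup U gamma E W q f) ^+ 2) =
  (\int[leb]_(q in `[s, (s + (Num.sqrt p)^-1)%R]) (l2 (mu \x kappa)%E (zz_semigroup U gamma E W `|q| f) ^+ 2))%:E)%E.
 move=> s0; rewrite /Rintegral fineK; last first.
  by apply: integrable_fin_num => //; exact: (intble_itv_bounded _ _ mN NB).
 apply: eq_integral => q /set_mem qs.
 have /andP[sq _] : s <= q <= s + (Num.sqrt p)^-1 by move: qs; rewrite /= in_itv.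
 have q0 := le_trans s0 sq; rewrite ger0_norm// L2norm_sqr l2_sqr.
 have [_ i2] := inL2_zz_semigroup CU gamma0 inv q0 sf.
 by rewrite EFin_Rintegral.
have := E1 0 (lexx _); rewrite add0r => E0.
rewrite (E1 t t0) E0 -EFinM lee_fin; apply: le_trans dec _.
rewrite add0r ler_wpM2r//; first by apply: Rintegral_ge0 => q _; exact: sqr_ge0.
have b0 : 0 < beta by apply: relaxation_gt0; rewrite ?/coupling ?sqrtr_ge0.
rewrite ler_expR lerN2 ler_pdivlMr ?mulr_gt0// [leLHS]mulrAC -[leRHS]mul1r.
apply: ler_wpM2r => //; move: nub; move: beta => b; lra.
Qed.

(** With X = omega (p (1 + K) + L), the left-hand side is 2 gamma sqrt p + 12 (108 X + gamma^2 +
    (149/4) p). As 2 gamma sqrt p <= gamma^2 + p and p <= X, it is at most 13 gamma^2 + 1744 X.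
    Rounding up to 2000 makes 4 times the constant equal to 20^3. *)
Lemma relaxation_le : 1 <= omega ->
 gamma * p * beta <= 2000 * (gamma ^+ 2 + omega * (p * (1 + K) + L)).
Proof.
move=> o1; have [_ [p0 _] _ [K0 _]] := sa.
have Ap : coupling omega gamma L K p ^+ 2 * p = 108 * omega * (p * (1 + K) + L) + gamma ^+ 2.
 rewrite /coupling sqr_sqrtr.
  by rewrite /coupling_sq; field; rewrite gt_eqF.
 rewrite /coupling_sq addr_ge0//; last by rewrite divr_ge0 ?sqr_ge0// ltW.
 by rewrite !mulr_ge0// addr_ge0 ?addr_ge0// divr_ge0// ltW.
have sp : Num.sqrt p ^+ 2 = p by rewrite sqr_sqrtr// ltW.
have s0 : 0 < Num.sqrt p by rewrite sqrtr_gt0.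
have E : gamma * p * beta = 2 * gamma * Num.sqrt p + 12 * (coupling omega gamma L K p ^+ 2 * p + (5 / 4 + 36) * p).
 have alg (g a s q : R) : 0 < g -> 0 < s -> s ^+ 2 = q ->
   g * q * (2 * s^-1 + 12 * (a ^+ 2 + 5 / 4 + 36) / g) = 2 * g * s + 12 * (a ^+ 2 * q + (5 / 4 + 36) * q).
  by move=> g0 s_gt0 <-; field; rewrite !gt_eqF.
 exact: alg.
have pX : p <= omega * (p * (1 + K) + L).
 rewrite -[leLHS]mul1r; apply: ler_pM => //; first exact: ltW.
 by have : 0 <= p * K by [rewrite mulr_ge0// ltW]; move: L0; lra.
have X0 : 0 <= (gamma - Num.sqrt p) ^+ 2 by exact: sqr_ge0.
have g0 : 0 <= gamma ^+ 2 by exact: sqr_ge0.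
rewrite E Ap; move: X0 sp pX p0; rewrite -!mulrA; move: (omega * _) (Num.sqrt p) => X s.
by move=> X0 sp pX p0'; rewrite -sp in pX p0' *; nra.
Qed.

Lemma zigzag_contractive_rate : 1 <= omega ->
 zigzag_contractive U mu kappa gamma (Num.sqrt p)^-1
  ((20 ^+ 3)^-1 * (gamma * p / (gamma ^+ 2 + omega * (p * (1 + K) + L)))).
Proof.
move=> o1; apply: zigzag_contractive_relaxation; have [_ [p0 _] _ [K0 _]] := sa.
have := relaxation_le o1.
have : 0 < gamma ^+ 2 + omega * (p * (1 + K) + L).
 apply: ltr_pwDl; first exact: exprn_gt0.
 by apply: mulr_ge0 => //; apply: addr_ge0 => //; apply: mulr_ge0; [exact: ltW|exact: addr_ge0].
move: (gamma ^+ 2 + _) beta => D b D0 H.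
rewrite (_ : _ * (4 * b) = 2000^-1 * (gamma * p * b) / D); last by field; rewrite gt_eqF.
by rewrite ler_pdivrMr// mul1r; move: H; lra.
Qed.

Lemma zigzag_contractive_le (nu nu' : R) : nu <= nu' ->
 zigzag_contractive U mu kappa gamma (Num.sqrt p)^-1 nu' ->
 zigzag_contractive U mu kappa gamma (Num.sqrt p)^-1 nu.
Proof.
move=> nn H dO O P E W noise t f t0 L2f mean0; apply: (le_trans (H _ _ _ _ _ noise t f t0 L2f mean0)).
apply: lee_wpmul2r; first by apply: integral_ge0 => s _; rewrite L2norm_sqr integral_ge0// => z _; rewrite lee_fin sqr_ge0.
by rewrite lee_fin ler_expR lerN2 ler_wpM2r// ler_wpM2l.
Qed.

End contraction.

(** The upper bound on gamma gives gamma^2 + X <= (c2^2 + 1) X, and the lower bound makes the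
    numerator at least c1 sqrt X. *)
Lemma optimal_rate_le R (c0 c1 c2 gamma p X : R) :
 0 < c0 -> 0 < c1 -> 0 < c2 -> 0 < gamma -> 0 < p -> 0 < X ->
 c1 * Num.sqrt X <= gamma <= c2 * Num.sqrt X ->
 c0 * c1 / (c2 ^+ 2 + 1) * (p / Num.sqrt X) <= c0 * (gamma * p / (gamma ^+ 2 + X)).
Proof.
move=> c00 c10 c20 gamma0 p0 X0.
have := sqr_sqrtr (ltW X0); have := X0; rewrite -sqrtr_gt0.
move: (Num.sqrt X) => S S0 <- /andP[g1 g2].
have gS : gamma ^+ 2 <= c2 ^+ 2 * S ^+ 2.
 by rewrite -exprMn lerXn2r// nnegrE ?ltW// mulr_gt0.
have cS : 0 < c2 ^+ 2 + 1 by rewrite ltr_pwDr ?sqr_ge0.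
have D0 : 0 < gamma ^+ 2 + S ^+ 2 by rewrite addr_gt0 ?exprn_gt0.
have -> : c0 * c1 / (c2 ^+ 2 + 1) * (p / S) = c0 * p * (c1 / ((c2 ^+ 2 + 1) * S)).
 by field; rewrite !gt_eqF.
have -> : c0 * (gamma * p / (gamma ^+ 2 + S ^+ 2)) = c0 * p * (gamma / (gamma ^+ 2 + S ^+ 2)) by ring.
rewrite ler_pM2l ?mulr_gt0// ler_pdivrMr ?mulr_gt0// mulrAC ler_pdivlMr//.
apply: (@le_trans _ _ (c1 * ((c2 ^+ 2 + 1) * S ^+ 2))).
 by rewrite ler_pM2l// mulrDl mul1r lerD2r.
have -> : c1 * ((c2 ^+ 2 + 1) * S ^+ 2) = (c1 * S) * ((c2 ^+ 2 + 1) * S) by ring.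
by rewrite ler_pM2r// mulr_gt0.
Qed.

Lemma sqrt_rate R (p Y : R) : 0 < p ->
 Num.sqrt p / Num.sqrt Y = p / Num.sqrt (p * Y).
Proof.
move=> p0; have s0 : Num.sqrt p != 0 by rewrite gt_eqF// sqrtr_gt0.
rewrite (sqrtrM _ (ltW p0)) -[X in _ = X / _](sqr_sqrtr (ltW p0)) expr2 invfM.
by rewrite mulrACA divff ?mul1r.
Qed.

Theorem corollary25 (R : realType) :
 (* (i) *)
 ((exists2 c : R, 0 < c &
   forall (d : nat) (U : 'rV[R]_d -> R) (mu kappa : probability 'rV[R]_d R)
       (m K L gamma : R),
    (0 < d)%N -> standing_assumptions U mu m K ->
    0 <= L -> (forall k x, partial k (partial k U) x <= L) ->
    standard_gaussian kappa \/ uniform_hypercube kappa ->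
    0 < gamma ->
    zigzag_contractive U mu kappa gamma (Num.sqrt m)^-1
     (c * (gamma * m / (gamma ^+ 2 + m * (1 + K) + L))))
  /\
  (forall c1 c2 : R, 0 < c1 -> 0 < c2 ->
  exists2 c : R, 0 < c &
   forall (d : nat) (U : 'rV[R]_d -> R) (mu kappa : probability 'rV[R]_d R)
       (m K L gamma : R),
    (0 < d)%N -> standing_assumptions U mu m K ->
    0 <= L -> (forall k x, partial k (partial k U) x <= L) ->
    standard_gaussian kappa \/ uniform_hypercube kappa ->
    0 < gamma ->
    c1 * Num.sqrt (m * (1 + K) + L) <= gamma <=
     c2 * Num.sqrt (m * (1 + K) + L) ->
    zigzag_contractive U mu kappa gamma (Num.sqrt m)^-1
     (c * (Num.sqrt m / Num.sqrt ((1 + K) + L / m)))))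
 /\
 (* (ii) *)
 ((exists2 c : R, 0 < c &
   forall (d : nat) (U : 'rV[R]_d -> R) (mu kappa : probability 'rV[R]_d R)
       (m K L gamma : R),
    (0 < d)%N -> standing_assumptions U mu m K ->
    0 <= L -> (forall k x, partial k (partial k U) x <= L) ->
    uniform_axes kappa ->
    0 < gamma ->
    zigzag_contractive U mu kappa gamma (Num.sqrt m)^-1
     (c * (gamma * m / (gamma ^+ 2 + m * d%:R * (1 + K) + L * d%:R))))
  /\
  (forall c1 c2 : R, 0 < c1 -> 0 < c2 ->
  exists2 c : R, 0 < c &
   forall (d : nat) (U : 'rV[R]_d -> R) (mu kappa : probability 'rV[R]_d R)
       (m K L gamma : R),
    (0 < d)%N -> standing_assumptions U mu m K ->
    0 <= L -> (forall k x, partial k (partial k U) x <= L) ->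
    uniform_axes kappa ->
    0 < gamma ->
    c1 * Num.sqrt ((m * (1 + K) + L) * d%:R) <= gamma <=
     c2 * Num.sqrt ((m * (1 + K) + L) * d%:R) ->
    zigzag_contractive U mu kappa gamma (Num.sqrt m)^-1
     (c * (Num.sqrt m / Num.sqrt (((1 + K) + L / m) * d%:R))))).
Proof.
have rate1 (d : nat) (U : 'rV[R]_d -> R) (mu kappa : probability 'rV[R]_d R) (m K L gamma : R) :
  standing_assumptions U mu m K -> 0 <= L -> (forall k x, partial k (partial k U) x <= L) ->
  standard_gaussian kappa \/ uniform_hypercube kappa -> 0 < gamma ->
  zigzag_contractive U mu kappa gamma (Num.sqrt m)^-1
   ((20 ^+ 3)^-1 / 3 * (gamma * m / (gamma ^+ 2 + m * (1 + K) + L))).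
 move=> sa L0 HL kk gamma0; have [_ [m0 _] _ [K0 _]] := sa.
 have vl : velocity_law kappa 3.
  by case: kk; [exact: gaussian_velocity_law|exact: hypercube_velocity_law].
 apply: zigzag_contractive_le (zigzag_contractive_rate vl _ gamma0 sa L0 HL _); rewrite ?ler1n//.
 (* Since omega = 3, the denominator at hand is gamma^2 + 3 X; bounding it by 3 (gamma^2 + X) costs
    the additional factor 1/3. *)
 have X0 : 0 <= m * (1 + K) + L.
  by apply: addr_ge0 => //; apply: mulr_ge0; [exact: ltW|exact: addr_ge0].
 rewrite -[gamma ^+ 2 + _ + L]addrA; move: (m * (1 + K) + L) X0 => X X0.
 have g2 : 0 < gamma ^+ 2 by rewrite exprn_gt0.
 have gm : 0 < gamma * m by rewrite mulr_gt0.
 rewrite (_ : (20 ^+ 3)^-1 / 3 * _ = (20 ^+ 3)^-1 * (gamma * m / (3 * (gamma ^+ 2 + X)))); last first.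
  by field; rewrite gt_eqF// ltr_pwDl.
 rewrite ler_pM2l ?invr_gt0 ?exprn_gt0// ler_pM2l// lef_pV2 ?posrE.
 - by rewrite mulrDr lerD2r ler_peMl ?ltW// ltr1n.
 - by rewrite mulr_gt0// ltr_pwDl.
 - by rewrite ltr_pwDl// mulr_ge0.
have rate2 (d : nat) (U : 'rV[R]_d -> R) (mu kappa : probability 'rV[R]_d R) (m K L gamma : R) :
  (0 < d)%N -> standing_assumptions U mu m K -> 0 <= L -> (forall k x, partial k (partial k U) x <= L) ->
  uniform_axes kappa -> 0 < gamma ->
  zigzag_contractive U mu kappa gamma (Num.sqrt m)^-1
   ((20 ^+ 3)^-1 * (gamma * m / (gamma ^+ 2 + m * d%:R * (1 + K) + L * d%:R))).
 move=> d0 sa L0 HL ak gamma0.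
 have := zigzag_contractive_rate (axes_velocity_law d0 ak) (ler0n _ _) gamma0 sa L0 HL.
 by rewrite ler1n => /(_ d0); congr zigzag_contractive; congr (_ * (_ / _)); ring.
have Xgt0 (m K L : R) : 0 < m -> 0 <= K -> 0 <= L -> 0 < m * (1 + K) + L.
 by move=> m0 K0 L0; apply: ltr_pwDl => //; apply: mulr_gt0 => //; exact: ltr_pwDl.
have YE (m K L : R) : 0 < m -> m * (1 + K + L / m) = m * (1 + K) + L.
 by move=> m0; field; rewrite gt_eqF.
split; split.
- by exists ((20 ^+ 3)^-1 / 3); [rewrite divr_gt0 ?invr_gt0 ?exprn_gt0|move=> *; exact: rate1].
- move=> c1 c2 c10 c20; exists ((20 ^+ 3)^-1 / 3 * c1 / (c2 ^+ 2 + 1)).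
  by rewrite divr_gt0 ?mulr_gt0 ?divr_gt0 ?invr_gt0 ?exprn_gt0// ltr_pwDr ?sqr_ge0.
 move=> d U mu kappa m K L gamma d0 sa L0 HL kk gamma0 g12.
 have [_ [m0 _] _ [K0 _]] := sa.
 apply: zigzag_contractive_le (rate1 _ _ _ _ _ _ _ _ sa L0 HL kk gamma0).
 rewrite sqrt_rate// YE// -[gamma ^+ 2 + _ + L]addrA.
 by apply: optimal_rate_le => //; exact: Xgt0.
- by exists (20 ^+ 3)^-1; [rewrite invr_gt0 exprn_gt0|move=> *; exact: rate2].
- move=> c1 c2 c10 c20; exists ((20 ^+ 3)^-1 * c1 / (c2 ^+ 2 + 1)).
  by rewrite divr_gt0 ?mulr_gt0 ?invr_gt0 ?exprn_gt0// ltr_pwDr ?sqr_ge0.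
 move=> d U mu kappa m K L gamma d0 sa L0 HL kk gamma0 g12.
 have [_ [m0 _] _ [K0 _]] := sa.
 apply: zigzag_contractive_le (rate2 _ _ _ _ _ _ _ _ d0 sa L0 HL kk gamma0).
 rewrite sqrt_rate// [m * (_ * _)]mulrA YE//.
 have -> : gamma ^+ 2 + m * d%:R * (1 + K) + L * d%:R = gamma ^+ 2 + (m * (1 + K) + L) * d%:R by ring.
 apply: optimal_rate_le => //.
 by apply: mulr_gt0; [exact: Xgt0|rewrite ltr0n].
Qed.
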